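(* The set of maximal palindromes in a trie that undergoes leaf insertions and leaf deletions (one leaf inserted or deleted per operation), over a general unordered alphabet, can be maintained in worst-case $O(\min(\log h,\sigma))$ time per operation, where $h$ is the height of the trie and $\sigma$ is the alphabet size.
   Context: A trie $\mathcal{T}=(V,E)$ is a rooted tree whose edges are labeled by characters of an alphabet $\Sigma$, $\sigma=|\Sigma|$, so that the out-going edges of every node (the edges to its children) carry pairwise distinct labels. A leaf is a node without children. For nodes $u,v$ such that $u=v$ or $u$ is an ancestor of $v$, $\mathsf{str}(u,v)$ is the concatenation of the edge labels along the downward path from $u$ to $v$. A string is a palindrome if it equals its reversal; the empty string is a palindrome. A palindromic path $P=\mathsf{str}(u,v)$ (an occurrence, encoded by the pair $(|P|,v)$) is a maximal palindrome in $\mathcal{T}$ if: (1) $u\neq v$ and $u$ is the root; or (2) $u\neq v$ and $v$ is a leaf; or (3) $u$ is not the root, $v$ is not a leaf, and for every child $v'$ of $v$, $\mathsf{str}(\mathsf{parent}(u),v')$ is not a palindrome. The trie initially consists of the root only. An insertion is specified by the parent node and the edge label of the new leaf; a deletion is specified by the leaf to be removed. For each node $v$, the maximal palindromes ending at $v$ are represented by their lengths in increasing order, stored as arithmetic progressions $\langle s,d,t\rangle$, each representing $s,s+d,\dots,s+(t-1)d$. General unordered alphabet: characters can only be tested for equality, in constant time. Time is measured on the standard unit-cost word RAM; a factor such as $\min(\log h,\sigma)$ in a bound is read as at least $1$. *)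

(* Defs.v *)
From mathcomp Require Import all_boot all_order finmap.

Set Implicit Arguments.
Unset Strict Implicit.
Unset Printing Implicit Defensive.

Local Open Scope fset_scope.
Local Open Scope fmap_scope.
Local Open Scope nat_scope.

(* Nodes are named by natural numbers; [edges] maps every non-root node to its
   parent and to the label of the edge joining them. *)
Record trie (Sigma : finType) := Trie {
  root : nat;
  edges : {fmap nat -> nat * Sigma}
}.

Section Tries.
Variable Sigma : finType.
Implicit Types (T : trie Sigma) (u v p : nat) (a : Sigma) (s : seq Sigma).

Definition nodes T : {fset nat} := root T |` domf (edges T).

Definition edge T p a v : Prop := (edges T).[? v] = Some (p, a).

Definition parent T v : nat := if (edges T).[? v] is Some e then e.1 else v.

Definition leaf T v : Prop := v \in nodes T /\ forall a v', ~ edge T v a v'.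

Definition is_trie T : Prop :=
  [/\ root T \notin domf (edges T),
      (forall p a v, edge T p a v -> p \in nodes T),
      (forall v, v \in nodes T -> exists k, iter k (parent T) v = root T)
    & (forall p a v v', edge T p a v -> edge T p a v' -> v = v')].

(* [spells T u s v]: u = v or u is an ancestor of v, and str(u, v) = s. *)
Inductive spells T u : seq Sigma -> nat -> Prop :=
| spells_nil : u \in nodes T -> spells T u [::] u
| spells_rcons s v a v' :
    spells T u s v -> edge T v a v' -> spells T u (rcons s a) v'.

(* The first position of the root in v, parent v, parent (parent v), ... *)
Definition depth T v : nat := index (root T) (traject (parent T) v #|` nodes T|).

Definition height T : nat := \max_(v <- nodes T) depth T v.

Definition palindrome s : Prop := s = rev s.

Definition maximal_palindrome T u s v : Prop :=
  [/\ spells T u s v, palindrome s &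
      [\/ u <> v /\ u = root T,
          u <> v /\ leaf T v
        | [/\ u <> root T, ~ leaf T v &
              forall a v' s', edge T v a v' -> spells T (parent T u) s' v' ->
                ~ palindrome s']]].

Definition trie_init (r : nat) : trie Sigma := Trie r [fmap].

Definition trie_insert T p a v : trie Sigma :=
  Trie (root T) ((edges T).[v <- (p, a)]).

Definition trie_delete T v : trie Sigma := Trie (root T) ((edges T).[~ v]).

Definition insertable T p a : Prop :=
  p \in nodes T /\ forall v, ~ edge T p a v.

Definition deletable T v : Prop := leaf T v /\ v <> root T.

Lemma is_trie_init r : is_trie (trie_init r).
Proof.
split.
- by rewrite [edges _]/(fmap0) domf0 in_fset0.
- by move=> p a v; rewrite /edge /= fnd_fmap0.
- by move=> v; rewrite /nodes [edges _]/(fmap0) domf0 fsetU0 in_fset1 => /eqP ->; exists 0.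
- by move=> p a v v'; rewrite /edge /= fnd_fmap0.
Qed.

Lemma is_trie_insert T p a v :
  is_trie T -> insertable T p a -> v \notin nodes T ->
  is_trie (trie_insert T p a v).
Proof.
move=> [rootT parT upT uniqT] [pT newT] vT.
have [vr vd] : v != root T /\ v \notin domf (edges T).
  by apply/andP; move: vT; rewrite /nodes in_fsetU in_fset1 negb_or.
have nodesE x : (x \in nodes (trie_insert T p a v)) = (x == v) || (x \in nodes T).
  by rewrite /nodes /= !in_fsetU !in_fset1 orbCA.
have iterE k x : x \in nodes T ->
    iter k (parent (trie_insert T p a v)) x = iter k (parent T) x
    /\ iter k (parent T) x \in nodes T.
  move=> xT; elim: k => [//|k [IH kT]]; rewrite !iterS IH; split.
    rewrite /parent /= fnd_set; case: eqP => [E|//].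
    by rewrite E (negPf vT) in kT.
  rewrite /parent; case E: (_.[? _]) => [[q b]|//] /=; exact: parT E.
split.
- by rewrite /= in_fsetU in_fset1 eq_sym negb_or vr.
- move=> q b x; rewrite /edge /= fnd_set nodesE; case: eqP => [_ [<- _]|_ E].
    by rewrite pT orbT.
  by rewrite (parT _ _ _ E) orbT.
- move=> x; rewrite nodesE => /orP[/eqP ->|xT].
    have [k kE] := upT p pT; exists k.+1.
    by rewrite iterSr {2}/parent /= fnd_set eqxx (iterE k p pT).1.
  by have [k kE] := upT x xT; exists k; rewrite (iterE k x xT).1.
- move=> q b x y; rewrite /edge /= !fnd_set.
  case: eqP => [->|_]; case: eqP => [-> //|_].
  + by move=> [<- <-] E; case: (newT y E).
  + by move=> E [pq ab]; case: (newT x); rewrite /edge pq ab.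
  + exact: uniqT.
Qed.

Lemma is_trie_delete T v :
  is_trie T -> deletable T v -> is_trie (trie_delete T v).
Proof.
move=> [rootT parT upT uniqT] [[vT vleaf] /eqP vr].
have edgeE q b x : edge (trie_delete T v) q b x -> x != v /\ edge T q b x.
  by rewrite /edge /= fnd_rem1; case: ifP.
have nodesE x : (x \in nodes (trie_delete T v)) = (x != v) && (x \in nodes T).
  rewrite /nodes /= !in_fsetU !in_fset1 mem_remf1.
  by have [->|] := eqVneq x (root T); first by rewrite eq_sym vr.
have iterE k x : x \in nodes T -> x != v ->
    iter k (parent (trie_delete T v)) x = iter k (parent T) x
    /\ iter k (parent T) x \in nodes (trie_delete T v).
  move=> xT xv; elim: k => [|k [IH]]; first by rewrite nodesE xv.
  rewrite !iterS IH nodesE => /andP[kv kT]; set y := iter k _ _ in kv kT *.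
  have -> : parent (trie_delete T v) y = parent T y.
    by rewrite /parent /= fnd_rem1 kv.
  split=> //; rewrite /parent; case E: (_.[? _]) => [[q b]|] /=; last first.
    by rewrite nodesE kv.
  rewrite nodesE (parT _ _ _ E) andbT; apply/eqP => qv.
  by rewrite qv in E; case: (vleaf _ _ E).
split.
- by rewrite /= mem_remf1 (negPf rootT) andbF.
- move=> q b x /edgeE[_ E]; rewrite nodesE (parT _ _ _ E) andbT; apply/eqP => qv.
  by rewrite qv in E; case: (vleaf _ _ E).
- move=> x; rewrite nodesE => /andP[xv xT]; have [k kE] := upT x xT.
  by exists k; rewrite (iterE k x xT xv).1.
- by move=> q b x y /edgeE[_ E] /edgeE[_]; apply: uniqT E.
Qed.

End Tries.

(* (s, d, t) stands for s, s + d, ..., s + (t - 1) d. *)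
Definition progression : Type := nat * nat * nat.

Definition terms (x : progression) : seq nat :=
  let: (s, d, t) := x in mkseq (fun i => s + i * d) t.

(* Empty progressions are excluded. *)
Definition represents (L : seq progression) (P : nat -> Prop) : Prop :=
  [/\ all (fun x : progression => 0 < x.2) L,
      sorted ltn (flatten (map terms L))
    & forall n, n \in flatten (map terms L) <-> P n].

Definition words_of (L : seq progression) : seq nat :=
  flatten [seq [:: x.1.1; x.1.2; x.2] | x <- L].

(* A machine has words of w bits and, in separate registers and a separate
   memory, characters.  Both memories are addressed by words.  Characters are
   opaque: they can be copied, and two of them can be compared for equality
   ([CJumpEq]); no instruction turns a character into a word.  Programs mention
   neither w nor the alphabet. *)
Inductive wop := Add | Sub | Mul | Div | Mod | And | Or | Xor | Shl | Shr.

Inductive instr :=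
| Const of nat & nat
| Arith of wop & nat & nat & nat
| Read of nat & nat
| Write of nat & nat
| CRead of nat & nat
| CWrite of nat & nat
| Jump of nat
| JumpEq of nat & nat & nat
| JumpLt of nat & nat & nat
| CJumpEq of nat & nat & nat
| Emit of nat.

Definition wop_eval (w : nat) (o : wop) (x y : nat) : nat :=
  match o with
  | Add => x + y
  | Sub => x + (2 ^ w - y)
  | Mul => x * y
  | Div => x %/ y
  | Mod => x %% y
  | And => Nat.land x y
  | Or => Nat.lor x y
  | Xor => Nat.lxor x y
  | Shl => x * 2 ^ y
  | Shr => x %/ 2 ^ y
  end %% 2 ^ w.

(* Characters are optional because a cell may not have been written yet. *)
Record state (Sigma : finType) := State {
  pc : nat;
  reg : nat -> nat;
  creg : nat -> option Sigma;
  mem : nat -> nat;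
  cmem : nat -> option Sigma;
  output : seq nat
}.

Section Machine.
Variables (Sigma : finType) (w : nat).
Implicit Types (st : state Sigma) (P : seq instr).

Definition upd (X : Type) (f : nat -> X) (i : nat) (x : X) : nat -> X :=
  fun j => if j == i then x else f j.

Definition exec_instr (c : instr) st : state Sigma :=
  let: State k r cr m cm out := st in
  let branch (b : bool) l := State (if b then l else k.+1) r cr m cm out in
  match c with
  | Const i n => State k.+1 (upd r i (n %% 2 ^ w)) cr m cm out
  | Arith o i x y => State k.+1 (upd r i (wop_eval w o (r x) (r y))) cr m cm out
  | Read i x => State k.+1 (upd r i (m (r x))) cr m cm out
  | Write x i => State k.+1 r cr (upd m (r x) (r i)) cm out
  | CRead i x => State k.+1 r (upd cr i (cm (r x))) m cm out
  | CWrite x i => State k.+1 r cr m (upd cm (r x) (cr i)) out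
  | Jump l => branch true l
  | JumpEq x y l => branch (r x == r y) l
  | JumpLt x y l => branch (r x < r y) l
  | CJumpEq x y l => branch (cr x == cr y) l
  | Emit i => State k.+1 r cr m cm (rcons out (r i))
  end.

Definition halted P st : bool := size P <= pc st.

Definition step P st : state Sigma :=
  if halted P st then st else exec_instr (nth (Jump 0) P (pc st)) st.

(* Started in st, P halts in st' after at most t executed instructions. *)
Definition runs P st t st' : Prop := iter t (step P) st = st' /\ halted P st'.

(* Calling convention: word argument and result in word register 0, character
   argument in character register 0; everything else persists. *)
Definition call st (x : nat) (a : option Sigma) : state Sigma :=
  State 0 (upd (reg st) 0 x) (upd (creg st) 0 a) (mem st) (cmem st) [::].

Definition result st : nat := reg st 0.

Definition blank : state Sigma :=
  State 0 (fun=> 0) (fun=> None) (fun=> 0) (fun=> None) [::].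

End Machine.

Record algorithm := Algorithm {
  init : seq instr;     (* argument: the word size; result: the root *)
  insert : seq instr;   (* arguments: parent and label; result: the new leaf *)
  delete : seq instr;   (* argument: the leaf to be removed *)
  report : seq instr    (* argument: a node; output: its progressions *)
}.

Section Maintenance.
Variables (A : algorithm) (Sigma : finType) (w : nat).

(* [reachable N st T]: a sequence of leaf insertions and deletions, starting
   with the root only and never exceeding N nodes, may lead to the trie T and
   leave the machine in state st.  A node is named by the word that the machine
   returned when the node was created. *)
Inductive reachable (N : nat) : state Sigma -> trie Sigma -> Prop :=
| reachable_init t st :
    runs w (init A) (call (blank Sigma) w None) t st ->
    reachable N st (trie_init Sigma (result st))
| reachable_insert st T p a t st' :
    reachable N st T -> insertable T p a -> #|` nodes T| < N ->
    runs w (insert A) (call st p (Some a)) t st' ->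
    reachable N st' (trie_insert T p a (result st'))
| reachable_delete st T v t st' :
    reachable N st T -> deletable T v ->
    runs w (delete A) (call st v None) t st' ->
    reachable N st' (trie_delete T v).

End Maintenance.

(* log h is at least 1 from h = 2 on, so rounding it down to [trunc_log 2 h]
   changes the bounds by a constant factor only.  So does taking h before or
   after an operation, which changes the height by at most 1. *)
Definition log_height (Sigma : finType) (T : trie Sigma) : nat :=
  maxn 1 (trunc_log 2 (height T)).

Definition op_bound (Sigma : finType) (T : trie Sigma) : nat :=
  maxn 1 (minn (trunc_log 2 (height T)) #|Sigma|).

(* Main.v *)
Require Import Defs.
From mathcomp Require Import all_boot all_order finmap zify.
From Stdlib Require Import FunctionalExtensionality.
Set Implicit Arguments.
Unset Strict Implicit.
Unset Printing Implicit Defensive.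
Local Open Scope nat_scope.

(* The palindromic suffixes of a word are the iterated longest proper palindromic
   suffixes of the longest one, and their lengths form O(log h) arithmetic
   progressions (series).  Inside a series all members but the last are preceded by
   the same letter, so at an insertion it is enough to look at one suffix, a
   leader, per letter that precedes some suffix: at most min(log h, sigma) of them.
   The letter before the longest palindromic suffix itself lies at an arbitrary
   depth and is found with a level ancestor query, for which the path is cut into
   blocks of logarithmic length with jump pointers between the block anchors and
   words of child slots inside the blocks.

   Letters can only be compared, not used as indices.  Each edge therefore gets a
   name: the name of an earlier edge with the same letter whenever a palindromic
   suffix exhibits one, and a fresh name otherwise.  Palindromes of letters and of
   names coincide on root paths, so that the palindromes in the trie are the nodes
   of one palindromic tree whose transitions are indexed by names.  Memory is zero
   initially and has at least N ^ 40 words, so that transitions and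
   jump pointers are plain tables indexed by pairs.

   A palindromic suffix of v is maximal unless some child of v has the letter that
   precedes it.  A bit mask over the leaders of v records the letters without such
   a child; each child stores the bits it clears, which makes deletion an exact
   inverse.  Palindromes are freed when their reference count vanishes. *)

(** The obstacle is the letter before the longest palindromic suffix: finding it must be cheap both
    for small h and for small sigma, and every table involved must grow within single insertions.
    The jump pointers of an anchor are therefore not built at once: the node at offset [j] of block
    [k] is in charge of level [j] and writes a bounded number of entries, which is why a block is
    slightly longer than the logarithm of its depth. Inside a block a plain walk could take log h
    steps; packing child slots of [beta] bits each into a code of [b] bits skips about [b / beta]
    levels at a time. Slots are numbered below min(sigma, N), and [beta] grows by one only when a
    slot number does not fit, so a logarithmic stretch meets O(sigma) codes, whatever h is.

    A name is the lower end of an edge on the path of its user. It lives as long as it is used, and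
    its letter is found in character memory under the name itself.

    Entries that become stale by a deletion are mostly left alone: the invariants speak of live
    nodes and palindromes only and cover every entry that is read through them. *)

Section Words.
Variable A : eqType.
Implicit Types (x y z w : seq A) (a b c : A).

(** * Palindromic suffixes, borders, periods and series *)

Definition pal x := x == rev x.
Definition suf n x := drop (size x - n) x.

Lemma size_suf n x : n <= size x -> size (suf n x) = n.
Proof. by move=> h; rewrite size_drop; lia. Qed.

Lemma suf_suf m n x : m <= n <= size x -> suf m (suf n x) = suf m x.
Proof. by move=> h; rewrite /suf drop_drop size_drop; congr drop; lia. Qed.

Lemma suf_size x : suf (size x) x = x.
Proof. by rewrite /suf subnn drop0. Qed.

Lemma suf0 x : suf 0 x = [::].
Proof. by rewrite /suf subn0 drop_size. Qed.

Lemma suf_cat x y : suf (size y) (x ++ y) = y.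
Proof. by rewrite /suf size_cat addnK drop_size_cat. Qed.

Lemma suf_cat_le n x y : n <= size y -> suf n (x ++ y) = suf n y.
Proof.
move=> h; rewrite -[in LHS](suf_suf (n := size y)) ?suf_cat //.
by rewrite size_cat; lia.
Qed.

Lemma suf_rcons n x a : n <= size x -> suf n.+1 (rcons x a) = rcons (suf n x) a.
Proof.
move=> h; rewrite /suf size_rcons subSS drop_rcons //; lia.
Qed.

Lemma nth_suf d n x i : n <= size x -> nth d (suf n x) i = nth d x (size x - n + i).
Proof. by move=> h; rewrite nth_drop. Qed.

Lemma sufS d n x : n < size x -> suf n.+1 x = nth d x (size x - n.+1) :: suf n x.
Proof.
move=> h; rewrite /suf (drop_nth d); last by lia.
by congr (_ :: drop _ _); lia.
Qed.

Lemma pal_rev x : pal x -> rev x = x.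
Proof. by move/eqP. Qed.

Lemma pal_one a : pal [:: a].
Proof. exact: eqxx. Qed.

Lemma pal_wrap a b x : pal (a :: rcons x b) = (a == b) && pal x.
Proof.
rewrite /pal rev_cons rev_rcons rcons_cons /= eqseq_cons eqseq_rcons.
by rewrite [b == a]eq_sym; case: (a == b); rewrite ?andbT ?andbF.
Qed.

Lemma pal_nth d x : pal x <-> forall i, i < size x -> nth d x i = nth d x (size x - i.+1).
Proof.
split=> [/eqP E i h|H]; first by rewrite [in LHS]E nth_rev.
apply/eqP/(@eq_from_nth _ d); rewrite ?size_rev // => i h.
by rewrite nth_rev // H.
Qed.

Lemma pal_suf_rev n x : pal x -> n <= size x -> suf n x = rev (take n x).
Proof.
by move=> /eqP px h; rewrite /suf {2}px drop_rev subKn.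
Qed.

(** In a palindrome a suffix is the mirror image of the prefix of the same length, so its
    palindromic suffixes are exactly its borders. *)
Lemma pal_border n x : pal x -> n <= size x -> pal (suf n x) = (suf n x == take n x).
Proof.
by move=> px h; rewrite /pal (pal_suf_rev px h) revK.
Qed.

Lemma border_take n x : pal x -> n <= size x -> pal (suf n x) -> take n x = suf n x.
Proof. by move=> px h; rewrite pal_border // => /eqP. Qed.

Lemma nth_border d n x i : pal x -> n <= size x -> pal (suf n x) -> i < n ->
  nth d (suf n x) i = nth d x i.
Proof. by move=> px h ps hi; rewrite -border_take // nth_take. Qed.

(** With [per_border] this identifies the palindromic suffixes of a palindrome with its periods. *)
Lemma border_per d n x i : pal x -> n <= size x -> pal (suf n x) ->
  i + (size x - n) < size x -> nth d x i = nth d x (i + (size x - n)).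
Proof.
move=> px h ps hi; rewrite -(nth_border d px h ps); last by lia.
by rewrite nth_suf // addnC.
Qed.

Lemma per_border d n x : pal x -> n <= size x ->
  (forall i, i + (size x - n) < size x -> nth d x i = nth d x (i + (size x - n))) ->
  pal (suf n x).
Proof.
move=> px h H; rewrite pal_border //; apply/eqP/(@eq_from_nth _ d).
  by rewrite size_suf // size_takel.
rewrite size_suf // => i hi; rewrite nth_suf // nth_take // addnC -H //; lia.
Qed.

(** [lpsn] admits the whole word, [lnkn] does not; the latter gives the suffix link of palindromic
    trees. *)
Definition lpsn x := \max_(n < (size x).+1 | pal (suf n x)) n.
Definition lnkn x := \max_(n < size x | pal (suf n x)) n.

Lemma lpsn_max x n : n <= size x -> pal (suf n x) -> n <= lpsn x.
Proof.
move=> h p; have h' : n < (size x).+1 by [].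
exact: (@leq_bigmax_cond _ (fun i : 'I_(size x).+1 => pal (suf i x)) (@nat_of_ord _) (Ordinal h')).
Qed.

Lemma lnkn_max x n : n < size x -> pal (suf n x) -> n <= lnkn x.
Proof.
move=> h p.
exact: (@leq_bigmax_cond _ (fun i : 'I_(size x) => pal (suf i x)) (@nat_of_ord _) (Ordinal h)).
Qed.

Lemma lpsnP x : lpsn x <= size x /\ pal (suf (lpsn x) x).
Proof.
have [|i pi E] := @eq_bigmax_cond _ [pred i : 'I_(size x).+1 | pal (suf i x)] (@nat_of_ord _).
  by apply/card_gt0P; exists ord0; rewrite inE suf0.
by rewrite /lpsn E; split=> //; rewrite -ltnS.
Qed.

Lemma lnknP x : 0 < size x -> lnkn x < size x /\ pal (suf (lnkn x) x).
Proof.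
move=> h; have [|i pi E] := @eq_bigmax_cond _ [pred i : 'I_(size x) | pal (suf i x)] (@nat_of_ord _).
  by apply/card_gt0P; exists (Ordinal h); rewrite inE suf0.
by rewrite /lnkn E.
Qed.

Lemma lnkn_nil : lnkn [::] = 0.
Proof. by rewrite /lnkn big_ord0. Qed.

Lemma lnkn_le x : lnkn x <= size x.
Proof. by case: x => [|a x]; rewrite ?lnkn_nil //; case: (@lnknP (a :: x)) => // /ltnW. Qed.

Definition lps x := suf (lpsn x) x.
Definition lnk x := suf (lnkn x) x.
(** For a palindrome this is the smallest period. *)
Definition df x := size x - lnkn x.

Lemma size_lps x : size (lps x) = lpsn x.
Proof. by rewrite size_suf //; case: (lpsnP x). Qed.

Lemma pal_lps x : pal (lps x).
Proof. by case: (lpsnP x). Qed.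

Lemma lpsn_gt0 x : x != [::] -> 0 < lpsn x.
Proof.
case/lastP: x => // x a _; apply: lpsn_max; first by rewrite size_rcons.
by rewrite suf_rcons // suf0 pal_one.
Qed.

Lemma lps_nil : lps [::] = [::].
Proof. exact: drop_oversize. Qed.

Lemma size_lnk x : size (lnk x) = lnkn x.
Proof. by rewrite size_suf // lnkn_le. Qed.

Lemma pal_lnk x : pal (lnk x).
Proof. by case: x => [|a x]; [rewrite /lnk lnkn_nil | case: (@lnknP (a :: x))]. Qed.

Lemma lnk_nil : lnk [::] = [::]. Proof. by rewrite /lnk lnkn_nil. Qed.

Lemma df_nil : df [::] = 0. Proof. by []. Qed.

Lemma df_gt0 x : x != [::] -> 0 < df x.
Proof. by case: x => // a x _; rewrite /df subn_gt0; case: (@lnknP (a :: x)). Qed.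

Lemma df_lnk x : df x + lnkn x = size x.
Proof. by rewrite /df subnK // lnkn_le. Qed.

Lemma df_per d x i : pal x -> i + df x < size x -> nth d x i = nth d x (i + df x).
Proof.
by move=> px h; apply: border_per => //; [exact: lnkn_le | exact: pal_lnk].
Qed.

Lemma suf_lnk n x : n <= lnkn x -> suf n (lnk x) = suf n x.
Proof. by move=> h; rewrite suf_suf // h lnkn_le. Qed.

Lemma nth_lnk d x i : pal x -> i < lnkn x -> nth d (lnk x) i = nth d x i.
Proof. by move=> px; apply: nth_border => //; [exact: lnkn_le | exact: pal_lnk]. Qed.

(** The period [df x] is inherited by the suffix [lnk x] if it fits into it; if not, [df (lnk x)] is
    at most the length of [lnk x] and hence smaller. *)
Lemma df_leq x : pal x -> df (lnk x) <= df x.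
Proof.
move=> px; case: x px => [|a x0] px; first by rewrite df_nil.
set x := a :: x0 in px *; set y := lnk x.
have sy : size y = lnkn x by exact: size_lnk.
have dx := df_lnk x; have dy := df_lnk y.
have [h|h] := leqP (df x) (size y); last by lia.
have [->|yn] := eqVneq y [::]; first by rewrite df_nil.
suff : size y - df x <= lnkn y by lia.
have d0 : 0 < df x by exact: df_gt0.
apply: lnkn_max; first by lia.
apply: (@per_border a); [exact: pal_lnk | lia |].
have -> : size y - (size y - df x) = df x by lia.
move=> i hi; rewrite !nth_lnk //; try lia; apply: df_per => //; lia.
Qed.

(* If the period of the longest border strictly drops, the next border is
   short: otherwise the smaller period would propagate to the whole word. *)
Lemma df_drop x : pal x -> df (lnk x) < df x -> lnkn (lnk x) < df x.
Proof.
move=> px h; set y := lnk x in h *; rewrite ltnNge; apply/negP => hz.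
have xn : 0 < size x by rewrite lt0n size_eq0; apply: contraTneq h => ->; rewrite df_nil.
have sy : size y = lnkn x by exact: size_lnk.
have dx := df_lnk x; have dy := df_lnk y.
have [yn|yn] := eqVneq y [::]; first by move: hz dx; rewrite yn lnkn_nil; lia.
have y0 := df_gt0 yn.
have a : A by case: (x) xn.
suff : size x - df y <= lnkn x by lia.
apply: lnkn_max; first by lia.
apply: (@per_border a) => //; first by lia.
have -> : size x - (size x - df y) = df y by lia.
have py : pal y by exact: pal_lnk.
have P1 j : df x <= j -> j + df y < size x -> nth a x j = nth a x (j + df y).
  move=> h1 h2; have e k : df x <= k -> nth a x k = nth a y (k - df x).
    by move=> hk; rewrite nth_suf ?lnkn_le //; congr nth; rewrite -/(df x); lia.
  rewrite !e; try lia.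
  by rewrite df_per //; [congr nth; lia | lia].
move=> i hi; have [h1|h1] := leqP (df x) i; first exact: P1.
rewrite df_per //; last by lia.
rewrite P1; [|lia|lia].
rewrite [in RHS]df_per //; last by lia.
by congr nth; lia.
Qed.

(** The series link: the first palindrome on the chain of links whose smallest period differs from
    that of [x]. The fuel is harmless because links shorten the word; [slkE] is the recursion
    without it. *)
Fixpoint slkf k x :=
  if k is k'.+1 then
    if df (lnk x) == df x then slkf k' (lnk x) else lnk x
  else [::].
Definition slk x := slkf (size x) x.

Lemma slkf_nil k : slkf k [::] = [::].
Proof. by elim: k => //= k IH; rewrite lnk_nil IH if_same. Qed.

Lemma slkf_ge k x : size x <= k -> slkf k x = slk x.
Proof.
rewrite /slk; have [n] := ubnP (size x); elim: n k x => // n IH k [|a x] /= hn hk.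
  by rewrite slkf_nil.
case: k hk => // k hk /=; case: ifP => // _; set y := lnk (a :: x).
have hy : size y <= size x.
  by rewrite size_lnk -ltnS; case: (@lnknP (a :: x)).
by rewrite !IH //; lia.
Qed.

Lemma slkE x : x != [::] -> slk x = if df (lnk x) == df x then slk (lnk x) else lnk x.
Proof.
case: x => // a x _; rewrite {1}/slk /=; case: ifP => // _; apply: slkf_ge.
by rewrite size_lnk -ltnS; case: (@lnknP (a :: x)).
Qed.

Lemma slk_nil : slk [::] = [::]. Proof. by []. Qed.

Lemma seq_ind_size (P : seq A -> Prop) :
  (forall x, (forall y, size y < size x -> P y) -> P x) -> forall x, P x.
Proof.
move=> H x; have [n] := ubnP (size x); elim: n x => // n IH x hx.
by apply: H => y hy; apply: IH; lia.
Qed.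

Lemma size_lnk_lt x : x != [::] -> size (lnk x) < size x.
Proof. by case: x => // a x _; rewrite size_lnk; case: (@lnknP (a :: x)). Qed.

Lemma slkP x : pal x -> x != [::] ->
  [/\ size (slk x) < size x, slk x = suf (size (slk x)) x, pal (slk x)
    & exists2 t, 0 < t & size x = size (slk x) + t * df x].
Proof.
elim/seq_ind_size: x => x IH px xn; rewrite slkE //.
have ly := size_lnk_lt xn; have dx := df_lnk x; have sy := size_lnk x.
case: eqP => E; last first.
  split=> //; [by rewrite size_lnk | exact: pal_lnk | exists 1; rewrite ?mul1n //; lia].
have yn : lnk x != [::].
  by apply: contraTneq (df_gt0 xn) => e; rewrite -E e df_nil.
have [h1 h2 h3 [t t0 ht]] := IH _ ly (pal_lnk x) yn; split=> //.
- lia.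
- by rewrite {1}h2 suf_lnk // -size_lnk ltnW.
- by exists t.+1 => //; rewrite mulSn -E in ht *; lia.
Qed.

(** The series counted here has the lengths from [size (slk x)] up to [lnkn x]: the series link is
    included, [x] itself is not. *)
Definition cnt x := (size x - size (slk x)) %/ df x.

Lemma cntP x : pal x -> x != [::] -> 0 < cnt x /\ size x = size (slk x) + cnt x * df x.
Proof.
move=> px xn; have [_ _ _ [t t0 ht]] := slkP px xn.
suff -> : cnt x = t by [].
by rewrite /cnt ht addKn mulnK // df_gt0.
Qed.

(** As long as the period persists, each link shortens the word by the same [df x]; the progression
    ends where the period changes. *)
Lemma slk_pals x n : pal x -> x != [::] ->
  n < size x -> pal (suf n x) <->
  (n < size (slk x) /\ pal (suf n (slk x))) \/
  (exists2 i, i < cnt x & n = size (slk x) + i * df x).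
Proof.
elim/seq_ind_size: x n => x IH n px xn hn.
have ly := size_lnk_lt xn; have dx := df_lnk x; have sy := size_lnk x.
have [c0 cE] := cntP px xn; have d0 := df_gt0 xn.
have base : pal (suf n x) <-> n = lnkn x \/ (n < lnkn x /\ pal (suf n (lnk x))).
  split=> [h|[->|[h1 h2]]]; last 2 first.
  - exact: pal_lnk.
  - by rewrite -(suf_lnk (ltnW h1)).
  have := lnkn_max hn h; rewrite leq_eqVlt => /orP[/eqP|h1]; [by left | right].
  by rewrite suf_lnk // ltnW.
rewrite base; have := slkE xn; case: eqP => E sE; last first.
  have c1 : cnt x = 1 by rewrite /cnt sE size_lnk -/(df x) divnn d0.
  rewrite sE size_lnk c1; split=> [[->|h]|[h|[i]]].
  - by right; exists 0 => //; lia.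
  - by left.
  - by right.
  - by rewrite ltnS leqn0 => /eqP -> ->; left; lia.
have yn : lnk x != [::].
  by apply: contraTneq d0 => e; rewrite -E e df_nil.
have cS : cnt x = (cnt (lnk x)).+1.
  by rewrite /cnt sE E -[size x]dx -sy addnC -addnBAC ?(divnDr _ (dvdnn _)) ?divnn ?d0 ?addn1 //;
    case: (slkP (pal_lnk x) yn) => /ltnW.
rewrite sE cS; split.
- case=> [->|[h1 h2]].
    right; exists (cnt (lnk x)) => //.
    by have [_] := cntP (pal_lnk x) yn; rewrite E sy => ->.
  have [//||[i hi ->]] := (IH _ ly n (pal_lnk x) yn _).1 h2; [lia | by left |].
  by right; exists i; rewrite ?E //; lia.
- have [_ ec] := cntP (pal_lnk x) yn.
  case=> [[h1 h2]|[i]].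
    have [h3 h4 _ _] := slkP (pal_lnk x) yn.
    right; split; first by lia.
    by apply/(IH _ ly n (pal_lnk x) yn); [lia | left].
  rewrite ltnS leq_eqVlt => /orP[/eqP -> ->|hi ->].
    by left; rewrite -sy ec E.
  have lt : size (slk (lnk x)) + i * df x < size (lnk x).
    by rewrite ec E ltn_add2l ltn_pmul2r.
  right; split; first by lia.
  by apply/(IH _ ly _ (pal_lnk x) yn) => //; right; exists i; rewrite ?E.
Qed.

(* The letter that precedes the suffix [lnk x] of the palindrome [x]. *)
Definition pch d x := nth d x (lnkn x).

(** By mirror symmetry the letter before the suffix of length [n] is also the letter at index [n].
    Along a series these indices differ by multiples of the period [df x]. *)
Lemma piece_pch d x i : pal x -> x != [::] -> i < cnt x ->
  nth d x (size (slk x) + i * df x) = pch d x.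
Proof.
move=> px xn hi; have [c0 cE] := cntP px xn; have dx := df_lnk x.
have d0 := df_gt0 xn.
have key k : i + k < cnt x ->
    nth d x (size (slk x) + i * df x) = nth d x (size (slk x) + (i + k) * df x).
  elim: k => [|k IHk] h; first by rewrite addn0.
  have : (i + k).+2 * df x <= cnt x * df x by rewrite leq_mul2r; lia.
  rewrite !mulSn => h'; rewrite IHk; last by lia.
  rewrite df_per //; last by lia.
  by congr nth; rewrite addnS mulSn; lia.
(* Go to the longest member of the series, whose length is [lnkn x]. *)
rewrite (key (cnt x - i.+1)); last by lia.
rewrite /pch; congr nth.
have -> : i + (cnt x - i.+1) = (cnt x).-1 by lia.
by move: cE; rewrite -[X in _ = _ + X * _](prednK c0) mulSn /=; lia.
Qed.

(** One head per series. A series consists of proper suffixes of its head, so [x] itself belongs to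
    none of the series headed by [grp x]. *)
Fixpoint grpf k x := if k is k'.+1 then (if x == [::] then [::] else x :: grpf k' (slk x)) else [::].
Definition grp x := grpf (size x) x.

Lemma grpf_nil k : grpf k [::] = [::]. Proof. by case: k. Qed.

Lemma size_slk_lt x : x != [::] -> size (slk x) < size x.
Proof.
elim/seq_ind_size: x => x IH xn; rewrite slkE //; have h := size_lnk_lt xn.
case: ifP => // _; have [e|yn] := eqVneq (lnk x) [::]; first by rewrite e lt0n size_eq0.
exact: ltn_trans (IH _ h yn) h.
Qed.

Lemma grpf_ge k x : size x <= k -> grpf k x = grp x.
Proof.
rewrite /grp; elim/seq_ind_size: x k => x IH k; have [->|xn] := eqVneq x [::].
  by rewrite !grpf_nil.
have h := size_slk_lt xn.
case: k => [|k hk]; first by rewrite leqn0 size_eq0 (negPf xn).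
case E: (size x) => [|n]; first by move/eqP: E; rewrite size_eq0 (negPf xn).
by rewrite /= (negPf xn) !IH //; lia.
Qed.

Lemma grpE x : grp x = if x == [::] then [::] else x :: grp (slk x).
Proof.
have [->|xn] := eqVneq x [::]; first by [].
have h := size_slk_lt xn.
rewrite {1}/grp; case E: (size x) => [|n] /=; first by lia.
by rewrite (negPf xn) grpf_ge //; lia.
Qed.

Lemma grp_mem x z : pal x -> z \in grp x ->
  [/\ pal z, z != [::], size z <= size x & z = suf (size z) x].
Proof.
elim/seq_ind_size: x => x IH px; rewrite grpE; case: eqVneq => // xn.
rewrite inE => /orP[/eqP ->|]; first by rewrite suf_size.
have [h1 h2 h3 _] := slkP px xn => h.
have [k1 k2 k3 k4] := IH _ h1 h3 h; split=> //; first by lia.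
by rewrite {1}k4 h2 suf_suf // k3 ltnW.
Qed.

Lemma grp_pals x n : pal x -> n < size x -> pal (suf n x) <->
  exists z i, [/\ z \in grp x, i < cnt z & n = size (slk z) + i * df z].
Proof.
elim/seq_ind_size: x n => x IH n px hn.
have xn : x != [::] by case: x hn {IH px}.
have [h1 h2 h3 _] := slkP px xn.
rewrite (slk_pals px xn hn) grpE (negPf xn); split.
- case=> [[k1 /(IH _ h1 n h3 k1)[z [i [k2 k3 k4]]]]|[i k1 k2]].
    by exists z, i; rewrite inE k2 orbT.
  by exists x, i; rewrite mem_head.
- case=> z [i]; rewrite inE => -[/orP[/eqP ->|k1] k2 k3]; first by right; exists i.
  have [q1 q2 q3 _] := grp_mem h3 k1; have [c0 cE] := cntP q1 q2.
  have hn' : n < size (slk x).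
    by apply: leq_trans q3; rewrite k3 cE ltn_add2l ltn_pmul2r // df_gt0.
  by left; split=> //; apply/(IH _ h1 n h3 hn'); exists z, i.
Qed.

(** Let [z] be the last palindrome on the chain with the period of [x], so that [slk x = lnk z]. By
    [df_drop] the word [lnk (lnk z)] is shorter than [df z], and it is also shorter than [lnk z];
    these two lengths add up to that of [z]. The second series link is no longer than
    [lnk (lnk z)]. *)
Lemma grp_half x : pal x -> slk x != [::] -> 2 * size (slk (slk x)) < size x.
Proof.
move=> px yn; have xn : x != [::] by apply: contraNneq yn => ->.
move: yn; elim/seq_ind_size: x px xn => x IH px xn.
have ly := size_lnk_lt xn; rewrite slkE //; case: (df (lnk x) =P df x) => E yn.
  have yn' : lnk x != [::] by apply: contraNneq yn => ->.
  exact: ltn_trans (IH _ ly (pal_lnk x) yn' yn) ly.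
have /df_drop h : df (lnk x) < df x by have := df_leq px; lia.
have := h px; have := size_lnk_lt yn; have := df_lnk x; have := size_lnk x.
have : size (slk (lnk x)) <= lnkn (lnk x).
  rewrite slkE // -size_lnk; case: ifP => // _.
  have [->//|n] := eqVneq (lnk (lnk x)) [::]; exact/ltnW/size_slk_lt.
rewrite -[lnkn (lnk x)]size_lnk; lia.
Qed.

(** Two series links halve the length. *)
Lemma grp_size x : pal x -> size (grp x) <= (2 * trunc_log 2 (size x)).+2.
Proof.
elim/seq_ind_size: x => x IH px; rewrite grpE; case: eqVneq => // xn /=.
have [h1 h2 h3 _] := slkP px xn.
rewrite grpE; case: eqVneq => //= yn.
have [k1 k2 k3 _] := slkP h3 yn.
have H := grp_half px yn.
have := IH _ (ltn_trans k1 h1) k3.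
have [zn|zn] := eqVneq (slk (slk x)) [::]; first by rewrite zn /=; lia.
suff : (trunc_log 2 (size (slk (slk x)))).+1 <= trunc_log 2 (size x) by lia.
have z0 : 0 < size (slk (slk x)) by rewrite lt0n size_eq0.
apply: trunc_log_max => //; rewrite expnS.
by have := trunc_logP (isT : 1 < 2) z0; lia.
Qed.

End Words.

Lemma uniq_map_inj (A B : eqType) (f : A -> B) (s : seq A) :
  uniq (map f s) -> {in s &, injective f}.
Proof.
elim: s => //= z s IH /andP[h u] x y; rewrite !inE.
move=> /orP[/eqP ->|hx] /orP[/eqP ->|hy] // e.
- by case/negP: h; rewrite e; apply: map_f.
- by case/negP: h; rewrite -e; apply: map_f.
- exact: IH.
Qed.

(** * Leaders: one series for every preceding letter *)

Section Leaders.
Variables (A : eqType) (d : A).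
Implicit Types (x y z w : seq A) (a b c : A).

Local Notation pc := (pch d).

(** Of all heads with the same preceding letter the first, hence longest, survives. *)
Fixpoint lds (s : seq (seq A)) :=
  if s is z :: s' then z :: [seq y <- lds s' | pc y != pc z] else [::].
Definition leaders x := lds (grp x).
(** The next shorter head with the same letter. The empty word stands for its absence, which is
    unambiguous because heads are nonempty. *)
Definition cnx x := head [::] [seq y <- leaders (slk x) | pc y == pc x].

Lemma leadersE x :
  leaders x = if x == [::] then [::] else x :: [seq y <- leaders (slk x) | pc y != pc x].
Proof. by rewrite /leaders grpE; case: eqP. Qed.

Lemma leaders_sub x : subseq (leaders x) (grp x).
Proof.
rewrite /leaders; elim: (grp x) => //= z s IH; rewrite eqxx.
by apply: subseq_trans IH; apply: filter_subseq.
Qed.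

Lemma leaders_grp x z : z \in leaders x -> z \in grp x.
Proof. exact/mem_subseq/leaders_sub. Qed.

Lemma leaders_uniq x : uniq [seq pc z | z <- leaders x].
Proof.
rewrite /leaders; elim: (grp x) => //= z s IH; apply/andP; split.
  by apply/mapP => -[y]; rewrite mem_filter => /andP[/eqP h _] e; apply: h.
by apply: subseq_uniq IH; apply/map_subseq/filter_subseq.
Qed.

Lemma leaders_eq x z z' : z \in leaders x -> z' \in leaders x -> pc z = pc z' -> z = z'.
Proof. by move=> h h' e; apply: (uniq_map_inj (leaders_uniq x)). Qed.

Lemma grp_le x z z' : pal x -> z \in grp x -> z' \in grp x ->
  size z <= size z' -> lnkn z <= lnkn z'.
Proof.
move=> px h h' l; have [p1 n1 s1 e1] := grp_mem px h; have [p2 n2 s2 e2] := grp_mem px h'.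
move: l; rewrite leq_eqVlt => /orP[/eqP l|l]; first by rewrite e1 e2 l.
apply: (@leq_trans (size z)).
  by rewrite -size_lnk; apply/ltnW/size_lnk_lt.
by apply: lnkn_max => //; rewrite e2 suf_suf ?s2 ?andbT ?(ltnW l) // -e1.
Qed.

Lemma leaders_ex x z : pal x -> z \in grp x ->
  exists2 y, y \in leaders x & pc y = pc z /\ size z <= size y.
Proof.
elim/(@seq_ind_size A): x => x IH px; rewrite leadersE {1}grpE; case: eqVneq => // xn.
have [h1 h2 h3 _] := slkP px xn.
rewrite inE => /orP[/eqP ->|h]; first by exists x; rewrite ?mem_head.
have [y y1 [y2 y3]] := IH _ h1 h3 h; have [e|e] := eqVneq (pc y) (pc x).
  exists x; rewrite ?mem_head //; split; first by rewrite -e.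
  by have [_ _ h4 _] := grp_mem h3 h; lia.
by exists y; rewrite // inE mem_filter e y1 orbT.
Qed.

Lemma cnx_leaders x : cnx x != [::] -> cnx x \in leaders (slk x) /\ pc (cnx x) = pc x.
Proof.
rewrite /cnx; case E: [seq _ <- _ | _] => [|y s] //= _.
have : y \in [seq y <- leaders (slk x) | pc y == pc x] by rewrite E mem_head.
by rewrite mem_filter => /andP[/eqP].
Qed.

Lemma cnx_eq x y : y \in leaders (slk x) -> pc y = pc x -> pal x -> x != [::] -> cnx x = y.
Proof.
move=> h e px xn.
have h0 : y \in [seq y <- leaders (slk x) | pc y == pc x] by rewrite mem_filter e eqxx.
have hd : cnx x \in [seq y <- leaders (slk x) | pc y == pc x].
  by rewrite /cnx; case: [seq _ <- _ | _] h0 => // z s _; apply: mem_head.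
move: hd; rewrite mem_filter => /andP[/eqP e1 h1].
by apply: (leaders_eq h1 h); rewrite e.
Qed.

Lemma cnx_none x : cnx x = [::] -> pal x -> x != [::] ->
  forall y, y \in grp (slk x) -> pc y != pc x.
Proof.
move=> e px xn y h; apply/eqP => ey; have [h1 h2 h3 _] := slkP px xn.
have [z z1 [z2 _]] := leaders_ex h3 h.
have := cnx_eq z1 (etrans z2 ey) px xn; rewrite e => zn.
by have [_] := grp_mem h3 (leaders_grp z1); rewrite -zn.
Qed.

Lemma cnx_grp x : pal x -> x != [::] -> cnx x != [::] -> cnx x \in grp (slk x).
Proof. by move=> px xn /cnx_leaders[/leaders_grp]. Qed.

Lemma cnx_size x : pal x -> x != [::] -> size (cnx x) < size x.
Proof.
move=> px xn; have [->|n] := eqVneq (cnx x) [::]; first by rewrite lt0n size_eq0.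
have [h1 h2 h3 _] := slkP px xn.
by have [_ _ h _] := grp_mem h3 (cnx_grp px xn n); lia.
Qed.

Lemma cnx_pal x : pal x -> x != [::] -> pal (cnx x).
Proof.
move=> px xn; have [->|n] := eqVneq (cnx x) [::]; first by [].
have [h1 h2 h3 _] := slkP px xn.
by have [] := grp_mem h3 (cnx_grp px xn n).
Qed.

Fixpoint chf k x := if k is k'.+1 then (if x == [::] then [::] else x :: chf k' (cnx x)) else [::].
Definition chain x := chf (size x) x.

Lemma chf_ge k x : pal x -> size x <= k -> chf k x = chain x.
Proof.
rewrite /chain; elim/(@seq_ind_size A): x k => x IH k px.
have [->|xn] := eqVneq x [::]; first by case: k.
have h := cnx_size px xn; have h' := cnx_pal px xn.
case: k => [|k hk]; first by rewrite leqn0 size_eq0 (negPf xn).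
case E: (size x) => [|n]; first by move/eqP: E; rewrite size_eq0 (negPf xn).
by rewrite /= (negPf xn) !IH //; lia.
Qed.

Lemma chainE x : pal x -> chain x = if x == [::] then [::] else x :: chain (cnx x).
Proof.
move=> px; have [->//|xn] := eqVneq x [::]; have h := cnx_size px xn.
rewrite {1}/chain; case E: (size x) => [|n] /=; first by lia.
by rewrite (negPf xn) chf_ge ?cnx_pal //; lia.
Qed.

(** The heads split into classes by letter and [cnx] threads each class, starting at its leader. A
    report can thus enumerate the series of the unextended letters without touching the others. *)
Lemma chain_filter x y : pal x -> y \in leaders x ->
  chain y = [seq z <- grp x | pc z == pc y].
Proof.
elim/(@seq_ind_size A): x y => x IH y px; rewrite leadersE; case: eqVneq => // xn.
have [h1 h2 h3 _] := slkP px xn; rewrite grpE (negPf xn) /=.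
rewrite inE mem_filter => /orP[/eqP ->|/andP[/negPf ey hy]]; last first.
  by rewrite eq_sym ey; apply: IH.
rewrite eqxx chainE // (negPf xn); congr (_ :: _).
have [e|n] := eqVneq (cnx x) [::]; last first.
  by have [h e] := cnx_leaders n; rewrite (IH _ h1 _ h3 h) e.
rewrite e; transitivity [seq z <- grp (slk x) | pred0 z]; first by rewrite filter_pred0.
by apply: eq_in_filter => z hz; rewrite (negPf (cnx_none e px xn hz)).
Qed.

Lemma chain_grp x z : pal x -> z \in grp x <-> exists2 y, y \in leaders x & z \in chain y.
Proof.
move=> px; split=> [h|[y hy]]; last by rewrite (chain_filter px hy) mem_filter => /andP[].
have [y y1 [y2 _]] := leaders_ex px h; exists y => //.
by rewrite (chain_filter px y1) mem_filter h y2 eqxx.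
Qed.

Lemma chain_pch x y z : pal x -> y \in leaders x -> z \in chain y -> pc z = pc y.
Proof. by move=> px h; rewrite (chain_filter px h) mem_filter => /andP[/eqP]. Qed.

Lemma grp_bound x z i : pal x -> z \in grp x -> i < cnt z -> size (slk z) + i * df z <= lnkn z.
Proof.
move=> px h hi; have [pz zn _ _] := grp_mem px h; have [c0 cE] := cntP pz zn.
have := df_lnk z; have : i.+1 * df z <= cnt z * df z by rewrite leq_mul2r hi orbT.
by rewrite mulSn; lia.
Qed.

Lemma grp_pals_pch x n : pal x -> n < size x -> pal (suf n x) ->
  exists2 z, z \in grp x & [/\ pc z = nth d x n, n <= lnkn z &
    exists2 i, i < cnt z & n = size (slk z) + i * df z].
Proof.
move=> px hn /(grp_pals px hn)[z [i [h1 h2 h3]]]; have [pz zn sz e] := grp_mem px h1.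
have hb := grp_bound px h1 h2; exists z => //; split; [|by rewrite h3 | by exists i].
rewrite -(piece_pch d pz zn h2) -h3 {1}e nth_border // -?e //.
by have := size_lnk_lt zn; rewrite size_lnk; lia.
Qed.

(** Longer heads have longer links ([grp_le]), so within the class of a letter the link of the
    leader is the longest suffix preceded by that letter. *)
Lemma leader_longest x n : pal x -> n < size x -> pal (suf n x) ->
  exists2 y, y \in leaders x & pc y = nth d x n /\ n <= lnkn y.
Proof.
move=> px hn ps; have [z z1 [z2 z3 _]] := grp_pals_pch px hn ps.
have [y y1 [y2 y3]] := leaders_ex px z1; exists y => //; split; first by rewrite y2.
by apply: (leq_trans z3); apply: (grp_le px z1) => //; apply: leaders_grp.
Qed.

Lemma leader_suffix x y : pal x -> y \in grp x ->
  [/\ lnkn y < size x, pal (suf (lnkn y) x) & nth d x (lnkn y) = pc y].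
Proof.
move=> px h; have [p1 n1 s1 e1] := grp_mem px h.
have hl := size_lnk_lt n1; rewrite size_lnk in hl; split; first by lia.
  by rewrite -(suf_suf (n := size y)) -?e1 ?pal_lnk //; lia.
by rewrite /pch {2}e1 nth_border // -e1.
Qed.

(* The length of the next shorter palindromic suffix of [y] that is preceded by
   the same letter as its longest one. *)
Definition nxt y : option nat :=
  if df (lnk y) == df y then Some (lnkn (lnk y))
  else if cnx y == [::] then None else Some (lnkn (cnx y)).

Lemma slk_lnk_le y : pal y -> y != [::] -> df (lnk y) = df y -> size (slk y) <= lnkn (lnk y).
Proof.
move=> py yn e; have ln : lnk y != [::].
  by apply: contraTneq (df_gt0 yn) => h; rewrite -e h df_nil.
rewrite slkE // e eqxx; have [h1 h2 h3 _] := slkP (pal_lnk y) ln.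
by apply: lnkn_max => //; rewrite -h2.
Qed.

(** If the period survives the link, the next member of the same series qualifies, by [piece_pch].
    Otherwise [lnk y] was the only member of its series, and the next qualifying suffix is the link
    of the next head of the class. *)
Lemma nxtP y : pal y -> y != [::] ->
  if nxt y is Some m then
    [/\ m < lnkn y, pal (suf m y), nth d y m = pc y &
     forall n, n < lnkn y -> pal (suf n y) -> nth d y n = pc y -> n <= m]
  else forall n, n < lnkn y -> pal (suf n y) -> nth d y n = pc y -> False.
Proof.
move=> py yn; rewrite /nxt; have [h1 h2 h3 _] := slkP py yn.
have dy := df_lnk y; have d0 := df_gt0 yn; have sl := size_lnk y.
have lt := size_lnk_lt yn; rewrite sl in lt.
have [c0 cE] := cntP py yn.
case: eqP => E.
  have ln : lnk y != [::] by apply: contraTneq d0 => h; rewrite -E h df_nil.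
  have dl := df_lnk (lnk y); rewrite sl in dl.
  have hle := slk_lnk_le py yn E.
  have nl : lnkn (lnk y) < lnkn y by lia.
  split=> //.
  - by rewrite -suf_lnk ?pal_lnk // ltnW.
  - rewrite /pch (_ : lnkn y = lnkn (lnk y) + df y); last by lia.
    by rewrite -df_per //; lia.
  - move=> n hn /(grp_pals py (ltn_trans hn lt))[z [i []]].
    rewrite grpE (negPf yn) inE => /orP[/eqP -> hi hn'|hz hi hn'] _; last first.
      have [pz zn sz _] := grp_mem h3 hz; have := grp_bound h3 hz hi.
      by have := size_lnk_lt zn; rewrite size_lnk; lia.
    have : i.+1 < cnt y.
      rewrite ltn_neqAle hi andbT; apply/eqP => e.
      by move: cE; rewrite -e mulSn; lia.
    by move=> e; have : i.+2 * df y <= cnt y * df y; [rewrite leq_mul2r e orbT | rewrite !mulSn; lia].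
have sE : slk y = lnk y by rewrite slkE //; case: eqP.
have key n : n < lnkn y -> pal (suf n y) -> nth d y n = pc y ->
    exists2 z, z \in grp (slk y) & pc z = pc y /\ n <= lnkn z.
  move=> hn hp e; have [z z1 [z2 z3 [i hi hn']]] := grp_pals_pch py (ltn_trans hn lt) hp.
  move: z1; rewrite grpE (negPf yn) inE => /orP[/eqP ez|hz]; last by exists z; rewrite ?z2.
  by move: hn'; rewrite ez sE size_lnk; lia.
case: eqVneq => en.
  move=> n hn hp e; have [z z1 [z2 _]] := key n hn hp e.
  by have := cnx_none en py yn z1; rewrite z2 eqxx.
have [hc ec] := cnx_leaders en; have hg := leaders_grp hc.
have [k1 k2 k3] := leader_suffix h3 hg.
split.
- by move: k1; rewrite sE sl.
- by rewrite -(suf_lnk (n := lnkn (cnx y))) -?sE //; move: k1; rewrite sE sl => /ltnW.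
- by rewrite -ec -k3 sE nth_lnk //; move: k1; rewrite sE sl.
- move=> n hn hp e; have [z z1 [z2 z3]] := key n hn hp e.
  have [u u1 [u2 u3]] := leaders_ex h3 z1.
  have -> : cnx y = u by apply: cnx_eq => //; rewrite u2.
  by apply: (leq_trans z3); apply: (grp_le h3 z1 (leaders_grp u1)).
Qed.

(** The bit position of the series headed by [x]. It strictly decreases along a list of heads and
    depends on the head only, so that all palindromes that share a series agree on its bit. *)
Definition gx x := size (grp x).
Definition gw x := 2 ^ gx x.

Lemma gxE x : x != [::] -> gx x = (gx (slk x)).+1.
Proof. by rewrite /gx grpE => /negPf ->. Qed.

Lemma gx_lnk x : x != [::] -> df (lnk x) = df x -> gx x = gx (lnk x).
Proof.
move=> xn e; have ln : lnk x != [::] by apply: contraTneq (df_gt0 xn) => h; rewrite -e h df_nil.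
by rewrite (gxE xn) (gxE ln) (slkE xn) e eqxx.
Qed.

Lemma grp_gx x z : pal x -> z \in grp x -> gx z <= gx x.
Proof.
elim/(@seq_ind_size A): x => x IH px; rewrite grpE; case: eqVneq => // xn.
have [h1 h2 h3 _] := slkP px xn; rewrite inE => /orP[/eqP ->//|h].
by rewrite (gxE xn); apply/leqW/IH.
Qed.

Lemma grp_sorted x : pal x -> sorted gtn [seq gx z | z <- grp x].
Proof.
elim/(@seq_ind_size A): x => x IH px; rewrite grpE; case: eqVneq => // xn /=.
have [h1 h2 h3 _] := slkP px xn.
rewrite path_sortedE ?IH //; last by move=> a b c h h'; apply: ltn_trans h' h.
rewrite andbT; apply/allP => k /mapP[z hz ->].
by rewrite /= (gxE xn) ltnS; apply: grp_gx.
Qed.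

Lemma grp_gx_inj x y z : pal x -> y \in grp x -> z \in grp x -> gx y = gx z -> y = z.
Proof.
move=> px hy hz e; have := grp_sorted px => /(sorted_uniq (leT := gtn)) u.
apply: (uniq_map_inj (u _ _)) hy hz e.
- by move=> a b c h h'; apply: ltn_trans h' h.
- exact: ltnn.
Qed.

(** Distinct heads have distinct bits, so the sum is a bit set. *)
Definition lmask x := \sum_(z <- leaders x) gw z.

Lemma leaders_sorted x : pal x -> sorted gtn [seq gx z | z <- leaders x].
Proof.
move=> px; apply: (subseq_sorted _ (map_subseq gx (leaders_sub x)) (grp_sorted px)).
by move=> a b c h h'; apply: ltn_trans h' h.
Qed.

End Leaders.

(** * Appending one letter to a word *)

Section Extend.
Variables (A : eqType) (d : A).
Implicit Types (x y z w : seq A) (a b c : A).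

Definition cand w a n := [&& n < size w, pal (suf n w) & nth d w (size w - n.+1) == a].

Lemma suf2 w a n : n < size w ->
  suf n.+2 (rcons w a) = nth d w (size w - n.+1) :: rcons (suf n w) a.
Proof. by move=> h; rewrite suf_rcons // (sufS d). Qed.

Lemma pal_cand w a n : n < size w -> pal (suf n.+2 (rcons w a)) = cand w a n.
Proof. by move=> h; rewrite (suf2 _ h) pal_wrap /cand h andbC. Qed.

Lemma lps_some w a q : cand w a q -> (forall n, cand w a n -> n <= q) ->
  lps (rcons w a) = a :: rcons (suf q w) a.
Proof.
move=> hq mx; have /and3P[h1 h2 /eqP h3] := hq.
rewrite -[in RHS]h3 h3 -[X in X :: _]h3 -suf2 // /lps; congr suf.
apply/eqP; rewrite eqn_leq lpsn_max ?pal_cand ?size_rcons // andbT.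
have [] := lpsnP (rcons w a); case: (lpsn _) => [|[|n]] //; rewrite size_rcons => l1.
by rewrite pal_cand // => /mx.
Qed.

Lemma lps_none w a : (forall n, ~~ cand w a n) -> lps (rcons w a) = [:: a].
Proof.
move=> H; have -> : [:: a] = suf 1 (rcons w a) by rewrite suf_rcons // suf0.
rewrite /lps; congr suf; apply/eqP; rewrite eqn_leq lpsn_gt0 ?andbT -?size_eq0 ?size_rcons //.
have [] := lpsnP (rcons w a); case: (lpsn _) => [|[|n]] //; rewrite size_rcons => l1.
by rewrite pal_cand // (negPf (H n)).
Qed.

(** A border of [a :: rcons y a] with at least two letters wraps a palindromic suffix of [y]
    preceded by [a], and mirror symmetry in [y] allows to read that letter at index [n] from the
    left. The link of the new palindrome therefore comes from the second longest candidate. *)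
Lemma lnk_some y a q : pal y -> q < size y -> pal (suf q y) -> nth d y q = a ->
  (forall n, n < size y -> pal (suf n y) -> nth d y n = a -> n <= q) ->
  lnk (a :: rcons y a) = a :: rcons (suf q y) a.
Proof.
move=> py h1 h2 h3 mx; have e : a :: rcons y a = rcons (a :: y) a by [].
have nE n : n < size y -> nth d (a :: y) (size (a :: y) - n.+1) = nth d y n.
  move=> h; have /(pal_nth d) := py => /(_ _ h) ->.
  by rewrite (_ : size (a :: y) - n.+1 = (size y - n.+1).+1) //=; lia.
have sE n : n <= size y -> suf n (a :: y) = suf n y.
  by move=> h; rewrite -cat1s suf_cat_le.
have cE n : n < size y -> cand (a :: y) a n = pal (suf n y) && (nth d y n == a).
  by move=> h; rewrite /cand /= ltnS (ltnW h) sE ?(ltnW h) // nE.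
rewrite -[X in X :: rcons (suf q y) _]h3 -nE // -sE ?(ltnW h1) //.
have hq : q < size (a :: y) by rewrite /= ltnS ltnW.
rewrite -(suf2 _ hq) /lnk.
suff -> : q.+2 = lnkn (a :: rcons y a) by [].
apply/eqP; rewrite eq_sym eqn_leq; apply/andP; split; last first.
  apply: lnkn_max; first by rewrite /= size_rcons; lia.
  by rewrite e pal_cand ?cE //= ?h2 ?h3 ?eqxx //; lia.
have [|] := @lnknP _ (a :: rcons y a); first by [].
case: (lnkn _) => [|[|n]] //; rewrite /= size_rcons !ltnS => l1.
by rewrite e pal_cand ?cE //=; [move=> /andP[p /eqP q1]; apply: mx | lia].
Qed.

Lemma lnk_none y a : pal y ->
  (forall n, n < size y -> pal (suf n y) -> nth d y n = a -> False) ->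
  lnk (a :: rcons y a) = [:: a].
Proof.
move=> py H; have e : a :: rcons y a = rcons (a :: y) a by [].
have nE n : n < size y -> nth d (a :: y) (size (a :: y) - n.+1) = nth d y n.
  move=> h; have /(pal_nth d) := py => /(_ _ h) ->.
  by rewrite (_ : size (a :: y) - n.+1 = (size y - n.+1).+1) //=; lia.
have sE n : n <= size y -> suf n (a :: y) = suf n y.
  by move=> h; rewrite -cat1s suf_cat_le.
have -> : [:: a] = suf 1 (a :: rcons y a) by rewrite e suf_rcons // suf0.
rewrite /lnk; congr suf; apply/eqP; rewrite eqn_leq; apply/andP; split; last first.
  apply: lnkn_max; first by rewrite /= size_rcons; lia.
  by rewrite e suf_rcons // suf0 pal_one.
have [|] := @lnknP _ (a :: rcons y a); first by [].
case: (lnkn _) => [|[|n]] //; rewrite /= size_rcons !ltnS => l1.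
rewrite e pal_cand /=; last by lia.
move=> /and3P[_]; rewrite sE ?(ltnW l1) // nE // => p /eqP q.
by case: (H n).
Qed.

Lemma lnk_one a : lnk [:: a] = [::].
Proof. by have := size_lnk_lt (isT : [:: a] != [::]); case: (lnk _). Qed.

Lemma strip_pal x : pal x -> 1 < size x -> exists a y, x = a :: rcons y a /\ pal y.
Proof.
case: x => // a x; case/lastP: x => // y b; rewrite pal_wrap => /andP[/eqP <- py] _.
by exists a, y.
Qed.

(** If [x] is not the longest palindromic suffix, its mirror image inside the longest one is an
    occurrence that ends earlier. Passing to the prefix that ends there shortens the word. *)
Lemma lps_first w x : x != [::] -> pal x -> suf (size x) w = x -> size x <= size w ->
  exists2 n, 0 < n <= size w & lps (take n w) = x.
Proof.
move=> xn px; elim/(@seq_ind_size A): w => w IH hs hw.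
have [e|ne] := eqVneq (lpsn w) (size x).
  exists (size w); last by rewrite take_size /lps e.
  by rewrite leqnn andbT; case: x xn hw {px hs IH e} => //= a x _; lia.
have hl : size x < lpsn w by rewrite ltn_neqAle eq_sym ne /=; apply: lpsn_max; rewrite ?hs.
(* [k] is the end of the mirror image of [x]. *)
have [l1 l2] := lpsnP w; set k := size w - (lpsn w - size x).
have hk : k < size w by lia.
have st : size (take k w) = k by rewrite size_takel // ltnW.
have e1 : suf (size x) (suf (lpsn w) w) = x by rewrite suf_suf // l1 ltnW.
have e2 : take (size x) (suf (lpsn w) w) = x.
  by rewrite border_take ?e1 // size_suf // ltnW.
have E : suf (size x) (take k w) = x.
  rewrite -[in RHS]e2 /suf st take_drop.
  have -> : size x + (size w - lpsn w) = k by lia.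
  by congr drop; lia.
have [||n hn en] := IH (take k w) _ E; rewrite ?st //; first by lia.
exists n; first by lia.
by rewrite -en take_takel //; lia.
Qed.

End Extend.

(** * A structured language and its compilation *)

Inductive bas :=
| BConst of nat & nat
| BMov of nat & nat
| BArith of wop & nat & nat & nat
| Ld1 of nat & nat & nat
| St1 of nat & nat & nat
| Ld2 of nat & nat & nat & nat
| St2 of nat & nat & nat & nat
| CLd of nat & nat
| CSt of nat & nat
| BEmit of nat.

Inductive cnd := CEq of nat & nat | CLt of nat & nat | CCeq of nat & nat.

Inductive cmd :=
| CSkip
| CB of bas
| CSeq of cmd & cmd
| CIf of cnd & cmd & cmd
| CWhile of cnd & cmd.

(* Registers 59-61 are reserved: 59 holds the base B of the memory layout, 60
   and 61 are scratch.  The memory is organised in one-dimensional and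
   two-dimensional tables with indices below B. *)
Definition cbas (b : bas) : seq instr :=
  match b with
  | BConst x n => [:: Const x n]
  | BMov x y => [:: Const 60 0; Arith Add x y 60]
  | BArith o x y z => [:: Arith o x y z]
  | Ld1 x f y => [:: Const 60 f; Arith Mul 60 60 59; Arith Add 60 60 y;
                     Arith Mul 60 60 59; Read x 60]
  | St1 f y x => [:: Const 60 f; Arith Mul 60 60 59; Arith Add 60 60 y;
                     Arith Mul 60 60 59; Write 60 x]
  | Ld2 x f y z => [:: Const 60 (64 + f); Arith Mul 60 60 59; Arith Add 60 60 y;
                     Arith Mul 60 60 59; Arith Add 60 60 z; Read x 60]
  | St2 f y z x => [:: Const 60 (64 + f); Arith Mul 60 60 59; Arith Add 60 60 y;
                     Arith Mul 60 60 59; Arith Add 60 60 z; Write 60 x]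
  | CLd i x => [:: CRead i x]
  | CSt x i => [:: CWrite x i]
  | BEmit x => [:: Emit x]
  end.

Definition ccnd (b : cnd) (l : nat) : instr :=
  match b with
  | CEq x y => JumpEq x y l
  | CLt x y => JumpLt x y l
  | CCeq x y => CJumpEq x y l
  end.

Fixpoint csize (c : cmd) : nat :=
  match c with
  | CSkip => 0
  | CB b => size (cbas b)
  | CSeq c1 c2 => csize c1 + csize c2
  | CIf _ c1 c2 => (csize c1 + csize c2).+2
  | CWhile _ c => (csize c).+3
  end.

(** Jump targets are absolute, hence the start address [k]. The else branch comes first, since a
    conditional jump that is taken leads to the then branch. *)
Fixpoint compile (k : nat) (c : cmd) : seq instr :=
  match c with
  | CSkip => [::]
  | CB b => cbas b
  | CSeq c1 c2 => compile k c1 ++ compile (k + csize c1) c2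
  | CIf b c1 c2 =>
      ccnd b (k + csize c2).+2 :: compile k.+1 c2 ++
      Jump (k + csize c1 + csize c2).+2 :: compile (k + csize c2).+2 c1
  | CWhile b c =>
      ccnd b k.+2 :: Jump (k + csize c).+3 :: compile k.+2 c ++ [:: Jump k]
  end.

(** Register 59 may be read but not written; the scratch registers 60 and 61 are out of reach. *)
Definition wfb (b : bas) : bool :=
  match b with
  | BConst x _ => x < 59
  | BMov x y => (x < 59) && (y < 60)
  | BArith _ x y z => [&& x < 59, y < 60 & z < 60]
  | Ld1 x f y => [&& x < 59, f < 64 & y < 60]
  | St1 f y x => [&& x < 60, f < 64 & y < 60]
  | Ld2 x f y z => [&& x < 59, f < 64, y < 60 & z < 60]
  | St2 f y z x => [&& x < 60, f < 64, y < 60 & z < 60]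
  | CLd _ x => x < 60
  | CSt x _ => x < 60
  | BEmit x => x < 60
  end.

Definition wfd (b : cnd) : bool :=
  match b with CEq x y => (x < 60) && (y < 60) | CLt x y => (x < 60) && (y < 60) | _ => true end.

Fixpoint wfc (c : cmd) : bool :=
  match c with
  | CSkip => true
  | CB b => wfb b
  | CSeq c1 c2 => wfc c1 && wfc c2
  | CIf b c1 c2 => [&& wfd b, wfc c1 & wfc c2]
  | CWhile b c => wfd b && wfc c
  end.

Lemma size_comp k c : size (compile k c) = csize c.
Proof.
elim: c k => //= [c1 IH1 c2 IH2|b c1 IH1 c2 IH2|b c IH] k.
- by rewrite size_cat IH1 IH2.
- by rewrite size_cat /= IH1 IH2; lia.
- by rewrite size_cat /= IH; lia.
Qed.

Lemma nat_oddE n : Nat.odd n = odd n.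
Proof.
rewrite /Nat.odd.
suff: Nat.even n = ~~ odd n /\ Nat.even n.+1 = odd n by case=> ->; rewrite negbK.
elim: n => // n [h1 h2]; by split; [rewrite h2 /= negbK | rewrite /= h1].
Qed.
Lemma nat_div2E n : Nat.div2 n = n./2.
Proof.
suff: Nat.div2 n = n./2 /\ Nat.div2 n.+1 = uphalf n by case.
by elim: n => // n [h1 h2]; split=> //; rewrite /= h1.
Qed.
Lemma bitwise0 op n b : (forall b, op false b = false) -> Nat.bitwise op n 0 b = 0.
Proof. by move=> o; elim: n b => //= n IH b; rewrite o IH. Qed.

Lemma bitwiseE op n m a b : a <= n -> a <= m -> (forall b, op false b = false) ->
  Nat.bitwise op n a b = Nat.bitwise op m a b.
Proof.
move=> + + o; elim: n m a b => [|n IH] [|m] a b //.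
- by rewrite leqn0 => /eqP -> _; rewrite !bitwise0.
- by rewrite leqn0 => _ /eqP ->; rewrite !bitwise0.
- move=> h1 h2 /=; congr (_ + _); rewrite (IH m) //; rewrite nat_div2E; lia.
Qed.
(** The binary recursion behind [land_le] and [land_low]. *)
Lemma land_half x y : Nat.land x y = (odd x && odd y) + (Nat.land x./2 y./2).*2.
Proof.
rewrite /Nat.land; case: x => [|x]; first by [].
have bS n a b : Nat.bitwise andb n.+1 a b =
    (if odd a && odd b then 1 else 0) + 2 * Nat.bitwise andb n a./2 b./2.
  by rewrite -!nat_oddE -!nat_div2E.
rewrite bS (@bitwiseE andb x (x.+1)./2) //; try lia.
by case: (odd x.+1 && odd y); lia.
Qed.

Lemma land_le x y : Nat.land x y <= x.
Proof.
have [k] := ubnP x; elim: k x y => // k IH x y h; rewrite land_half.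
have [->|x0] := posnP x; first by rewrite andFb.
have := odd_double_half x; have := IH x./2 y./2.
by case: (odd x); case: (odd y) => /=; lia.
Qed.

(** * Semantics with tables and unbounded numbers, and its simulation by the machine *)

Section Semantics.
Variables (Sigma : finType) (w B : nat).

(** [h1] and [h2] are the tables with one and two indices; [tk] counts basic commands and tests. *)
Record hst := HS {
  vr : nat -> nat;
  vc : nat -> option Sigma;
  h1 : nat -> nat -> nat;
  h2 : nat -> nat -> nat -> nat;
  hc : nat -> option Sigma;
  ho : seq nat;
  tk : nat
}.

(** Register and table numbers are literals in programs, so that [Nat.eqb] lets simplification
    decide the comparison. Table indices are symbolic and are compared by boolean equality. *)
Definition hu (X : Type) (r : nat -> X) (i : nat) (x : X) : nat -> X :=
  fun j => if Nat.eqb j i then x else r j.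
Definition hu1 (m : nat -> nat -> nat) f i x : nat -> nat -> nat :=
  fun f' i' => if Nat.eqb f' f then (if i' == i then x else m f' i') else m f' i'.
Definition hu2 (m : nat -> nat -> nat -> nat) f i j x : nat -> nat -> nat -> nat :=
  fun f' i' j' => if Nat.eqb f' f then (if (i' == i) && (j' == j) then x else m f' i' j')
                  else m f' i' j'.
Definition huc (m : nat -> option Sigma) i x : nat -> option Sigma :=
  fun i' => if i' == i then x else m i'.

Definition hop (o : wop) (x y : nat) : nat :=
  match o with
  | Add => x + y
  | Defs.Sub => x - y
  | Mul => x * y
  | Div => x %/ y
  | Mod => x %% y
  | And => Nat.land x y
  | Or => Nat.lor x y
  | Xor => Nat.lxor x y
  | Shl => x * 2 ^ y
  | Shr => x %/ 2 ^ y
  end.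

(** The conditions under which word arithmetic agrees with natural numbers: no overflow and no
    negative difference. *)
Definition hop_ok (o : wop) (x y : nat) : Prop :=
  match o with
  | Add => x + y < 2 ^ w
  | Defs.Sub => y <= x
  | Mul => x * y < 2 ^ w
  | Shl => x * 2 ^ y < 2 ^ w
  | Or => False
  | Xor => False
  | _ => True
  end.

Definition side (b : bas) (s : hst) : Prop :=
  match b with
  | BConst x n => n < 2 ^ w
  | BMov _ _ => True
  | BArith o x y z => hop_ok o (vr s y) (vr s z)
  | Ld1 x f y => vr s y < B
  | St1 f y x => vr s y < B
  | Ld2 x f y z => vr s y < B /\ vr s z < B
  | St2 f y z x => vr s y < B /\ vr s z < B
  | _ => True
  end.

Definition hexec (b : bas) (s : hst) : hst :=
  let: HS r rc m1 m2 mc out t := s in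
  match b with
  | BConst x n => HS (hu r x n) rc m1 m2 mc out t.+1
  | BMov x y => HS (hu r x (r y)) rc m1 m2 mc out t.+1
  | BArith o x y z => HS (hu r x (hop o (r y) (r z))) rc m1 m2 mc out t.+1
  | Ld1 x f y => HS (hu r x (m1 f (r y))) rc m1 m2 mc out t.+1
  | St1 f y x => HS r rc (hu1 m1 f (r y) (r x)) m2 mc out t.+1
  | Ld2 x f y z => HS (hu r x (m2 f (r y) (r z))) rc m1 m2 mc out t.+1
  | St2 f y z x => HS r rc m1 (hu2 m2 f (r y) (r z) (r x)) mc out t.+1
  | CLd i x => HS r (hu rc i (mc (r x))) m1 m2 mc out t.+1
  | CSt x i => HS r rc m1 m2 (huc mc (r x) (rc i)) out t.+1
  | BEmit x => HS r rc m1 m2 mc (rcons out (r x)) t.+1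
  end.

Definition hcnd (b : cnd) (s : hst) : bool :=
  match b with
  | CEq x y => vr s x == vr s y
  | CLt x y => vr s x < vr s y
  | CCeq x y => vc s x == vc s y
  end.

Definition tick (s : hst) : hst :=
  let: HS r rc m1 m2 mc out t := s in HS r rc m1 m2 mc out t.+1.

Inductive ev : cmd -> hst -> hst -> Prop :=
| ev_skip s : ev CSkip s s
| ev_bas b s : side b s -> ev (CB b) s (hexec b s)
| ev_seq c1 c2 s s1 s2 : ev c1 s s1 -> ev c2 s1 s2 -> ev (CSeq c1 c2) s s2
| ev_if b c1 c2 s s' :
    ev (if hcnd b s then c1 else c2) (tick s) s' -> ev (CIf b c1 c2) s s'
| ev_while0 b c s : ~~ hcnd b s -> ev (CWhile b c) s (tick s)
| ev_while1 b c s s1 s2 : hcnd b s -> ev c (tick s) s1 ->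
    ev (CWhile b c) s1 s2 -> ev (CWhile b c) s s2.

Definition ok (c : cmd) (s : hst) (Q : hst -> Prop) : Prop :=
  exists s', ev c s s' /\ Q s'.

Lemma ok_skip s (Q : hst -> Prop) : Q s -> ok CSkip s Q.
Proof. by move=> q; exists s; split=> //; constructor. Qed.

Lemma ok_bas b s (Q : hst -> Prop) : side b s -> Q (hexec b s) -> ok (CB b) s Q.
Proof. by move=> h q; exists (hexec b s); split=> //; constructor. Qed.

Lemma ok_seq c1 c2 s (Q : hst -> Prop) : ok c1 s (ok c2 ^~ Q) -> ok (CSeq c1 c2) s Q.
Proof. by move=> [s1 [e1 [s2 [e2 q]]]]; exists s2; split=> //; apply: ev_seq e1 e2. Qed.

Lemma ok_if b c1 c2 s (Q : hst -> Prop) :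
  ok (if hcnd b s then c1 else c2) (tick s) Q -> ok (CIf b c1 c2) s Q.
Proof. by move=> [s1 [e q]]; exists s1; split=> //; apply: ev_if. Qed.

Lemma ok_while b c s (Q : hst -> Prop) :
  (if hcnd b s then ok c (tick s) (ok (CWhile b c) ^~ Q) else Q (tick s)) ->
  ok (CWhile b c) s Q.
Proof.
case: ifP => [h [s1 [e1 [s2 [e2 q]]]]|h q].
  by exists s2; split=> //; apply: ev_while1 e1 e2.
by exists (tick s); split=> //; apply: ev_while0; rewrite h.
Qed.

Lemma ok_mono c s (Q Q' : hst -> Prop) : (forall s, Q s -> Q' s) -> ok c s Q -> ok c s Q'.
Proof. by move=> H [s' [e q]]; exists s'; split=> //; apply: H. Qed.

(** Tables with one index use the multiples of [B] below [64 * B * B], tables with two indices the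
    cells from there up to [128 * B * B]. *)
Definition simrel (s : hst) (st : state Sigma) : Prop :=
  [/\ [/\ forall x, x < 60 -> reg st x = vr s x,
          vr s 59 = B,
          forall x, reg st x < 2 ^ w
        & forall a, Defs.mem st a < 2 ^ w],
      creg st =1 vc s,
      forall f i, f < 64 -> i < B -> Defs.mem st ((f * B + i) * B) = h1 s f i,
      forall f i j, f < 64 -> i < B -> j < B ->
        Defs.mem st (((64 + f) * B + i) * B + j) = h2 s f i j
    & cmem st =1 hc s /\ output st = ho s].

Hypothesis Bw : 128 * B * B <= 2 ^ w.
Hypothesis B1 : 1 < B.

Lemma wop_hop o x y : x < 2 ^ w -> y < 2 ^ w -> hop_ok o x y -> wop_eval w o x y = hop o x y.
Proof.
move=> hx hy; case: o => //= h; try exact: modn_small.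
- rewrite /wop_eval addnBA; last exact: ltnW.
  rewrite -addnBAC // modnDr modn_small //.
  exact: leq_ltn_trans (leq_subr _ _) hx.
- exact/modn_small/(leq_ltn_trans (leq_div _ _) hx).
- exact/modn_small/(leq_ltn_trans (leq_mod _ _) hx).
- exact/modn_small/(leq_ltn_trans (land_le _ _) hx).
- exact/modn_small/(leq_ltn_trans (leq_div _ _) hx).
Qed.

Let B0 : 0 < B. Proof. exact: ltnW. Qed.

Lemma wop_lt o x y : wop_eval w o x y < 2 ^ w.
Proof. by case: o; rewrite ltn_mod expn_gt0. Qed.

Definition place (P : seq instr) (k : nat) (l : seq instr) : Prop :=
  exists l1 l2, P = l1 ++ l ++ l2 /\ size l1 = k.

Lemma place_cat P k l l' : place P k (l ++ l') -> place P k l /\ place P (k + size l) l'.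
Proof.
move=> [l1 [l2 [-> <-]]]; split; first by exists l1, (l' ++ l2); rewrite -!catA.
by exists (l1 ++ l), l2; rewrite size_cat -!catA.
Qed.

Lemma place_cons P k i l : place P k (i :: l) ->
  (nth (Jump 0) P k = i /\ k < size P) /\ place P k.+1 l.
Proof.
move=> [l1 [l2 [-> <-]]]; split; last by exists (rcons l1 i), l2; rewrite cat_rcons size_rcons.
by rewrite nth_cat ltnn subnn size_cat /=; split=> //; lia.
Qed.

Lemma step_at P (st : state Sigma) k i : pc st = k -> nth (Jump 0) P k = i /\ k < size P ->
  step w P st = exec_instr w i st.
Proof. by move=> e [h1 h2]; rewrite /step /halted e leqNgt h2 h1. Qed.

Lemma updE (X : Type) (f : nat -> X) i x j : upd f i x j = if j == i then x else f j.
Proof. by []. Qed.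

Lemma addr1 f i : f < 128 -> i < B ->
  [/\ f < 2 ^ w, f * B < 2 ^ w, f * B + i < 2 ^ w & (f * B + i) * B < 2 ^ w].
Proof.
move=> hf hi.
have h : (f * B + i).+1 * B <= 128 * B * B.
  rewrite leq_mul2r; apply/orP; right.
  by apply: (@leq_trans (f.+1 * B)); [rewrite mulSn; lia | rewrite leq_mul2r hf orbT].
have h' := leq_trans h Bw; rewrite mulSn in h'.
have : f * B + i <= (f * B + i) * B by rewrite -{1}[X in X <= _]muln1 leq_mul2l; lia.
have : f <= f * B by rewrite -{1}[X in X <= _]muln1 leq_mul2l; lia.
by split; lia.
Qed.

Lemma addr2 f i j : f < 128 -> i < B -> j < B -> (f * B + i) * B + j < 2 ^ w.
Proof.
move=> hf hi hj.
have h : (f * B + i).+1 * B <= 128 * B * B.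
  rewrite leq_mul2r; apply/orP; right.
  by apply: (@leq_trans (f.+1 * B)); [rewrite mulSn; lia | rewrite leq_mul2r hf orbT].
by have h' := leq_trans h Bw; rewrite mulSn in h'; lia.
Qed.

Lemma addr_inj f i j f' i' j' : i < B -> j < B -> i' < B -> j' < B ->
  (f * B + i) * B + j = (f' * B + i') * B + j' -> [/\ f = f', i = i' & j = j'].
Proof.
move=> hi hj hi' hj' e.
have e1 : (f * B + i) = (f' * B + i').
  by have := congr1 (divn^~ B) e; rewrite !divnMDl // !(divn_small hj, divn_small hj') !addn0.
have e2 : f = f'.
  by have := congr1 (divn^~ B) e1; rewrite !divnMDl // !(divn_small hi, divn_small hi') !addn0.
by split=> //; lia.
Qed.

(** The factor 6 is the length of the longest translation of a basic command; a test costs at most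
    two instructions including the unconditional jump. *)
Definition sim (P : seq instr) (k : nat) (n : nat) (s s' : hst) (st : state Sigma) : Prop :=
  exists t st', [/\ iter t (step w P) st = st', simrel s' st', pc st' = k + n
    & t + 6 * tk s <= 6 * tk s'].

Fixpoint exs (l : seq instr) (st : state Sigma) : state Sigma :=
  if l is i :: l' then exs l' (exec_instr w i st) else st.

Definition straight (i : instr) : bool :=
  match i with Jump _ | JumpEq _ _ _ | JumpLt _ _ _ | CJumpEq _ _ _ => false | _ => true end.

Lemma exs_run P k l st : pc st = k -> place P k l -> all straight l ->
  iter (size l) (step w P) st = exs l st /\ pc (exs l st) = k + size l.
Proof.
elim: l k st => [|i l IH] k st hp hl /=; first by rewrite addn0.
case/andP => si sl; have [h1 h2] := place_cons hl.
rewrite -iterS iterSr (step_at hp h1) -addSnnS; apply: IH => //.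
by move: si hp; case: st => ? ? ? ? ? ?; case: i {hl h1} => //= *; congr S.
Qed.

Lemma bas_sim P k b s st : wfb b -> side b s -> pc st = k -> place P k (cbas b) ->
  simrel s st -> sim P k (size (cbas b)) s (hexec b s) st.
Proof.
move=> wf sd hp pl [[rr rB rl ml] rc r1 r2 [rm ro]].
have [e1 e2] := exs_run hp pl (ltac:(by case: (b))).
exists (size (cbas b)), (exs (cbas b) st); split=> //; last first.
  by case: (s) => ? ? ? ? ? ? ?; case: (b) => //= *; rewrite mulnS; lia.
have R59 : reg st 59 = B by rewrite rr.
have pw : 0 < 2 ^ w by rewrite expn_gt0.
have A1 f i : f < 128 -> i < B ->
   [/\ f %% 2 ^ w = f, (f * B) %% 2 ^ w = f * B, (f * B + i) %% 2 ^ w = f * B + i &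
     ((f * B + i) * B) %% 2 ^ w = (f * B + i) * B].
  by move=> hf hi; have [? ? ? ?] := addr1 hf hi; rewrite !modn_small.
have A2 f i j : f < 128 -> i < B -> j < B -> ((f * B + i) * B + j) %% 2 ^ w = (f * B + i) * B + j.
  by move=> hf hi hj; rewrite modn_small // addr2.
have nb x x' : Nat.eqb x x' = (x == x') by [].
have f64 f : f < 64 -> f < 128 by lia.
have g64 f : f < 64 -> 64 + f < 128 by lia.
have U (r r' : nat -> nat) x v v' : (forall i, i < 60 -> r i = r' i) -> v = v' ->
    forall i, i < 60 -> upd r x v i = hu r' x v' i.
  by move=> h -> i hi; rewrite /upd /hu nb; case: eqP => // _; apply: h.
have U60 (r r' : nat -> nat) v : (forall i, i < 60 -> r i = r' i) ->
    forall i, i < 60 -> upd r 60 v i = r' i.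
  by move=> h i hi; rewrite /upd; case: eqP => [e|_]; [rewrite e in hi | apply: h].
have L (r : nat -> nat) x v : (forall i, r i < 2 ^ w) -> v < 2 ^ w -> forall i, upd r x v i < 2 ^ w.
  by move=> h hv i; rewrite /upd; case: eqP.
have ML x : x %% 2 ^ w < 2 ^ w by rewrite ltn_mod.
move: rr rB rl ml rc r1 r2 rm ro R59 sd {hp pl e1 e2}.
case: st => k' r c m cm out; case: s => vr1 vc1 m1 m2 mc1 ho1 t1 /=.
move=> rr rB rl ml rc r1 r2 rm ro R59.
case: b wf => /= [x n hx sd|x y /andP[hx hy] _|o x y z /and3P[hx hy hz] sd
  |x f y /and3P[hx hf hy] sd|f y x /and3P[hx hf hy] sd
  |x f y z /and4P[hx hf hy hz] [s1 s2]|f y z x /and4P[hx hf hy hz] [s1 s2]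
  |i x hx _|x i hx _|x hx _]; rewrite ?updE ?eqxx /=.
- split=> //; split=> //=; rewrite ?modn_small //; first exact: U.
    by rewrite /hu nb; case: eqP hx => [<-|].
  exact: L.
- have y60 : (y == 60) = false by apply/eqP => e; rewrite e in hy.
  split=> //; split=> //=.
  + apply: (U); first exact: U60.
    by rewrite /wop_eval y60 mod0n addn0 modn_small ?rr // -rr.
  + by rewrite /hu nb; case: eqP hx => [<-|].
  + by apply: (L _) => //; [apply: (L) | apply: wop_lt].
- split=> //; split=> //=.
  + by apply: (U) => //; rewrite -(rr y) // -(rr z) // wop_hop // !rr.
  + by rewrite /hu nb; case: eqP hx => [<-|].
  + by apply: (L) => //; exact: wop_lt.
- have y60 : (y == 60) = false by apply/eqP => e; rewrite e in hy.
  rewrite -rr // in sd; have [q1 q2 q3 q4] := A1 f (r y) (f64 f hf) sd.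
  have [? ? ? ?] := addr1 (f64 f hf) sd.
  rewrite /wop_eval R59 y60 q1 q2 q3 q4.
  split=> //; split=> //=.
  + apply: (U); first by do 4! apply: (U60).
    by rewrite r1 -?rr.
  + by rewrite /hu nb; case: eqP hx => [<-|].
  + by apply: (L) => //; do 4! apply: (L) => //.
- have y60 : (y == 60) = false by apply/eqP => e; rewrite e in hy.
  have x60 : (x == 60) = false by apply/eqP => e; rewrite e in hx.
  rewrite -rr // in sd; have [q1 q2 q3 q4] := A1 f (r y) (f64 f hf) sd.
  have [? ? ? ?] := addr1 (f64 f hf) sd.
  rewrite /wop_eval R59 y60 x60 q1 q2 q3 q4.
  split=> //=; first split=> //=.
  + by do 4! apply: (U60).
  + by do 4! apply: (L) => //.
  + by apply: (L).
  + move=> f' i' hf' hi'; rewrite /upd /hu1 nb -!rr //.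
    case: eqP => [e|ne].
      have [] := @addr_inj f' i' 0 f (r y) 0 hi' B0 sd B0; first by rewrite !addn0.
      by move=> -> -> _; rewrite !eqxx.
    case: eqP => [ef|_]; last exact: r1.
    by case: eqP => [ei|_]; [case: ne; rewrite ef ei | exact: r1].
  + move=> f' i' j' hf' hi' hj'; rewrite /upd; case: eqP => [e|_]; last exact: r2.
    have [] := @addr_inj (64 + f') i' j' f (r y) 0 hi' hj' sd B0; first by rewrite !addn0.
    by move=> e1; move: hf; rewrite -e1; lia.
- have y60 : (y == 60) = false by apply/eqP => e; rewrite e in hy.
  have z60 : (z == 60) = false by apply/eqP => e; rewrite e in hz.
  rewrite -!rr // in s1 s2; have [q1 q2 q3 q4] := A1 (64 + f) (r y) (g64 f hf) s1.
  have q5 := A2 (64 + f) (r y) (r z) (g64 f hf) s1 s2.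
  have [? ? ? ?] := addr1 (g64 f hf) s1; have ? := addr2 (g64 f hf) s1 s2.
  rewrite /wop_eval R59 y60 z60 q1 q2 q3 q4 q5.
  split=> //; split=> //=.
  + apply: (U); first by do 5! apply: (U60).
    by rewrite r2 -?rr.
  + by rewrite /hu nb; case: eqP hx => [<-|].
  + by apply: (L) => //; do 5! apply: (L) => //.
- have y60 : (y == 60) = false by apply/eqP => e; rewrite e in hy.
  have z60 : (z == 60) = false by apply/eqP => e; rewrite e in hz.
  have x60 : (x == 60) = false by apply/eqP => e; rewrite e in hx.
  rewrite -!rr // in s1 s2; have [q1 q2 q3 q4] := A1 (64 + f) (r y) (g64 f hf) s1.
  have q5 := A2 (64 + f) (r y) (r z) (g64 f hf) s1 s2.
  have [? ? ? ?] := addr1 (g64 f hf) s1; have ? := addr2 (g64 f hf) s1 s2.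
  rewrite /wop_eval R59 y60 z60 x60 q1 q2 q3 q4 q5.
  split=> //=; first split=> //=.
  + by do 5! apply: (U60).
  + by do 5! apply: (L) => //.
  + by apply: (L).
  + move=> f' i' hf' hi'; rewrite /upd; case: eqP => [e|_]; last exact: r1.
    have [] := @addr_inj f' i' 0 (64 + f) (r y) (r z) hi' B0 s1 s2; first by rewrite addn0.
    by move=> e1; move: hf'; rewrite e1; lia.
  + move=> f' i' j' hf' hi' hj'; rewrite /upd /hu2 nb -!rr //.
    case: eqP => [e|ne].
      have [] := @addr_inj (64 + f') i' j' (64 + f) (r y) (r z) hi' hj' s1 s2 e.
      by move=> /addnI -> -> ->; rewrite !eqxx.
    case: eqP => [ef|_]; last exact: r2.
    case: eqP => [ei|_] /=; last exact: r2.
    by case: eqP => [ej|_]; [case: ne; rewrite ef ei ej | exact: r2].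
- by split=> //= j; rewrite /upd /hu nb rm rr // rc.
- by split=> //; split=> // a /=; rewrite /upd /huc rr // rc rm.
- by split=> //; split=> //; rewrite ro rr.
Qed.

Lemma cnd_eq b s st : wfd b -> simrel s st ->
  forall k, exec_instr w (ccnd b k) st =
    let: State k' r cr m cm out := st in
    State (if hcnd b s then k else k'.+1) r cr m cm out.
Proof.
move=> + [[rr _ _ _] rc _ _ _] k; move: rr rc.
case: st => k' r c m cm out; case: b => [x y|x y|x y] /= rr rc.
- by case/andP => hx hy; rewrite -!rr.
- by case/andP => hx hy; rewrite -!rr.
- by rewrite !rc.
Qed.

Lemma rel_tick s st : simrel s st -> simrel (tick s) st.
Proof. by case: s. Qed.

Lemma step_cnd b k l i s st P : wfd b -> place P k (ccnd b l :: i) -> simrel s st -> pc st = k ->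
  exists2 st1, step w P st = st1 & simrel (tick s) st1 /\ pc st1 = if hcnd b s then l else k.+1.
Proof.
move=> wf pl r p; have [h _] := place_cons pl; have e := cnd_eq wf r l.
exists (exec_instr w (ccnd b l) st); first exact: step_at p h.
by rewrite e; move: r p; case: (st) => /= ? ? ? ? ? ? r <-; split=> //; apply: rel_tick.
Qed.

Lemma step_jump k l i s st P : place P k (Jump l :: i) -> simrel s st -> pc st = k ->
  exists2 st1, step w P st = st1 & simrel s st1 /\ pc st1 = l.
Proof.
move=> pl r p; have [h _] := place_cons pl.
by exists (exec_instr w (Jump l) st); [exact: step_at p h | move: r; case: (st)].
Qed.

Lemma tk_tick s : tk (tick s) = (tk s).+1. Proof. by case: s. Qed.

(** Induction on the execution rather than on the program, because each iteration of a loop reenters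
    the same code. *)
Lemma comp_sim c s s' : ev c s s' -> wfc c -> forall P k st,
  place P k (compile k c) -> simrel s st -> pc st = k -> sim P k (csize c) s s' st.
Proof.
elim=> {c s s'}.
- by move=> s _ P k st _ r p; exists 0, st; split=> //=; rewrite ?addn0.
- move=> b s sd wf P k st pl r p; exact: bas_sim.
- move=> c1 c2 s s1 s2 _ IH1 _ IH2 /andP[w1 w2] P k st /place_cat[p1 p2] r p.
  have [t1 [st1 [e1 r1 q1 l1]]] := IH1 w1 P k st p1 r p.
  rewrite size_comp in p2.
  have [t2 [st2 [e2 r2 q2 l2]]] := IH2 w2 P _ st1 p2 r1 q1.
  exists (t2 + t1), st2; split=> //; [by rewrite iterD e1 | by rewrite q2 /= addnA | lia].
- move=> b c1 c2 s s' _ IH /and3P[wb w1 w2] P k st /= pl r p.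
  have [_ pl2] := place_cons pl.
  have [pl3 pl4] := place_cat pl2; rewrite size_comp addSn in pl4.
  have [_ pl5] := place_cons pl4.
  have [st1 e1 [r1 p1]] := step_cnd wb pl r p.
  case: (hcnd b s) p1 IH => p1 IH.
    have [t [st2 [e2 r2 p2 l2]]] := IH w1 P _ st1 pl5 r1 p1.
    exists t.+1, st2; split=> //; first by rewrite iterSr e1.
      by rewrite p2; lia.
    by move: l2; rewrite tk_tick; lia.
  have [t [st2 [e2 r2 p2 l2]]] := IH w2 P _ st1 pl3 r1 p1.
  rewrite addSn in p2; have [st3 e3 [r3 p3]] := step_jump pl4 r2 p2.
  exists t.+2, st3; split=> //; first by rewrite iterS iterSr e1 e2.
    by rewrite p3; lia.
  by move: l2; rewrite tk_tick; lia.
- move=> b c s /negPf hb /= /andP[wb wc] P k st pl r p.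
  have [_ pl2] := place_cons pl.
  have [st1 e1 [r1]] := step_cnd wb pl r p; rewrite hb => p1.
  have [st2 e2 [r2 p2]] := step_jump pl2 r1 p1.
  exists 2, st2; split=> //; first by rewrite /= e1.
    by rewrite p2; lia.
  by rewrite tk_tick; lia.
- move=> b c s s1 s2 hb _ IH1 _ IH2 /= wf P k st pl r p.
  have /andP[wb wc] := wf.
  have [_ pl2] := place_cons pl; have [_ pl3] := place_cons pl2.
  have [pl4 pl5] := place_cat pl3; rewrite size_comp in pl5.
  have [st1 e1 [r1]] := step_cnd wb pl r p; rewrite hb => p1.
  have [t [st2 [e2 r2 p2 l2]]] := IH1 wc P _ st1 pl4 r1 p1.
  have [st3 e3 [r3 p3]] := step_jump pl5 r2 p2.
  have [t' [st4 [e4 r4 p4 l4]]] := IH2 wf P k st3 pl r3 p3.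
  exists (t' + t.+2), st4; split=> //; first by rewrite iterD iterS iterSr e1 e2 e3.
  by move: l2; rewrite tk_tick; lia.
Qed.

End Semantics.

(** * Level ancestors *)

(* Tables with one index.  Up to [ALL] they describe nodes, palindromes and names:
   parent, depth, macro anchor of the block, previous macro anchor, index of the
   anchor; sub-block and code in it; [BET] bits per child slot; child slot, number
   of children, name of the incoming edge, longest palindromic suffix; [ACT] is the
   bit mask of the leaders whose suffixes are not extended by any child and [TOPA]
   the same for the longest suffix; [KILL] and [KTOP] are what a child removes from
   them; length, longest palindromic suffix and series link of a palindrome, the
   letter before the former, bit of its series, mask of its leaders, next leader
   with the same letter, inner palindrome, outer letter, reference count.  [LOG],
   [KOF] are lookup tables, [ALL] is the stack of free names. *)
Notation PAR := 0. Notation DEP := 1. Notation AM := 2. Notation MPAR := 3.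
Notation KIX := 4. Notation SUB := 5. Notation CODE := 6. Notation BET := 7.
Notation RNK := 8. Notation NCH := 9. Notation IDN := 10. Notation PAL := 11.
Notation ACT := 12. Notation TOPA := 13. Notation KILL := 14. Notation KTOP := 15.
Notation LEN := 20. Notation LINK := 21. Notation DIFF := 22. Notation SLINK := 23.
Notation PCH := 24. Notation GW := 25. Notation LMASK := 26. Notation CNEXT := 27.
Notation INNER := 28. Notation CHAR := 29. Notation CNT := 30.
Notation LOG := 31. Notation KOF := 32. Notation ALL := 33. Notation SCR := 34.
(* Tables with two indices, hence the reuse of the numbers: [YT] and [TT] jump
   between macro anchors, [NEXT] maps an inner palindrome and an outer letter to a
   palindrome and [LD] maps a palindrome and a bit to the leader with that bit. *)
Notation NODE := 0. Notation YT := 1. Notation TT := 2. Notation SLOT := 3.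
Notation NEXT := 4. Notation LD := 5.

Coercion CB : bas >-> cmd.
Definition seqs (l : seq cmd) : cmd := foldr CSeq CSkip l.

Arguments seqs : simpl never.
Arguments hu {X} r i x j /.
Arguments hu1 m f i x f' i' /.
Arguments hu2 m f i j x f' i' j' /.

Section Blocks.

(** Block [k] of a root path starts at depth [ast k], and [kap] gives the block of a depth. The
    length [lam] exceeds the logarithm of the starting depth, so every level [j] with [2 ^ j <= k]
    has an offset of its own in block [k] ([off_lt]). *)
Definition lam D := (trunc_log 2 D).+2.
Fixpoint ast k := if k is k'.+1 then ast k' + lam (ast k') else 0.
Fixpoint kap D :=
  if D is D'.+1 then (if D'.+1 == ast (kap D').+1 then (kap D').+1 else kap D') else 0.

Lemma ast_lt k : ast k < ast k.+1.
Proof. by rewrite /= /lam; lia. Qed.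

Lemma ast_mono : {mono ast : m n / m <= n}.
Proof.
by apply: leq_mono; apply: (homo_ltn ltn_trans); exact: ast_lt.
Qed.

Lemma ast_ltn m n : (ast m < ast n) = (m < n).
Proof. by rewrite !ltnNge ast_mono. Qed.

Lemma ast_ge k : k <= ast k.
Proof. by elim: k => // k IH; apply: leq_ltn_trans IH (ast_lt k). Qed.

Lemma kapP D : ast (kap D) <= D < ast (kap D).+1.
Proof.
elim: D => [|D]; first by [].
set k := kap D => /andP[h1 h2]; rewrite [kap _]/= -/k; case: eqP => e.
  by rewrite e -[ast k + _]/(ast k.+1) leqnn; exact: ast_lt.
by rewrite (leqW h1) ltn_neqAle h2 andbT; apply/eqP.
Qed.

Lemma kap_eq k D : ast k <= D < ast k.+1 -> kap D = k.
Proof.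
move=> /andP[h1 h2]; have /andP[h3 h4] := kapP D.
have := leq_ltn_trans h1 h4; have := leq_ltn_trans h3 h2.
by rewrite !ast_ltn; lia.
Qed.

Lemma kap_ast k : kap (ast k) = k.
Proof. by apply: kap_eq; rewrite leqnn ast_lt. Qed.

Lemma kap_le D D' : D <= D' -> kap D <= kap D'.
Proof.
move=> h; have /andP[h1 _] := kapP D; have /andP[_ h2] := kapP D'.
by have := leq_ltn_trans (leq_trans h1 h) h2; rewrite ast_ltn.
Qed.

Lemma kap_leq D : kap D <= D.
Proof. by have /andP[h _] := kapP D; apply: leq_trans h; apply: ast_ge. Qed.

Lemma log_le a b : a <= b -> trunc_log 2 a <= trunc_log 2 b.
Proof. exact: leq_trunc_log. Qed.

Lemma lam_le a b : a <= b -> lam a <= lam b.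
Proof. by move=> h; rewrite /lam !ltnS log_le. Qed.

Lemma off_lt j q : 2 ^ j <= q -> ast q + j < ast q.+1.
Proof.
move=> h; rewrite /= ltn_add2l /lam ltnS leqW //; apply: trunc_log_max => //.
exact: leq_trans h (ast_ge q).
Qed.

Lemma astS k : ast k.+1 = ast k + lam (ast k). Proof. by []. Qed.

End Blocks.
Arguments ast : simpl never.
Arguments kap : simpl never.

(** * Trees described by their root paths *)

Section Tree.
Variables (rt : nat).
Implicit Types (ns : seq nat) (pn : nat -> seq nat) (u v p : nat).

Definition anc pn v t := nth rt (rt :: pn v) t.
Definition dep pn v := size (pn v).

(** [pn v] lists the path from the root, excluded, to [v]. It is a ghost function of the proof and
    is stored nowhere. *)
Definition wft ns pn :=
  [/\ rt \in ns, pn rt = [::], uniq ns,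
      forall v, v \in ns -> uniq (rt :: pn v)
    & forall v, v \in ns -> v != rt -> exists2 p, p \in ns & pn v = rcons (pn p) v].

Variables (ns : seq nat) (pn : nat -> seq nat).
Hypothesis wf : wft ns pn.

Lemma dep0 v : v \in ns -> (dep pn v == 0) = (v == rt).
Proof.
move=> h; have [_ e _ _ H] := wf; have [->|n] := eqVneq v rt; first by rewrite /dep e.
by have [p _ ep] := H v h n; rewrite /dep ep size_rcons.
Qed.

Lemma anc0 v : anc pn v 0 = rt. Proof. by []. Qed.

Lemma anc_spec v t : v \in ns -> t <= dep pn v ->
  anc pn v t \in ns /\ pn (anc pn v t) = take t (pn v).
Proof.
have [rn e un _ H] := wf; have [n] := ubnP (dep pn v); elim: n v t => // n IH v t hn hv ht.
have [ev|nv] := eqVneq v rt.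
  by move: ht; rewrite ev /dep e /= leqn0 => /eqP ->; rewrite /anc /= e.
have [p hp ep] := H v hv nv; move: ht hn; rewrite /dep ep size_rcons leq_eqVlt.
case/orP => [/eqP ->|ht] hn.
  by rewrite /anc ep /= nth_rcons ltnn eqxx take_oversize ?size_rcons.
have [k1 k2] := IH p t hn hp ht.
have -> : anc pn v t = anc pn p t by rewrite /anc ep -rcons_cons nth_rcons /= ht.
by rewrite k1 k2 -cats1 takel_cat.
Qed.

Lemma anc_ns v t : v \in ns -> t <= dep pn v -> anc pn v t \in ns.
Proof. by move=> hv ht; have [] := anc_spec hv ht. Qed.

Lemma dep_anc v t : v \in ns -> t <= dep pn v -> dep pn (anc pn v t) = t.
Proof. by move=> hv ht; have [_ e] := anc_spec hv ht; rewrite /dep e size_takel. Qed.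

Lemma anc_anc v t t' : v \in ns -> t <= dep pn v -> t' <= t ->
  anc pn (anc pn v t) t' = anc pn v t'.
Proof.
move=> hv ht h; have [_ e] := anc_spec hv ht; rewrite /anc e.
by case: t' h => // t' h; rewrite /= nth_take.
Qed.

Lemma anc_dep v : v \in ns -> anc pn v (dep pn v) = v.
Proof.
have [rn e un _ H] := wf => hv; have [ev|nv] := eqVneq v rt.
  by rewrite ev /dep e.
by have [p hp ep] := H v hv nv; rewrite /anc /dep ep size_rcons /= nth_rcons ltnn eqxx.
Qed.

Definition par v := anc pn v (dep pn v).-1.

Lemma par_ns v : v \in ns -> par v \in ns.
Proof. by move=> hv; apply: anc_ns => //; apply: leq_pred. Qed.

Lemma dep_par v : v \in ns -> dep pn (par v) = (dep pn v).-1.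
Proof. by move=> hv; rewrite dep_anc // leq_pred. Qed.

Lemma pn_par v : v \in ns -> v != rt -> pn v = rcons (pn (par v)) v.
Proof.
have [rn e un _ H] := wf => hv nv; have [p hp ep] := H v hv nv.
suff -> : par v = p by [].
rewrite /par /anc /dep ep size_rcons /= -rcons_cons nth_rcons /= ltnSn.
exact: anc_dep.
Qed.

Lemma dep_gt0 v : v \in ns -> v != rt -> 0 < dep pn v.
Proof. by move=> h n; rewrite lt0n dep0. Qed.

Lemma anc_par v t : v \in ns -> t < dep pn v -> anc pn (par v) t = anc pn v t.
Proof. by move=> hv ht; apply: anc_anc => //; lia. Qed.

Lemma pn_ns v x : v \in ns -> x \in pn v -> x \in ns.
Proof.
move=> hv hx; have h : index x (pn v) < size (pn v) by rewrite index_mem.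
have -> : x = anc pn v (index x (pn v)).+1 by rewrite /anc /= nth_index.
exact: anc_ns.
Qed.

Lemma dep_size v : v \in ns -> dep pn v < size ns.
Proof.
have [rn e un hu _] := wf => hv; rewrite -[(dep pn v).+1]/(size (rt :: pn v)).
apply: uniq_leq_size; first exact: hu.
by move=> x; rewrite inE => /orP[/eqP ->//|]; apply: pn_ns.
Qed.

End Tree.

(* Names for [anc] and [dep] where local notations hide them. *)
Notation ancestor := anc (only parsing).
Notation pathlen := dep (only parsing).

(** A node at offset [j] of block [k] guarantees level [j]. [YT] leads from anchor [k] to the anchor
    whose index [i] is the multiple of [2 ^ j] before the last one up to [k]. The [2 ^ j]
    consecutive blocks that share this [i] complete four entries each of its row in [TT], which
    finally reaches back [4 * 2 ^ j] anchors. Branches below a common anchor agree on these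
    entries. *)
Definition isla (m1 : nat -> nat -> nat) (m2 : nat -> nat -> nat -> nat) rt pn v : Prop :=
  let D := dep pn v in
  let k := kap D in
  let A i := anc rt pn v (ast i) in
  [/\ [/\ m1 DEP v = D, m1 PAR v = par rt pn v, m1 AM v = A k,
        m1 LOG D = trunc_log 2 D & m1 KOF D = k],
      D = ast k -> m1 KIX v = k /\ m1 MPAR v = A k.-1
    & let j := D - ast k in 2 ^ j <= k ->
      let i := (k %/ 2 ^ j).-1 * 2 ^ j in
      m2 YT (A k) j = A i /\
      forall n, n < 4 * (k %% 2 ^ j) + 4 -> m2 TT (A i) n = A (i - n)].

(* [NODE s c] is the node of the sub-block rooted at [s] with code [c]: the
   digits of the code are the child slots on the path from [s], in base
   [2 ^ BET s], behind a leading 1. *)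
Definition issb (B M : nat) (m1 : nat -> nat -> nat) (m2 : nat -> nat -> nat -> nat) rt pn v : Prop :=
  let p := par rt pn v in
  let s := m1 SUB v in
  [/\ m2 NODE s (m1 CODE v) = v /\ m1 CODE v < B,
      0 < m1 BET s /\ 2 ^ m1 BET s <= 2 * M
    & if s == v then
        m1 CODE v = 1 /\
        (v <> rt -> let s' := m1 SUB p in
           m1 BET v = (m1 BET s').+1 \/
           m1 BET v = m1 BET s' /\ B <= (m1 CODE p).+1 * 2 ^ m1 BET s')
      else [/\ v <> rt, s = m1 SUB p, m1 CODE v = m1 CODE p * 2 ^ m1 BET s + m1 RNK v
             & m1 RNK v < 2 ^ m1 BET s]].

Definition invLA B M m1 m2 rt ns pn : Prop :=
  [/\ wft rt ns pn,
      forall v, v \in ns -> isla m1 m2 rt pn v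
    & forall v, v \in ns -> issb B M m1 m2 rt pn v].

Section Query.
Variables (b B M N rt : nat) (m1 : nat -> nat -> nat) (m2 : nat -> nat -> nat -> nat).
Variables (ns : seq nat) (pn : nat -> seq nat).
Hypothesis inv : invLA B M m1 m2 rt ns pn.
Implicit Types (u v z : nat).

Let wf : wft rt ns pn. Proof. by case: inv. Qed.
Local Notation anc := (anc rt pn).
Local Notation dep := (dep pn).
Local Notation par := (par rt pn).

Lemma la_basic v : v \in ns -> [/\ m1 DEP v = dep v, m1 PAR v = par v & m1 AM v = anc v (ast (kap (dep v)))].
Proof. by move=> hv; have [_ /(_ v hv)[[]]] := inv. Qed.

Lemma la_glob v t : v \in ns -> t <= dep v -> m1 LOG t = trunc_log 2 t /\ m1 KOF t = kap t.
Proof.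
move=> hv ht; have [_ /(_ _ (anc_ns wf hv ht))[[_ _ _]]] := inv.
by rewrite (dep_anc wf).
Qed.

Lemma la_kix v k : v \in ns -> ast k <= dep v ->
  m1 KIX (anc v (ast k)) = k /\ m1 MPAR (anc v (ast k)) = anc v (ast k.-1).
Proof.
move=> hv ht; have [_ /(_ _ (anc_ns wf hv ht))[_ + _]] := inv.
rewrite (dep_anc wf) // kap_ast => /(_ erefl)[-> ->]; split=> //.
by rewrite (anc_anc wf) // ast_mono leq_pred.
Qed.

(** Only blocks strictly above that of [v] lie on the path in full length, hence [q < kap (dep v)];
    the node at offset [j] of block [q] supplies the entries. *)
Lemma Y_ok v q j : v \in ns -> q < kap (dep v) -> 2 ^ j <= q ->
  let i := (q %/ 2 ^ j).-1 * 2 ^ j in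
  m2 YT (anc v (ast q)) j = anc v (ast i) /\
  forall n, n < 4 * (q %% 2 ^ j) + 4 -> m2 TT (anc v (ast i)) n = anc v (ast (i - n)).
Proof.
move=> hv hq hj; have lt := off_lt hj.
have ht : ast q + j <= dep v.
  apply/ltnW/(leq_trans lt); have /andP[h _] := kapP (dep v).
  by apply: leq_trans h; rewrite ast_mono.
have [_ /(_ _ (anc_ns wf hv ht))[_ _]] := inv.
rewrite (dep_anc wf) // (@kap_eq q) ?lt ?andbT ?leq_addr // addKn => /(_ hj) /=.
have e i : i <= q -> anc (anc v (ast q + j)) (ast i) = anc v (ast i).
  by move=> hi; rewrite (anc_anc wf) //; apply: (leq_trans _ (leq_addr _ _)); rewrite ast_mono.
have hi : (q %/ 2 ^ j).-1 * 2 ^ j <= q.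
  by apply: leq_trans (leq_trunc_div q (2 ^ j)); rewrite leq_mul2r leq_pred orbT.
move=> /=; rewrite (e q (leqnn q)) (e _ hi) => -[-> H]; split=> // n hn; rewrite H // e //.
by apply: leq_trans hi; apply: leq_subr.
Qed.

Lemma T_ok v i j n : v \in ns -> i.+2 * 2 ^ j <= kap (dep v) -> n < 4 * 2 ^ j ->
  m2 TT (anc v (ast (i * 2 ^ j))) n = anc v (ast (i * 2 ^ j - n)).
Proof.
move=> hv hq hn; have p0 : 0 < 2 ^ j by rewrite expn_gt0.
(* The last block that contributes to this row: its remainder modulo [2 ^ j] is maximal. *)
set q := i.+1 * 2 ^ j + (2 ^ j).-1.
have qE : q.+1 = i.+2 * 2 ^ j by rewrite /q [in RHS]mulSn; lia.
have e1 : q %/ 2 ^ j = i.+1 by rewrite divnMDl // divn_small ?addn0 //; lia.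
have e2 : q %% 2 ^ j = (2 ^ j).-1 by rewrite modnMDl modn_small //; lia.
have [||_] := @Y_ok v q j hv; first by lia.
  by rewrite /q mulSn; lia.
by rewrite e1 e2 => -> //=; lia.
Qed.

Lemma sub_anc v : v \in ns -> exists2 e, e <= dep v & m1 SUB v = anc v e.
Proof.
have [n] := ubnP (dep v); elim: n v => // n IH v hn hv.
have [_ _ /(_ v hv)[_ _]] := inv; case: eqP => [-> _|_ [/eqP nr e _ _]].
  by exists (dep v) => //; rewrite (anc_dep wf).
have d0 := dep_gt0 wf hv nr; have dp := dep_par wf hv.
have [||f hf ef] := IH (par v); rewrite ?(par_ns wf) //; first by rewrite dp; lia.
exists f; first by lia.
by rewrite e ef (anc_par wf) //; lia.
Qed.

Lemma sub_ns v : v \in ns -> m1 SUB v \in ns.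
Proof. by move=> hv; have [e he ->] := sub_anc hv; apply: anc_ns. Qed.

Lemma dep_sub v : v \in ns -> dep (m1 SUB v) <= dep v.
Proof. by move=> hv; have [e he ->] := sub_anc hv; rewrite (dep_anc wf). Qed.

Lemma anc_sub v t : v \in ns -> t <= dep (m1 SUB v) -> anc (m1 SUB v) t = anc v t.
Proof.
move=> hv; have [e he ->] := sub_anc hv; rewrite (dep_anc wf) // => h.
exact: (anc_anc wf).
Qed.

Lemma sub_idem v : v \in ns -> m1 SUB (m1 SUB v) = m1 SUB v.
Proof.
have [n] := ubnP (dep v); elim: n v => // n IH v hn hv.
have [_ _ /(_ v hv)[_ _]] := inv; case: eqP => [es _|_ [/eqP nr e _ _]]; first by rewrite !es.
have d0 := dep_gt0 wf hv nr; have dp := dep_par wf hv.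
by rewrite e IH ?(par_ns wf) //; lia.
Qed.

(** A leading 1 and one digit of [BET] bits per level. *)
Lemma code_bound v : v \in ns ->
  m1 CODE v < 2 ^ (m1 BET (m1 SUB v) * (dep v - dep (m1 SUB v))).+1.
Proof.
have [n] := ubnP (dep v); elim: n v => // n IH v hn hv.
have [_ _ /(_ v hv)[_ [b0 _]]] := inv; case: eqP => [e [-> _] |_ [/eqP nr e -> hr]].
  by rewrite e subnn muln0.
have d0 := dep_gt0 wf hv nr; have dp := dep_par wf hv.
have pns := par_ns wf hv.
have := IH (par v); rewrite -e dp => /(_ _ pns) IH'.
have ds : dep (m1 SUB v) <= (dep v).-1 by rewrite e -dp dep_sub.
set be := m1 BET _ in b0 hr IH' *.
set z := _.-1 - _ in IH' *.
have -> : dep v - dep (m1 SUB v) = z.+1 by rewrite /z; lia.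
have -> : (be * z.+1).+1 = (be * z).+1 + be by rewrite mulnS; lia.
rewrite expnD.
have : (m1 CODE (par v)).+1 * 2 ^ be <= 2 ^ (be * z).+1 * 2 ^ be.
  by rewrite leq_mul2r IH' ?orbT //; lia.
by rewrite mulSn; lia.
Qed.

(** Climbing one level inside a sub-block drops the last digit of the code, and the digits of one
    sub-block have equal width. *)
Lemma code_anc v t : v \in ns -> dep (m1 SUB v) <= t <= dep v ->
  m1 SUB (anc v t) = m1 SUB v /\
  m1 CODE (anc v t) = m1 CODE v %/ 2 ^ (m1 BET (m1 SUB v) * (dep v - t)).
Proof.
have [n] := ubnP (dep v); elim: n v => // n IH v hn hv /andP[h1 h2].
have [->|ne] := eqVneq t (dep v).
  by rewrite (anc_dep wf) // subnn muln0 divn1.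
have lt : t < dep v by lia.
have [_ _ /(_ v hv)[_ _]] := inv; case: eqP => [e|_ [/eqP nr e ec hr]].
  by rewrite e in h1; lia.
have dp := dep_par wf hv.
have [|||e1 e2] := IH (par v); rewrite ?(par_ns wf) //; first by lia.
  by rewrite -e h1 dp; lia.
rewrite (anc_par wf) // -?e in e1 e2; rewrite e1 e2; split=> //.
have -> : dep v - t = (dep (par v) - t).+1 by rewrite dp; lia.
rewrite mulnS expnD divnMA ec divnMDl ?expn_gt0 //.
by rewrite [_ %/ 2 ^ m1 BET _]divn_small // addn0.
Qed.

Lemma node_anc v t : v \in ns -> dep (m1 SUB v) <= t <= dep v ->
  m2 NODE (m1 SUB v) (m1 CODE v %/ 2 ^ (m1 BET (m1 SUB v) * (dep v - t))) = anc v t.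
Proof.
move=> hv h; have [e1 e2] := code_anc hv h; rewrite -e2 -e1.
have [_ _ /(_ (anc v t))[|[]]] := inv; last by [].
by apply: anc_ns => //; case/andP: h.
Qed.

(* Number of sub-blocks that the walk from [v] to depth [t] leaves. *)
Fixpoint hops k v t :=
  if k is k'.+1 then
    (if dep (m1 SUB v) <= t then 0 else (hops k' (par (m1 SUB v)) t).+1)
  else 0.

Lemma hops_le1 k v t : v \in ns -> t <= dep v -> hops k v t <= dep v - t.
Proof.
elim: k v => // k IH v hv ht /=; case: (leqP (dep (m1 SUB v)) t) => // h.
have sn := sub_ns hv; have ds := dep_sub hv.
have dp := dep_par wf sn; have pns := par_ns wf sn.
have le : t <= dep (par (m1 SUB v)) by rewrite dp; lia.
by have := IH _ pns le; rewrite dp; lia.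
Qed.

Hypothesis BE : B = 2 ^ b.

(** Seen upwards, a hop either enters a sub-block with one bit less per slot, which happens at most
    [BET] times, or one with the same width. The latter was left because its code was full, so it
    spans at least [q] levels. *)
Lemma hops_le2 k v t q : v \in ns -> t <= dep v -> 0 < q ->
  m1 BET (m1 SUB v) * q <= b.-1 ->
  hops k v t <= m1 BET (m1 SUB v) + (dep v - t) %/ q + 1.
Proof.
elim: k v => // k IH v hv ht q0 hq /=; case: (leqP (dep (m1 SUB v)) t) => // h.
have sn := sub_ns hv; have ds := dep_sub hv; have si := sub_idem hv.
set s := m1 SUB v in h sn ds si hq *.
have dp := dep_par wf sn; have pns := par_ns wf sn.
have [_ _ H] := inv; have [_ _] := H s sn; rewrite si eqxx.
have nr : s <> rt by move=> e; move/eqP: e; rewrite -(dep0 wf) //; lia.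
case=> _ /(_ nr) /=; set s' := m1 SUB (par s) => hb.
have sn' : s' \in ns by apply: sub_ns.
have [_ [b0 _] _] := H _ pns; rewrite -/s' in b0.
have si' : m1 SUB s' = s' by exact: sub_idem.
have hE : hops k (par s) t = hops k s' t by case: (k) => //= k'; rewrite -/s' si'.
rewrite hE; have ds' := dep_sub pns; rewrite -/s' in ds'.
have [hs|hs] := leqP (dep s') t.
  have -> : hops k s' t = 0 by case: (k) => //= k'; rewrite si' hs.
  by rewrite addn1.
have IH' : hops k s' t <= m1 BET s' + (dep s' - t) %/ q + 1.
  rewrite -[X in m1 BET X]si'; apply: IH => //; first by lia.
  rewrite si'.
  by apply: leq_trans hq; rewrite leq_mul2r; case: hb => [->|[-> _]]; rewrite ?leqnSn ?leqnn orbT.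
case: hb => [e|[e hB]].
  have : (dep s' - t) %/ q <= (dep v - t) %/ q by apply: leq_div2r; lia.
  by lia.
(* The next code would have reached [B = 2 ^ b], while [code_bound] allots [BET] bits to a level. *)
have full : q <= dep s - dep s'.
  have cb := code_bound pns; rewrite -/s' in cb.
  have : 2 ^ b <= 2 ^ (m1 BET s' * (dep (par s) - dep s')).+1 * 2 ^ m1 BET s'.
    by rewrite -BE; apply: leq_trans hB _; rewrite leq_mul2r cb orbT.
  rewrite -expnD leq_exp2l // addSn addnC -mulnS dp => hb'.
  have hb2 : b.-1 <= m1 BET s' * (dep s - dep s').
    by rewrite (_ : dep s - dep s' = ((dep s).-1 - dep s').+1); lia.
  by have := leq_trans hq hb2; rewrite e leq_pmul2l.
have : (dep s' - t + q) %/ q <= (dep v - t) %/ q by apply: leq_div2r; lia.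
by rewrite divnDr ?dvdnn // divnn q0; lia.
Qed.

End Query.

(** * Rules for symbolic execution *)

Section Exec.
Variables (Sigma : finType) (w B : nat).
Local Notation hst := (hst Sigma).
Local Notation ok := (@ok Sigma w B).

Lemma ok_cons c l (s : hst) (Q : hst -> Prop) : ok c s (ok (seqs l) ^~ Q) -> ok (seqs (c :: l)) s Q.
Proof. exact: ok_seq. Qed.

Lemma ok_consb b l (s : hst) (Q : hst -> Prop) : side w B b s -> ok (seqs l) (hexec b s) Q ->
  ok (seqs (CB b :: l)) s Q.
Proof. by move=> h1 h2; apply: ok_cons; apply: ok_bas. Qed.

Lemma ok_nil (s : hst) (Q : hst -> Prop) : Q s -> ok (seqs [::]) s Q.
Proof. exact: ok_skip. Qed.

Lemma ok_cut c (s : hst) (P Q : hst -> Prop) : ok c s P -> (forall s', P s' -> Q s') -> ok c s Q.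
Proof. by move=> h H; apply: ok_mono h. Qed.

End Exec.

Ltac bs := apply: ok_consb => /=; last (rewrite /=).

(** Moves register 20 to the first anchor below the block of the target depth in register 21. With
    [d] anchors to climb and [3 * 2 ^ j <= d < 6 * 2 ^ j], two jumps of level [j] climb at least
    [2 * 2 ^ j] and fewer than [3 * 2 ^ j] anchors. They do not overshoot, and what remains is less
    than [4 * 2 ^ j], the reach of a row of [TT]. *)
Definition laq_macro : cmd := seqs [::
  Ld1 23 KOF 21 : cmd; BConst 24 1 : cmd; BArith Add 23 23 24 : cmd; Ld1 25 AM 20 : cmd;
  Ld1 26 KIX 25 : cmd;
  CIf (CLt 23 26) (seqs [::
    Ld1 25 MPAR 25 : cmd; BArith Defs.Sub 26 26 24 : cmd; BArith Defs.Sub 26 26 23 : cmd;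
    BConst 27 3 : cmd;
    CIf (CLt 26 27)
      (seqs [:: BConst 28 0 : cmd;
         CIf (CLt 28 26) (seqs [:: Ld1 25 MPAR 25 : cmd;
           CIf (CLt 24 26) (seqs [:: Ld1 25 MPAR 25 : cmd]) CSkip]) CSkip])
      (seqs [:: BArith Div 27 26 27 : cmd; Ld1 27 LOG 27 : cmd; Ld2 28 YT 25 27 : cmd;
         Ld2 28 YT 28 27 : cmd; Ld1 29 KIX 28 : cmd; BArith Defs.Sub 29 29 23 : cmd;
         Ld2 25 TT 28 29 : cmd]);
    BMov 20 25 : cmd]) CSkip].

Definition laq_micro : cmd := seqs [::
  Ld1 25 SUB 20 : cmd; Ld1 26 DEP 25 : cmd;
  CWhile (CLt 21 26) (seqs [:: Ld1 20 PAR 25 : cmd; Ld1 25 SUB 20 : cmd; Ld1 26 DEP 25 : cmd]);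
  Ld1 26 DEP 20 : cmd; BArith Defs.Sub 26 26 21 : cmd; Ld1 27 BET 25 : cmd;
  BArith Mul 26 26 27 : cmd; Ld1 27 CODE 20 : cmd; BArith Shr 27 27 26 : cmd;
  Ld2 22 NODE 25 27 : cmd].

Definition laq : cmd := CSeq laq_macro laq_micro.

Definition frame (lo hi : nat) (r r' : nat -> nat) : Prop :=
  forall x, (x < lo) || (hi <= x) -> r' x = r x.

Lemma frame_refl lo hi r : frame lo hi r r. Proof. by []. Qed.

Lemma frame_hu lo hi r r' i x : lo <= i < hi -> frame lo hi r r' -> frame lo hi r (hu r' i x).
Proof.
move=> h H y hy; rewrite /hu; have -> : Nat.eqb y i = (y == i) by []; case: eqP => e; last exact: H.
by move: hy; rewrite e; lia.
Qed.

Lemma frame_trans lo hi r1 r2 r3 : frame lo hi r1 r2 -> frame lo hi r2 r3 -> frame lo hi r1 r3.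
Proof. by move=> h1 h2 x hx; rewrite h2 // h1. Qed.

Ltac fr := do ?[apply: frame_hu => //]; try exact: frame_refl.

Lemma N4B (N B : nat) : N.+2 ^ 8 <= B -> 64 * N.+2 <= B.
Proof.
move=> NB; have : N.+2 * 2 ^ 7 <= N.+2 ^ 8 by rewrite [N.+2 ^ 8]expnS leq_mul2l leq_exp2r.
by rewrite (_ : 2 ^ 7 = 128) //; lia.
Qed.

Lemma ltB (w N B x : nat) : 128 * B * B <= 2 ^ w -> N.+2 ^ 8 <= B -> x < B -> x < 2 ^ w.
Proof. by move=> Bw /N4B h1 h2; apply: leq_trans Bw; nia. Qed.

Definition frameS (l : seq nat) (r r' : nat -> nat) : Prop := forall x, x \notin l -> r' x = r x.

Lemma frs_hu l r r' i x : i \in l -> frameS l r r' -> frameS l r (hu r' i x).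
Proof.
move=> h H y hy; rewrite /hu (_ : Nat.eqb y i = (y == i)) //; case: eqP => e; last exact: H.
by rewrite -e (negPf hy) in h.
Qed.

Lemma frs_refl l r : frameS l r r. Proof. by []. Qed.

Lemma frs_trans l r1 r2 r3 : frameS l r1 r2 -> frameS l r2 r3 -> frameS l r1 r3.
Proof. by move=> h1 h2 x hx; rewrite h2 // h1. Qed.

Lemma frs_sub l l' r r' : {subset l <= l'} -> frameS l r r' -> frameS l' r r'.
Proof. by move=> h H x hx; apply: H; apply: contra hx; apply: h. Qed.

Ltac frs := do ?[apply: frs_hu; first done]; try exact: frs_refl.

(** * Correctness and cost of a level ancestor query *)

Section Laq.
Variables (Sigma : finType) (w b B M N rt : nat).
Variables (m1 : nat -> nat -> nat) (m2 : nat -> nat -> nat -> nat).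
Variables (ns : seq nat) (pn : nat -> seq nat).
Hypothesis inv : invLA B M m1 m2 rt ns pn.
Hypothesis BE : B = 2 ^ b.
Hypothesis Bw : 128 * B * B <= 2 ^ w.
Hypothesis NB : N.+2 ^ 8 <= B.
Hypothesis nsz : size ns <= N.+1.
Hypothesis nsB : forall v : nat, v \in ns -> v < B.
Hypothesis MN : 0 < M <= N.+1.

Let wf : wft rt ns pn. Proof. by case: inv. Qed.
Local Notation anc := (anc rt pn).
Local Notation dep := (dep pn).
Local Notation ok := (@ok Sigma w B).

Lemma depB v : v \in ns -> dep v <= N.
Proof. by move=> h; have := dep_size wf h; lia. Qed.

Lemma laq_macro_ok (v t : nat) (r : nat -> nat) rc mc out (tt : nat) (Q : hst Sigma -> Prop) :
  v \in ns -> t <= dep v -> r 20 = v -> r 21 = t ->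
  (forall (r' : nat -> nat) (z tt' : nat), z \in ns -> t <= dep z <= dep v -> dep z - t <= 2 * lam (dep v) ->
     anc z t = anc v t -> r' 20 = z -> frame 20 30 r r' -> r' 21 = t -> tt' <= tt + 20 ->
     Q (HS r' rc m1 m2 mc out tt')) ->
  ok laq_macro (HS r rc m1 m2 mc out tt) Q.
Proof.
move=> hv ht r20 r21 HQ.
have dN := depB hv; have NB' := N4B NB; have tB : t < B by lia.
have [eD eP eA] := la_basic inv hv; have [_ eK] := la_glob inv hv ht.
set k := kap (dep v) in eA *.
have /andP[k1 k2] := kapP (dep v); rewrite -/k in k1 k2.
have kN : k <= dep v by apply: kap_leq.
have [eX eM] := la_kix inv hv k1.
have /andP[t1 t2] := kapP t; have tk := kap_le ht; rewrite -/k in tk.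
rewrite /laq_macro; bs; first by rewrite r21.
rewrite r21 eK; bs; first by apply: (ltB Bw NB); lia.
bs; first by apply: (ltB Bw NB); lia.
bs; first by rewrite r20 nsB.
rewrite r20 eA; bs; first by rewrite nsB // anc_ns.
rewrite eX; apply: ok_cons; apply: ok_if => /=; rewrite addn1.
case: ltnP => hk; last first.
  apply: ok_skip; apply: ok_nil => /=; apply: (HQ _ v) => //=; [lia| |by fr| by lia].
  have : dep v < ast k + lam (dep v).
    by apply: leq_trans k2 _; rewrite astS leq_add2l lam_le.
  have [k0|k0] := posnP k; first by rewrite k0 {1}/ast /=; lia.
  have e : k.-1 <= kap t by lia.
  have : ast k <= ast k.-1 + lam (dep v).
    rewrite -[in ast k](prednK k0) astS leq_add2l lam_le //.
    by apply: leq_trans k1; rewrite ast_mono leq_pred.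
  by rewrite -(ast_mono k.-1) in e; lia.
have k0 : 0 < k by lia.
bs; first by rewrite nsB // anc_ns.
bs; first by lia.
bs; first by lia.
bs; first by apply: (ltB Bw NB); lia.
rewrite eM; set kt := (kap t).+1 in hk *.
have HZ r' tt' : r' 25 = anc v (ast kt) -> frame 20 30 r r' -> r' 21 = t -> tt' <= tt + 18 ->
    Q (HS (hu r' 20 (r' 25)) rc m1 m2 mc out tt'.+1).
  have h1 : ast kt <= dep v by apply: leq_trans k1; rewrite ast_mono ltnW.
  move=> e25 hfr e21 htt; apply: (HQ _ (anc v (ast kt))) => //=; rewrite ?(dep_anc wf) ?(anc_ns wf) //.
  - by rewrite h1 (ltnW t2).
  - have : lam (ast (kap t)) <= lam (dep v) by apply: lam_le; apply: leq_trans ht.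
    by rewrite /kt astS; lia.
  - by rewrite (anc_anc wf) // ltnW.
  - by apply: frame_hu.
  - by lia.
(* The tables of anchor [k] may be incomplete on this path, so the jumps start one anchor higher. *)
set d := k - 1 - kt.
apply: ok_cons; apply: ok_if => /=; case: ltnP => hd.
  bs; first by apply: (ltB Bw NB); lia.
  apply: ok_cons; apply: ok_if => /=; have [d0|d0] := posnP d.
    rewrite d0; apply: ok_skip; apply: ok_nil; bs => //; apply: ok_nil => /=; apply: ok_nil.
    apply: HZ => /=; rewrite ?r21 //; [|by fr|by lia].
    by congr (anc v (ast _)); lia.
  have h1 : ast k.-1 <= dep v by apply: leq_trans k1; rewrite ast_mono leq_pred.
  rewrite /=; bs; first by rewrite nsB // anc_ns.
  have [_ eM1] := la_kix inv hv h1; rewrite eM1.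
  apply: ok_cons; apply: ok_if => /=; case: ltnP => d1; last first.
    apply: ok_skip; apply: ok_nil; apply: ok_nil; bs => //; apply: ok_nil; apply: ok_nil => /=.
    apply: HZ => /=; rewrite ?r21 //; [|by fr|by lia].
    by congr (anc v (ast _)); lia.
  have h2 : ast k.-2 <= dep v by apply: leq_trans k1; rewrite ast_mono; lia.
  bs; first by rewrite nsB // anc_ns.
  have [_ eM2] := la_kix inv hv h2; rewrite eM2.
  apply: ok_nil; apply: ok_nil; apply: ok_nil; bs => //; apply: ok_nil; apply: ok_nil => /=.
  apply: HZ => /=; rewrite ?r21 //; [|by fr|by lia].
  by congr (anc v (ast _)); lia.
have h3 : d %/ 3 <= dep v by apply: leq_trans (leq_div _ _) _; rewrite /d; lia.
bs; first by [].
bs; first by lia.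
have [eL _] := la_glob inv hv h3; rewrite eL.
set j := trunc_log 2 (d %/ 3); set q := k.-1.
have d30 : 0 < d %/ 3 by rewrite divn_gt0.
have jl : 2 ^ j <= d %/ 3 by apply: trunc_logP.
have ju : d %/ 3 < 2 ^ j.+1 by apply: trunc_log_ltn.
rewrite expnS in ju.
have d3 : 3 * 2 ^ j <= d by have := leq_trunc_div d 3; lia.
have d6 : d < 6 * 2 ^ j by have := ltn_ceil d (isT : 0 < 3); lia.
have p0 : 0 < 2 ^ j by rewrite expn_gt0.
have jB : j < B.
  by have := ltn_expl j (isT : 1 < 2); lia.
have hq : q < kap (dep v) by rewrite -/k /q; lia.
have A1 i : i <= k -> anc v (ast i) \in ns.
  by move=> hi; apply: (anc_ns wf) => //; apply: leq_trans k1; rewrite ast_mono.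
have qd : d <= q by rewrite /d /q; lia.
bs; first by rewrite nsB ?A1 // /q; lia.
have jq : 2 ^ j <= q by lia.
have [Y1 _] := Y_ok inv hv hq jq; rewrite Y1.
set i1 := (q %/ 2 ^ j).-1.
have q3 : 3 <= q %/ 2 ^ j by rewrite leq_divRL // (leq_trans d3).
have hq2 : q < (q %/ 2 ^ j).+1 * 2 ^ j by apply: ltn_ceil.
have hq1 := leq_trunc_div q (2 ^ j).
have i1E : (q %/ 2 ^ j) = i1.+1 by rewrite /i1; lia.
rewrite i1E !mulSn in hq1 hq2.
bs; first by rewrite nsB ?A1; lia.
have i12 : 2 <= i1 by rewrite /i1; lia.
have hq3 : i1 * 2 ^ j < kap (dep v) by lia.
have jq3 : 2 ^ j <= i1 * 2 ^ j by rewrite leq_pmull //; lia.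
have [Y2 _] := Y_ok inv hv hq3 jq3.
rewrite Y2 mulnK //; set i2 := i1.-1.
have i2E : i1 = i2.+1 by rewrite /i2; lia.
rewrite i2E mulSn in hq1 hq2.
bs; first by rewrite nsB ?A1; lia.
have h2 : ast (i2 * 2 ^ j) <= dep v by apply: (leq_trans _ k1); rewrite ast_mono; lia.
have [eX2 _] := la_kix inv hv h2.
have dE : d = q - kt by rewrite /d /q; lia.
rewrite eX2; bs; first by lia.
bs; first by rewrite nsB ?A1; lia.
rewrite (T_ok inv hv); [|by rewrite !mulSn -/k; lia|by lia].
apply: ok_nil; bs => //; apply: ok_nil; apply: ok_nil => /=.
apply: HZ => /=; rewrite ?r21 //; [|by fr|by lia].
by congr (anc v (ast _)); lia.
Qed.

Lemma bet_bound (z : nat) : z \in ns -> let be := m1 BET (m1 SUB z) in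
  [/\ 0 < be, be <= M & 2 ^ be <= 2 * M].
Proof.
move=> hz; have [_ _ /(_ z hz)[_ [b0 b1] _]] := inv; split=> //.
move: b1; case E: (m1 BET _) b0 => [|be] // _; rewrite expnS leq_pmul2l // => h.
by apply: leq_trans h; apply: ltn_expl.
Qed.

Lemma logN_b : 8 * trunc_log 2 N.+2 <= b /\ 0 < trunc_log 2 N.+2.
Proof.
split; last by apply: trunc_log_max.
rewrite -(@leq_exp2l 2) // mulnC expnM -BE; apply: leq_trans NB.
by rewrite leq_exp2r // trunc_logP.
Qed.

(** The stretch has at most [2 * lam (dep v)] levels, which is below [b] because
    [8 * trunc_log 2 N.+2 <= b]. In [hops_le2] take [q = b.-1 %/ be]: fewer than [2 * be] full
    sub-blocks, [be] changes of width and one more hop, with [be <= M]. *)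
Lemma hops_M (z t v k : nat) : z \in ns -> v \in ns -> t <= dep z -> dep z - t <= 2 * lam (dep v) ->
  hops rt m1 pn k z t <= 3 * M + 1.
Proof.
move=> hz hv ht hd; have [b0 bM b2] := bet_bound hz; set be := m1 BET _ in b0 bM b2.
have [L8 L0] := logN_b; set L := trunc_log 2 _ in L8 L0.
have hl : lam (dep v) <= L.+2.
  by rewrite /lam !ltnS; apply: leq_trunc_log; have := depB hv; lia.
have hb : be <= L.+1.
  have : 2 ^ be < 2 ^ L.+2.
    have := trunc_log_ltn N.+2 (isT : 1 < 2); rewrite -/L => h.
    by rewrite expnS; lia.
  by rewrite ltn_exp2l.
set q := b.-1 %/ be.
have q0 : 0 < q by rewrite divn_gt0 //; lia.
have hq : be * q <= b.-1 by rewrite mulnC leq_trunc_div.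
have hq2 : b.-1 < 2 * be * q.
  have := ltn_ceil b.-1 b0; rewrite -/q mulSn => h.
  by rewrite -mulnA mul2n -addnn; nia.
have := hops_le2 inv BE k hz ht q0 hq; rewrite -/be => h; apply: (leq_trans h).
have : (dep z - t) %/ q <= b.-1 %/ q by apply: leq_div2r; lia.
have : b.-1 %/ q < 2 * be by rewrite ltn_divLR.
by lia.
Qed.

Lemma laq_walk (k z t : nat) (r : nat -> nat) rc mc out (tt : nat) (Q : hst Sigma -> Prop) :
  z \in ns -> t <= dep z < k -> r 20 = z -> r 21 = t -> r 25 = m1 SUB z ->
  r 26 = dep (m1 SUB z) ->
  (forall (r' : nat -> nat) (z' tt' : nat), z' \in ns -> dep (m1 SUB z') <= t <= dep z' ->
     anc z' t = anc z t -> r' 20 = z' -> r' 21 = t -> r' 25 = m1 SUB z' ->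
     frame 20 30 r r' -> tt' <= tt + 1 + 4 * hops rt m1 pn k z t ->
     Q (HS r' rc m1 m2 mc out tt')) ->
  ok (CWhile (CLt 21 26) (seqs [:: Ld1 20 PAR 25 : cmd; Ld1 25 SUB 20 : cmd; Ld1 26 DEP 25 : cmd]))
    (HS r rc m1 m2 mc out tt) Q.
Proof.
elim: k z r tt => [|k IH] z r tt hz; first by rewrite ltn0 andbF.
move=> /andP[ht hk] r20 r21 r25 r26 HQ.
have sn := sub_ns inv hz; have ds := dep_sub inv hz.
apply: ok_while => /=; rewrite r21 r26; case: ltnP => h; last first.
  by apply: (HQ r z) => //; rewrite ?h //; lia.
have pns := par_ns wf sn; have dp := dep_par wf sn.
have [_ eP _] := la_basic inv sn.
bs; first by rewrite r25 nsB.
rewrite r25 eP; bs; first by rewrite nsB.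
bs; first by rewrite nsB // (sub_ns inv).
have sp := sub_ns inv pns.
have [-> _ _] := la_basic inv sp.
apply: ok_nil; apply: (IH (par rt pn (m1 SUB z))) => //=.
  by rewrite dp; apply/andP; split; lia.
move=> r' z' tt' z1 z2 z3 z4 z5 z6 z7 z8; apply: (HQ r' z') => //.
- by rewrite z3 (anc_par wf) // (anc_sub inv) // ltnW.
- by apply: frame_trans z7; fr.
- by move: z8; rewrite /= [dep _ <= t]leqNgt h /=; lia.
Qed.

Lemma laq_micro_ok (z t : nat) (r : nat -> nat) rc mc out (tt : nat) (Q : hst Sigma -> Prop) :
  z \in ns -> t <= dep z -> r 20 = z -> r 21 = t ->
  (forall (r' : nat -> nat) (tt' : nat), r' 22 = anc z t ->
     frame 20 30 r r' -> tt' <= tt + 10 + 4 * hops rt m1 pn (dep z).+1 z t ->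
     Q (HS r' rc m1 m2 mc out tt')) ->
  ok laq_micro (HS r rc m1 m2 mc out tt) Q.
Proof.
move=> hz ht r20 r21 HQ; rewrite /laq_micro.
have sn := sub_ns inv hz.
bs; first by rewrite r20 nsB.
rewrite r20; bs; first by rewrite nsB.
have [-> _ _] := la_basic inv sn.
apply: ok_cons; apply: (@laq_walk (dep z).+1 z t) => //=; first by rewrite ht ltnSn.
move=> r' z' tt' z1 z2 z3 z4 z5 z6 z7 z8.
have [e1 _ _] := la_basic inv z1; have [b0 bM b2] := bet_bound z1.
have dN := depB z1; have NB' := N4B NB.
have [_ _ /(_ z' z1)[[_ cB] _ _]] := inv.
have := MN => /andP[_ MN'].
bs; first by rewrite z4 nsB.
rewrite z4 e1; bs; first by rewrite z5; case/andP: z2.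
rewrite z5; bs; first by rewrite z6 nsB // (sub_ns inv).
rewrite z6; bs.
  apply: leq_trans Bw; set x := dep z' - t; set y := m1 BET _ in bM b0 *.
  have : x * y <= N * N.+1 by apply: leq_mul; rewrite /x; lia.
  have : N * N.+1 < B * B.
    by apply: (@leq_ltn_trans (N.+1 * N.+1)); [rewrite leq_mul2r leqnSn orbT | apply: ltn_mul; lia].
  by rewrite -mulnA; lia.
bs; first by rewrite z4 nsB.
rewrite z4; bs => //.
bs; first by split; [rewrite z6 nsB // (sub_ns inv) | apply: leq_ltn_trans (leq_div _ _) cB].
apply: ok_nil; apply: HQ => /=.
- by rewrite z6 mulnC (node_anc inv) // z3.
- by fr; apply: frame_trans z7; fr.
- by lia.
Qed.

Lemma laq_ok (v t : nat) (r : nat -> nat) rc mc out (tt : nat) (Q : hst Sigma -> Prop) :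
  v \in ns -> t <= dep v -> r 20 = v -> r 21 = t ->
  (forall (r' : nat -> nat) (tt' : nat), r' 22 = anc v t -> frame 20 30 r r' ->
     tt' <= tt + 30 + 4 * minn (2 * lam (dep v)) (3 * M + 1) ->
     Q (HS r' rc m1 m2 mc out tt')) ->
  ok laq (HS r rc m1 m2 mc out tt) Q.
Proof.
move=> hv ht r20 r21 HQ; apply: ok_seq; apply: (@laq_macro_ok v t) => //.
move=> r' z tt' z1 /andP[z2 z2'] z3 z4 z5 z6 z7 z8; apply: (@laq_micro_ok z t) => //.
move=> r1 tt1 y1 y2 y3; apply: HQ; first by rewrite y1.
  exact: frame_trans z6 y2.
have h1 := hops_le1 inv (dep z).+1 z1 z2.
have h2 := hops_M (dep z).+1 z1 hv z2 z3.
have : hops rt m1 pn (dep z).+1 z t <= minn (2 * lam (dep v)) (3 * M + 1) by rewrite leq_min h2 andbT; lia.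
by lia.
Qed.

End Laq.

(** * A new leaf in the level ancestor structure *)

Section Insert.
Variables (B M N rt : nat).
Variables (m1 : nat -> nat -> nat) (m2 : nat -> nat -> nat -> nat).
Variables (ns : seq nat) (pn : nat -> seq nat).
Hypothesis inv : invLA B M m1 m2 rt ns pn.
Variables (p v : nat).
Hypothesis pns : p \in ns.
Hypothesis vns : v \notin ns.

Definition pn_ins : nat -> seq nat := fun u => if u == v then rcons (pn p) v else pn u.

Let wf : wft rt ns pn. Proof. by case: inv. Qed.
Local Notation anc := (anc rt pn).
Local Notation dep := (dep pn).
Local Notation D := (dep p).+1.
Local Notation k := (kap D).
Local Notation j := (D - ast k).
Local Notation anc' := (ancestor rt pn_ins).
Local Notation dep' := (pathlen pn_ins).
Local Notation A i := (anc' v (ast i)).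
Local Notation y := ((k %/ 2 ^ j).-1 * 2 ^ j).

Lemma ne_v u : u \in ns -> u == v = false.
Proof. by move=> h; apply/eqP => e; rewrite e (negPf vns) in h. Qed.

Lemma pn_ins_old u : u \in ns -> pn_ins u = pn u.
Proof. by move=> h; rewrite /pn_ins ne_v. Qed.

Lemma pn_ins_new : pn_ins v = rcons (pn p) v.
Proof. by rewrite /pn_ins eqxx. Qed.

Lemma dep_ins_old u : u \in ns -> dep' u = dep u.
Proof. by move=> h; rewrite /pathlen pn_ins_old. Qed.

Lemma dep_ins_new : dep' v = D.
Proof. by rewrite /pathlen pn_ins_new size_rcons. Qed.

Lemma anc_ins_old u t : u \in ns -> anc' u t = anc u t.
Proof. by move=> h; rewrite /ancestor pn_ins_old. Qed.

Lemma anc_ins_new t : t <= dep p -> anc' v t = anc p t.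
Proof. by move=> h; rewrite /ancestor pn_ins_new -rcons_cons nth_rcons /= ltnS h. Qed.

Lemma anc_ins_v : anc' v D = v.
Proof. by rewrite /ancestor pn_ins_new /= nth_rcons ltnn eqxx. Qed.

Lemma wft_ins : wft rt (v :: ns) pn_ins.
Proof.
have [rn e un hu H] := wf; split.
- by rewrite inE rn orbT.
- by rewrite pn_ins_old.
- by rewrite /= vns.
- move=> u; rewrite inE => /orP[/eqP ->|h]; last by rewrite pn_ins_old ?hu.
  rewrite pn_ins_new -rcons_cons rcons_uniq hu // andbT; apply: contra vns.
  by rewrite inE => /orP[/eqP ->|/(pn_ns wf pns)].
- move=> u; rewrite inE => /orP[/eqP -> _|h nr].
    by exists p; rewrite ?inE ?pns ?orbT // pn_ins_new pn_ins_old.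
  by have [q qn eq] := H u h nr; exists q; rewrite ?inE ?qn ?orbT // !pn_ins_old.
Qed.

Lemma par_ins_new : par rt pn_ins v = p.
Proof. by rewrite /par dep_ins_new /= anc_ins_new // (anc_dep wf). Qed.

Lemma par_ins_old u : u \in ns -> par rt pn_ins u = par rt pn u.
Proof. by move=> h; rewrite /par dep_ins_old // anc_ins_old. Qed.

Lemma kD : ast k <= D < ast k.+1. Proof. exact: kapP. Qed.

Lemma off_gt0 : 0 < j -> kap (dep p) = k.
Proof. by move=> h; apply: kap_eq; have := kD; lia. Qed.

Lemma off0 : j = 0 -> ast k = D /\ (kap (dep p)).+1 = k.
Proof.
move=> h; have e : ast k = D by have := kD; lia.
split=> //; have k0 : 0 < k by case: (k) e.
suff -> : kap (dep p) = k.-1 by rewrite prednK.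
apply: kap_eq; rewrite prednK // e ltnSn andbT.
have := ast_lt k.-1; rewrite prednK // e; lia.
Qed.

Lemma A_lt i : i < k -> ast i <= dep p.
Proof.
move=> h; have : ast i < ast k by rewrite ast_ltn.
by have := kD; lia.
Qed.

Lemma A_old i : i < k -> A i = anc p (ast i) /\ A i \in ns.
Proof. by move=> h; have := A_lt h => h'; rewrite anc_ins_new ?(anc_ns wf). Qed.

Lemma kix_ins i : i < k -> m1 KIX (A i) = i /\ m1 MPAR (A i) = A i.-1.
Proof.
move=> h; have [-> _] := A_old h; have [|-> _] := @A_old i.-1; first by lia.
by have [-> ->] := la_kix inv pns (A_lt h).
Qed.

Lemma y_lt : 2 ^ j <= k -> y < k.
Proof.
move=> h; have p0 : 0 < 2 ^ j by rewrite expn_gt0.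
have := leq_trunc_div k (2 ^ j); have : 0 < k %/ 2 ^ j by rewrite divn_gt0.
by case: (k %/ 2 ^ j) => // q _; rewrite mulSn /=; lia.
Qed.

(** If [2 ^ j] divides [k], two jumps of level [j - 1] make one of level [j], and the first of them
    was entered by the parent, one offset earlier. Otherwise block [k - 1] has the same target. *)
Lemma Y_new : 2 ^ j <= k ->
  A y = if j == 0 then A k.-1
        else if k %% 2 ^ j == 0 then m2 YT (m2 YT (A k) j.-1) j.-1 else m2 YT (A k.-1) j.
Proof.
move=> h; case: eqP => [->|/eqP j0]; first by rewrite expn0 divn1 muln1.
rewrite -lt0n in j0; have kp := off_gt0 j0.
have p0 i : 0 < 2 ^ i by rewrite expn_gt0.
have jE : j = j.-1.+1 by lia.
have kk : k < kap (dep p) \/ k = kap (dep p) by right.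
have Ak : A k = anc p (ast k).
  by rewrite anc_ins_new //; have := kD; lia.
have [k1 _] := A_old (ltac:(lia) : k.-1 < k).
case: eqP => hm.
  have [q qE] : exists q, k = q * 2 ^ j by apply/dvdnP; rewrite /dvdn hm.
  have q0 : 0 < q by case: (q) qE => // e; have := p0 j; lia.
  set j' := j.-1 in jE *.
  have e2 : 2 ^ j = 2 * 2 ^ j' by rewrite jE expnS.
  have [_ HL _] := inv; have [_ _] := HL _ pns; rewrite kp.
  have -> : dep p - ast k = j' by rewrite /j'; lia.
  rewrite Ak; case=> [|-> _]; first by lia.
  have dE : k %/ 2 ^ j' = 2 * q by rewrite {1}qE e2 mulnA mulnK // mulnC.
  rewrite dE; set i := (2 * q).-1 * 2 ^ j'.
  have iE : i + 2 ^ j' = k.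
    by rewrite qE e2 /i addnC -mulSn prednK ?muln_gt0 //; lia.
  have [||-> _] := @Y_ok _ _ _ _ _ _ _ inv p i j' pns; first by rewrite kp; have := p0 j'; lia.
    by rewrite /i leq_pmull //; lia.
  rewrite -anc_ins_new; last by apply: A_lt; have := y_lt h; rewrite /i mulnK //; have := p0 j'; lia.
  congr (A _); rewrite /i mulnK // {1}qE mulnK //.
  by rewrite e2 mulnA; congr (_ * _); lia.
have k2 : 2 ^ j < k.
  by rewrite ltn_neqAle h andbT; apply/eqP => e; case: hm; rewrite -{1}e modnn.
rewrite k1; have [||-> _] := @Y_ok _ _ _ _ _ _ _ inv p k.-1 j pns; [by lia | by lia |].
have p0j := p0 j; have e := divn_eq k (2 ^ j); have lt := ltn_pmod k p0j.
have e' : k.-1 = k %/ 2 ^ j * 2 ^ j + (k %% 2 ^ j).-1 by lia.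
have dE : k.-1 %/ 2 ^ j = k %/ 2 ^ j.
  by rewrite e' divnMDl // [_.-1 %/ _]divn_small ?addn0 // (leq_ltn_trans (leq_pred _) lt).
by rewrite dE anc_ins_new //; apply: A_lt; apply: y_lt.
Qed.

(** If [2 ^ j] divides [k], the range of [n] is empty. Otherwise block [k - 1] works on the same row
    and has completed it so far. *)
Lemma T_old n : 2 ^ j <= k -> n < 4 * (k %% 2 ^ j) -> m2 TT (A y) n = A (y - n).
Proof.
move=> h hn; have p0 : 0 < 2 ^ j by rewrite expn_gt0.
have j0 : 0 < j by case: (j) hn => //; rewrite expn0 modn1.
have kp := off_gt0 j0; have hm : 0 < k %% 2 ^ j by lia.
have e := divn_eq k (2 ^ j).
have k2 : 2 ^ j < k.
  by rewrite ltn_neqAle h andbT; apply/eqP => e'; move: hm; rewrite -{1}e' modnn.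
have e' : k.-1 = k %/ 2 ^ j * 2 ^ j + (k %% 2 ^ j).-1 by lia.
have lt : (k %% 2 ^ j).-1 < 2 ^ j by have := ltn_pmod k p0; lia.
have dE : k.-1 %/ 2 ^ j = k %/ 2 ^ j by rewrite e' divnMDl // [_.-1 %/ _]divn_small // addn0.
have mE : k.-1 %% 2 ^ j = (k %% 2 ^ j).-1 by rewrite e' modnMDl modn_small.
have yk := y_lt h.
have [||_] := @Y_ok _ _ _ _ _ _ _ inv p k.-1 j pns; [by lia | by lia |].
rewrite dE mE => H; rewrite !anc_ins_new ?A_lt //; last by lia.
by apply: H; lia.
Qed.

Section New.
Variables (n1 : nat -> nat -> nat) (n2 : nat -> nat -> nat -> nat).
Local Notation s := (n1 SUB v).
Hypothesis old : forall f u, f \in [:: PAR; DEP; AM; MPAR; KIX; SUB; CODE; BET; RNK] ->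
  u != v -> n1 f u = m1 f u.
Hypothesis logs : forall t, n1 LOG t = (if t == D then trunc_log 2 D else m1 LOG t) /\
  n1 KOF t = (if t == D then k else m1 KOF t).
Hypothesis news : [/\ n1 DEP v = D, n1 PAR v = p & n1 AM v = A k].
Hypothesis anch : j = 0 -> n1 KIX v = k /\ n1 MPAR v = A k.-1.
Hypothesis Yold : forall x i, n2 YT x i = m2 YT x i \/
  [/\ x = A k, i = j, 2 ^ j <= k & n2 YT x i = A y].
Hypothesis Told : forall x n, n2 TT x n = m2 TT x n \/
  [/\ x = A y, 2 ^ j <= k & n2 TT x n = A (y - n)].
Hypothesis Ynew : 2 ^ j <= k -> n2 YT (A k) j = A y.
Hypothesis Tnew : 2 ^ j <= k -> forall n, 4 * (k %% 2 ^ j) <= n < 4 * (k %% 2 ^ j) + 4 ->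
  n2 TT (A y) n = A (y - n).
Hypothesis Nold : forall x c, n2 NODE x c = (if (x == s) && (c == n1 CODE v) then v else m2 NODE x c).
Hypothesis slots : forall u, u \in ns -> u != rt -> par rt pn u = p -> m1 RNK u != n1 RNK v.
Hypothesis Bpos : 1 < B.
Hypothesis subs :
  if s == v then
    n1 CODE v = 1 /\ (n1 BET v = (m1 BET (m1 SUB p)).+1 /\ 2 ^ n1 BET v <= 2 * M \/
      n1 BET v = m1 BET (m1 SUB p) /\ B <= (m1 CODE p).+1 * 2 ^ m1 BET (m1 SUB p))
  else [/\ s = m1 SUB p, n1 CODE v = m1 CODE p * 2 ^ m1 BET s + n1 RNK v,
           n1 RNK v < 2 ^ m1 BET s & n1 CODE v < B].

(** Used to see that an overwritten jump entry suits the older nodes as well: a common anchor has a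
    common index, by its depth, and a common path above it. *)
Lemma anc_dep_inj u i x : u \in ns -> ast i <= dep u -> anc u (ast i) = A x -> x <= k -> i = x /\
  forall i', i' <= i -> anc u (ast i') = A i'.
Proof.
move=> hu hi e hx.
have hxD : ast x <= D.
  by have /andP[h _] := kD; apply: leq_trans h; rewrite ast_mono.
have vn : v \in v :: ns by rewrite mem_head.
have e1 := dep_anc wf hu hi.
have e2 : dep' (A x) = ast x by rewrite (dep_anc wft_ins) ?dep_ins_new.
have ne : A x \in ns by rewrite -e (anc_ns wf).
have ei : ast i = ast x by rewrite -e1 -e2 e dep_ins_old // -e.
have -> : i = x by apply/eqP; rewrite eqn_leq -(ast_mono i) -(ast_mono x) ei leqnn.
split=> // i' hi'; have h' : ast i' <= ast x by rewrite ast_mono.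
have hii : ast i' <= ast i by rewrite ei.
by rewrite -(anc_anc wf hu hi hii) e -anc_ins_old // (anc_anc wft_ins) ?dep_ins_new.
Qed.

Lemma code_gt0 u : u \in ns -> 0 < m1 CODE u.
Proof.
have [n] := ubnP (dep u); elim: n u => // n IH u hn hu.
have [_ _ /(_ u hu)[_ [b0 _]]] := inv; case: eqP => [_ [-> //]|_ [/eqP nr _ -> _]].
have d0 := dep_gt0 wf hu nr; have dp := dep_par wf hu.
by rewrite addn_gt0 muln_gt0 expn_gt0 IH ?(par_ns wf) //; lia.
Qed.

(** Entries of the jump tables may be overwritten, but only by the value that every node below the
    same anchor expects. Codes of different nodes in a sub-block differ because siblings occupy
    different slots. *)
Lemma invLA_ins : invLA B M n1 n2 rt (v :: ns) pn_ins.
Proof.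
have O f u : f \in [:: PAR; DEP; AM; MPAR; KIX; SUB; CODE; BET; RNK] -> u \in ns -> n1 f u = m1 f u.
  by move=> hf hu; apply: old => //; rewrite ne_v.
have vn : v \in v :: ns by rewrite mem_head.
have [d1 d2 d3] := news.
split; first exact: wft_ins.
- move=> u; rewrite inE => /orP[/eqP ->|hu].
    rewrite /isla dep_ins_new par_ins_new d1 d2 d3; have [-> ->] := logs D; rewrite eqxx.
    split=> // [e|/= hj]; first by apply: anch; lia.
    split=> [|n hn]; first exact: Ynew.
    have [h|h] := leqP (4 * (k %% 2 ^ j)) n; first by rewrite Tnew // h.
    by have [->|[_ _ ->]] := Told (A y) n; rewrite ?T_old.
  have [[e1 e2 e3 e4 e5] e6 e7] := (let: And3 _ H _ := inv in H u hu).
  rewrite /isla dep_ins_old // par_ins_old //; have [-> ->] := logs (dep u).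
  have E t : anc' u t = anc u t by rewrite anc_ins_old.
  split.
  + rewrite !O // e1 e2 e3 e4 e5 E; split=> //; by case: eqP => [->|].
  + by rewrite !O // E.
  + have /andP[ku _] := kapP (dep u).
    have su i n : (i %/ 2 ^ n).-1 * 2 ^ n <= i.
      by apply: leq_trans (leq_trunc_div i (2 ^ n)); rewrite leq_mul2r leq_pred orbT.
    have ay i : i <= kap (dep u) -> ast i <= dep u.
      by move=> hi; apply: leq_trans ku; rewrite ast_mono.
    move=> /= hj; have [f1 f2] := e7 hj; rewrite !E; split.
      have [->//|[g1 g2 g3 ->]] := Yold (anc u (ast (kap (dep u)))) (dep u - ast (kap (dep u))).
      have [ek A'] := anc_dep_inj hu ku g1 (leqnn _).
      by rewrite g2 -A' ?ek.
    move=> n hn; rewrite E; set i := (_ %/ _).-1 * _ in f2 *.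
    have [->|[g1 g2 ->]] := Told (anc u (ast i)) n; first exact: f2.
    have [ek A'] := anc_dep_inj hu (ay _ (su _ _)) g1 (ltnW (y_lt g2)).
    by rewrite -ek A' ?leq_subr.
- move=> u; rewrite inE => /orP[/eqP ->|hu].
    rewrite /issb par_ins_new Nold !eqxx; have [_ _ /(_ p pns)[_ [b0 bM] _]] := inv.
    have sp : m1 SUB p \in ns by apply: (sub_ns inv).
    case: eqP subs => [e [c1 c2]|ne [c1 c2 c3 c4]]; last first.
      have sn : s \in ns by rewrite c1.
      split; [by [] | by rewrite (O BET s) ?c1 | ].
      split; [|by rewrite (O SUB p) | by rewrite (O CODE p) // (O BET s) | by rewrite (O BET s)].
      by move=> e; case: wf => rn *; rewrite -e (negPf vns) in rn.
    rewrite e c1; split; first by [].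
    + by case: c2 => [[eb b2]|[eb _]]; rewrite eb ?ltn0Sn //; move: b2; rewrite eb.
    + split=> // _; rewrite (O SUB p) // (O CODE p) // (O BET (m1 SUB p)) //.
      by case: c2 => [[-> _]|[-> ?]]; [left|right].
  have [[e1 e1'] e2 e3] := (let: And3 _ _ H := inv in H u hu).
  have su : m1 SUB u \in ns by apply: (sub_ns inv).
  have pu := par_ns wf hu; have spu := sub_ns inv pu.
  rewrite /issb par_ins_old // !O //; split=> //; last first.
  (* A live node with the sub-block and code of [v] would share parent and slot with it. *)
  rewrite Nold; case: andP => // -[/eqP h1 /eqP h2]; case: eqP subs => [e|ne [c1 c2 c3 c4]].
    by rewrite h1 e (negPf vns) in su.
  have [_ _ /(_ p pns)[_ [b0 bM] _]] := inv.
  move: e3; case: eqP => [eu [e3 _]|_ [/eqP nr f1 f2 f3]].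
    (* The root of a sub-block has code 1, while the code of [v] is at least 2. *)
    have := code_gt0 pns; have : 2 <= 2 ^ m1 BET s by rewrite -{1}[2]expn1 leq_exp2l // c1.
    by move: c2; rewrite -h2 e3; nia.
  rewrite h1 c1 in f1; rewrite h1 h2 c2 in f2; rewrite h1 in f3.
  have p0 : 0 < 2 ^ m1 BET s by rewrite expn_gt0.
  have q1 : m1 CODE p = m1 CODE (par rt pn u).
    by have := congr1 (divn^~ (2 ^ m1 BET s)) f2; rewrite !divnMDl // !divn_small // !addn0.
  have q2 : n1 RNK v = m1 RNK u.
    by have := congr1 (modn^~ (2 ^ m1 BET s)) f2; rewrite !modnMDl !modn_small.
  have q3 : par rt pn u = p.
    have [_ _ H] := inv; have [[np _] _ _] := H _ pns; have [[nu _] _ _] := H _ pu.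
    by rewrite -nu -f1 -q1 np.
  by have := slots hu nr q3; rewrite q2 eqxx.
Qed.

End New.
End Insert.

(** * Programs that insert a leaf into this structure *)

(** The logarithm of the depth follows from the entry at half the depth, which exists because an
    ancestor has that depth. The new leaf is an anchor if its depth equals that of the last anchor
    plus [lam] of it. *)
Definition lains_a : cmd := seqs [::
  Ld1 3 DEP 2 : cmd; BConst 30 1 : cmd; BArith Add 3 3 30 : cmd; St1 DEP 1 3 : cmd;
  St1 PAR 1 2 : cmd;
  BConst 31 2 : cmd; BArith Div 32 3 31 : cmd; BConst 33 0 : cmd;
  CIf (CLt 33 32) (seqs [:: Ld1 34 LOG 32 : cmd; BArith Add 34 34 30 : cmd])
    (seqs [:: BConst 34 0 : cmd]);
  St1 LOG 3 34 : cmd;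
  Ld1 4 AM 2 : cmd; Ld1 34 DEP 4 : cmd; Ld1 35 LOG 34 : cmd; BArith Add 35 35 31 : cmd;
  BArith Add 35 35 34 : cmd; Ld1 5 KIX 4 : cmd;
  CIf (CEq 35 3)
    (seqs [:: St1 MPAR 1 4 : cmd; BArith Add 5 5 30 : cmd; St1 KIX 1 5 : cmd; BMov 4 1 : cmd;
       BConst 6 0 : cmd])
    (seqs [:: BArith Defs.Sub 6 3 34 : cmd]);
  St1 AM 1 4 : cmd; St1 KOF 3 5 : cmd].

(** One more entry of a row: the previous macro anchor of the entry before. [lains_b] writes a first
    entry and three more of this kind. *)
Definition lains_t : seq cmd := [::
  BArith Add 35 35 30 : cmd; Ld1 36 MPAR 36 : cmd; St2 TT 8 35 36 : cmd].

Definition lains_b : cmd := seqs [::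
  BConst 7 1 : cmd; BArith Shl 7 7 6 : cmd;
  CIf (CLt 5 7) CSkip (CSeq (seqs [::
    Ld1 34 MPAR 4 : cmd;
    CIf (CEq 6 33) (seqs [:: BMov 8 34 : cmd]) (seqs [::
       BArith Mod 35 5 7 : cmd;
       CIf (CEq 35 33)
         (seqs [:: BArith Defs.Sub 35 6 30 : cmd; Ld2 8 YT 4 35 : cmd; Ld2 8 YT 8 35 : cmd])
         (seqs [:: Ld2 8 YT 34 6 : cmd])])])
    (seqs ([:: St2 YT 4 6 8 : cmd;
    BArith Mod 35 5 7 : cmd; BConst 36 4 : cmd; BArith Mul 35 35 36 : cmd;
    CIf (CEq 35 33) (seqs [:: BMov 36 8 : cmd])
      (seqs [:: BArith Defs.Sub 36 35 30 : cmd; Ld2 36 TT 8 36 : cmd; Ld1 36 MPAR 36 : cmd]);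
    St2 TT 8 35 36 : cmd] ++ lains_t ++ lains_t ++ lains_t)))].

(** The leaf stays in the sub-block of its parent if its slot fits into the digits and its code
    stays below [B]. It opens a sub-block with wider digits if the slot fails, and one with equal
    digits if only the code fails. *)
Definition lains_c : cmd := seqs [::
  Ld1 9 NCH 2 : cmd; Ld2 10 SLOT 2 9 : cmd;
  CIf (CEq 10 33) (seqs [:: BMov 10 9 : cmd]) (seqs [:: BArith Defs.Sub 10 10 30 : cmd]);
  St1 RNK 1 10 : cmd;
  Ld1 34 SUB 2 : cmd; Ld1 35 BET 34 : cmd; BConst 36 1 : cmd; BArith Shl 36 36 35 : cmd;
  Ld1 37 CODE 2 : cmd; BArith Mul 37 37 36 : cmd; BArith Add 37 37 10 : cmd;
  CIf (CLt 10 36)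
    (CIf (CLt 37 59) (seqs [:: St1 SUB 1 34 : cmd; St1 CODE 1 37 : cmd; St2 NODE 34 37 1 : cmd])
       (seqs [:: St1 SUB 1 1 : cmd; St1 CODE 1 30 : cmd; St2 NODE 1 30 1 : cmd; St1 BET 1 35 : cmd]))
    (seqs [:: St1 SUB 1 1 : cmd; St1 CODE 1 30 : cmd; St2 NODE 1 30 1 : cmd;
       BArith Add 35 35 30 : cmd; St1 BET 1 35 : cmd])].

Definition lains : cmd := CSeq lains_a (CSeq lains_b lains_c).

(** A stack of free slots in zeroed memory: entry 0 stands for the initial content [n], any other
    slot is stored plus one. *)
Definition slot_of (m2 : nat -> nat -> nat -> nat) p n :=
  if m2 SLOT p n == 0 then n else (m2 SLOT p n).-1.

Lemma eqb_notin (f c : nat) (l : seq nat) : f \notin l -> c \in l -> Nat.eqb f c = false.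
Proof. by move=> h h'; apply/negbTE; apply: contra h => /eqP ->. Qed.

Ltac nf hf := rewrite /=; do ?[rewrite (eqb_notin hf); last done].

Section Lains.
Variables (Sigma : finType) (w b B M N rt : nat).
Variables (m1 : nat -> nat -> nat) (m2 : nat -> nat -> nat -> nat).
Variables (ns : seq nat) (pn : nat -> seq nat).
Hypothesis inv : invLA B M m1 m2 rt ns pn.
Hypothesis BE : B = 2 ^ b.
Hypothesis Bw : 128 * B * B <= 2 ^ w.
Hypothesis NB : N.+2 ^ 8 <= B.
Hypothesis nsz : size ns <= N.
Hypothesis nsB : forall v : nat, v \in ns -> v < B.
Hypothesis MN : 0 < M <= N.+1.
Variables (p v : nat).
Hypothesis pns : p \in ns.
Hypothesis vns : v \notin ns.
Hypothesis vB : v < B.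

Let wf : wft rt ns pn. Proof. by case: inv. Qed.
Local Notation anc := (anc rt pn).
Local Notation dep := (dep pn).
Local Notation D := (dep p).+1.
Local Notation k := (kap D).
Local Notation j := (D - ast k).
Local Notation pn' := (pn_ins pn p v).
Local Notation anc' := (ancestor rt pn').
Local Notation A i := (anc' v (ast i)).
Local Notation y := ((k %/ 2 ^ j).-1 * 2 ^ j).
Local Notation ok := (@ok Sigma w B).

Let NB' : 64 * N.+2 <= B. Proof. exact: N4B. Qed.
Let sB x : x < B -> x < 2 ^ w. Proof. exact: (ltB Bw NB). Qed.
Let DN : D <= N. Proof. by have := dep_size wf pns; lia. Qed.

Definition Afields := [:: DEP; PAR; LOG; MPAR; KIX; AM; KOF].

Definition Aregs := [:: 3; 4; 5; 6; 30; 31; 32; 33; 34; 35].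

Lemma lains_a_ok (r : nat -> nat) rc mc out (tt : nat) (Q : hst Sigma -> Prop) :
  r 1 = v -> r 2 = p ->
  (forall (r' : nat -> nat) (n1 : nat -> nat -> nat) (tt' : nat),
     (forall f u, f \notin Afields -> n1 f u = m1 f u) ->
     (forall f u, f \in [:: PAR; DEP; AM; MPAR; KIX] -> u != v -> n1 f u = m1 f u) ->
     (forall t, n1 LOG t = (if t == D then trunc_log 2 D else m1 LOG t) /\
        n1 KOF t = (if t == D then k else m1 KOF t)) ->
     [/\ n1 DEP v = D, n1 PAR v = p & n1 AM v = A k] ->
     (j = 0 -> n1 KIX v = k /\ n1 MPAR v = A k.-1) ->
     n1 MPAR (A k) = A k.-1 -> A k < B ->
     frameS Aregs r r' ->
     [/\ r' 3 = D, r' 4 = A k, r' 5 = k & r' 6 = j] -> r' 30 = 1 -> r' 33 = 0 -> tt' <= tt + 30 ->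
     Q (HS r' rc n1 m2 mc out tt')) ->
  ok lains_a (HS r rc m1 m2 mc out tt) Q.
Proof.
move=> r1 r2 HQ; have [eD eP eA] := la_basic inv pns; have dN := DN.
have w128 c : c < 128 -> c < 2 ^ w by move=> h; apply: sB; lia.
have /andP[k1 k2] := kapP (dep p); have [kx1 kx2] := la_kix inv pns k1.
have An := anc_ns wf pns k1.
rewrite /lains_a; bs; first by rewrite r2 nsB.
rewrite r2 eD; bs; first exact: w128.
bs; first by apply: sB; lia.
rewrite addn1; bs; first by rewrite r1.
rewrite r1; bs; first by rewrite r1.
rewrite r1 r2; bs; first exact: w128.
bs => //; bs; first exact: w128.
apply: ok_cons; apply: ok_if => /=.
apply: (@ok_cut _ _ _ _ _ (fun s' => exists r' t', [/\ s' = HS r' rc (hu1 (hu1 m1 DEP v D) PAR v p) m2 mc out t',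
   r' 34 = trunc_log 2 D, t' <= tt + 12,
   [/\ r' 30 = 1, r' 31 = 2, r' 33 = 0, r' 3 = D & r' 1 = v /\ r' 2 = p] &
   frameS Aregs r r'])).
  case: ltnP => h.
    have h2 : D %/ 2 <= dep p by have := leq_trunc_div D 2; lia.
    have [eL _] := la_glob inv pns h2.
    bs; first by lia.
    bs; first by rewrite eL; apply: sB; have := trunc_logP (isT : 1 < 2) h; have := ltn_expl (trunc_log 2 (D %/ 2)) (isT : 1 < 2); lia.
    apply: ok_nil; eexists; eexists; split; first by [].
    - by rewrite /= eL addn1 [in RHS]trunc_log2S ?divn2 //; move: h; rewrite divn_gt0.
    - by lia.
    - by split=> //=.
    - by frs.
  bs; first exact: w128.
  apply: ok_nil; eexists; eexists; split; first by [].
  - have -> : D = 1 by have := ltn_ceil D (isT : 0 < 2); move: h; rewrite leqn0 => /eqP ->; lia.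
    by [].
  - by lia.
  - by split=> //=.
  - by frs.
move=> s' [r' [t' [-> e34 ht [e30 e31 e33 e3 [e1 e2]] fr']]] {s'}.
bs; first by rewrite e3; lia.
rewrite e3 e34; bs; first by rewrite e2 nsB.
have pv : (p == v) = false by apply: (ne_v vns).
have nv u : u \in ns -> (u == v) = false by apply: (ne_v vns).
have lam_D : ast (kap (dep p)) + lam (ast (kap (dep p))) = ast (kap (dep p)).+1 by [].
rewrite e2 eA; bs; first by rewrite nsB.
have [dA _ _] := la_basic inv An; rewrite (dep_anc wf pns k1) in dA.
rewrite (nv _ An) dA; have sD : ast (kap (dep p)) < D by lia.
bs; first by lia.
have logA : trunc_log 2 (ast (kap (dep p))) <= dep p.
  apply: leq_trans k1; case: (ast _) => [|a]; first by rewrite trunc_log0.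
  exact/ltnW/(leq_trans (ltn_expl _ (isT : 1 < 2)))/trunc_logP.
rewrite (ltn_eqF sD) (la_glob inv pns k1).1; bs; first by rewrite e31; apply: sB; lia.
rewrite e31; bs; first by apply: sB; lia.
bs; first by rewrite nsB.
rewrite kx1; apply: ok_cons; apply: ok_if => /=; rewrite e3.
have lamE : trunc_log 2 (ast (kap (dep p))) + 2 + ast (kap (dep p)) = ast (kap (dep p)).+1.
  by rewrite astS /lam; lia.
have kapD : (D == ast (kap (dep p)).+1) = (ast k == D).
  have /andP[q1 q2] := kapP D; apply/eqP/eqP => [e|e]; first by rewrite {1}e kap_ast.
  by have [|_ kE] := off0 (pn := pn) pns vns; rewrite ?kE; lia.
rewrite lamE eq_sym kapD; case: eqP => hk.
  have [|_ kE] := off0 (pn := pn) pns vns; first by lia.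
  bs; first by rewrite e1.
  rewrite e1; bs; first by rewrite e30; apply: sB; have := kap_leq (dep p); lia.
  rewrite e30 addn1 kE; bs; first by rewrite e1.
  rewrite e1; bs => //; bs; first exact: w128.
  apply: ok_nil; bs; first by rewrite e1.
  rewrite e1; bs; first by rewrite e3; lia.
  have Ak : A k = v by rewrite hk anc_ins_v.
  have kE1 : kap (dep p) = k.-1 by rewrite -kE.
  have Ak1 : A k.-1 = anc p (ast (kap (dep p))).
    by rewrite -kE1 anc_ins_new.
  rewrite e3; apply: ok_nil; apply: HQ => //=; rewrite ?Ak ?Ak1 ?eqxx //.
  - by move=> f u hf; nf hf.
  - move=> f u hf /negPf nu; move: hf; rewrite !inE.
    by do ?[case/orP]; move/eqP => -> /=; rewrite ?nu.
  - by frs.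
  - by split=> //; rewrite hk subnn.
  - by lia.
have hj : 0 < j by have /andP[q1 q2] := kapP D; lia.
have kE := off_gt0 pns vns hj.
have ek : anc p (ast k) = A k by rewrite anc_ins_new // -kE.
bs; first by rewrite e3; lia.
rewrite e3 kE ek; apply: ok_nil; bs; first by rewrite e1.
rewrite e1; bs; first by rewrite e3; lia.
rewrite e3; apply: ok_nil; rewrite kE ek in kx1 kx2 An; apply: HQ => //=; rewrite ?eqxx //.
- by move=> f u hf; nf hf.
- move=> f u hf /negPf nu; move: hf; rewrite !inE.
  by do ?[case/orP]; move/eqP => -> /=; rewrite ?nu.
- by move=> h; rewrite h in hj.
- rewrite kx2 anc_ins_new //; apply: leq_trans k1.
  by rewrite ast_mono kE leq_pred.
- exact: nsB.
- by frs.
- by lia.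
Qed.

Definition Bregs := [:: 7; 8; 34; 35; 36].

Lemma lains_b_ok (r : nat -> nat) rc mc out (tt : nat) (n1 : nat -> nat -> nat) (Q : hst Sigma -> Prop) :
  (forall f u, f \in [:: PAR; DEP; AM; MPAR; KIX] -> u != v -> n1 f u = m1 f u) ->
  n1 MPAR (A k) = A k.-1 -> A k < B ->
  [/\ r 3 = D, r 4 = A k, r 5 = k & r 6 = j] -> r 30 = 1 -> r 33 = 0 ->
  (forall (r' : nat -> nat) (n2 : nat -> nat -> nat -> nat) (tt' : nat),
     (forall f u u', f \notin [:: YT; TT] -> n2 f u u' = m2 f u u') ->
     (forall x i, n2 YT x i = m2 YT x i \/ [/\ x = A k, i = j, 2 ^ j <= k & n2 YT x i = A y]) ->
     (forall x n, n2 TT x n = m2 TT x n \/ [/\ x = A y, 2 ^ j <= k & n2 TT x n = A (y - n)]) ->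
     (2 ^ j <= k -> n2 YT (A k) j = A y) ->
     (2 ^ j <= k -> forall n, 4 * (k %% 2 ^ j) <= n < 4 * (k %% 2 ^ j) + 4 ->
        n2 TT (A y) n = A (y - n)) ->
     frameS Bregs r r' -> tt' <= tt + 40 ->
     Q (HS r' rc n1 n2 mc out tt')) ->
  ok lains_b (HS r rc n1 m2 mc out tt) Q.
Proof.
move=> old mpk AkB [r3 r4 r5 r6] r30 r33 HQ; have dN := DN; have NB2 := NB'.
have w128 c : c < 128 -> c < 2 ^ w by move=> h; apply: sB; lia.
have kN := kap_leq D; have /andP[k1 k2] := kapP D.
have jl : j <= trunc_log 2 D + 1.
  by have := log_le k1; move: k2; rewrite astS /lam; lia.
have jB : 2 ^ j < B.
  have := trunc_logP (isT : 1 < 2) (ltn0Sn (dep p)).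
  have : 2 ^ j <= 2 ^ (trunc_log 2 D + 1) by rewrite leq_exp2l.
  by rewrite addn1 expnS; lia.
have jB' : j < B by have := ltn_expl j (isT : 1 < 2); lia.
have p0 : 0 < 2 ^ j by rewrite expn_gt0.
have AB i : i < k -> A i < B by move=> h; apply: nsB; case: (A_old inv pns vns h).
have mp i : i < k -> n1 MPAR (A i) = A i.-1.
  move=> h; have [_ <-] := kix_ins inv pns vns h; apply: old => //.
  by have [_ h'] := A_old inv pns vns h; rewrite (ne_v vns h').
have mB : 4 * (k %% 2 ^ j) + 4 < B.
  by have := ltn_pmod k p0; have := leq_mod k (2 ^ j); lia.
rewrite /lains_b /lains_t [cat]lock /= -lock; bs; first exact: w128.
bs; first by rewrite r6 mul1n; apply: sB.
rewrite r6 mul1n; apply: ok_cons; apply: ok_if => /=; rewrite r5; case: ltnP => hk.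
  apply: ok_skip; apply: ok_nil; apply: HQ => //; try (by left); try (by move=> h; move: hk; rewrite ltnNge h); try lia.
  by frs.
have yk := y_lt pns vns hk; have k0 : 0 < k by lia.
apply: ok_seq; bs; first by rewrite r4.
rewrite r4 mpk; apply: ok_cons.
apply: (@ok_cut _ _ _ _ _ (fun s' => exists r' t', [/\ s' = HS r' rc n1 m2 mc out t',
   r' 8 = A y, t' <= tt + 11, r' 7 = 2 ^ j & frameS Bregs r r'])).
  rewrite (Y_new inv pns vns hk); apply: ok_if => /=; rewrite r6 r33; case: eqP => [j0|nj].
    bs => //; apply: ok_nil; eexists; eexists; split; first by [].
    - by [].
    - by lia.
    - by [].
    - by frs.
  have j1 : j.-1 < B by lia.
  bs => //; rewrite r5; apply: ok_cons; apply: ok_if => /=; rewrite r33; case: eqP => [hm|hm].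
    bs; first by rewrite r6 r30; lia.
    rewrite r6 r30 subn1; bs; first by rewrite r4.
    rewrite r4; bs.
      split=> //; move: (Y_new inv pns vns hk); case: eqP => // _; rewrite hm /=.
      have j0 : 0 < j by lia.
      have kp := off_gt0 pns vns j0; have Ak : A k = anc p (ast k).
        by rewrite anc_ins_new //; lia.
      have jE : j = j.-1.+1 by lia.
      have [_ HL _] := inv; have [_ _] := HL _ pns; rewrite kp.
      have -> : dep p - ast k = j.-1 by lia.
      rewrite Ak; case=> [|-> _ _].
        by apply: leq_trans hk; rewrite leq_exp2l //; lia.
      apply: nsB; apply: (anc_ns wf) => //; apply: (@leq_trans (ast k)); last by lia.
      rewrite ast_mono; apply: leq_trans (leq_trunc_div k (2 ^ j.-1)).
      by rewrite leq_mul2r leq_pred orbT.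
    apply: ok_nil; apply: ok_nil; eexists; eexists; split; first by [].
    - by [].
    - by lia.
    - by [].
    - by frs.
  bs; first by rewrite r6; split=> //; apply: AB; lia.
  rewrite r6; apply: ok_nil; apply: ok_nil; eexists; eexists; split; first by [].
  - by [].
  - by lia.
  - by [].
  - by frs.
move=> s1 [r1 [t1 [-> e8 ht e7 fr1]]] {s1}.
have e4 : r1 4 = A k by rewrite fr1.
have e5 : r1 5 = k by rewrite fr1.
have e6 : r1 6 = j by rewrite fr1.
have e30 : r1 30 = 1 by rewrite fr1.
have e33 : r1 33 = 0 by rewrite fr1.
apply: ok_nil; bs; first by rewrite e4 e6.
rewrite e4 e6 e8; bs => //; rewrite e5 e7; bs; first exact: w128.
bs; first by apply: sB; lia.
rewrite mulnC; set i0 := 4 * _ in mB *.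
set N2 := hu2 m2 YT _ _ _.
apply: ok_cons; apply: (@ok_cut _ _ _ _ _ (fun s' => exists r' t', [/\ s' = HS r' rc n1 N2 mc out t',
   r' 36 = A (y - i0), t' <= tt + 20, [/\ r' 8 = A y, r' 35 = i0 & r' 30 = 1] & frameS Bregs r r'])).
  apply: ok_if => /=; rewrite e33; case: eqP => [i00|ni].
    bs => //; apply: ok_nil; eexists; eexists; split; first by [].
    - by rewrite /= e8 i00 subn0.
    - by lia.
    - by split.
    - by frs.
  bs; first by rewrite e30; lia.
  rewrite e30; bs; first by rewrite e8; split; [exact: AB | lia].
  have N2E x n : N2 TT x n = m2 TT x n by [].
  rewrite e8 N2E (T_old inv pns vns hk); last by rewrite -/i0; lia.
  bs; first by apply: AB; lia.
  rewrite mp; last by lia.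
  apply: ok_nil; eexists; eexists; split; first by [].
  - by congr (A _); lia.
  - by lia.
  - by split.
  - by frs.
move=> s2 [r2 [t2 [-> f36 ht2 [f8 f35 f30] fr2]]] {s2}.
rewrite /N2.
bs; first by rewrite ?(f8, f30, f35, f36); split; [exact: AB | lia].
bs; first by rewrite ?(f8, f30, f35, f36); apply: sB; lia.
bs; first by rewrite ?(f8, f30, f35, f36); apply: AB; lia.
rewrite ?(f8, f30, f35, f36) mp; last by lia.
bs; first by rewrite ?(f8, f30, f35, f36); split; [exact: AB | lia].
bs; first by rewrite ?(f8, f30, f35, f36); apply: sB; lia.
bs; first by rewrite ?(f8, f30, f35, f36); apply: AB; lia.
rewrite ?(f8, f30, f35, f36) mp; last by lia.
bs; first by rewrite ?(f8, f30, f35, f36); split; [exact: AB | lia].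
bs; first by rewrite ?(f8, f30, f35, f36); apply: sB; lia.
bs; first by rewrite ?(f8, f30, f35, f36); apply: AB; lia.
rewrite ?(f8, f30, f35, f36) mp; last by lia.
bs; first by rewrite ?(f8, f30, f35, f36); split; [exact: AB | lia].
rewrite ?(f8, f30, f35, f36); apply: ok_nil; apply: ok_nil.
(* The four stores together cover the interval from [i0] to [i0 + 3]. *)
have TE x n : (if (x == A y) && (n == i0 + 1 + 1 + 1) then A (y - i0).-1.-1.-1 else
   if (x == A y) && (n == i0 + 1 + 1) then A (y - i0).-1.-1 else
   if (x == A y) && (n == i0 + 1) then A (y - i0).-1 else
   if (x == A y) && (n == i0) then A (y - i0) else m2 TT x n) =
   (if (x == A y) && (i0 <= n < i0 + 4) then A (y - n) else m2 TT x n).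
  case: (x =P A y) => //= _.
  case: eqP => [->|n3]; first by rewrite ifT; [congr (A _); lia | lia].
  case: eqP => [->|n2]; first by rewrite ifT; [congr (A _); lia | lia].
  case: eqP => [->|n1']; first by rewrite ifT; [congr (A _); lia | lia].
  case: eqP => [->|n0]; first by rewrite ifT; [congr (A _); lia | lia].
  by rewrite ifF //; lia.
apply: HQ => /=.
- by move=> f u u' hf; nf hf.
- move=> x i; case: (x =P A k) => [->|_]; last by left.
  by case: (i =P j) => [->|_]; [right | left].
- move=> x n; rewrite TE; case: andP => [[/eqP -> _]|_]; by [right | left].
- by rewrite !eqxx.
- by move=> _ n hn; rewrite TE eqxx hn.
- by frs.
- by lia.
Qed.

Definition Cregs := [:: 9; 10; 34; 35; 36; 37; 38].

Lemma lains_c_ok (r : nat -> nat) rc mc out (tt : nat) (n1 : nat -> nat -> nat)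
    (n2 : nat -> nat -> nat -> nat) (Q : hst Sigma -> Prop) :
  (forall f u, f \notin Afields -> n1 f u = m1 f u) ->
  (forall f u u', f \notin [:: YT; TT] -> n2 f u u' = m2 f u u') ->
  r 1 = v -> r 2 = p -> r 30 = 1 -> r 33 = 0 -> m1 NCH p < B -> slot_of m2 p (m1 NCH p) < M ->
  (forall (r' : nat -> nat) (k1 : nat -> nat -> nat) (k2 : nat -> nat -> nat -> nat) (tt' : nat),
     (forall f u, f \notin [:: RNK; SUB; CODE; BET] -> k1 f u = n1 f u) ->
     (forall f u, f \in [:: RNK; SUB; CODE; BET] -> u != v -> k1 f u = n1 f u) ->
     (forall f u u', f \notin [:: NODE] -> k2 f u u' = n2 f u u') ->
     k1 RNK v = slot_of m2 p (m1 NCH p) ->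
     (forall x c, k2 NODE x c = (if (x == k1 SUB v) && (c == k1 CODE v) then v else n2 NODE x c)) ->
     (if k1 SUB v == v then
        k1 CODE v = 1 /\ (k1 BET v = (m1 BET (m1 SUB p)).+1 /\ 2 ^ k1 BET v <= 2 * M \/
        k1 BET v = m1 BET (m1 SUB p) /\ B <= (m1 CODE p).+1 * 2 ^ m1 BET (m1 SUB p))
      else [/\ k1 SUB v = m1 SUB p, k1 CODE v = m1 CODE p * 2 ^ m1 BET (k1 SUB v) + k1 RNK v,
           k1 RNK v < 2 ^ m1 BET (k1 SUB v) & k1 CODE v < B]) ->
     frameS Cregs r r' -> tt' <= tt + 30 ->
     Q (HS r' rc k1 k2 mc out tt')) ->
  r 59 = B ->
  ok lains_c (HS r rc n1 n2 mc out tt) Q.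
Proof.
move=> o1 o2 r1 r2 r30 r33 nB sM HQ r59; have NB2 := NB'; have /andP[M0 MN'] := MN.
have w128 c : c < 128 -> c < 2 ^ w by move=> h; apply: sB; lia.
have pB := nsB pns; have sp := sub_ns inv pns; have spB := nsB sp.
have nsp : (m1 SUB p == v) = false by apply: (ne_v vns).
have [b0 bM b2] := bet_bound inv pns; set be := m1 BET _ in b0 bM b2 *.
have [_ _ /(_ p pns)[[_ cB] _ _]] := inv.
rewrite /lains_c; bs; first by rewrite r2.
rewrite r2 o1 //; bs; first by rewrite r2.
rewrite r2 o2 //; apply: ok_cons.
set rk := slot_of m2 p (m1 NCH p) in sM HQ.
apply: (@ok_cut _ _ _ _ _ (fun s' => exists r' t', [/\ s' = HS r' rc n1 n2 mc out t',
   r' 10 = rk, t' <= tt + 4 & frameS Cregs r r'])).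
  apply: ok_if => /=; rewrite r33 /rk /slot_of; case: eqP => [s0|ns0].
    by bs => //; apply: ok_nil; eexists; eexists; split; [by [] | by [] | by lia | by frs].
  bs; first by rewrite r30; lia.
  by rewrite r30 subn1; apply: ok_nil; eexists; eexists; split; [by [] | by [] | by lia | by frs].
move=> s1 [r' [t1 [-> e10 ht fr1]]] {s1}.
have e1 : r' 1 = v by rewrite fr1.
have e2 : r' 2 = p by rewrite fr1.
have e30 : r' 30 = 1 by rewrite fr1.
have e59 : r' 59 = B by rewrite fr1.
bs; first by rewrite e1.
rewrite e1 e10; bs; first by rewrite e2.
rewrite e2 o1 //; bs => //; rewrite o1 // -/be; bs; first exact: w128.
have be2B : 2 ^ be <= B by lia.
bs; first by rewrite mul1n; apply: (leq_ltn_trans be2B); apply: leq_trans Bw; nia.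
rewrite mul1n; bs; first by rewrite e2.
rewrite e2 o1 //.
have hm : m1 CODE p * 2 ^ be + rk < 2 ^ w.
  apply: leq_trans Bw; have : m1 CODE p * 2 ^ be <= B * B by apply: leq_mul => //; apply: ltnW.
  have : B <= B * B by rewrite leq_pmulr //; lia.
  by rewrite -mulnA; lia.
bs; first by apply: leq_ltn_trans hm; apply: leq_addr.
bs; first by rewrite e10.
rewrite e10; set cd := _ + rk in hm *.
apply: ok_cons; apply: ok_if => /=; rewrite e10.
have fin (k1 : nat -> nat -> nat) : (forall f u, f \notin [:: RNK; SUB; CODE; BET] -> k1 f u = n1 f u) -> True by [].
case: ltnP => h1; last first.
  bs; first by rewrite e1.
  rewrite e1; bs; first by rewrite e1.
  rewrite e1 e30; bs; first by rewrite e1 e30; split=> //; lia.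
  rewrite e1 e30; bs; first by rewrite e30; apply: sB; lia.
  rewrite e30; bs; first by rewrite e1.
  rewrite e1; apply: ok_nil; apply: ok_nil; apply: HQ => /=; rewrite ?eqxx //.
  - by move=> f u hf; nf hf.
  - move=> f u hf /negPf nu; move: hf; rewrite !inE.
    by do ?[case/orP]; move/eqP => -> /=; rewrite ?nu.
  - by move=> f u u' hf; nf hf.
  (* A slot that does not fit satisfies [2 ^ be <= rk < M], so one more bit keeps the power within
     [2 * M]. *)
  - split=> //; left; split; first by rewrite addn1.
    by rewrite addn1 expnS leq_pmul2l //; lia.
  - by frs; apply: frs_trans fr1 _; frs.
  - by lia.
apply: ok_if => /=; rewrite e59; case: ltnP => h2.
  bs; first by rewrite e1.
  rewrite e1; bs; first by rewrite e1.
  rewrite e1; bs => //; rewrite e1; apply: ok_nil; apply: ok_nil; apply: HQ => /=; rewrite ?eqxx //.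
  - by move=> f u hf; nf hf.
  - move=> f u hf /negPf nu; move: hf; rewrite !inE.
    by do ?[case/orP]; move/eqP => -> /=; rewrite ?nu.
  - by move=> f u u' hf; nf hf.
  - by rewrite nsp.
  - by frs; apply: frs_trans fr1 _; frs.
  - by lia.
bs; first by rewrite e1.
rewrite e1; bs; first by rewrite e1.
rewrite e1 e30; bs; first by rewrite e1 e30; split=> //; lia.
rewrite e1 e30; bs; first by rewrite e1.
rewrite e1; apply: ok_nil; apply: ok_nil; apply: HQ => /=; rewrite ?eqxx //.
- by move=> f u hf; nf hf.
- move=> f u hf /negPf nu; move: hf; rewrite !inE.
  by do ?[case/orP]; move/eqP => -> /=; rewrite ?nu.
- by move=> f u u' hf; nf hf.
- split=> //; right; split=> //; apply: leq_trans h2 _; rewrite /cd -/be mulSn addnC leq_add2r.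
  exact: ltnW.
- by frs; apply: frs_trans fr1 _; frs.
- by lia.
Qed.

Definition LAf := [:: DEP; PAR; LOG; MPAR; KIX; AM; KOF; RNK; SUB; CODE; BET].
Definition Lregs := [:: 3; 4; 5; 6; 7; 8; 9; 10; 30; 31; 32; 33; 34; 35; 36; 37; 38].

Lemma lains_ok (r : nat -> nat) rc mc out (tt : nat) (Q : hst Sigma -> Prop) :
  r 1 = v -> r 2 = p -> r 59 = B -> m1 NCH p < B -> slot_of m2 p (m1 NCH p) < M ->
  (forall u, u \in ns -> u != rt -> par rt pn u = p -> m1 RNK u != slot_of m2 p (m1 NCH p)) ->
  (forall (r' : nat -> nat) (n1 : nat -> nat -> nat) (n2 : nat -> nat -> nat -> nat) (tt' : nat),
     (forall f u, f \notin LAf -> n1 f u = m1 f u) ->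
     (forall f u u', f \notin [:: NODE; YT; TT] -> n2 f u u' = m2 f u u') ->
     invLA B M n1 n2 rt (v :: ns) pn' ->
     (forall u, u != v -> n1 RNK u = m1 RNK u) -> n1 RNK v = slot_of m2 p (m1 NCH p) ->
     frameS Lregs r r' -> r' 3 = D -> tt' <= tt + 100 ->
     Q (HS r' rc n1 n2 mc out tt')) ->
  ok lains (HS r rc m1 m2 mc out tt) Q.
Proof.
move=> r1 r2 r59 nB sM sd HQ; have /andP[M0 _] := MN; apply: ok_seq; apply: lains_a_ok => //.
move=> ra a1 ta A1 A2 A3 A4 A5 A6 A7 A8 [A9 A10 A11 A12] A13 A14 A15.
apply: ok_seq; apply: lains_b_ok => //.
move=> rb b2 tb B1 B2 B3 B4 B5 B6 B7.
apply: (@lains_c_ok _ _ _ _ _ a1 b2) => //; try by rewrite B6 // A8.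
move=> rc' c1 c2 tc C1 C2 C3 C4 C5 C6 C7 C8; apply: HQ => //.
- move=> f u hf; rewrite C1; last by apply: contra hf; rewrite !inE; do ?[case/orP] => /eqP ->.
  by apply: A1; apply: contra hf; rewrite !inE; do ?[case/orP] => /eqP ->.
- move=> f u u' hf; rewrite C3; last by apply: contra hf; rewrite !inE => /eqP ->.
  by apply: B1; apply: contra hf; rewrite !inE; do ?[case/orP] => /eqP ->.
- apply: (invLA_ins inv pns vns) => //.
  + move=> f u; rewrite !inE; do ?[case/orP]; move/eqP => -> nu;
      by first [rewrite C2 // A1 | rewrite C1 // A2].
  + by move=> t; rewrite !C1.
  + by rewrite !C1.
  + by rewrite !C1.
  + by move=> x i; rewrite C3.
  + by move=> x n; rewrite C3.
  + by rewrite C3.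
  + by move=> h n hn; rewrite C3 // B5.
  + by move=> x c; rewrite C5 B1.
  + by move=> u h1 h2 h3; rewrite C4; apply: sd.
  + by have := NB'; lia.
- by move=> u nu; rewrite C2 // A1.
- by apply: frs_trans; [apply: (frs_sub _ A8) | apply: frs_trans; [apply: (frs_sub _ B6) | apply: (frs_sub _ C7)]];
    move=> x; rewrite !inE; do ?[case/orP] => /eqP ->.
- by rewrite C7 // B6.
- by lia.
Qed.

End Lains.

(** * Palindrome objects *)

Definition bsum (l : seq nat) := \sum_(k <- l) 2 ^ k.

(** The conjunction of a number and its predecessor clears the lowest set bit; the number is given
    as a power of two times an odd number. *)
Lemma land_low k c : Nat.land (2 ^ k * c.*2.+1) (2 ^ k * c.*2.+1).-1 = 2 ^ k.+1 * c.
Proof.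
elim: k => [|k IH].
  rewrite expn0 !mul1n land_half /= odd_double /= uphalf_double doubleK.
  have E x : Nat.land x x = x.
    have [n] := ubnP x; elim: n x => // n IH x h; rewrite land_half andbb.
    have [->|x0] := posnP x; first by [].
    by rewrite IH ?odd_double_half //; have := odd_double_half x; lia.
  by rewrite E expn1 mul2n.
rewrite expnS -mulnA mul2n land_half odd_double /= add0n doubleK.
have p0 : 0 < 2 ^ k * c.*2.+1 by rewrite muln_gt0 expn_gt0.
rewrite (_ : _.-1 = (2 ^ k * c.*2.+1).-1.*2.+1); last by lia.
rewrite (_ : _./2 = (2 ^ k * c.*2.+1).-1); last by rewrite /= uphalf_double.
by rewrite IH -mul2n mulnA -expnS.
Qed.

Lemma bsum_low k l : sorted ltn (k :: l) ->
  Nat.land (bsum (k :: l)) (bsum (k :: l)).-1 = bsum l.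
Proof.
move=> /= hp; have [c e] : exists c, bsum l = 2 ^ k.+1 * c.
  have : all (ltn k) l by apply: order_path_min hp => ? ? ?; apply: ltn_trans.
  elim: l {hp} => [|i l IH] /=; first by exists 0; rewrite /bsum big_nil muln0.
  case/andP => h /IH[c e]; exists (2 ^ (i - k.+1) + c).
  by rewrite /bsum big_cons -/(bsum l) e mulnDr -expnD subnKC.
have -> : bsum (k :: l) = 2 ^ k * c.*2.+1.
  by rewrite /bsum big_cons -/(bsum l) e expnS -mul2n mulnS mulnA [2 * _]mulnC.
by rewrite land_low e.
Qed.

Lemma bsum_cons k l : bsum (k :: l) = 2 ^ k + bsum l.
Proof. by rewrite /bsum big_cons. Qed.

Definition lowbit : seq cmd := [::
  BArith Defs.Sub 42 17 13 : cmd; BArith And 42 17 42 : cmd; BArith Defs.Sub 43 17 42 : cmd].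

Lemma lowbit_ok (Sigma : finType) (w B : nat) (l : seq cmd) (s : seq nat) (k : nat) (r : nat -> nat) rc m1 m2
    mc out (tt : nat) (Q : hst Sigma -> Prop) :
  sorted ltn (k :: s) -> r 17 = bsum (k :: s) -> r 13 = 1 ->
  ok w B (seqs l) (HS (hu (hu (hu r 42 (bsum (k :: s)).-1) 42 (bsum s)) 43 (2 ^ k)) rc m1 m2 mc out tt.+3) Q ->
  ok w B (seqs (lowbit ++ l)) (HS r rc m1 m2 mc out tt) Q.
Proof.
move=> hs r17 r13 H; have p0 : 0 < 2 ^ k by rewrite expn_gt0.
bs; first by rewrite r17 r13 bsum_cons; lia.
rewrite r17 r13 subn1; bs => //.
rewrite r17 bsum_low //; bs; first by rewrite r17 bsum_cons; lia.
by rewrite r17 [X in X - _]bsum_cons addnK.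
Qed.

Definition strip (x : seq nat) := take (size x - 2) (behead x).
(** Object 1 is the imaginary palindrome of length -1, whose extensions are the single letters.
    Object 2 is the empty palindrome, and 0 means absence. *)
Definition inn (ob : seq nat -> nat) x := if size x == 1 then 1 else ob (strip x).

Lemma strip_wrap a y : strip (a :: rcons y a) = y.
Proof. by rewrite /strip /= size_rcons subSS subn1 /= -cats1 take_size_cat. Qed.

Lemma inn_wrap ob a y : inn ob (a :: rcons y a) = ob y.
Proof. by rewrite /inn /= size_rcons strip_wrap. Qed.

(** Closure guarantees that the links, series links, leaders and inner palindromes of an object have
    objects too. *)
Definition pclosed (pals : seq (seq nat)) : Prop :=
  [/\ forall x, x \in pals -> x != [::] /\ pal x,
      forall x n, x \in pals -> 0 < n <= size x -> pal (suf n x) -> suf n x \in pals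
    & forall x, x \in pals -> 1 < size x -> strip x \in [::] :: pals].

Definition obj_ok (m1 : nat -> nat -> nat) (m2 : nat -> nat -> nat -> nat) (ob : seq nat -> nat) x : Prop :=
  [/\ [/\ m1 LEN (ob x) = size x, m1 DIFF (ob x) = df x, m1 GW (ob x) = gw x
        & m1 LMASK (ob x) = lmask 0 x],
      x != [::] -> [/\ m1 LINK (ob x) = ob (lnk x), m1 SLINK (ob x) = ob (slk x),
         m1 PCH (ob x) = pch 0 x,
         m1 CNEXT (ob x) = (if cnx 0 x == [::] then 0 else ob (cnx 0 x))
       & forall z, z \in leaders 0 x -> m2 LD (ob x) (gw z) = ob z]
    & x != [::] -> [/\ m1 INNER (ob x) = inn ob x, m1 CHAR (ob x) = head 0 x
       & m2 NEXT (inn ob x) (head 0 x) = ob x]].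

(** The last clause makes every nonzero transition trustworthy; therefore a freed palindrome must
    have its transition cleared, whereas its other entries may become stale. *)
Definition invO (B : nat) (m1 : nat -> nat -> nat) (m2 : nat -> nat -> nat -> nat)
    (ob : seq nat -> nat) (pals : seq (seq nat)) : Prop :=
  [/\ pclosed pals,
      ob [::] = 2,
      uniq (map ob pals) /\ (forall x, x \in pals -> 3 <= ob x < B),
      forall x, x \in [::] :: pals -> obj_ok m1 m2 ob x
    & forall q i, m2 NEXT q i != 0 -> exists2 x, x \in pals & inn ob x = q /\ head 0 x = i].

Section Obj.
Variables (B : nat) (m1 : nat -> nat -> nat) (m2 : nat -> nat -> nat -> nat).
Variables (ob : seq nat -> nat) (pals : seq (seq nat)).
Hypothesis inv : invO B m1 m2 ob pals.
Implicit Types (x y z : seq nat).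
Local Notation live x := (x \in [::] :: pals).

Lemma live_pal x : live x -> pal x.
Proof. by rewrite inE => /orP[/eqP ->//|h]; have [[/(_ _ h)[]]] := inv. Qed.

Lemma live_suf x n : live x -> n <= size x -> pal (suf n x) -> live (suf n x).
Proof.
rewrite !inE => /orP[/eqP ->|h] hn ps; first by rewrite /suf drop_oversize.
have [->|n0] := posnP n; first by rewrite suf0.
by have [[_ -> //]] := inv; rewrite ?n0 ?orbT.
Qed.

Lemma live_grp x z : live x -> z \in grp x -> z \in pals.
Proof.
move=> hx hz; have [pz zn sz e] := grp_mem (live_pal hx) hz.
have := live_suf hx sz; rewrite -e inE (negPf zn) /=; exact.
Qed.

Lemma live_lnk x : live x -> live (lnk x).
Proof. by move=> h; apply: live_suf => //; [apply: lnkn_le | apply: pal_lnk]. Qed.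

Lemma live_slk x : live x -> live (slk x).
Proof.
move=> h; have [->|xn] := eqVneq x [::]; first by rewrite inE.
have [h1 h2 h3 _] := slkP (live_pal h) xn.
by have := live_suf h (ltnW h1); rewrite -h2; exact.
Qed.

Lemma live_cnx x : live x -> cnx 0 x != [::] -> cnx 0 x \in pals.
Proof.
move=> h n; have [e|xn] := eqVneq x [::].
  by move: n; rewrite e /cnx slk_nil leadersE eqxx.
by apply: (live_grp (live_slk h)); apply: cnx_grp => //; apply: live_pal.
Qed.

Lemma ob_inj x y : live x -> live y -> ob x = ob y -> x = y.
Proof.
have [_ e2 [u bd] _ _] := inv; rewrite !inE.
move=> /orP[/eqP ->|hx] /orP[/eqP ->|hy] //; rewrite ?e2 => e.
- by have := bd _ hy; rewrite -e.
- by have := bd _ hx; rewrite e.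
- exact: (uniq_map_inj u).
Qed.

Lemma ob_gt1 x : live x -> 1 < ob x < maxn 3 B.
Proof.
have [_ e2 [_ bd] _ _] := inv; rewrite inE => /orP[/eqP ->|/bd]; first by rewrite e2; lia.
by lia.
Qed.

(** Inner palindrome and outer letter determine a palindrome, and objects are injective on live
    palindromes. *)
Lemma next_spec i y : live y -> let x := i :: rcons y i in
  m2 NEXT (ob y) i = if x \in pals then ob x else 0.
Proof.
move=> hy x; have [cl e2 _ H N] := inv; case: ifP => hx.
  have xl : live x by rewrite inE hx orbT.
  by have [_ _ /(_ isT)[_ _]] := H x xl; rewrite inn_wrap.
apply/eqP; apply: contraFT hx => /N[z hz [h1 h2]].
have [c1 _ c3] := cl; have [zn pz] := c1 z hz; move: h1; rewrite /inn; case: eqP => [_ e|].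
  by have := ob_gt1 hy; rewrite -e.
move=> /eqP s1 e; have s2 : 1 < size z by move: zn s1; rewrite -size_eq0; case: (size z) => [|[]].
have ey := ob_inj (c3 _ hz s2) hy e.
have [a [u [ez _]]] := strip_pal pz s2.
by rewrite /x -ey -h2 ez strip_wrap /= -ez.
Qed.

Lemma next_one i : m2 NEXT 1 i = if [:: i] \in pals then ob [:: i] else 0.
Proof.
have [cl e2 _ H N] := inv; case: ifP => hx.
  have xl : live [:: i] by rewrite inE hx orbT.
  by have [_ _ /(_ isT)[_ _]] := H _ xl.
apply/eqP; apply: contraFT hx => /N[z hz [h1 h2]].
have [c1 _ c3] := cl; have [zn pz] := c1 z hz; move: h1; rewrite /inn; case: eqP => [s1 _|/eqP s1 e].
  by case: z s1 zn h2 hz {pz} => [|a []] //= _ _ ->.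
have s2 : 1 < size z by move: zn s1; rewrite -size_eq0; case: (size z) => [|[]].
by have := ob_gt1 (c3 _ hz s2); rewrite e.
Qed.

Section New.
Variables (n1 : nat -> nat -> nat) (n2 : nat -> nat -> nat -> nat) (x : seq nat) (o : nat).
Definition ob_ins (z : seq nat) := if z == x then o else ob z.
Hypothesis xn : x \notin pals.
Hypothesis x0 : x != [::].
Hypothesis px : pal x.
Hypothesis cl : pclosed (x :: pals).
Hypothesis oB : 3 <= o < B.
Hypothesis ofr : o \notin map ob pals.
Hypothesis old1 : forall f u, f \in [:: LEN; DIFF; GW; LMASK; LINK; SLINK; PCH; CNEXT; INNER; CHAR] ->
  u != o -> n1 f u = m1 f u.
Hypothesis old2 : forall u g, u != o -> n2 LD u g = m2 LD u g.
Hypothesis oldN : forall q i, n2 NEXT q i = if (q == inn ob x) && (i == head 0 x) then o else m2 NEXT q i.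
Hypothesis Nx : m2 NEXT (inn ob x) (head 0 x) = 0.
Hypothesis new1 : [/\ n1 LEN o = size x, n1 DIFF o = df x, n1 GW o = gw x & n1 LMASK o = lmask 0 x].
Hypothesis new2 : [/\ n1 LINK o = ob (lnk x), n1 SLINK o = ob (slk x), n1 PCH o = pch 0 x,
   n1 CNEXT o = (if cnx 0 x == [::] then 0 else ob (cnx 0 x))
 & forall z, z \in leaders 0 x -> n2 LD o (gw z) = if z == x then o else ob z].
Hypothesis new3 : n1 INNER o = inn ob x /\ n1 CHAR o = head 0 x.

Lemma ob_ins_old z : live z -> ob_ins z = ob z.
Proof.
move=> h; rewrite /ob_ins; case: eqP => // e; move: h; rewrite e inE (negPf x0) /=.
by rewrite (negPf xn).
Qed.

Lemma ob_ins_lt z : size z < size x -> ob_ins z = ob z.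
Proof. by move=> h; rewrite /ob_ins; case: eqP => // e; move: h; rewrite e ltnn. Qed.

Lemma inn_ins z : z \in x :: pals -> inn ob_ins z = inn ob z.
Proof.
move=> hz; rewrite /inn; case: eqP => // /eqP s1; have [c1 _ c3] := cl.
have [zn _] := c1 z hz.
have s2 : 1 < size z by move: zn s1; rewrite -size_eq0; case: (size z) => [|[]].
move: hz; rewrite inE => /orP[/eqP ez|hz].
  by apply: ob_ins_lt; rewrite -ez /strip size_take size_behead; case: ifP; lia.
by apply: ob_ins_old; have [[_ _ d3] _ _ _ _] := inv; apply: d3.
Qed.

Lemma invO_ins : invO B n1 n2 ob_ins (x :: pals).
Proof.
have [[c1 c2 c3] e2 [u bd] H N] := inv; split=> //.
- by rewrite ob_ins_old ?inE.
- have E : map ob_ins pals = map ob pals.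
    by apply/eq_in_map => z hz; rewrite ob_ins_old // inE hz orbT.
  split; first by rewrite /= E u andbT {1}/ob_ins eqxx.
  move=> z; rewrite inE => /orP[/eqP ->|hz]; first by rewrite /ob_ins eqxx.
  by rewrite ob_ins_old ?bd // inE hz orbT.
- move=> z hz; have [ez|nz] := eqVneq z x.
    have ox : ob_ins x = o by rewrite /ob_ins eqxx.
    rewrite ez /obj_ok ox; split=> // _.
      have [q1 q2 q3 q4 q5] := new2.
      rewrite (ob_ins_lt (size_lnk_lt x0)) (ob_ins_lt (size_slk_lt x0)) (ob_ins_lt (cnx_size _ px x0)).
      by split=> // y hy; rewrite q5.
    rewrite inn_ins ?mem_head //; have [q1 q2] := new3.
    by split=> //; rewrite oldN !eqxx.
  have lz : live z by move: hz; rewrite !inE (negPf nz).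
  have no : ob z != o.
    move: lz; rewrite inE => /orP[/eqP ->|lz]; first by rewrite e2; lia.
    by apply: contraNneq ofr => <-; apply: map_f.
  have [[p1 p2 p3 p4] p5 p6] := H z lz.
  rewrite /obj_ok ob_ins_old // !old1 //; split=> // zn.
    have [q1 q2 q3 q4 q5] := p5 zn.
    rewrite (ob_ins_old (live_lnk lz)) (ob_ins_old (live_slk lz)) q1 q2 q3 q4; split=> //.
      case: eqP => // /eqP cn; rewrite ob_ins_old // inE live_cnx ?orbT //.
    move=> y hy; rewrite old2 // q5 // ob_ins_old // inE (live_grp lz) ?orbT //.
    exact: leaders_grp hy.
  have zp : z \in pals by move: lz; rewrite inE (negPf zn).
  have [q1 q2 q3] := p6 zn; rewrite inn_ins ?inE ?zp ?orbT //; split=> //.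
  rewrite oldN; case: andP => // -[/eqP h1 /eqP h2].
  by move: q3; rewrite h1 h2 Nx => e; have := bd z zp; rewrite -e.
- move=> q i; rewrite oldN; case: andP => [[/eqP -> /eqP ->] _|_ /N[z hz [h1 h2]]].
    by exists x; rewrite ?mem_head // inn_ins ?mem_head.
  by exists z; rewrite ?inE ?hz ?orbT // inn_ins // inE hz orbT.
Qed.

End New.
End Obj.

(** * Identities of edges *)

Lemma map_suf (A B : eqType) (f : A -> B) n (x : seq A) : map f (suf n x) = suf n (map f x).
Proof. by rewrite /suf map_drop size_map. Qed.

(* If [f] creates no palindromes, then two palindromic suffixes whose preceding
   letters have the same image are preceded by the same letter: the mirror image
   of the longer one in itself puts both letters around a copy of the shorter. *)
Lemma same_letter (A B : eqType) (d : A) (f : A -> B) (w : seq A) a b :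
  (forall t n, t <= size w -> n <= t -> pal (suf n (take t (map f w))) -> pal (suf n (take t w))) ->
  a < size w -> b < size w -> pal (suf a w) -> pal (suf b w) ->
  f (nth d w (size w - a.+1)) = f (nth d w (size w - b.+1)) ->
  nth d w (size w - a.+1) = nth d w (size w - b.+1).
Proof.
move=> H; wlog ab : a b / a < b.
  move=> W ha hb pa pb e; case: (ltngtP a b) => [h|h|->] //; first exact: W.
  by symmetry; apply: W.
move=> ha hb pa pb e; set S := size w in ha hb e *.
(* The prefix of length [t] ends with the mirror image, inside suffix [b], of the letter before
   suffix [a]. There a copy of suffix [a] stands between the letter before suffix [b] and this
   mirror image. *)
set t := (S - b + a).+1; have ht : t <= S by rewrite /t; lia.
have hpos : nth d w (S - b + a) = nth d w (S - a.+1).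
  rewrite -(nth_suf d a (ltnW hb)) (pal_nth d _).1 ?size_suf ?(ltnW hb) //.
  by rewrite nth_suf ?(ltnW hb) //; congr (nth _ _ _); rewrite -/S; lia.
have sa : suf a (take (S - b + a) w) = suf a w.
  rewrite /suf size_takel; last by rewrite -/S; lia.
  rewrite addnK [S - b + a]addnC -take_drop -/S.
  rewrite (_ : drop (S - b) w = suf b w) //.
  have := border_take pb; rewrite size_suf ?(ltnW hb) // => /(_ a (ltnW ab)).
  rewrite suf_suf; last by rewrite (ltnW ab) ltnW.
  by move=> /(_ pa) ->.
have tw : take t w = rcons (take (S - b + a) w) (nth d w (S - a.+1)).
  by rewrite /t (take_nth d) -?hpos //.
have st : size (take (S - b + a) w) = S - b + a by rewrite size_takel // -/S; lia.
have := H t a.+2 ht; rewrite -map_take tw map_rcons.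
have hn : a < size (take (S - b + a) w) by rewrite st; lia.
have nb : nth d (take (S - b + a) w) (size (take (S - b + a) w) - a.+1) = nth d w (S - b.+1).
  by rewrite st nth_take; [congr (nth _ _ _) |]; lia.
rewrite (pal_cand d _ hn) (pal_cand (f d)) ?size_map // /cand size_map hn /= nb sa pa /=.
rewrite (nth_map d); last by rewrite st; lia.
rewrite nb -map_suf sa e eqxx andbT.
have pf : pal (map f (suf a w)) by rewrite /pal -map_rev (pal_rev pa).
by rewrite pf => /(_ _ isT) h; apply/esym/eqP/h; rewrite /t; lia.
Qed.

Section Nodes.
Variables (Sigma : finType).
Implicit Types (idn : nat -> nat) (mc : nat -> option Sigma) (pn : nat -> seq nat) (ns : seq nat).

Definition iwd idn pn (v : nat) := map idn (pn v).
Definition rwd mc pn (v : nat) := map mc (pn v).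
Definition kids rt ns pn (p : nat) := [seq u <- ns | (u != rt) && (par rt pn u == p)].

(** The name of an edge is the lower end of an edge with the same label on the same path. Comparing
    a letter with a name is thus one read of character memory, and a name cannot be deleted before
    its users. *)
Definition invW idn mc rt ns pn : Prop :=
  [/\ forall v, v \in ns -> v != rt -> [/\ idn v \in pn v, mc (idn v) = mc v & mc v != None],
      forall v n, v \in ns -> n <= dep pn v -> pal (suf n (rwd mc pn v)) -> pal (suf n (iwd idn pn v))
    & forall u u', u \in ns -> u' \in ns -> u != rt -> u' != rt ->
        par rt pn u = par rt pn u' -> mc u = mc u' -> u = u'].

Lemma lettersP (w : seq nat) n : n < size w -> nth 0 w (size w - n.+1) \in w.
Proof. by move=> h; apply: mem_nth; rewrite ltn_subrL (leq_trans _ h). Qed.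

Section W.
Variables (idn : nat -> nat) (mc : nat -> option Sigma) (rt : nat) (ns : seq nat) (pn : nat -> seq nat).
Hypothesis wf : wft rt ns pn.
Hypothesis inv : invW idn mc rt ns pn.
Local Notation iw := (iwd idn pn).
Local Notation rw := (rwd mc pn).
Local Notation dep := (dep pn).
Local Notation anc := (anc rt pn).

Lemma size_iw v : size (iw v) = dep v. Proof. by rewrite size_map. Qed.

Lemma pn_nrt v x : v \in ns -> x \in pn v -> x != rt.
Proof.
move=> hv hx; have [_ _ _ /(_ v hv) /= /andP[h _] _] := wf.
by apply: contraNneq h => <-.
Qed.

Lemma rw_iw v : v \in ns -> map mc (iw v) = rw v.
Proof.
move=> hv; rewrite -map_comp; apply/eq_in_map => x hx /=.
by have [/(_ x (pn_ns wf hv hx) (pn_nrt hv hx))[]] := inv.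
Qed.

Lemma iw_anc v t : v \in ns -> t <= dep v -> iw (anc v t) = take t (iw v).
Proof. by move=> hv ht; rewrite /iwd (anc_spec wf hv ht).2 map_take. Qed.

Lemma pal_iw v n : v \in ns -> n <= dep v -> pal (suf n (rw v)) = pal (suf n (iw v)).
Proof.
move=> hv hn; apply/idP/idP; first by have [_ H _] := inv; apply: H.
by move=> h; rewrite -rw_iw // -map_suf /pal -map_rev (pal_rev h).
Qed.

Lemma iw_ns v x : v \in ns -> x \in iw v -> x \in ns.
Proof.
move=> hv /mapP[u hu ->]; have un := pn_ns wf hv hu; apply: (pn_ns wf un).
by have [/(_ u un (pn_nrt hv hu))[]] := inv.
Qed.

(** Words of names and words of labels have the same palindromic suffixes on every prefix of the
    path, which is what [same_letter] asks of the labelling. *)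
Lemma iw_label v a b : v \in ns -> a < dep v -> b < dep v -> pal (suf a (iw v)) -> pal (suf b (iw v)) ->
  mc (nth 0 (iw v) (dep v - a.+1)) = mc (nth 0 (iw v) (dep v - b.+1)) ->
  nth 0 (iw v) (dep v - a.+1) = nth 0 (iw v) (dep v - b.+1).
Proof.
rewrite -size_iw => hv; apply: same_letter => t n ht hn.
rewrite rw_iw // /rwd -map_take -map_take; move: ht; rewrite size_iw => ht.
have [_ H _] := inv; rewrite -(anc_spec wf hv ht).2.
by apply: H; [apply: (anc_ns wf) | rewrite (dep_anc wf)].
Qed.

Lemma kid_ids p u u' : u \in kids rt ns pn p -> u' \in kids rt ns pn p -> idn u = idn u' -> u = u'.
Proof.
rewrite !mem_filter => /andP[/andP[u0 /eqP up] un] /andP[/andP[u0' /eqP up'] un'] e.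
have [H1 _ H3] := inv; apply: H3 => //; first by rewrite up up'.
by have [_ <- _] := H1 u un u0; have [_ <- _] := H1 u' un' u0'; rewrite e.
Qed.

(* The letters of the word of [v] are names of edges on its path, so each has an
   occurrence of its real label. *)
Lemma lps_iw_first v x : v \in ns -> x != [::] -> pal x -> size x <= dep v -> suf (size x) (iw v) = x ->
  exists2 u, u \in ns & lps (iw u) = x.
Proof.
move=> hv xn px sx e; have := lps_first xn px e; rewrite size_iw => /(_ sx)[n /andP[_ hn] h].
by exists (anc v n); [apply: anc_ns | rewrite iw_anc].
Qed.

Lemma pn_prefix v x y : v \in ns -> x \in pn v -> y \in pn x -> y \in pn v.
Proof.
move=> hv hx; have hi : (index x (pn v)).+1 <= dep v by rewrite index_mem.
have [_] := anc_spec wf hv hi; rewrite /anc /= nth_index // => ->; exact: mem_take.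
Qed.

Section Insert.
Variables (p v : nat) (c : option Sigma) (i : nat).
Hypothesis pns : p \in ns.
Hypothesis vns : v \notin ns.
Local Notation w := (iw p).
Local Notation let_ n := (nth 0 w (dep p - n.+1)).
Local Notation idn' := (fun u => if u == v then i else idn u).
Local Notation mc' := (huc mc v c).
Local Notation pn' := (pn_ins pn p v).

(** In the second case the label may well occur on the path already. Equal labels may then bear
    different names, but no palindromic suffix exhibits the old one at this moment. *)
Definition idspec : Prop :=
  (exists n, [/\ n < dep p, pal (suf n w), mc (let_ n) = c & i = let_ n]) \/
  (forall n, n < dep p -> pal (suf n w) -> mc (let_ n) != c) /\ i = v.

Hypothesis ids : idspec.
Hypothesis c0 : c != None.
Hypothesis cn : forall u, u \in ns -> u != rt -> par rt pn u = p -> mc u != c.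

(** Where a palindromic suffix can be extended, testing the label and testing the name agree. A
    fresh name is the new node, which occurs on no older path. *)
Lemma id_label n : n < dep p -> pal (suf n w) -> (mc (let_ n) == c) = (let_ n == i).
Proof.
move=> hn pl; apply/eqP/eqP => e.
  case: ids => [[m [hm pm em ->]]|[/(_ n hn pl)]]; last by rewrite e eqxx.
  by apply: iw_label; rewrite ?em.
case: ids => [[m [hm pm em ei]]|[_ ei]]; first by rewrite e ei.
by have := lettersP (w := w) (n := n); rewrite size_iw e ei => /(_ hn) /(iw_ns pns); rewrite (negPf vns).
Qed.

Lemma iw_old u : u \in ns -> iwd idn' pn' u = iw u.
Proof.
move=> hu; rewrite /iwd (pn_ins_old pn p vns hu); apply/eq_in_map => x hx.
by case: eqP => // e; move: vns; rewrite -e (pn_ns wf hu hx).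
Qed.

Lemma iw_new : iwd idn' pn' v = rcons w i.
Proof.
rewrite /iwd pn_ins_new map_rcons eqxx; congr rcons; apply/eq_in_map => x hx.
by case: eqP => // e; move: vns; rewrite -e (pn_ns wf pns hx).
Qed.

Lemma rw_old u : u \in ns -> rwd mc' pn' u = rw u.
Proof.
move=> hu; rewrite /rwd (pn_ins_old pn p vns hu); apply/eq_in_map => x hx.
by rewrite /huc; case: eqP => // e; move: vns; rewrite -e (pn_ns wf hu hx).
Qed.

Lemma rw_new : rwd mc' pn' v = rcons (rw p) c.
Proof.
rewrite /rwd pn_ins_new map_rcons {2}/huc eqxx; congr rcons; apply/eq_in_map => x hx.
by rewrite /huc; case: eqP => // e; move: vns; rewrite -e (pn_ns wf pns hx).
Qed.

Lemma par_new : par rt pn' v = p.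
Proof. by rewrite /par dep_ins_new anc_ins_new // (anc_dep wf). Qed.

Lemma invW_ins : invW idn' mc' rt (v :: ns) pn'.
Proof.
have [H1 H2 H3] := inv; have nv u : u \in ns -> u == v = false by move=> h; apply: contraNF vns => /eqP <-.
have mo u : u \in ns -> mc' u = mc u by move=> h; rewrite /huc nv.
have mv : mc' v = c by rewrite /huc eqxx.
have vrt : v != rt by apply: contraNneq vns => ->; case: wf.
split.
- move=> u; rewrite inE => /orP[/eqP -> _|hu u0].
    rewrite eqxx pn_ins_new {2 3}/huc eqxx mem_rcons inE; split=> //.
      case: ids => [[n [hn _ _ ->]]|[_ ->]]; last by rewrite eqxx.
      have := lettersP (w := w) (n := n); rewrite size_iw => /(_ hn) /mapP[x hx ->].
      have xn := pn_ns wf pns hx; have [h _ _] := H1 x xn (pn_nrt pns hx).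
      by rewrite (pn_prefix pns hx h) orbT.
    by rewrite /huc; case: eqP => // iv; case: ids => [[n [_ _ e ->]]|[_ e]].
  have [h1 h2 h3] := H1 u hu u0; rewrite (pn_ins_old pn p vns hu) nv // !mo //.
  exact: (pn_ns wf hu).
- move=> u n; rewrite inE => /orP[/eqP ->|hu]; last first.
    by rewrite iw_old // rw_old // (dep_ins_old pn p vns hu); apply: H2.
  rewrite iw_new rw_new dep_ins_new => hn.
  case: n hn => [|[|n]] hn; first by rewrite !suf0.
    by move=> _; rewrite (@suf_rcons _ 0 w i) // suf0; apply: pal_one.
  have hn' : n < dep p by [].
  rewrite (pal_cand 0) ?size_iw // (pal_cand None) ?size_map // /cand size_iw hn' /=.
  rewrite size_map -/(dep p) hn' /= => /andP[].
  rewrite pal_iw ?(ltnW hn') // => pl; rewrite -rw_iw // (nth_map 0); last by rewrite size_iw; lia.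
  by rewrite id_label // pl.
- move=> u u'; rewrite !inE => /orP[/eqP ->|hu] /orP[/eqP ->|hu'] // u0 u0'.
  + rewrite par_new (par_ins_old rt pn p vns hu') (mo _ hu') mv => e1 e2.
    by have := cn hu' u0' (esym e1); rewrite e2 eqxx.
  + rewrite par_new (par_ins_old rt pn p vns hu) (mo _ hu) mv => e1 e2.
    by have := cn hu u0 e1; rewrite e2 eqxx.
  + by rewrite (par_ins_old rt pn p vns hu) (par_ins_old rt pn p vns hu') (mo _ hu) (mo _ hu'); apply: H3.
Qed.

End Insert.

(** By [lps_iw_first] each palindromic suffix of a root path is the longest one of some ancestor.
    The inner palindrome ends one edge earlier, at the parent. *)
Lemma nodes_closed pals : (forall x, x \in pals <-> x != [::] /\ exists2 v, v \in ns & lps (iw v) = x) ->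
  pclosed pals.
Proof.
move=> H; split.
- by move=> x /H[xn [v _ e]]; split=> //; rewrite -e; apply: pal_lps.
- move=> x n /H[xn [v hv e]] /andP[n0 hn] pn0.
  have sx : size x <= dep v by rewrite -e size_lps -size_iw; case: (lpsnP (iw v)).
  apply/H; split; first by rewrite -size_eq0 size_suf // -lt0n.
  apply: (@lps_iw_first v) => //; rewrite ?size_suf //; first by rewrite -size_eq0 size_suf // -lt0n.
    by apply: leq_trans sx.
  by rewrite -e /lps suf_suf // -size_lps e hn size_iw.
- move=> x /H[xn [v hv e]] s2; have px : pal x by rewrite -e pal_lps.
  have [a [y [ex py]]] := strip_pal px s2; rewrite ex strip_wrap inE -implyNb.
  apply/implyP => yn; apply/H; split=> //.
  have sx : size x <= dep v by rewrite -e size_lps -size_iw; case: (lpsnP (iw v)).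
  have sy : (size y).+2 = size x by rewrite ex /= size_rcons.
  have d0 : 0 < dep v by lia.
  apply: (@lps_iw_first (anc v (dep v).-1)) => //.
  + by apply: (anc_ns wf) => //; lia.
  + by rewrite (dep_anc wf) //; lia.
  + rewrite iw_anc //; last by lia.
    have st : size (take (dep v).-1 (iw v)) = (dep v).-1 by rewrite size_takel // size_iw leq_pred.
    have eW : iw v = rcons (take (dep v).-1 (iw v)) (nth 0 (iw v) (dep v).-1).
      by rewrite -take_nth ?size_iw ?prednK // take_oversize // size_iw.
    have h : suf (size x) (iw v) = x by rewrite -{2}e /lps -e size_lps.
    move: (take _ _) (nth _ _ _) st eW => W z st eW; move: h; rewrite eW.
    rewrite -sy ex suf_rcons; last by rewrite st; lia.
    rewrite -rcons_cons => /rcons_inj[e1 _].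
    rewrite -(@suf_suf _ _ (size y).+1); last by rewrite st; lia.
    by rewrite e1 (_ : a :: y = [:: a] ++ y) // suf_cat.
Qed.

End W.
End Nodes.

(** * Invariants of the nodes *)

(** At most one leader contributes. The form of a sum makes the contributions of the children add
    up. *)
Definition kill (x : seq nat) i := \sum_(z <- leaders 0 x | pch 0 z == i) gw z.
Definition ktop (w : seq nat) i : nat := (lpsn w < size w) && (nth 0 w (size w - (lpsn w).+1) == i).

Lemma kill_sum (x : seq nat) (l : seq nat) : uniq l ->
  \sum_(i <- l) kill x i = \sum_(z <- leaders 0 x | pch 0 z \in l) gw z.
Proof.
elim: l => [|i l IH] /=; first by rewrite big_nil big_pred0.
case/andP => il ul; rewrite big_cons IH // /kill.
rewrite [RHS](bigID (fun z => pch 0 z == i)) /=; congr (_ + _); apply: eq_bigl => z.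
  by rewrite inE; case: (_ == i); rewrite ?andbF.
by rewrite inE; case: eqP => /= [->|_]; rewrite ?andbT // (negPf il).
Qed.

Lemma ktop_sum (w : seq nat) (l : seq nat) : uniq l ->
  \sum_(i <- l) ktop w i = ((lpsn w < size w) && (nth 0 w (size w - (lpsn w).+1) \in l) : nat).
Proof.
elim: l => [|i l IH] /=; first by rewrite big_nil andbF.
case/andP => il ul; rewrite big_cons IH // /ktop inE; case: ltnP => //= _.
by case: eqP => // ->; rewrite (negPf il).
Qed.

Lemma kill_sum_le (x : seq nat) l : uniq l -> \sum_(i <- l) kill x i <= lmask 0 x.
Proof.
move=> ul; rewrite kill_sum // /lmask [leqRHS](bigID (fun z => pch 0 z \in l)) /=; exact: leq_addr.
Qed.

Lemma ktop_sum_le (w : seq nat) l : uniq l -> \sum_(i <- l) ktop w i <= 1.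
Proof. by move=> ul; rewrite ktop_sum //; case: (_ && _). Qed.

(** The mask of unextended leaders is determined by an equation with a sum over the children, so an
    insertion subtracts one term and a deletion adds it back, in whatever order they come. In the
    last clause the slots in use and the stack of free slots together permute the numbers below
    [M]. *)
Definition invM (m1 : nat -> nat -> nat) (m2 : nat -> nat -> nat -> nat) rt ns (pn : nat -> seq nat)
    (ob : seq nat -> nat) (pals : seq (seq nat)) M : Prop :=
  let iw := iwd (m1 IDN) pn in
  [/\ [/\ forall v, v \in ns -> m1 PAL v = ob (lps (iw v)),
        forall x, x \in pals <-> x != [::] /\ exists2 v, v \in ns & lps (iw v) = x
      & forall x, x \in pals -> m1 CNT (ob x) = count (fun v => lps (iw v) == x) ns],
      forall u, u \in ns -> u != rt -> m1 KILL u = kill (lps (iw (par rt pn u))) (m1 IDN u) /\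
        m1 KTOP u = ktop (iw (par rt pn u)) (m1 IDN u),
      forall v, v \in ns -> m1 ACT v + \sum_(u <- kids rt ns pn v) m1 KILL u = lmask 0 (lps (iw v)) /\
        m1 TOPA v + \sum_(u <- kids rt ns pn v) m1 KTOP u = 1
    & forall p, m1 NCH p = size (kids rt ns pn p) /\
        perm_eq (map (m1 RNK) (kids rt ns pn p) ++ [seq slot_of m2 p i | i <- iota (m1 NCH p) (M - m1 NCH p)])
          (iota 0 M)].

Lemma invM_perm m1 m2 rt ns ns' pn ob pals M : perm_eq ns ns' ->
  invM m1 m2 rt ns pn ob pals M -> invM m1 m2 rt ns' pn ob pals M.
Proof.
move=> e [[A1 A2 A3] H2 H3 H4]; have me := perm_mem e.
have ek p : perm_eq (kids rt ns pn p) (kids rt ns' pn p) by apply: perm_filter.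
split.
- split; [by move=> v; rewrite -me; apply: A1 | | ].
    by move=> x; split=> [/A2[h [v hv ev]]|[h [v hv ev]]]; [split=> //; exists v; rewrite -?me|apply/A2; split=> //; exists v; rewrite ?me].
  by move=> x hx; rewrite A3 //; apply/permP.
- by move=> u; rewrite -me; apply: H2.
- by move=> v; rewrite -me => /H3[h h']; rewrite -!(perm_big _ (ek v)).
- move=> p; have [h h'] := H4 p; rewrite h (perm_size (ek p)); split=> //.
  apply: perm_trans h'; rewrite h (perm_size (ek p)) perm_cat2r perm_sym; exact: perm_map.
Qed.

Section MIns.
Variables (Sigma : finType) (mc : nat -> option Sigma).
Variables (m1 n1 : nat -> nat -> nat) (m2 n2 : nat -> nat -> nat -> nat) (rt : nat) (ns : seq nat).
Variables (pn : nat -> seq nat) (ob ob' : seq nat -> nat) (pals pals' : seq (seq nat)) (M : nat).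
Hypothesis wf : wft rt ns pn.
Hypothesis invw : invW (m1 IDN) mc rt ns pn.
Hypothesis invm : invM m1 m2 rt ns pn ob pals M.
Variables (p v : nat) (c : option Sigma) (i : nat).
Hypothesis pns : p \in ns.
Hypothesis vns : v \notin ns.
Hypothesis ids : idspec (m1 IDN) mc pn p v c i.
Hypothesis cn : forall u, u \in ns -> u != rt -> par rt pn u = p -> mc u != c.
Local Notation iw := (iwd (m1 IDN) pn).
Local Notation w := (iw p).
Local Notation pn' := (pn_ins pn p v).
Local Notation iw' := (iwd (n1 IDN) pn').
Local Notation x := (lps (rcons w i)).

Lemma kid_id_new u : u \in kids rt ns pn p -> m1 IDN u != i.
Proof.
rewrite mem_filter => /andP[/andP[u0 /eqP up] un]; have [H1 _ _] := invw.
have [h1 h2 _] := H1 u un u0; apply: contraTneq (cn un u0 up) => e; rewrite -h2 e negbK.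
case: ids => [[n [_ _ <- ->]] //|[_ ev]].
by move: (pn_ns wf un h1); rewrite e ev (negPf vns).
Qed.

Lemma kid_uniq q : uniq (map (m1 IDN) (kids rt ns pn q)).
Proof.
rewrite map_inj_in_uniq ?filter_uniq //; first by case: wf.
by move=> u u' hu hu'; apply: (kid_ids invw hu hu').
Qed.

Lemma kids_sums (m : nat -> nat -> nat) q : (forall u, u \in ns -> u != rt -> m KILL u = kill (lps (iw (par rt pn u))) (m1 IDN u) /\
        m KTOP u = ktop (iw (par rt pn u)) (m1 IDN u)) ->
  \sum_(u <- kids rt ns pn q) m KILL u = \sum_(j <- map (m1 IDN) (kids rt ns pn q)) kill (lps (iw q)) j /\
  \sum_(u <- kids rt ns pn q) m KTOP u = \sum_(j <- map (m1 IDN) (kids rt ns pn q)) ktop (iw q) j.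
Proof.
move=> H; rewrite !big_map /kids !big_filter.
by split; rewrite big_seq_cond [RHS]big_seq_cond; apply: eq_bigr => u /and3P[un u0 /eqP <-]; have [] := H u un u0.
Qed.

(** Siblings have distinct names and remove disjoint sets of leaders, so the subtraction at the
    parent does not underflow. *)
Lemma kill_le : kill (lps w) i <= m1 ACT p /\ ktop w i <= m1 TOPA p.
Proof.
have [_ H2 H3 _] := invm; have [h h'] := H3 p pns.
have [e1 e2] := kids_sums p H2; rewrite e1 in h; rewrite e2 in h'.
have u : uniq (i :: map (m1 IDN) (kids rt ns pn p)).
  by rewrite /= kid_uniq andbT; apply/mapP => -[u hu e]; move: (kid_id_new hu); rewrite e eqxx.
have := kill_sum_le (lps w) u; rewrite big_cons -h leq_add2r => ->.
split=> //; have := ktop_sum_le w u; rewrite big_cons -[X in _ <= X]h' leq_add2r; exact.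
Qed.

Hypothesis old : forall f u, f \in [:: IDN; PAL; KILL; KTOP; RNK] -> u != v -> n1 f u = m1 f u.
Hypothesis new : [/\ n1 IDN v = i, n1 PAL v = ob' x, n1 KILL v = kill (lps w) i,
   n1 KTOP v = ktop w i & n1 RNK v = slot_of m2 p (m1 NCH p)].
Hypothesis act : forall u, u != v -> n1 ACT u = (if u == p then m1 ACT u - kill (lps w) i else m1 ACT u) /\
   n1 TOPA u = (if u == p then m1 TOPA u - ktop w i else m1 TOPA u).
Hypothesis actv : n1 ACT v = lmask 0 x /\ n1 TOPA v = 1.
Hypothesis nch : forall u, n1 NCH u = if u == p then (m1 NCH u).+1 else m1 NCH u.
Hypothesis nM : m1 NCH p < M.
Hypothesis slot : forall q j, n2 SLOT q j = m2 SLOT q j.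
Hypothesis obl : forall y, y \in [::] :: pals -> ob' y = ob y.
Hypothesis palsE : pals' = if x \in pals then pals else x :: pals.
Hypothesis obi : uniq (map ob' pals').
Hypothesis cntx : n1 CNT (ob' x) = if x \in pals then (m1 CNT (ob x)).+1 else 1.
Hypothesis cnto : forall u, u != ob' x -> n1 CNT u = m1 CNT u.

Lemma x_neq0 : x != [::].
Proof. by rewrite -size_eq0 size_lps -lt0n lpsn_gt0 // -size_eq0 size_rcons. Qed.

Let nv u : u \in ns -> u == v = false. Proof. by move=> h; apply: contraNF vns => /eqP <-. Qed.
Let nv' u : u \in ns -> u != v. Proof. by move=> h; rewrite nv. Qed.

Lemma iwE u : u \in ns -> iw' u = iw u.
Proof.
move=> hu; rewrite /iwd (pn_ins_old pn p vns hu); apply/eq_in_map => y hy.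
by rewrite old // nv' // (pn_ns wf hu).
Qed.

Lemma iwEv : iw' v = rcons w i.
Proof.
rewrite /iwd pn_ins_new map_rcons; have [-> _ _ _ _] := new; congr rcons; apply/eq_in_map => y hy.
by rewrite old // nv' // (pn_ns wf pns).
Qed.

Lemma kidsE q : kids rt (v :: ns) pn' q = if q == p then v :: kids rt ns pn q else kids rt ns pn q.
Proof.
have vrt : v != rt by apply: contraNneq vns => ->; case: wf.
have e : [seq u <- ns | (u != rt) && (par rt pn' u == q)] = kids rt ns pn q.
  by apply: eq_in_filter => u hu; rewrite (par_ins_old rt pn p vns hu).
by rewrite {1}/kids /= e (par_new wf v pns) vrt /= eq_sym.
Qed.

Lemma kids_sub q u : u \in kids rt ns pn q -> u \in ns.
Proof. by rewrite mem_filter => /andP[]. Qed.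

Lemma kids_v : kids rt ns pn v = [::].
Proof.
apply/eqP; rewrite -size_eq0 size_filter -leqn0 leqNgt -has_count; apply/hasP => -[u un /andP[_ /eqP up]].
by move: (par_ns wf un); rewrite up (negPf vns).
Qed.

Lemma map_kids f q : f \in [:: IDN; PAL; KILL; KTOP; RNK] -> map (n1 f) (kids rt ns pn q) = map (m1 f) (kids rt ns pn q).
Proof. by move=> hf; apply/eq_in_map => u /kids_sub /nv' h; rewrite old. Qed.

Lemma sum_kids f q : f \in [:: IDN; PAL; KILL; KTOP; RNK] ->
  \sum_(u <- kids rt ns pn q) n1 f u = \sum_(u <- kids rt ns pn q) m1 f u.
Proof. by move=> hf; rewrite -(big_map (n1 f) predT id) map_kids // big_map. Qed.

Lemma invM_ins : invM n1 n2 rt (v :: ns) pn' ob' pals' M.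
Proof.
have [[A1 A2 A3] H2 H3 H4] := invm; have [k1 k2] := kill_le.
have [E1 E2 E3 E4 E5] := new; have pv := nv' pns; have vp : v == p = false by rewrite eq_sym nv.
have live y : y \in pals -> y \in pals' by rewrite palsE; case: ifP => // _; rewrite inE orbC => ->.
have xl : x \in pals' by rewrite palsE; case: ifP => // _; rewrite mem_head.
split.
- split.
  + move=> u; rewrite inE => /orP[/eqP ->|hu]; first by rewrite E2 iwEv.
    rewrite iwE // old ?nv' // A1 // obl // inE -implyNb; apply/implyP => xn.
    by apply/A2; split=> //; exists u.
  + move=> y; split=> [|[yn [u]]].
      have h : y \in pals -> y != [::] /\ exists2 u, u \in v :: ns & lps (iw' u) = y.
        by case/A2 => yn [u hu e]; split=> //; exists u; rewrite ?inE ?hu ?orbT // iwE.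
      have hx : x != [::] /\ exists2 u, u \in v :: ns & lps (iw' u) = x.
        by split; [apply: x_neq0 | exists v; rewrite ?mem_head // iwEv].
      by rewrite palsE; case: ifP => // _; rewrite inE => /orP[/eqP ->|].
    rewrite inE => /orP[/eqP ->|hu]; first by rewrite iwEv => <-.
    by rewrite iwE // => e; apply/live/A2; split=> //; exists u.
  + move=> y hy; rewrite /= iwEv.
    have -> : count (fun u => lps (iw' u) == y) ns = count (fun u => lps (iw u) == y) ns.
      by apply: eq_in_count => u hu; rewrite iwE.
    have [ey|ny] := eqVneq x y.
      rewrite -ey cntx; case: ifP => hx; first by rewrite A3.
      rewrite -[LHS]addn0; congr addn; symmetry; apply/eqP; rewrite -leqn0 leqNgt -has_count.
      apply: contraFN hx => /hasP[u hu /eqP e]; apply/A2; split; [apply: x_neq0 | by exists u].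
    have yo : y \in pals by move: hy; rewrite palsE; case: ifP => // _; rewrite inE eq_sym (negPf ny).
    rewrite cnto; last by apply: contraNneq ny => e; apply/eqP/(uniq_map_inj obi).
    by rewrite obl ?A3 // inE yo orbT.
- move=> u; rewrite inE => /orP[/eqP ->|hu] u0.
    by rewrite (par_new wf v pns) E1 E3 E4 iwE.
  by rewrite (par_ins_old rt pn p vns hu) iwE ?(par_ns wf) // !old ?nv' //; apply: H2.
- move=> u; rewrite inE => /orP[/eqP ->|hu].
    by rewrite kidsE vp kids_v !big_nil iwEv !addn0; case: actv.
  have [-> ->] := act (nv' hu); have [h h'] := H3 u hu.
  rewrite kidsE (iwE hu) -h -[X in _ /\ _ = X]h'; case: eqP => [e|_]; last by rewrite !sum_kids.
  by rewrite !big_cons !sum_kids // E3 E4 e !addnA !subnK.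
- move=> q; have [h h'] := H4 q.
  have se l : map (slot_of n2 q) l = map (slot_of m2 q) l by apply: eq_map => j; rewrite /slot_of slot.
  rewrite se kidsE nch; case: eqP => [e|_]; last by rewrite map_kids.
  split; first by rewrite h.
  apply: perm_trans h'; rewrite map_cons map_kids // E5 -e.
  have -> : M - m1 NCH q = (M - (m1 NCH q).+1).+1 by move: nM; rewrite -e; clear; lia.
  by apply/permPl; apply: (perm_catCA [:: _]).
Qed.

End MIns.

Section MDel.
Variables (m1 n1 : nat -> nat -> nat) (m2 n2 : nat -> nat -> nat -> nat) (rt : nat) (ns : seq nat).
Variables (pn : nat -> seq nat) (ob : seq nat -> nat) (pals : seq (seq nat)) (M v : nat).
Local Notation p := (par rt pn v).
Local Notation iw := (iwd (m1 IDN) pn).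
Local Notation x := (lps (iw v)).
Hypothesis invm : invM m1 m2 rt (v :: ns) pn ob pals M.
Hypothesis vrt : v != rt.
Hypothesis xn : x != [::].
Hypothesis old : forall f u, f \in [:: IDN; PAL; KILL; KTOP; RNK] -> n1 f u = m1 f u.
Hypothesis act : forall u, n1 ACT u = (if u == p then m1 ACT u + m1 KILL v else m1 ACT u) /\
   n1 TOPA u = (if u == p then m1 TOPA u + m1 KTOP v else m1 TOPA u).
Hypothesis nch : forall u, n1 NCH u = if u == p then (m1 NCH u).-1 else m1 NCH u.
Hypothesis nM : m1 NCH p <= M.
Hypothesis slot : forall q j, n2 SLOT q j =
  if (q == p) && (j == (m1 NCH p).-1) then (m1 RNK v).+1 else m2 SLOT q j.
Hypothesis obi : uniq (map ob pals).
Hypothesis cnt : forall u, n1 CNT u = if u == ob x then (m1 CNT u).-1 else m1 CNT u.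
Local Notation pals' := (if m1 CNT (ob x) == 1 then [seq y <- pals | y != x] else pals).

Lemma kids_del q : kids rt (v :: ns) pn q = if q == p then v :: kids rt ns pn q else kids rt ns pn q.
Proof. by rewrite {1}/kids /= vrt /= eq_sym. Qed.

Lemma lps_pals : x \in pals.
Proof. by have [[_ /(_ x)[_ H2] _] _ _ _] := invm; apply: H2; split=> //; exists v; rewrite ?mem_head. Qed.

Lemma cnt_gt0 : 0 < m1 CNT (ob x).
Proof. by have [[_ _ H] _ _ _] := invm; rewrite H ?lps_pals //= eqxx. Qed.

Lemma invM_del : invM n1 n2 rt ns pn ob pals' M.
Proof.
have [[A1 A2 A3] H2 H3 H4] := invm; have xp := lps_pals.
have io u : u \in ns -> u \in v :: ns by move=> h; rewrite inE h orbT.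
have iwE u : iwd (n1 IDN) pn u = iw u by apply: eq_map => y; apply: old.
have ko q f : f \in [:: IDN; PAL; KILL; KTOP; RNK] ->
    \sum_(u <- kids rt ns pn q) n1 f u = \sum_(u <- kids rt ns pn q) m1 f u.
  by move=> hf; apply: eq_bigr => u _; rewrite old.
have sub y : y \in pals' -> y \in pals by case: ifP => // _; rewrite mem_filter => /andP[].
have c y : y \in pals -> count (fun u => lps (iw u) == y) ns = m1 CNT (ob y) - (x == y).
  by move=> hy; rewrite A3 //= addKn.
split.
- split.
  + by move=> u /io hu; rewrite old // iwE A1.
  + move=> y; split=> [hy|[yn [u hu e]]].
      have [yn [u hu e]] := (A2 y).1 (sub y hy); split=> //.
      move: hu; rewrite inE => /orP[/eqP eu|hu]; last by exists u; rewrite ?iwE.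
      rewrite eu in e; move: hy; rewrite -e; case: ifP => [_|h1 _]; first by rewrite mem_filter eqxx.
      have : has (fun u => lps (iw u) == x) ns.
        by rewrite has_count c // eqxx; have := cnt_gt0; move: h1; case: (m1 _ _) => [|[]].
      by case/hasP => z hz /eqP ez; exists z; rewrite ?iwE.
    rewrite iwE in e; have yp : y \in pals by apply/A2; split=> //; exists u; rewrite ?io.
    case: ifP => // /eqP c1; rewrite mem_filter yp andbT; apply: contraTneq isT => ey.
    have : has (fun u => lps (iw u) == x) ns by apply/hasP; exists u => //; rewrite e ey.
    by rewrite has_count c // eqxx c1.
  + move=> y /sub hy; have -> : count (fun u => lps (iwd (n1 IDN) pn u) == y) ns =
        count (fun u => lps (iw u) == y) ns by apply: eq_count => u; rewrite iwE.
    rewrite c // cnt; case: (eqVneq x y) => [->|ny]; first by rewrite eqxx subn1.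
    by rewrite subn0; case: eqP => // e; case/eqP: ny; apply/esym/(uniq_map_inj obi).
- by move=> u hu u0; rewrite !old // iwE; apply: H2; rewrite ?io.
- move=> u hu; have [h h'] := H3 u (io u hu); have [-> ->] := act u.
  rewrite iwE -h -[X in _ /\ _ = X]h' !ko // kids_del; case: eqP => [e|//].
  by rewrite !big_cons !addnA.
- move=> q; have [h h'] := H4 q; rewrite nch.
  rewrite (_ : map (n1 RNK) _ = map (m1 RNK) (kids rt ns pn q)); last by apply: eq_map => u; rewrite old.
  move: h h'; rewrite kids_del; case: eqP => [e|ne] h h'.
    split; first by rewrite h.
    apply: perm_trans h'; rewrite h /=.
    have -> : M - size (kids rt ns pn q) = (M - (size (kids rt ns pn q)).+1).+1.
      by move: nM; rewrite -e h /=; clear; lia.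
    rewrite /= {1}/slot_of slot e eqxx -e h /= eqxx /=.
    rewrite (_ : map (slot_of n2 q) _ = map (slot_of m2 q) (iota (size (kids rt ns pn q)).+1 (M - (size (kids rt ns pn q)).+1))).
      by apply/permPl; apply: (perm_catCA _ [:: _]).
    apply/eq_in_map => j; rewrite mem_iota /slot_of slot -e h /= => /andP[hj _].
    by rewrite (gtn_eqF hj) andbF.
  split=> //; rewrite (_ : map (slot_of n2 q) _ = map (slot_of m2 q) (iota (m1 NCH q) (M - m1 NCH q))) //.
  by apply: eq_map => j; rewrite /slot_of slot (_ : q == p = false) //; apply/eqP.
Qed.

End MDel.

Section Lead.
Variables (Sigma : finType) (mc : nat -> option Sigma) (idn : nat -> nat) (rt : nat) (ns : seq nat).
Variables (pn : nat -> seq nat).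
Hypothesis wf : wft rt ns pn.
Hypothesis inv : invW idn mc rt ns pn.
Variables (v : nat) (x : seq nat).
Local Notation w := (iwd idn pn v).
Hypothesis hv : v \in ns.
Hypothesis px : pal x.
Hypothesis sx : size x <= dep pn v.
Hypothesis xw : suf (size x) w = x.

Lemma leader_letter z : z \in leaders 0 x ->
  [/\ lnkn z < dep pn v, pal (suf (lnkn z) w) & nth 0 w (dep pn v - (lnkn z).+1) = pch 0 z].
Proof.
move=> hz; have [h1 h2 h3] := leader_suffix 0 px (leaders_grp hz).
have h4 : lnkn z < dep pn v by apply: leq_trans h1 sx.
split=> //; first by move: h2; rewrite -xw suf_suf // size_iw sx ltnW.
have := h3; rewrite (pal_nth 0 x).1 // -{1}xw nth_suf ?size_iw //.
by move=> <-; congr (nth _ _ _); rewrite addnBA // subnK.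
Qed.

Lemma leaders_label z z' : z \in leaders 0 x -> z' \in leaders 0 x ->
  mc (pch 0 z) = mc (pch 0 z') -> z = z'.
Proof.
move=> hz hz' e; apply: (leaders_eq hz hz').
have [a1 a2 a3] := leader_letter hz; have [b1 b2 b3] := leader_letter hz'.
by move: e; rewrite -a3 -b3; apply: (iw_label wf inv).
Qed.

(** The bound by sigma: leaders have distinct names as preceding letters, and for letters that
    precede palindromic suffixes distinct names have distinct labels. *)
Lemma size_leaders : size (leaders 0 x) <= minn #|Sigma| ((trunc_log 2 (dep pn v)).*2.+2).
Proof.
rewrite leq_min; apply/andP; split; last first.
  apply: leq_trans (size_subseq (leaders_sub 0 x)) _.
  apply: leq_trans (grp_size px) _; rewrite mul2n !ltnS leq_double; exact: log_le.
pose f z := mc (pch 0 z).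
have fS z : z \in leaders 0 x -> f z != None.
  move=> /leader_letter[h1 _ h2]; have := lettersP (w := w) (n := lnkn z); rewrite size_iw => /(_ h1).
  rewrite /f -h2 => /mapP[u hu ->]; have un := pn_ns wf hv hu.
  by have [/(_ u un (pn_nrt wf hv hu))[_ -> ]] := inv.
have u : uniq (map f (leaders 0 x)).
  rewrite map_inj_in_uniq; last by move=> z z'; apply: leaders_label.
  by have := leaders_uniq 0 x; apply: map_uniq.
rewrite -(size_map f).
have -> : #|Sigma| = size (map (@Some Sigma) (enum Sigma)) by rewrite size_map cardE.
apply: uniq_leq_size => // y /mapP[z hz ->]; have := fS z hz; case: (f z) => // a _.
by apply: map_f; rewrite mem_enum.
Qed.

End Lead.

(** * Insertion *)

(** Visits the set bits from the lowest. The body finds its bit in register 43 and has to preserve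
    the remaining mask in register 42. *)
Definition bitloop (body : seq cmd) : cmd :=
  CWhile (CLt 41 17) (seqs (lowbit ++ [:: seqs body; BMov 17 42 : cmd])).

(** The ghost list holds the items still to be visited, ordered by their bits [g]; the cost [cb] may
    depend on the item. *)
Lemma bitloop_gen (Sigma : finType) (w B : nat) (T : Type) (g cb : T -> nat) (body : seq cmd)
    (I : seq T -> (nat -> nat) -> (nat -> option Sigma) -> (nat -> nat -> nat) -> (nat -> nat -> nat -> nat) -> seq nat -> Prop) mc :
  (forall l r r' rc m1 m2 o, frameS [:: 17; 42; 43] r r' -> I l r rc m1 m2 o -> I l r' rc m1 m2 o) ->
  (forall z l r rc m1 m2 o t, sorted ltn (map g (z :: l)) -> I (z :: l) r rc m1 m2 o -> r 13 = 1 -> r 41 = 0 -> r 43 = 2 ^ g z ->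
     ok w B (seqs body) (HS r rc m1 m2 mc o t) (fun s' => exists r' rc' m1' m2' o' t',
       [/\ s' = HS r' rc' m1' m2' mc o' t', I l r' rc' m1' m2' o', t' <= t + cb z & [/\ r' 42 = r 42, r' 13 = 1 & r' 41 = 0]])) ->
  forall l r rc m1 m2 o t (Q : hst Sigma -> Prop), sorted ltn (map g l) -> I l r rc m1 m2 o -> r 13 = 1 -> r 41 = 0 ->
   r 17 = bsum (map g l) ->
   (forall r' rc' m1' m2' o' t', I [::] r' rc' m1' m2' o' -> r' 13 = 1 -> r' 41 = 0 -> t' <= t + \sum_(z <- l) (cb z + 5) + 1 ->
      Q (HS r' rc' m1' m2' mc o' t')) ->
   ok w B (bitloop body) (HS r rc m1 m2 mc o t) Q.
Proof.
move=> HI Hb; elim=> [|z l IH] r rc m1 m2 o t Q hs hI r13 r41 r17 HQ; apply: ok_while => /=.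
  rewrite r41 r17 /bsum big_nil /=; apply: HQ => //; rewrite big_nil; lia.
have p0 : 0 < 2 ^ g z by rewrite expn_gt0.
rewrite r41 r17 bsum_cons ltn_addr //.
apply: (lowbit_ok (k := g z) (s := map g l)) => //; apply: ok_cons; apply: ok_cut.
  apply: (Hb z l) => //=; last by apply: (HI (z :: l) r) => //; frs.
move=> s' [r' [rc' [m1' [m2' [o' [t' [-> hI' ht [e42 e13 e41]]]]]]]] /=.
bs => //; apply: ok_nil; apply: IH => //=.
- exact: (path_sorted hs).
- by apply: (HI l r') => //; frs.
move=> r2 rc2 a1 a2 o2 t2 h1 h2 h3 h4; apply: HQ => //.
move: ht h4; rewrite /= big_cons; move: (\sum_(_ <- _) _) => X; clear; lia.
Qed.

Lemma bitloop_ok (Sigma : finType) (w B : nat) (body : seq cmd) (cb : nat)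
    (I : seq nat -> (nat -> nat) -> (nat -> option Sigma) -> (nat -> nat -> nat) -> (nat -> nat -> nat -> nat) -> Prop)
    mc out :
  (forall l r r' rc m1 m2, frameS [:: 17; 42; 43] r r' -> I l r rc m1 m2 -> I l r' rc m1 m2) ->
  (forall k l r rc m1 m2 t, sorted ltn (k :: l) -> I (k :: l) r rc m1 m2 -> r 13 = 1 -> r 41 = 0 -> r 43 = 2 ^ k ->
     ok w B (seqs body) (HS r rc m1 m2 mc out t) (fun s' => exists r' rc' m1' m2' t',
       [/\ s' = HS r' rc' m1' m2' mc out t', I l r' rc' m1' m2', t' <= t + cb & [/\ r' 42 = r 42, r' 13 = 1 & r' 41 = 0]])) ->
  forall l r rc m1 m2 t (Q : hst Sigma -> Prop), sorted ltn l -> I l r rc m1 m2 -> r 13 = 1 -> r 41 = 0 -> r 17 = bsum l ->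
   (forall r' rc' m1' m2' t', I [::] r' rc' m1' m2' -> r' 13 = 1 -> r' 41 = 0 -> t' <= t + (cb + 5) * size l + 1 ->
      Q (HS r' rc' m1' m2' mc out t')) ->
   ok w B (bitloop body) (HS r rc m1 m2 mc out t) Q.
Proof.
move=> HI Hb l r rc m1 m2 t Q hs hI h13 h41 h17 HQ.
apply: (@bitloop_gen Sigma w B nat id (fun=> cb) body
  (fun l r rc a1 a2 o => I l r rc a1 a2 /\ o = out) mc _ _ l) => //=; rewrite ?map_id //.
- by move=> l0 r1 r2 rc1 a1 a2 o fr [h ->]; split=> //; apply: HI fr h.
- move=> k l0 r1 rc1 a1 a2 o t1; rewrite map_id => hs1 [h ->] h1 h2 h3.
  apply: ok_mono _ (Hb k l0 r1 rc1 a1 a2 t1 hs1 h h1 h2 h3).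
  by move=> s1 [r' [rc' [b1 [b2 [t' [-> H1 H2 H3]]]]]]; exists r', rc', b1, b2, out, t'.
- move=> r' rc' b1 b2 o t' [h ->] e1 e2 e3; apply: HQ => //.
  by move: e3; rewrite big_const_seq count_predT iter_addn_0.
Qed.

Lemma mirror (A : eqType) (d : A) (x : seq A) q n : q <= size x -> pal (suf q x) -> n < q ->
  nth d (suf q x) n = nth d x (size x - n.+1).
Proof.
move=> hq hp hn; rewrite (pal_nth d _).1 ?size_suf // nth_suf //; congr (nth _ _ _).
by rewrite addnBA // subnK.
Qed.

(** Logarithmically many series make the bits polynomial in the length, so a bit can serve as a
    table index. *)
Lemma gw_le (x : seq nat) : pal x -> gw x <= 4 * (size x).+1 ^ 2.
Proof.
move=> px; apply: leq_trans (_ : 2 ^ (2 * trunc_log 2 (size x)).+2 <= _).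
  by rewrite leq_exp2l //; apply: grp_size.
rewrite -(addn2 (2 * _)) expnD [2 * _]mulnC expnM mulnC; apply: leq_mul => //; rewrite leq_sqr.
have [->|s0] := posnP (size x); first by rewrite trunc_log0.
exact: leq_trans (trunc_logP _ s0) _.
Qed.

Lemma gw_lt (N B : nat) (x : seq nat) : pal x -> size x <= N -> N.+2 ^ 8 <= B -> gw x < B.
Proof.
move=> px sx NB; apply: leq_ltn_trans (gw_le px) _; apply: leq_trans NB.
apply: (@leq_ltn_trans (N.+2 ^ 2 * N.+1 ^ 2)).
  by apply: leq_mul; rewrite ?(leq_sqr _ N.+1) ?(leq_sqr 2).
apply: (@leq_trans (N.+2 ^ 2 * N.+2 ^ 2)); last by rewrite -expnD leq_exp2l.
by rewrite ltn_mul2l expn_gt0 ltn_exp2r //= ltnS leqnn.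
Qed.

Lemma bsum_lt k l : sorted gtn (k :: l) -> bsum (k :: l) < 2 ^ k.+1.
Proof.
elim: l k => [|i l IH] k /=; first by rewrite /bsum big_seq1 ltn_exp2l.
case/andP => h /IH h'; rewrite bsum_cons expnS mul2n -addnn ltn_add2l.
by apply: leq_trans h' _; rewrite leq_exp2l.
Qed.

Lemma lmask_lt (x : seq nat) : pal x -> lmask 0 x < 2 * gw x.
Proof.
move=> px; have [->|xn] := eqVneq x [::]; first by rewrite /lmask leadersE big_nil muln_gt0 expn_gt0.
have := leadersE 0 x; rewrite (negPf xn) /lmask; have := leaders_sorted 0 px => /[swap] ->.
by rewrite map_cons => /bsum_lt; rewrite /bsum -map_cons big_map expnS.
Qed.

(** * Allocation of names *)

(** The same lazily initialised stack as in [slot_of]. *)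
Definition alloc_of (m1 : nat -> nat -> nat) i := if m1 ALL i == 0 then i else (m1 ALL i).-1.

(** Nodes and palindromes draw on one pool that begins at 3, after the reserved objects. The stack
    position [n] equals 3 plus the number of live names. *)
Definition invA K (m1 : nat -> nat -> nat) (live : seq nat) n : Prop :=
  [/\ n = size live + 3, n <= K
    & perm_eq (live ++ [seq alloc_of m1 i | i <- iota n (K - n)]) (iota 3 (K - 3))].

Lemma invA_perm K m1 live live' n : perm_eq live live' -> invA K m1 live n -> invA K m1 live' n.
Proof.
move=> e [h1 h2 h3]; split=> //; first by rewrite -(perm_size e).
by apply: perm_trans h3; rewrite perm_cat2r perm_sym.
Qed.

Lemma invA_new K m1 live n : invA K m1 live n -> n < K ->
  [/\ alloc_of m1 n \notin live, 3 <= alloc_of m1 n < K & invA K m1 (alloc_of m1 n :: live) n.+1].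
Proof.
move=> [h1 h2 h3] h.
have e : K - n = (K - n.+1).+1 by lia.
rewrite e /= in h3; have h4 : perm_eq ((alloc_of m1 n :: live) ++ [seq alloc_of m1 i | i <- iota n.+1 (K - n.+1)]) (iota 3 (K - 3)).
  by apply: perm_trans h3; rewrite perm_sym -cat1s; apply/permPl/(perm_catCA live [:: _]).
split.
- have := perm_uniq h4; rewrite iota_uniq cat_uniq /= => /andP[/andP[-> _] _] //.
- by have := perm_mem h4 (alloc_of m1 n); rewrite mem_cat mem_head mem_iota => /esym; lia.
- by split=> //=; rewrite h1.
Qed.

Lemma invA_free K m1 n1 x live n : invA K m1 (x :: live) n.+1 ->
  (forall i, n1 ALL i = if i == n then x.+1 else m1 ALL i) -> invA K n1 live n.
Proof.
move=> [[h1] h2 h3] H; split=> //; first exact: ltnW.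
apply: perm_trans h3; have -> : K - n = (K - n.+1).+1 by lia.
rewrite /= {1}/alloc_of H eqxx /=.
rewrite (_ : map (alloc_of n1) _ = map (alloc_of m1) (iota n.+1 (K - n.+1))).
  by rewrite -cat1s; apply/permPl/(perm_catCA live [:: _]).
apply/eq_in_map => i; rewrite mem_iota /alloc_of H => /andP[hi _].
by rewrite (gtn_eqF hi).
Qed.

Definition alloc : seq cmd := [:: Ld1 48 ALL 40 : cmd;
  CIf (CEq 48 41) (BMov 48 40) (BArith Defs.Sub 48 48 13); BArith Add 40 40 13 : cmd].

Lemma alloc_ok (Sigma : finType) (w B n : nat) (l : seq cmd) (r : nat -> nat) rc m1 m2 mc out (t : nat) (Q : hst Sigma -> Prop) :
  r 13 = 1 -> r 41 = 0 -> r 40 = n -> n < B -> n.+1 < 2 ^ w ->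
  (forall r', frameS [:: 40; 48] r r' -> r' 48 = alloc_of m1 n -> r' 40 = n.+1 ->
     ok w B (seqs l) (HS r' rc m1 m2 mc out (t + 4)) Q) ->
  ok w B (seqs (alloc ++ l)) (HS r rc m1 m2 mc out t) Q.
Proof.
move=> r13 r41 r40 nB nw HQ.
rewrite /alloc; bs; first by rewrite r40.
rewrite r40; apply: ok_cons; apply: ok_if => /=; rewrite r41.
rewrite (_ : t + 4 = t.+4) in HQ; last by rewrite addn4.
case: ifP => e.
  apply: ok_bas => //=; rewrite r40; bs; first by rewrite r40 r13 addn1.
  rewrite r13 r40 addn1; apply: HQ => //=; first by frs.
  by rewrite /alloc_of e.
apply: ok_bas => /=; first by rewrite r13 lt0n e.
rewrite r13; bs; first by rewrite r40 r13 addn1.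
rewrite r13 r40 addn1; apply: HQ => //=; first by frs.
by rewrite /alloc_of e subn1.
Qed.

(** * Naming the new edge and finding its palindrome *)

(** The letter before the suffix of length [n] labels the edge into the ancestor at depth
    [D - n]. *)
Definition ins_top : cmd := seqs [::
  Ld1 14 PAL 2 : cmd; Ld1 15 LEN 14 : cmd; BArith Defs.Sub 11 3 13 : cmd; BConst 44 0 : cmd;
  CIf (CLt 15 11) (seqs [:: BMov 20 2 : cmd; BArith Defs.Sub 21 11 15 : cmd; laq; CLd 1 22 : cmd;
    CIf (CCeq 0 1) (seqs [:: BConst 44 1 : cmd; Ld1 16 IDN 22 : cmd]) CSkip]) CSkip].

(** Register 18 receives the leader preceded by the new label, register 19 its bit, both 0 if there
    is none. This bit is exactly what the new child removes from the mask of its parent. *)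
Definition ins_scan : cmd := seqs [::
  Ld1 17 LMASK 14 : cmd; BConst 18 0 : cmd; BConst 19 0 : cmd;
  bitloop [:: Ld2 45 LD 14 43 : cmd; Ld1 46 PCH 45 : cmd; CLd 1 46 : cmd;
    CIf (CCeq 0 1) (seqs [:: BMov 18 45 : cmd; BMov 19 43 : cmd]) CSkip]].

(** Register 46 receives the inner palindrome of the new longest palindromic suffix and register 47
    that of its link, 0 if the link has fewer than two letters. If the old longest suffix itself is
    extended, the second candidate is the link of the matching leader; otherwise that link is the
    first candidate and [nxt] gives the second. *)
Definition ins_choose : cmd :=
  CIf (CEq 44 13)
    (seqs [:: BMov 46 14 : cmd; BConst 47 0 : cmd; CIf (CLt 41 18) (seqs [:: Ld1 47 LINK 18 : cmd]) CSkip])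
    (CIf (CLt 41 18)
      (seqs [:: Ld1 46 LINK 18 : cmd; Ld1 16 PCH 18 : cmd; Ld1 42 DIFF 46 : cmd; Ld1 43 DIFF 18 : cmd;
         CIf (CEq 42 43) (seqs [:: Ld1 47 LINK 46 : cmd])
           (seqs [:: Ld1 47 CNEXT 18 : cmd; CIf (CLt 41 47) (seqs [:: Ld1 47 LINK 47 : cmd]) CSkip])])
      (seqs [:: BConst 46 1 : cmd; BMov 16 1 : cmd; BConst 47 0 : cmd])).

Section Ins.
Variables (Sigma : finType) (w b B M N rt : nat).
Variables (m1 : nat -> nat -> nat) (m2 : nat -> nat -> nat -> nat) (mc0 : nat -> option Sigma).
Variables (ns : seq nat) (pn : nat -> seq nat) (ob : seq nat -> nat) (pals : seq (seq nat)).
Variables (p v : nat) (c : option Sigma).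
Local Notation pn' := (pn_ins pn p v).
Local Notation mc := (huc mc0 v c).
Hypothesis invl : invLA B M m1 m2 rt (v :: ns) pn'.
Hypothesis wf : wft rt ns pn.
Hypothesis invw : invW (m1 IDN) mc0 rt ns pn.
Hypothesis invo : invO B m1 m2 ob pals.
Hypothesis BE : B = 2 ^ b.
Hypothesis Bw : 128 * B * B <= 2 ^ w.
Hypothesis NB : N.+2 ^ 8 <= B.
Hypothesis nsz : size ns <= N.
Hypothesis nsB : forall u : nat, u \in v :: ns -> u < B.
Hypothesis MN : 0 < M <= N.+1.
Hypothesis pns : p \in ns.
Hypothesis vns : v \notin ns.
Local Notation W := (iwd (m1 IDN) pn p).
Local Notation P := (lps W).
Local Notation D := (dep pn p).
Local Notation lt_ n := (nth 0 W (D - n.+1)).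
Local Notation ok := (@ok Sigma w B).
Hypothesis palp : m1 PAL p = ob P.
Hypothesis livep : P \in [::] :: pals.

Definition istop := (lpsn W < D) && (mc0 (lt_ (lpsn W)) == c).

Lemma label_lt n : n < D -> mc0 (lt_ n) = mc0 (anc rt pn p (D - n)) /\
  m1 IDN (anc rt pn p (D - n)) = lt_ n /\ anc rt pn p (D - n) \in ns /\ mc (anc rt pn p (D - n)) = mc0 (lt_ n).
Proof.
move=> hn; have an : anc rt pn p (D - n) \in ns by apply: (anc_ns wf pns); apply: leq_subr.
have e : anc rt pn p (D - n) = nth rt (pn p) (D - n.+1) by rewrite /anc subnS; case: (D - n) (subn_gt0 n D) => //; rewrite hn.
have hi : D - n.+1 < size (pn p) by rewrite -/(dep pn p); lia.
have hx : anc rt pn p (D - n) \in pn p by rewrite e mem_nth.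
have e2 : m1 IDN (anc rt pn p (D - n)) = lt_ n by rewrite /iwd (nth_map rt) // -e.
have [/(_ _ an (pn_nrt wf pns hx))[h1 h2 h3] _ _] := invw.
rewrite -e2 h2; split=> //; split=> //; split=> //.
by rewrite /huc; case: eqP => // ev; move: vns; rewrite -ev an.
Qed.

Lemma ins_top_ok (r : nat -> nat) rc out (tt : nat) (Q : hst Sigma -> Prop) :
  r 2 = p -> r 3 = D.+1 -> r 13 = 1 -> r 41 = 0 -> rc 0 = c ->
  (forall (r' : nat -> nat) (rc' : nat -> option Sigma) (tt' : nat), r' 14 = ob P -> rc' 0 = c ->
     r' 44 = istop -> (istop -> r' 16 = lt_ (lpsn W)) -> frameS ([:: 14; 15; 11; 44; 16] ++ iota 20 10) r r' ->
     tt' <= tt + 41 + 4 * minn (2 * lam D) (3 * M + 1) -> Q (HS r' rc' m1 m2 mc out tt')) ->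
  ok ins_top (HS r rc m1 m2 mc out tt) Q.
Proof.
move=> r2 r3 r13 r41 rc0 HQ; have NB' := N4B NB.
have pB : p < B by apply: nsB; rewrite inE pns orbT.
have obB y : y \in [::] :: pals -> ob y < B by move=> hy; have := ob_gt1 invo hy; lia.
have [[[eL _ _ _] _ _] dl] : obj_ok m1 m2 ob P /\ lpsn W <= D.
  by split; [have [_ _ _ H _] := invo; apply: H | have [+ _] := lpsnP W; rewrite size_iw].
rewrite size_lps in eL.
rewrite /ins_top; bs; first by rewrite r2.
rewrite r2 palp; bs; first exact: obB.
rewrite eL; bs; first by rewrite r3 r13.
rewrite r3 r13 subn1 /=; bs; first by rewrite expn_gt0.
apply: ok_cons; apply: ok_if => /=; case: ltnP => hd; last first.
  apply: ok_skip; apply: ok_nil; apply: HQ => //=; first by rewrite /istop ltnNge hd.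
  - by rewrite /istop ltnNge hd.
  - by frs.
  - lia.
have [l1 [l2 [l3 l4]]] := label_lt hd.
have ea : anc rt pn' p (D - lpsn W) = anc rt pn p (D - lpsn W) by apply: (anc_ins_old rt pn p vns).
have ed : dep pn' p = D by apply: (dep_ins_old pn p vns).
bs => //; rewrite r2; bs; first exact: ltnW.
apply: ok_cons; apply: (laq_ok invl BE Bw NB _ nsB MN (v := p) (t := D - lpsn W)) => //.
- by rewrite inE pns orbT.
- by rewrite ed leq_subr.
move=> r1 t1; rewrite ea ed => e22 fr ht; bs => //; rewrite e22 l4.
have fr' : frameS (iota 20 10) (hu (hu (hu (hu (hu (hu r 14 (ob P)) 15 (lpsn W)) 11 D) 44 0) 20 p) 21 (D - lpsn W)) r1.
  by move=> x; rewrite mem_iota => hx; apply: fr; lia.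
apply: ok_cons; apply: ok_if => /=; rewrite rc0 eq_sym; case: ifP => e.
  bs; first by apply: leq_trans Bw; nia.
  bs; first by rewrite e22; apply: nsB; rewrite inE l3 orbT.
  rewrite e22 l2; apply: ok_nil; apply: ok_nil; apply: ok_nil; apply: HQ => //=; rewrite /istop ?hd ?e //.
  - by rewrite fr.
  - by do ?[apply: frs_hu; first by []]; apply: frs_trans (frs_sub _ fr'); [frs|move=> x hx; rewrite -[_ :: _]/([:: 14; 15; 11; 44; 16] ++ iota 20 10) mem_cat hx orbT].
  - by move: ht; clear; lia.
apply: ok_skip; apply: ok_nil; apply: ok_nil; apply: HQ => //=; rewrite /istop ?hd ?e //.
- by rewrite fr.
- by rewrite fr.
- by apply: frs_trans (frs_sub _ fr'); [frs|move=> x hx; rewrite -[_ :: _]/([:: 14; 15; 11; 44; 16] ++ iota 20 10) mem_cat hx orbT].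
- by move: ht; clear; lia.
Qed.

Definition scanned (r18 r19 : nat) : Prop :=
  (exists2 z, z \in leaders 0 P & [/\ mc0 (pch 0 z) = c, r18 = ob z & r19 = gw z]) \/
  [/\ forall z, z \in leaders 0 P -> mc0 (pch 0 z) <> c, r18 = 0 & r19 = 0].

Lemma pch_label z : z \in leaders 0 P ->
  [/\ lnkn z < D, pal (suf (lnkn z) W), lt_ (lnkn z) = pch 0 z & mc (pch 0 z) = mc0 (pch 0 z)].
Proof.
have [h1 h2] := lpsnP W; rewrite size_iw in h1 *.
have sw : suf (size P) W = P by rewrite size_lps.
have sD : size P <= D by rewrite size_lps.
move=> hz; have [a1 a2 a3] := leader_letter (pal_lps W) sD sw hz; split=> //.
have : pch 0 z \in W by rewrite -a3 -(size_iw (m1 IDN) pn p); apply: lettersP; rewrite size_iw.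
move=> /(iw_ns wf invw pns) h; rewrite /huc; by case: eqP => // e; move: vns; rewrite -e h.
Qed.

Lemma gw_bound z : z \in leaders 0 P -> gw z < B /\ ob z < B.
Proof.
move=> hz; have zg := leaders_grp hz.
have zl : z \in pals by apply: (live_grp invo livep).
split; last by have := ob_gt1 invo (x := z); rewrite inE zl orbT => /(_ isT); have := N4B NB; lia.
apply: (@gw_lt N) => //; first by have [[/(_ z zl)[]]] := invo.
have [_ _ h _] := grp_mem (pal_lps W) zg; apply: leq_trans h _.
rewrite size_lps; have [+ _] := lpsnP W; rewrite size_iw => h; apply: leq_trans h _.
by have := dep_size wf pns; have := nsz; lia.
Qed.

Lemma ins_scan_ok (r : nat -> nat) rc out (tt : nat) (Q : hst Sigma -> Prop) :
  r 14 = ob P -> r 13 = 1 -> r 41 = 0 -> rc 0 = c ->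
  (forall (r' : nat -> nat) (rc' : nat -> option Sigma) (tt' : nat), scanned (r' 18) (r' 19) ->
     frameS [:: 17; 18; 19; 42; 43; 45; 46] r r' ->
     tt' <= tt + 12 * size (leaders 0 P) + 5 -> Q (HS r' rc' m1 m2 mc out tt')) ->
  ok ins_scan (HS r rc m1 m2 mc out tt) Q.
Proof.
move=> r14 r13 r41 rc0 HQ; have NB' := N4B NB.
have [o1 o2 _] : obj_ok m1 m2 ob P by have [_ _ _ H _] := invo; apply: H.
have oB : ob P < B by have := ob_gt1 invo livep; lia.
rewrite /ins_scan; bs; first by rewrite r14.
bs; first by rewrite expn_gt0.
bs; first by rewrite expn_gt0.
rewrite r14; have [_ _ _ ->] := o1; apply: ok_cons.
set r0 := hu _ 19 0.
pose I (l : seq nat) (r' : nat -> nat) (rc' : nat -> option Sigma) n1 n2 := exists2 zs, l = map (@gx _) zs &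
  [/\ forall z, z \in zs -> z \in leaders 0 P, n1 = m1 /\ n2 = m2, rc' 0 = c,
    frameS [:: 17; 18; 19; 42; 43; 45; 46] r r' &
    (exists2 z, z \in leaders 0 P & [/\ mc0 (pch 0 z) = c, r' 18 = ob z & r' 19 = gw z]) \/
    [/\ forall z, z \in leaders 0 P -> z \notin zs -> mc0 (pch 0 z) <> c, r' 18 = 0 & r' 19 = 0]].
(* Leaders are listed by decreasing bits and visited by increasing ones. *)
apply: (@bitloop_ok Sigma w B _ 7 I mc out _ _ (rev (map (@gx _) (leaders 0 P)))) => //.
- move=> l r1 r2 rc1 a1 a2 fr [zs -> [h1 h2 h3 h4 h5]]; exists zs => //; split=> //.
    by apply: frs_trans h4 _; apply: frs_sub fr => x; rewrite !inE; do ?[case/orP] => /eqP ->.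
  by rewrite (fr 18) // (fr 19).
- move=> k l r1 rc1 a1 a2 t hs [[//|z zs] [ek el] [h1 [-> ->] h3 h4 h5]] e13 e41 e43.
  have hz := h1 z (mem_head _ _); have [g1 g2] := gw_bound hz; have [p1 p2 p3 p4] := pch_label hz.
  have e14 : r1 14 = ob P by rewrite h4.
  have Pn : P != [::] by apply: contraTneq hz => ->; rewrite leadersE.
  have [_ _ _ _ /(_ z hz) eld] := o2 Pn.
  have zl : z \in pals by apply: (live_grp invo livep); apply: leaders_grp hz.
  have zn : z != [::] by have [[H _ _] _ _ _ _] := invo; have [] := H z zl.
  have [_ /(_ zn)[_ _ epc _ _] _] : obj_ok m1 m2 ob z.
    by have [_ _ _ H _] := invo; apply: H; rewrite inE zl orbT.
  have e43' : r1 43 = gw z by rewrite e43 ek.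
  bs; first by rewrite e14 e43'.
  rewrite e14 e43' eld; bs => //; rewrite epc; bs => //; rewrite p4.
  apply: ok_cons; apply: ok_if => /=; rewrite h3 eq_sym; case: eqP => ec.
    bs => //; bs => //; apply: ok_nil; apply: ok_nil; do 5![eexists]; split; first by reflexivity.
    + exists zs => //; split=> //.
      * by move=> y hy; apply: h1; rewrite inE hy orbT.
      * by frs; apply: frs_trans h4 _; frs.
      * by left; exists z.
    + by clear; lia.
    + by [].
  apply: ok_skip; apply: ok_nil; do 5![eexists]; split; first by reflexivity.
  + exists zs => //; split=> //.
    * by move=> y hy; apply: h1; rewrite inE hy orbT.
    * by frs; apply: frs_trans h4 _; frs.
    * case: h5 => [h5|[h5 h6 h7]]; [by left|right; split=> // y hy hyz].
      by have [->//|ny] := eqVneq y z; apply: h5 => //; rewrite inE negb_or ny.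
  + by clear; lia.
  + by [].
- by rewrite rev_sorted; apply: leaders_sorted; apply: pal_lps.
- exists (rev (leaders 0 P)); first by rewrite map_rev.
  split=> //; [by move=> z; rewrite mem_rev | by rewrite /r0; frs | right; split=> // z hz].
  by rewrite mem_rev hz.
- by rewrite /r0 /= /lmask /bsum big_rev big_map.
move=> r' rc' a1 a2 t' [[|//] _ [_ [-> ->] _ h4 h5]] _ _; rewrite size_rev size_map => ht.
apply: ok_nil; apply: HQ => //; last by move: ht; clear; lia.
case: h5 => [h5|[h5 h6 h7]]; [by left | by right; split=> // z hz; apply: h5].
Qed.

Local Notation cd := (cand 0 W).

Definition chosen i (r46 r47 : nat) : Prop :=
  (exists q, [/\ cd i q, forall n, cd i n -> n <= q, r46 = ob (suf q W) &
     (exists m, [/\ m < q, cd i m, forall n, n < q -> cd i n -> n <= m & r47 = ob (suf m W)]) \/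
     (forall n, n < q -> ~~ cd i n) /\ r47 = 0]) \/
  [/\ forall n, ~~ cd i n, r46 = 1 & r47 = 0].

Lemma cdE i n : cd i n = [&& n < D, pal (suf n W) & lt_ n == i].
Proof. by rewrite /cand size_iw. Qed.

Lemma cd_le i n : cd i n -> n <= lpsn W.
Proof. by case/and3P => h1 h2 _; apply: lpsn_max => //; apply: ltnW. Qed.

Lemma suf_P n : n <= lpsn W -> suf n P = suf n W.
Proof. by move=> h; rewrite suf_suf // h; case: (lpsnP W). Qed.

Lemma cd_leader i n : cd i n -> n < lpsn W ->
  exists2 z, z \in leaders 0 P & pch 0 z = i /\ n <= lnkn z.
Proof.
case/and3P => h1 h2 /eqP h3 h; have [h4 h5] := lpsnP W.
have := @leader_longest _ 0 P n (pal_lps W); rewrite size_lps suf_P ?(ltnW h) // => /(_ h h2)[z hz [e1 e2]].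
by exists z => //; split=> //; rewrite e1 (mirror 0 h4 h5 h).
Qed.

Lemma leader_cd z : z \in leaders 0 P -> cd (pch 0 z) (lnkn z) /\ lnkn z < lpsn W.
Proof.
move=> hz; have [a1 a2 a3 _] := pch_label hz; rewrite cdE a1 a2 a3 eqxx; split=> //.
by have [+ _ _] := leader_suffix 0 (pal_lps W) (leaders_grp hz); rewrite size_lps.
Qed.

Lemma leader_W z : z \in leaders 0 P -> [/\ pal z, z != [::], size z <= D & z = suf (size z) W].
Proof.
move=> hz; have [a1 a2 a3 a4] := grp_mem (pal_lps W) (leaders_grp hz).
have [h1 _] := lpsnP W; rewrite size_lps in a3; split=> //.
  by rewrite -(size_iw (m1 IDN) pn p); apply: leq_trans h1.
by rewrite -suf_P.
Qed.

Lemma cd_in z n : z \in leaders 0 P -> n < size z ->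
  cd (pch 0 z) n = pal (suf n z) && (nth 0 z n == pch 0 z).
Proof.
move=> /leader_W[a1 a2 a3 a4] hn; have hW : size z <= size W by rewrite size_iw.
have ez : suf n z = suf n W by rewrite {1}a4 suf_suf // (ltnW hn).
rewrite /cand (leq_trans hn) //= ez.
by have := mirror 0 hW; rewrite -a4 => /(_ n a1 hn) ->.
Qed.

Lemma leader_next z : z \in leaders 0 P ->
  if nxt 0 z is Some m then [/\ m < lnkn z, cd (pch 0 z) m & forall n, n < lnkn z -> cd (pch 0 z) n -> n <= m]
  else forall n, n < lnkn z -> ~~ cd (pch 0 z) n.
Proof.
move=> hz; have [a1 a2 a3 a4] := leader_W hz; have h := size_lnk_lt a2; rewrite size_lnk in h.
have lt n : n < lnkn z -> n < size z by move=> h'; apply: ltn_trans h' h.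
have := nxtP 0 a1 a2; case: (nxt 0 z) => [m [b1 b2 b3 b4]|b0].
  split=> //; first by rewrite cd_in ?lt // b2 b3 eqxx.
  by move=> n hn; rewrite cd_in ?lt // => /andP[c1 /eqP c2]; apply: b4.
move=> n hn; rewrite cd_in ?lt //; apply/andP => -[c1 /eqP c2]; exact: b0 c2.
Qed.

(** The program compares labels, the invariant speaks of names; [id_label] reconciles them. *)
Lemma id_scan i r18 r19 : idspec (m1 IDN) mc0 pn p v c i -> scanned r18 r19 ->
  r19 = kill P i /\ (istop : nat) = ktop W i.
Proof.
move=> ids hs; split; last first.
  rewrite /istop /ktop size_iw; case: ltnP => //= hd.
  by rewrite (id_label wf invw pns vns ids) //; case: (lpsnP W).
have key z : z \in leaders 0 P -> (mc0 (pch 0 z) == c) = (pch 0 z == i).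
  by move=> /pch_label[a1 a2 a3 _]; rewrite -a3 (id_label wf invw pns vns ids).
case: hs => [[z hz [h1 _ ->]]|[h1 _ ->]].
  rewrite /kill (big_rem z hz) /= -key // h1 eqxx big_seq_cond big1 ?addn0 // => y /andP[hy].
  have ul : uniq (leaders 0 P) by apply: map_uniq (leaders_uniq 0 P).
  move: hy; rewrite (mem_rem_uniq _ ul) inE => /andP[ny hy]; rewrite -key // => /eqP hc.
  by case/eqP: ny; apply: (leaders_label wf invw pns (pal_lps W) _ _ hy hz); rewrite ?h1 ?size_lps //;
    rewrite -(size_iw (m1 IDN) pn p); case: (lpsnP W).
by rewrite /kill big_seq_cond big1 // => z /andP[hz]; rewrite -key // => /eqP /h1; case.
Qed.

Lemma ins_choose_ok (r : nat -> nat) rc out (tt : nat) (Q : hst Sigma -> Prop) :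
  r 1 = v -> r 13 = 1 -> r 41 = 0 -> r 14 = ob P -> r 44 = istop -> (istop -> r 16 = lt_ (lpsn W)) ->
  scanned (r 18) (r 19) ->
  (forall (r' : nat -> nat) (tt' : nat), idspec (m1 IDN) mc0 pn p v c (r' 16) -> chosen (r' 16) (r' 46) (r' 47) ->
     frameS [:: 16; 42; 43; 46; 47] r r' -> tt' <= tt + 10 -> Q (HS r' rc m1 m2 mc out tt')) ->
  ok ins_choose (HS r rc m1 m2 mc out tt) Q.
Proof.
move=> r1 r13 r41 r14 r44 r16 hs HQ.
have obP y : y \in [::] :: pals -> [/\ 1 < ob y, ob y < B & obj_ok m1 m2 ob y].
  move=> hy; have := ob_gt1 invo hy; have := N4B NB; have [_ _ _ H _] := invo.
  by move=> h1 /andP[h2 h3]; split=> //; [lia | apply: H].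
have zl z : z \in leaders 0 P -> z \in [::] :: pals.
  by move=> hz; rewrite inE (live_grp invo livep (leaders_grp hz)) orbT.
have [q1 q2] := lpsnP W; rewrite size_iw in q1.
have same z : z \in leaders 0 P -> forall n, n < D -> pal (suf n W) -> mc0 (lt_ n) = mc0 (pch 0 z) -> lt_ n = pch 0 z.
  by move=> /pch_label[a1 a2 <- _] n hn hp; apply: (iw_label wf invw).
have sufl z : z \in leaders 0 P -> lnk z = suf (lnkn z) W.
  move=> hz; have [a1 a2 a3 a4] := leader_W hz; rewrite /lnk {2}a4 suf_suf //.
  by rewrite size_iw a3 andbT lnkn_le.
apply: ok_if => /=; rewrite r44 r13; case: (boolP istop) => top /=.
  have ei : r 16 = lt_ (lpsn W) by apply: r16.
  have [hd /eqP hc] := andP top.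
  have ids : idspec (m1 IDN) mc0 pn p v c (r 16) by left; exists (lpsn W).
  have cq : cd (r 16) (lpsn W) by rewrite cdE hd q2 ei eqxx.
  bs => //; bs; first by rewrite expn_gt0.
  apply: ok_cons; apply: ok_if => /=; rewrite r41 r14; case: hs => [[z hz [h1 h2 h3]]|[h1 h2 h3]].
    have [o1 o2 [_ o3 _]] := obP _ (zl _ hz); have [z1 z2 z3 z4] := leader_W hz.
    have [o4 _ _ _ _] := o3 z2.
    rewrite h2 (ltn_trans _ o1) //; bs; first by rewrite h2.
    rewrite h2 o4; apply: ok_nil; apply: ok_nil; apply: HQ => //=.
    + left; exists (lpsn W); split=> //; first exact: cd_le.
      left; exists (lnkn z); have ez : pch 0 z = r 16 by rewrite ei; apply/esym/same; rewrite ?h1.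
      have [c1 c2] := leader_cd hz; rewrite ez in c1; split=> //; last by rewrite sufl.
      move=> n hn hcn; have [y hy [y1 y2]] := cd_leader hcn hn.
      by rewrite -(leaders_eq hy hz (etrans y1 (esym ez))).
    + by frs.
    + by clear; lia.
  rewrite h2; apply: ok_skip; apply: ok_nil; apply: HQ => //=.
  + left; exists (lpsn W); split=> //; first exact: cd_le.
    right; split=> // n hn; apply/negP => hcn; have [y hy [y1 y2]] := cd_leader hcn hn.
    by apply: (h1 y hy); rewrite y1 ei.
  + by frs.
  + by clear; lia.
apply: ok_if => /=; rewrite r41; case: hs => [[z hz [h1 h2 h3]]|[h1 h2 h3]]; last first.
  rewrite h2; bs; first by apply: leq_trans Bw; have := N4B NB; nia.
  bs => //; bs; first by rewrite expn_gt0.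
  rewrite r1; apply: ok_nil; apply: HQ => //=.
  - right; split=> // n hn pn0; apply/eqP => hc.
    have hle : n <= lpsn W by apply: lpsn_max => //; rewrite size_iw (ltnW hn).
    have [en|nn] := eqVneq n (lpsn W); first by move: top; rewrite /istop -en hn hc eqxx.
    have hcn : cd (lt_ n) n by rewrite cdE hn pn0 eqxx.
    have hlt : n < lpsn W by rewrite ltn_neqAle nn.
    have [y hy [y1 y2]] := cd_leader hcn hlt.
    by apply: (h1 y hy); rewrite y1.
  - right; split=> // n; apply/negP; rewrite cdE => /and3P[n1 _ /eqP e].
    have := lettersP (w := W) (n := n); rewrite size_iw e => /(_ n1) /(iw_ns wf invw pns).
    by rewrite (negPf vns).
  - by frs.
  - by clear; lia.
have [o1 o2 [_ o3 _]] := obP _ (zl _ hz); have [z1 z2 z3 z4] := leader_W hz.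
have [p1 p2 p3 p4 _] := o3 z2; set i := pch 0 z in p3.
have [c1 c2] := leader_cd hz.
have ids : idspec (m1 IDN) mc0 pn p v c i.
  by have [a1 a2 a3 _] := pch_label hz; left; exists (lnkn z); rewrite a3.
(* The letter before the longest suffix has failed the test, so every candidate is a proper suffix
   of it and the leader bounds its length. *)
have cmax n : cd i n -> n <= lnkn z.
  move=> hcn; have hle := cd_le hcn; have [en|nn] := eqVneq n (lpsn W).
    move: hcn; rewrite en cdE => /and3P[n1 _ /eqP n2].
    by move: top; rewrite /istop n1 n2 h1 eqxx.
  have hlt : n < lpsn W by rewrite ltn_neqAle nn.
    have [y hy [y1 y2]] := cd_leader hcn hlt.
  by rewrite -(leaders_eq hy hz y1).
have ll := live_lnk invo (zl _ hz); have [l1 l2 [[l3 l4 _ _] l5 _]] := obP _ ll.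
have sk k : k < lnkn z -> suf k (lnk z) = suf k W.
  move=> hk; rewrite sufl // suf_suf // (ltnW hk) /= size_iw.
  by move: c1; rewrite cdE => /andP[/ltnW].
have [[_ p5 _ _] _ _] : obj_ok m1 m2 ob z by case: (obP _ (zl _ hz)).
rewrite h2 (ltn_trans _ o1) //; bs; first by rewrite h2.
rewrite h2 p1; bs; first by rewrite h2.
rewrite h2 p3; bs => //; rewrite l4; bs; first by rewrite h2.
rewrite h2 p5; apply: ok_cons; apply: ok_if => /=.
have := leader_next hz; rewrite /nxt; case: ifP => ed.
  have [ln0|ln0] := eqVneq (lnk z) [::].
    by move: ed; rewrite ln0 df_nil eq_sym => /eqP e; have := df_gt0 z2; rewrite e.
  have [e1 _ _ _ _] := l5 ln0 => -[n1 n2 n3].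
  bs => //; rewrite e1; apply: ok_nil; apply: ok_nil; apply: HQ => //=.
  - left; exists (lnkn z); split=> //; first by rewrite -sufl.
    left; exists (lnkn (lnk z)); split=> //; congr ob.
    have -> : lnk (lnk z) = suf (lnkn (lnk z)) (lnk z) by [].
    by rewrite sk.
  - by frs.
  - by clear; lia.
move=> hn; bs; first by rewrite h2.
rewrite h2 p4; apply: ok_cons; apply: ok_if => /=; rewrite r41; move: hn; case: ifP => cn.
  move=> hn; rewrite ltnn; apply: ok_skip; apply: ok_nil; apply: ok_nil; apply: HQ => //=.
  - left; exists (lnkn z); split=> //; first by rewrite -sufl.
    by right.
  - by frs.
  - by clear; lia.
have cl : cnx 0 z \in [::] :: pals by rewrite inE (live_cnx invo (zl _ hz)) ?cn ?orbT.
have [k1 k2 [_ k3 _]] := obP _ cl; have [k4 _ _ _ _] := k3 (negbT cn).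
move=> [n1 n2 n3]; rewrite (ltn_trans _ k1) //; bs => //; rewrite k4.
apply: ok_nil; apply: ok_nil; apply: ok_nil; apply: HQ => //=.
- left; exists (lnkn z); split=> //; first by rewrite -sufl.
  left; exists (lnkn (cnx 0 z)); split=> //; congr ob.
  have [s1 s2 s3 _] := slkP z1 z2; have [t1 t2 t3 t4] := grp_mem s3 (cnx_grp z1 z2 (negbT cn)).
  have e : cnx 0 z = suf (size (cnx 0 z)) W.
    rewrite {1}t4 s2 suf_suf; last by rewrite t3 ltnW.
    rewrite {2}z4 suf_suf // size_iw z3 andbT; apply: leq_trans t3 (ltnW s1).
  rewrite /lnk {2}e suf_suf // lnkn_le size_iw /=.
  by apply: leq_trans t3 _; apply: leq_trans (ltnW s1) _.
- by frs.
- by clear; lia.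
Qed.

End Ins.

Lemma invLA_ext B M m1 n1 m2 n2 rt ns pn :
  (forall f u, f \in LAf -> n1 f u = m1 f u) ->
  (forall f u u', f \in [:: NODE; YT; TT] -> n2 f u u' = m2 f u u') ->
  invLA B M m1 m2 rt ns pn -> invLA B M n1 n2 rt ns pn.
Proof.
move=> e1 e2 [wf H1 H2]; split=> // v hv.
  have [[a1 a2 a3 a4 a5] b c] := H1 v hv; split; first by rewrite !e1.
    by move=> /b[b1 b2]; rewrite !e1.
  by move=> j hj i; have [c1 c2] := c hj; split=> [|n hn]; rewrite !e2 // c2.
have [[a1 a2] [b1 b2] c] := H2 v hv; split; rewrite ?(e1 SUB) ?(e1 CODE) ?(e1 BET) //.
  by rewrite e2.
by move: c; rewrite /= !(e1 BET) // !(e1 RNK).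
Qed.

Definition OBf := [:: LEN; DIFF; GW; LMASK; LINK; SLINK; PCH; CNEXT; INNER; CHAR].

Lemma invO_ext B m1 n1 m2 n2 ob pals :
  (forall f u, f \in OBf -> n1 f u = m1 f u) ->
  (forall f u u', f \in [:: NEXT; LD] -> n2 f u u' = m2 f u u') ->
  invO B m1 m2 ob pals -> invO B n1 n2 ob pals.
Proof.
move=> e1 e2 [H1 H2 H3 H4 H5]; split=> //; last by move=> q i; rewrite e2 //; apply: H5.
move=> x /H4[[a1 a2 a3 a4] b c]; split; first by rewrite !e1.
  by move=> /b[b1 b2 b3 b4 b5]; split=> [||||z hz]; rewrite ?e1 ?e2 // b5.
by move=> /c[c1 c2 c3]; rewrite !e1 // !e2.
Qed.

(** * Creating a palindrome *)

(** The link already has an object: a new palindrome is the only one added, and the set of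
    palindromes remains closed under palindromic suffixes. *)
Definition obj_link : cmd :=
  CIf (CEq 46 13) (seqs [:: BConst 50 1 : cmd; BConst 51 2 : cmd])
    (seqs [:: Ld1 50 LEN 46 : cmd; BConst 51 2 : cmd; BArith Add 50 50 51 : cmd;
       CIf (CLt 41 47) (seqs [:: Ld2 51 NEXT 47 16 : cmd]) (seqs [:: Ld2 51 NEXT 13 16 : cmd])]).

(** The second level ancestor query finds the letter before the link inside the new palindrome. A
    palindrome that continues a series inherits its bit and series link; one that starts a series
    doubles the bit. *)
Definition obj_regs : cmd := seqs [:: Ld1 52 LEN 51 : cmd; BMov 20 1 : cmd; BArith Defs.Sub 21 3 52 : cmd;
  laq; Ld1 53 IDN 22 : cmd; BArith Defs.Sub 54 50 52 : cmd; Ld1 55 DIFF 51 : cmd; Ld1 57 GW 51 : cmd;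
  CIf (CEq 54 55) (seqs [:: Ld1 56 SLINK 51 : cmd])
    (seqs [:: BMov 56 51 : cmd; BArith Add 57 57 57 : cmd])].

(** The leaders are those of the series link, except that the one with the letter of the new
    palindrome is superseded and becomes its successor [CNEXT]. *)
Definition obj_loop : cmd := seqs [:: BConst 58 0 : cmd; BMov 15 57 : cmd; St2 LD 49 57 49 : cmd;
  Ld1 17 LMASK 56 : cmd;
  bitloop [:: Ld2 45 LD 56 43 : cmd; Ld1 47 PCH 45 : cmd;
    CIf (CEq 47 53) (seqs [:: BMov 58 45 : cmd]) (seqs [:: St2 LD 49 43 45 : cmd; BArith Add 15 15 43 : cmd])]].

Definition obj_store : cmd := seqs [:: St1 LEN 49 50 : cmd; St1 LINK 49 51 : cmd; St1 DIFF 49 54 : cmd;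
  St1 SLINK 49 56 : cmd; St1 PCH 49 53 : cmd; St1 GW 49 57 : cmd; St1 LMASK 49 15 : cmd; St1 CNEXT 49 58 : cmd;
  St1 INNER 49 46 : cmd; St1 CHAR 49 16 : cmd; St1 CNT 49 41 : cmd; St2 NEXT 46 16 49 : cmd].

Definition obj_new : cmd := seqs (alloc ++ [:: BMov 49 48 : cmd; obj_link; obj_regs; obj_loop; obj_store]).

Definition ins_obj : cmd := seqs [:: Ld2 49 NEXT 46 16 : cmd; CIf (CEq 49 41) obj_new CSkip].

Section Obj.
Variables (Sigma : finType) (w b B M N rt : nat).
Variables (m1 : nat -> nat -> nat) (m2 : nat -> nat -> nat -> nat) (mc : nat -> option Sigma).
Variables (ns : seq nat) (pn : nat -> seq nat) (ob : seq nat -> nat) (pals : seq (seq nat)).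
Variables (v i n r46 r47 : nat) (W : seq nat).
Hypothesis invl : invLA B M m1 m2 rt ns pn.
Hypothesis invo : invO B m1 m2 ob pals.
Hypothesis BE : B = 2 ^ b.
Hypothesis Bw : 128 * B * B <= 2 ^ w.
Hypothesis NB : N.+2 ^ 8 <= B.
Hypothesis nsz : size ns <= N.+1.
Hypothesis nsB : forall u : nat, u \in ns -> u < B.
Hypothesis MN : 0 < M <= N.+1.
Hypothesis vns : v \in ns.
Hypothesis iwv : iwd (m1 IDN) pn v = rcons W i.
Hypothesis iB : i < B.
Local Notation cd := (cand 0 W i).
Hypothesis Wlive : forall n, n <= size W -> pal (suf n W) -> suf n W \in [::] :: pals.
Hypothesis ch :
  (exists q, [/\ cd q, forall n, cd n -> n <= q, r46 = ob (suf q W) &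
     (exists m, [/\ m < q, cd m, forall n, n < q -> cd n -> n <= m & r47 = ob (suf m W)]) \/
     (forall n, n < q -> ~~ cd n) /\ r47 = 0]) \/
  [/\ forall n, ~~ cd n, r46 = 1 & r47 = 0].
Local Notation x := (lps (rcons W i)).
Local Notation ok := (@ok Sigma w B).

Let wf : wft rt ns pn. Proof. by case: invl. Qed.

Lemma obB y : y \in [::] :: pals -> [/\ 1 < ob y, ob y < B & obj_ok m1 m2 ob y].
Proof.
move=> hy; have := ob_gt1 invo hy; have := N4B NB; have [_ _ _ H _] := invo.
by move=> h1 /andP[h2 h3]; split=> //; [lia | apply: H].
Qed.

Lemma chosen_word :
  (exists y, [/\ y \in [::] :: pals, x = i :: rcons y i, r46 = ob y &
     (exists2 y', y' \in [::] :: pals & lnk x = i :: rcons y' i /\ r47 = ob y') \/ lnk x = [:: i] /\ r47 = 0]) \/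
  [/\ x = [:: i], lnk x = [::], r46 = 1 & r47 = 0].
Proof.
case: ch => [[q [h1 h2 h3 h4]]|[h1 h2 h3]]; last first.
  by right; rewrite (lps_none h1) lnk_one.
have /and3P[q1 q2 q3] := h1; left; exists (suf q W); split=> //; first exact: Wlive (ltnW q1) q2.
  exact: (lps_some h1 h2).
rewrite (lps_some h1 h2); have sq : size (suf q W) = q by rewrite size_suf // ltnW.
have cdE k : k < q -> cd k = pal (suf k (suf q W)) && (nth 0 (suf q W) k == i).
  by move=> hk; rewrite /cand (ltn_trans hk) //= suf_suf ?(ltnW hk) ?(ltnW q1) // (mirror 0 (ltnW q1) q2 hk).
case: h4 => [[m [m1' m2' m3 m4]]|[m1' m2']].
  left; exists (suf m W); first by have /and3P[/ltnW a1 a2 _] := m2'; apply: Wlive.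
  split=> //; have := m2'; rewrite cdE // => /andP[a1 /eqP a2].
  rewrite (@lnk_some _ 0 (suf q W) i m) ?sq // ?suf_suf // ?(ltnW m1') ?(ltnW q1) //.
  by move=> k hk b1 b2; apply: m3; rewrite ?cdE // b1 b2 eqxx.
right; split=> //; apply: (lnk_none q2 (d := 0)) => k; rewrite sq => hk b1 b2.
by have := m1' k hk; rewrite cdE // b1 b2 eqxx.
Qed.

Lemma x_neq : x != [::].
Proof. by case: chosen_word => [[y [_ -> _ _]]|[-> _ _ _]]. Qed.

Lemma x_inn : inn ob x = r46 /\ head 0 x = i.
Proof. by case: chosen_word => [[y [_ -> -> _]]|[-> _ -> _]]; rewrite ?inn_wrap. Qed.

Lemma x_next : m2 NEXT r46 i = if x \in pals then ob x else 0.
Proof.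
case: chosen_word => [[y [h1 -> -> _]]|[-> _ -> _]]; last exact: (next_one invo).
exact: (next_spec invo).
Qed.

Lemma r46B : r46 < B /\ r47 < B.
Proof.
have NB' := N4B NB; case: chosen_word => [[y [h1 _ -> h2]]|[_ _ -> ->]]; last by lia.
have [_ h3 _] := obB h1; split=> //.
by case: h2 => [[y' h4 [_ ->]]|[_ ->]]; [case: (obB h4) | lia].
Qed.

Lemma sx : size x <= dep pn v /\ size x <= N.
Proof.
have h : size x <= dep pn v by rewrite -(size_iw (m1 IDN)) iwv size_lps; case: (lpsnP (rcons W i)).
by split=> //; have := dep_size wf vns; have := nsz; lia.
Qed.

Hypothesis xn : x \notin pals.
Hypothesis cl : pclosed (x :: pals).

Lemma lnk_live : lnk x \in [::] :: pals.
Proof.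
have [->|ln] := eqVneq (lnk x) [::]; first by rewrite inE.
have [_ H _] := cl; have := H x (lnkn x) (mem_head _ _).
rewrite lnkn_le pal_lnk andbT lt0n -size_lnk size_eq0 ln => /(_ isT isT).
rewrite inE -/(lnk x) size_lnk -/(lnk x) => /orP[/eqP e|h]; last by rewrite inE h orbT.
by have := size_lnk_lt x_neq; rewrite e ltnn.
Qed.

Lemma obj_link_ok (r : nat -> nat) rc out (tt : nat) (Q : hst Sigma -> Prop) :
  r 46 = r46 -> r 47 = r47 -> r 13 = 1 -> r 41 = 0 -> r 16 = i ->
  (forall (r' : nat -> nat) (tt' : nat), r' 50 = size x -> r' 51 = ob (lnk x) -> frameS [:: 50; 51] r r' ->
     tt' <= tt + 6 -> Q (HS r' rc m1 m2 mc out tt')) ->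
  ok obj_link (HS r rc m1 m2 mc out tt) Q.
Proof.
move=> e46 e47 e13 e41 e16 HQ; have NB' := N4B NB; have c2 : 2 < 2 ^ w by apply: leq_trans Bw; nia.
have [d1 d2] := r46B; have [_ ob0 _ _ _] := invo; have ll := lnk_live.
apply: ok_if => /=; rewrite e46 e13; case: chosen_word => [[y [h1 h2 h3 h4]]|[h1 h2 h3 h4]]; last first.
  rewrite h3 eqxx; bs; first exact: ltnW.
  bs => //; apply: ok_nil; apply: HQ => //=; rewrite ?h2 ?ob0 ?h1 //; first by frs.
  by clear; lia.
have [o1 o2 [[o3 _ _ _] _ _]] := obB h1.
rewrite h3 gtn_eqF //; bs; first by rewrite e46 h3.
rewrite e46 h3 o3; bs => //; have [sx1 sx2] := sx.
have ex : size y + 2 = size x by rewrite h2 /= size_rcons addn2.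
bs; first by rewrite ex; apply: (ltB Bw NB); lia.
rewrite ex; apply: ok_cons; apply: ok_if => /=; rewrite e41 e47; case: h4 => [[y' l1 [l2 l3]]|[l2 l3]].
  have [o4 o5 _] := obB l1; rewrite l3 (ltn_trans _ o4) //; bs; first by rewrite e47 e16 l3.
  rewrite e47 e16 l3 (next_spec invo) // -l2; move: ll; rewrite inE l2 /= -l2 => ->.
  by apply: ok_nil; apply: ok_nil; apply: HQ => //=; [frs | clear; lia].
rewrite l3; bs; first by rewrite e13 e16; split=> //; lia.
rewrite e13 e16 (next_one invo) // -l2; move: ll; rewrite inE l2 /= -l2 => ->.
by apply: ok_nil; apply: ok_nil; apply: HQ => //=; [frs | clear; lia].
Qed.

Lemma obj_regs_ok (r : nat -> nat) rc out (tt : nat) (Q : hst Sigma -> Prop) :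
  r 1 = v -> r 3 = dep pn v -> r 50 = size x -> r 51 = ob (lnk x) ->
  (forall (r' : nat -> nat) (tt' : nat), r' 53 = pch 0 x -> r' 54 = df x -> r' 56 = ob (slk x) -> r' 57 = gw x ->
     frameS (iota 20 10 ++ iota 52 6) r r' ->
     tt' <= tt + 41 + 4 * minn (2 * lam (dep pn v)) (3 * M + 1) -> Q (HS r' rc m1 m2 mc out tt')) ->
  ok obj_regs (HS r rc m1 m2 mc out tt) Q.
Proof.
move=> e1 e3 e50 e51 HQ; have NB' := N4B NB; have ll := lnk_live; have [o1 o2 [[o3 o4 o5 o6] o7 _]] := obB ll.
have [sx1 sx2] := sx; have lx := size_lnk_lt x_neq; have px : pal x := pal_lps _.
rewrite /obj_regs; bs; first by rewrite e51.
rewrite e51 o3; bs => //; rewrite e1; bs; first by rewrite e3 (leq_trans (ltnW lx) sx1).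
rewrite e3; apply: ok_cons; apply: (laq_ok invl BE Bw NB nsz nsB MN (v := v) (t := dep pn v - size (lnk x))) => //.
  exact: leq_subr.
move=> r1 t1 e22 fr ht.
set t := dep pn v - size (lnk x) in e22; have t0 : 0 < t <= dep pn v by rewrite subn_gt0 leq_subr andbT; lia.
have eid : m1 IDN (anc rt pn v t) = pch 0 x.
  have ti : t.-1 < size (pn v) by rewrite -/(dep pn v); lia.
  have -> : anc rt pn v t = nth rt (pn v) t.-1 by rewrite /anc -{1}(ltn_predK (andP t0).1).
  rewrite -(nth_map rt 0) // -/(iwd (m1 IDN) pn v) iwv /pch.
  have [h1 h2] := lpsnP (rcons W i); rewrite -size_lnk.
  rewrite (mirror 0 h1 h2); last by rewrite -size_lps.
  have sz : size (rcons W i) = dep pn v by rewrite -iwv size_iw.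
  by rewrite sz /t subnS.
have aB : anc rt pn v t < B by apply: nsB; apply: (anc_ns wf) => //; case/andP: t0.
have fr' : frameS (iota 20 10) (hu (hu (hu r 52 (size (lnk x))) 20 v) 21 t) r1.
  by move=> z; rewrite mem_iota => hz; apply: fr; lia.
have e50' : r1 50 = size x by rewrite fr'.
have e51' : r1 51 = ob (lnk x) by rewrite fr'.
have e52' : r1 52 = size (lnk x) by rewrite fr'.
bs; first by rewrite e22.
rewrite e22 eid; bs; first by rewrite e50' e52' ltnW.
rewrite e50' e52'; have -> : size x - size (lnk x) = df x by rewrite size_lnk.
bs; first by rewrite e51'.
rewrite e51' o4; bs; first by rewrite e51'.
rewrite e51' o5; apply: ok_cons; apply: ok_if => /=.
have gB : gw (lnk x) < B by apply: (@gw_lt N) => //; [apply: pal_lnk | exact: leq_trans (ltnW lx) sx2].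
have frE r2 : frameS (iota 52 6) r1 r2 -> frameS (iota 20 10 ++ iota 52 6) r r2.
  move=> h; apply: frs_trans (frs_sub _ h); last by move=> z hz; rewrite mem_cat hz orbT.
  apply: frs_trans (frs_sub _ fr'); last by move=> z hz; rewrite mem_cat hz.
  by frs.
have slE := slkE x_neq; case: eqP => ed.
  rewrite -ed eqxx in slE; have ln0 : lnk x != [::].
    by apply: contra_eq_neq ed => ->; rewrite df_nil -lt0n df_gt0 // x_neq.
  have [_ o8 _ _ _] := o7 ln0.
  bs; first by rewrite e51'.
  rewrite e51' o8 -slE; apply: ok_nil; apply: ok_nil; apply: HQ => //=.
  - by rewrite /gw (gx_lnk x_neq (esym ed)).
  - by apply: frE; frs.
  - by move: ht; clear; lia.
rewrite ifN in slE; last by apply/eqP => e; apply: ed.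
bs => //; bs; first by apply: leq_trans Bw; nia.
rewrite e51' -slE; apply: ok_nil; apply: ok_nil; apply: HQ => //=.
- by rewrite /gw (gxE x_neq) slE expnS addnn mul2n.
- by apply: frE; frs.
- by move: ht; clear; lia.
Qed.


Variable o : nat.
Hypothesis oB : 3 <= o < B.
Hypothesis ofr : o \notin map ob pals.

Lemma slk_live : slk x \in [::] :: pals.
Proof.
rewrite (slkE x_neq); case: ifP => _; last exact: lnk_live.
exact: (live_slk invo lnk_live).
Qed.

Lemma ob_ne y : y \in [::] :: pals -> ob y != o.
Proof.
rewrite inE => /orP[/eqP ->|h]; first by have [_ -> _ _ _] := invo; rewrite ltn_eqF //; case/andP: oB.
by apply: contraNneq ofr => <-; apply: map_f.
Qed.

Lemma slk_leader z : z \in leaders 0 (slk x) -> z \in grp x /\ z \in pals.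
Proof.
move=> hz; split; last exact: (live_grp invo slk_live (leaders_grp hz)).
by rewrite grpE (negPf x_neq) inE (leaders_grp hz) orbT.
Qed.

Lemma gwB (y : seq nat) : pal y -> size y <= size x -> gw y < B.
Proof. by move=> py sy; apply: (@gw_lt N) => //; apply: leq_trans sy _; case: sx. Qed.

Lemma leaders_x z : z \in leaders 0 x -> z = x \/ z \in leaders 0 (slk x) /\ pch 0 z != pch 0 x.
Proof. by rewrite leadersE (negPf x_neq) inE mem_filter => /orP[/eqP|/andP[h1 h2]]; [left|right]. Qed.

Lemma cnx_of z : z \in leaders 0 (slk x) -> pch 0 z = pch 0 x -> cnx 0 x = z.
Proof. by move=> h1 h2; apply: cnx_eq => //; [apply: pal_lps | apply: x_neq]. Qed.

Lemma cnx_no : (forall z, z \in leaders 0 (slk x) -> pch 0 z != pch 0 x) -> cnx 0 x = [::].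
Proof.
by move=> H; apply/eqP; apply: contraT => /cnx_leaders[/H /negP h e]; case: h; rewrite e.
Qed.

Lemma obj_loop_ok (r : nat -> nat) rc out (tt : nat) (Q : hst Sigma -> Prop) :
  r 13 = 1 -> r 41 = 0 -> r 49 = o -> r 53 = pch 0 x -> r 56 = ob (slk x) -> r 57 = gw x ->
  (forall (r' : nat -> nat) m2' (tt' : nat), r' 15 = lmask 0 x ->
     r' 58 = (if cnx 0 x == [::] then 0 else ob (cnx 0 x)) ->
     (forall f u u', (f != LD) || (u != o) -> m2' f u u' = m2 f u u') ->
     (forall z, z \in leaders 0 x -> m2' LD o (gw z) = if z == x then o else ob z) ->
     frameS [:: 15; 17; 42; 43; 45; 47; 58] r r' ->
     tt' <= tt + 12 * size (leaders 0 (slk x)) + 8 -> Q (HS r' rc m1 m2' mc out tt')) ->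
  ok obj_loop (HS r rc m1 m2 mc out tt) Q.
Proof.
move=> e13 e41 e49 e53 e56 e57 HQ; have NB' := N4B NB; have px : pal x := pal_lps _.
have [o3 o4 [[_ _ _ o5] o6 _]] := obB slk_live; have [oL oR] := andP oB.
have gxB : gw x < B by apply: gwB.
have ps : pal (slk x) by apply: (live_pal invo slk_live).
rewrite /obj_loop; bs; first by rewrite expn_gt0.
bs => //; bs; first by rewrite e49 e57.
rewrite e49 e57; bs; first by rewrite e56.
rewrite e56 o5; apply: ok_cons; set r0 := hu _ 17 _; set m20 := hu2 _ _ _ _ _.
pose I (l : seq nat) (r' : nat -> nat) (rc' : nat -> option Sigma) n1 (n2 : nat -> nat -> nat -> nat) :=
  exists2 zs, l = map (@gx _) zs & [/\ [/\ forall z, z \in zs -> z \in leaders 0 (slk x), n1 = m1, rc' = rc,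
    frameS [:: 15; 17; 42; 43; 45; 47; 58] r0 r' &
    r' 15 + \sum_(z <- zs | pch 0 z != pch 0 x) gw z = lmask 0 x],
    (exists z, [/\ z \in leaders 0 (slk x), pch 0 z = pch 0 x & r' 58 = ob z]) \/
    (forall z, z \in leaders 0 (slk x) -> z \notin zs -> pch 0 z != pch 0 x) /\ r' 58 = 0,
    forall f u u', (f != LD) || (u != o) -> n2 f u u' = m2 f u u'
  & forall z, z \in leaders 0 x -> z \notin zs -> n2 LD o (gw z) = if z == x then o else ob z].
apply: (@bitloop_ok Sigma w B _ 6 I mc out _ _ (rev (map (@gx _) (leaders 0 (slk x))))) => //.
- move=> l r1 r2 rc1 a1 a2 fr [zs -> [[h1 h2 h3 h4 h5] h6 h7 h8]]; exists zs => //; rewrite (fr 58) //.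
  split=> //; rewrite (fr 15) //; split=> //.
  by apply: frs_trans h4 _; apply: frs_sub fr => y; rewrite !inE; do ?[case/orP] => /eqP ->.
- move=> k l r1 rc1 a1 a2 t hs [[//|z zs] [ek el] [[h1 -> -> h4 h5] h6 h7 h8]] f13 f41 f43.
  have hz := h1 z (mem_head _ _); have [zg zl] := slk_leader hz.
  have zl' : z \in [::] :: pals by rewrite inE zl orbT.
  have [pz zn sz _] := grp_mem px zg; have gB : gw z < B by apply: gwB.
  have sn : slk x != [::] by apply: contraTneq hz => ->; rewrite leadersE.
  have [_ _ _ _ /(_ z hz) eld] := o6 sn; have [p1 p2 [_ /(_ zn)[_ _ epc _ _] _]] := obB zl'.
  have f56 : r1 56 = ob (slk x) by rewrite h4.
  have f53 : r1 53 = pch 0 x by rewrite h4.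
  have f49 : r1 49 = o by rewrite h4.
  have f43' : r1 43 = gw z by rewrite f43 ek.
  have zsub y : y \in zs -> y \in leaders 0 (slk x) by move=> hy; apply: h1; rewrite inE hy orbT.
  bs; first by rewrite f56 f43'.
  rewrite f56 f43' h7 ?ob_ne ?slk_live ?orbT // eld; bs => //; rewrite epc.
  apply: ok_cons; apply: ok_if => /=; rewrite f53; move: h5; rewrite big_cons; case: eqP => ec /= h5.
    bs => //; apply: ok_nil; apply: ok_nil; do 5![eexists]; split; first by reflexivity.
    + exists zs => //; split=> //.
      * by split=> //; frs; apply: frs_trans h4 _; frs.
      * by left; exists z.
      * move=> y hy nys; apply: h8 => //; rewrite inE negb_or nys andbT.
        apply: contraTneq hy => ->; rewrite leadersE (negPf x_neq) inE mem_filter ec eqxx /= orbF.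
        by apply/eqP => e; have := size_slk_lt x_neq; have [_ _ + _] := grp_mem ps (leaders_grp hz); rewrite {1}e leqNgt => /negP.
    + by clear; lia.
    + by [].
  bs; first by rewrite f49 f43'.
  rewrite f49 f43'; have lb := lmask_lt px.
  bs; first by rewrite f43'; apply: leq_trans Bw; move: h5 lb gxB NB'; clear; nia.
  rewrite f43'; apply: ok_nil; apply: ok_nil; do 5![eexists]; split; first by reflexivity.
  + exists zs => //; split=> //.
    * split=> //; first by frs; apply: frs_trans h4 _; frs.
      by rewrite /= -addnA.
    * case: h6 => [h6|[h6 h6']]; [by left|right; split=> // y hy hys].
      by have [->|ny] := eqVneq y z; [apply/eqP | apply: h6; rewrite // inE negb_or ny].
    * move=> f u u' hf; rewrite /hu2 (_ : Nat.eqb f 5 = (f == LD)) // -h7 //.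
      by case: eqP hf => //= _ /negPf ->.
    * move=> y hy nys; rewrite /hu2 /= eqxx /=; case: eqP => eg.
        have yg := leaders_grp hy; have gE : gx y = gx z by apply: (@expnI 2).
        rewrite (grp_gx_inj px yg zg gE); case: eqP => // ezx.
        by have := size_slk_lt x_neq; have [_ _ + _] := grp_mem ps (leaders_grp hz); rewrite {1}ezx leqNgt => /negP.
      by apply: h8; rewrite // inE negb_or nys andbT; apply/eqP => e; apply: eg; rewrite e.
  + by clear; lia.
  + by [].
- by rewrite rev_sorted; apply: leaders_sorted.
- exists (rev (leaders 0 (slk x))); first by rewrite map_rev.
  split.
  + split=> //; first by move=> z; rewrite mem_rev.
    by rewrite /r0 /= big_rev /lmask [leaders 0 x]leadersE (negPf x_neq) big_cons big_filter.
  + by right; split=> // z hz; rewrite mem_rev hz.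
  + move=> f u u' hf; rewrite /m20 /hu2 (_ : Nat.eqb f 5 = (f == LD)) //.
    by case: eqP hf => //= _ /negPf ->.
  + move=> z /leaders_x[-> _|[hz _]]; last by rewrite mem_rev hz.
    by rewrite /m20 /= !eqxx.
- by rewrite /r0 /= /lmask /bsum big_rev big_map.
move=> r' rc' a1 a2 t' [[|//] _ [[_ -> -> h4 h5] h6 h7 h8]] _ _; rewrite size_rev size_map => ht.
apply: ok_nil; apply: HQ => //.
- by rewrite -h5 big_nil addn0.
- case: h6 => [[z [z1 z2 ->]]|[z1 ->]].
    rewrite (cnx_of z1 z2); case: eqP => // e; have [_ h] := slk_leader z1.
    by have [[H _ _] _ _ _ _] := invo; have [+ _] := H z h; rewrite e.
  by rewrite cnx_no ?eqxx // => z hz; apply: z1.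
- by move=> z hz; apply: h8.
- by apply: frs_trans _ h4; rewrite /r0; frs.
- by move: ht; clear; lia.
Qed.

Lemma obj_store_ok (r : nat -> nat) rc m2' out (tt : nat) (Q : hst Sigma -> Prop) :
  r 41 = 0 -> r 49 = o -> r 46 = r46 -> r 16 = i -> r 50 = size x -> r 51 = ob (lnk x) ->
  r 53 = pch 0 x -> r 54 = df x -> r 56 = ob (slk x) -> r 57 = gw x -> r 15 = lmask 0 x ->
  r 58 = (if cnx 0 x == [::] then 0 else ob (cnx 0 x)) ->
  (forall f u u', (f != LD) || (u != o) -> m2' f u u' = m2 f u u') ->
  (forall z, z \in leaders 0 x -> m2' LD o (gw z) = if z == x then o else ob z) ->
  (forall n1 n2, invO B n1 n2 (ob_ins ob x o) (x :: pals) -> n1 CNT o = 0 ->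
     (forall f u, f \notin CNT :: OBf -> n1 f u = m1 f u) ->
     (forall u, u != o -> n1 CNT u = m1 CNT u) ->
     (forall f u u', f \notin [:: NEXT; LD] -> n2 f u u' = m2 f u u') ->
     Q (HS r rc n1 n2 mc out (tt + 12))) ->
  ok obj_store (HS r rc m1 m2' mc out tt) Q.
Proof.
move=> e41 e49 e46 e16 e50 e51 e53 e54 e56 e57 e15 e58 F1 F2 HQ; have [oL oR] := andP oB.
have [d1 d2] := r46B; have [ei eh] := x_inn.
rewrite /obj_store; do 11![bs; first by rewrite e49]; bs; first by rewrite e46 e16.
rewrite e41 e49 e46 e16 e50 e51 e53 e54 e56 e57 e15 e58; apply: ok_nil.
rewrite (_ : tt + 12 = tt.+4.+4.+4) in HQ; last by rewrite addnC.
apply: HQ => /=.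
- apply: (invO_ins invo xn x_neq (pal_lps _) cl oB ofr).
  + move=> f u hf /negPf nu; move: hf; rewrite !inE.
    by do ?[case/orP]; move/eqP => -> /=; rewrite ?nu.
  + by move=> u g nu /=; rewrite F1 // nu orbT.
  + by move=> q j; rewrite ei eh /= F1.
  + by rewrite ei eh x_next (negPf xn).
  + by rewrite /= eqxx.
  + by rewrite /= !eqxx; split=> // z hz; rewrite F2.
  + by rewrite /= !eqxx ei eh.
- by rewrite eqxx.
- by move=> f u hf; nf hf.
- by move=> u /negPf ->.
- by move=> f u u' hf; nf hf; apply: F1; move: hf; rewrite !inE negb_or => /andP[_ ->].
Qed.

End Obj.

Definition Oregs := [:: 15; 17; 40; 42; 43; 45; 47; 48; 49; 50; 51; 52; 53; 54; 55; 56; 57; 58] ++ iota 20 10.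

Lemma ins_obj_ok (Sigma : finType) (w b B M N rt : nat) (m1 : nat -> nat -> nat) (m2 : nat -> nat -> nat -> nat)
    (mc : nat -> option Sigma) (ns : seq nat) (pn : nat -> seq nat) (ob : seq nat -> nat) (pals : seq (seq nat))
    (v i n r46 r47 : nat) (W : seq nat) :
  invLA B M m1 m2 rt ns pn -> invO B m1 m2 ob pals -> B = 2 ^ b -> 128 * B * B <= 2 ^ w -> N.+2 ^ 8 <= B ->
  size ns <= N.+1 -> (forall u : nat, u \in ns -> u < B) -> 0 < M <= N.+1 -> v \in ns ->
  iwd (m1 IDN) pn v = rcons W i -> i < B ->
  (forall n, n <= size W -> pal (suf n W) -> suf n W \in [::] :: pals) ->
  ((exists q, [/\ cand 0 W i q, forall n, cand 0 W i n -> n <= q, r46 = ob (suf q W) &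
     (exists m, [/\ m < q, cand 0 W i m, forall n, n < q -> cand 0 W i n -> n <= m & r47 = ob (suf m W)]) \/
     (forall n, n < q -> ~~ cand 0 W i n) /\ r47 = 0]) \/
   [/\ forall n, ~~ cand 0 W i n, r46 = 1 & r47 = 0]) ->
  let x := lps (rcons W i) in
  (x \notin pals -> [/\ pclosed (x :: pals), 3 <= alloc_of m1 n < B & alloc_of m1 n \notin map ob pals]) ->
  n < B -> n.+1 < 2 ^ w ->
  forall (r : nat -> nat) (rc : nat -> option Sigma) out (tt : nat) (Q : hst Sigma -> Prop),
  r 1 = v -> r 3 = dep pn v -> r 13 = 1 -> r 16 = i -> r 40 = n -> r 41 = 0 -> r 46 = r46 -> r 47 = r47 ->
  (forall (r' : nat -> nat) n1 n2 ob' pals' (tt' : nat), invO B n1 n2 ob' pals' ->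
     (forall y, y \in [::] :: pals -> ob' y = ob y) -> pals' = (if x \in pals then pals else x :: pals) ->
     r' 49 = ob' x -> (x \notin pals -> ob' x = alloc_of m1 n) -> r' 40 = (if x \in pals then n else n.+1) ->
     (forall f u, f \notin CNT :: OBf -> n1 f u = m1 f u) ->
     (forall u, u != ob' x -> n1 CNT u = m1 CNT u) ->
     n1 CNT (ob' x) = (if x \in pals then m1 CNT (ob x) else 0) ->
     (forall f u u', f \notin [:: NEXT; LD] -> n2 f u u' = m2 f u u') ->
     frameS Oregs r r' ->
     tt' <= tt + 100 + 4 * minn (2 * lam (dep pn v)) (3 * M + 1) + 12 * size (leaders 0 (slk x)) ->
     Q (HS r' rc n1 n2 mc out tt')) ->
  ok w B ins_obj (HS r rc m1 m2 mc out tt) Q.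
Proof.
move=> invl invo BE Bw NB nsz nsB MN vns iwv iB Wlive ch x hx nB nw r rc out tt Q e1 e3 e13 e16 e40 e41 e46 e47 HQ.
have [d1 d2] := r46B invo BE Bw NB nsz MN vns iB Wlive ch.
have xe := x_next invo Wlive ch; have xn0 : x != [::] := x_neq Wlive ch.
rewrite /ins_obj; bs; first by rewrite e46 e16.
rewrite e46 e16 xe -/x; apply: ok_cons; apply: ok_if => /=; rewrite e41.
case: (boolP (x \in pals)) hx HQ => xp hx HQ.
  have : ob x != 0 by have := @ob_gt1 _ _ _ _ _ invo x; rewrite inE xp orbT => /(_ isT) /andP[]; case: (ob x).
  move=> /negPf ->; apply: ok_skip; apply: ok_nil; apply: (HQ _ m1 m2 ob pals) => //=.
  - by frs.
  - by clear; lia.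
have [cl oB ofr] := hx isT; rewrite eqxx /obj_new.
apply: (@alloc_ok _ w B n) => //=; move=> r1 fr1 f48 f40; set o := alloc_of m1 n in oB ofr f48 *.
bs => //; rewrite f48; apply: ok_cons.
apply: (obj_link_ok invl invo BE Bw NB nsz MN vns iwv iB Wlive ch xp cl) => /=; rewrite ?fr1 //=.
move=> r2 t2 g50 g51 fr2 ht2; apply: ok_cons.
have fr2' : frameS [:: 40; 48; 49; 50; 51] r r2.
  apply: frs_trans (frs_sub _ fr2); last by move=> z; rewrite !inE; do ?[case/orP] => /eqP ->.
  frs; apply: frs_trans (frs_sub _ fr1); last by move=> z; rewrite !inE; do ?[case/orP] => /eqP ->.
  by frs.
have g49 : r2 49 = o by rewrite fr2.
have g40 : r2 40 = n.+1 by rewrite fr2.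
apply: (obj_regs_ok invl invo BE Bw NB nsz nsB MN vns iwv iB Wlive ch xp cl) => //; rewrite ?fr2' //.
move=> r3 t3 g53 g54 g56 g57 fr3 ht3; apply: ok_cons.
have fr3' : frameS ([:: 40; 48; 49; 50; 51] ++ iota 20 10 ++ iota 52 6) r r3.
  apply: frs_trans (frs_sub _ fr2') (frs_sub _ fr3); first by move=> z hz; rewrite mem_cat hz.
  by move=> z hz; rewrite mem_cat hz orbT.
have g49' : r3 49 = o by rewrite fr3.
apply: (obj_loop_ok invl invo BE Bw NB nsz MN vns iwv iB Wlive ch cl oB ofr) => //; rewrite ?fr3' //.
move=> r4 m2' t4 g15 g58 F1 F2 fr4 ht4; apply: ok_cons.
have fr4' : frameS Oregs r r4.
  apply: frs_trans (frs_sub _ fr3') (frs_sub _ fr4).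
    by move=> z; rewrite !mem_cat => /or3P[]; rewrite !inE; do ?[case/orP] => /eqP ->.
  by move=> z; rewrite !inE; do ?[case/orP] => /eqP ->.
have h49 : r4 49 = o by rewrite fr4 // fr3.
have h40 : r4 40 = n.+1 by rewrite fr4 // fr3.
have h50 : r4 50 = size x by rewrite fr4 // fr3.
have h51 : r4 51 = ob (lnk x) by rewrite fr4 // fr3.
have h53 : r4 53 = pch 0 x by rewrite fr4.
have h54 : r4 54 = df x by rewrite fr4.
have h56 : r4 56 = ob (slk x) by rewrite fr4.
have h57 : r4 57 = gw x by rewrite fr4.
apply: (obj_store_ok invo BE Bw NB nsz MN vns iB Wlive ch xp cl oB ofr) => //; rewrite ?fr4' //.
move=> n1 n2 H1 H2 H3 H4 H5; apply: ok_nil; apply: ok_nil.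
have ox : ob_ins ob x o x = o by rewrite /ob_ins eqxx.
apply: (HQ _ n1 n2 (ob_ins ob x o) (x :: pals)) => //; rewrite ?ox ?(negPf xp) //.
- move=> y hy; rewrite /ob_ins; case: eqP => // ey; move: hy; rewrite ey inE (negPf xn0) /=.
  by rewrite (negPf xp).
- by move: ht2 ht3 ht4 => /=; rewrite -/x; move: (4 * minn _ _) (12 * _) => X Y; clear; lia.
Qed.

(** * The complete insertion *)

Definition ins_fin : cmd := seqs [:: St1 PAL 1 49 : cmd; Ld1 42 CNT 49 : cmd; BArith Add 42 42 13 : cmd; St1 CNT 49 42 : cmd;
  Ld1 42 LMASK 49 : cmd; St1 ACT 1 42 : cmd; St1 TOPA 1 13 : cmd; St1 KILL 1 19 : cmd; St1 KTOP 1 44 : cmd;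
  Ld1 42 ACT 2 : cmd; BArith Defs.Sub 42 42 19 : cmd; St1 ACT 2 42 : cmd;
  Ld1 42 TOPA 2 : cmd; BArith Defs.Sub 42 42 44 : cmd; St1 TOPA 2 42 : cmd;
  Ld1 42 NCH 2 : cmd; BArith Add 42 42 13 : cmd; St1 NCH 2 42 : cmd; BMov 0 1 : cmd].

(** The label is stored under the new node at once, so that a fresh name can be compared like any
    other. *)
Definition ins : cmd := seqs ([:: BConst 13 1 : cmd; BConst 41 0 : cmd; BMov 2 0 : cmd] ++ alloc ++
  [:: BMov 1 48 : cmd; CSt 1 0 : cmd; lains; ins_top; ins_scan; ins_choose; St1 IDN 1 16 : cmd; ins_obj; ins_fin]).

Definition NDf := [:: IDN; PAL; ACT; TOPA; KILL; KTOP; NCH; CNT].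

Lemma ins_fin_ok (Sigma : finType) (w b B : nat) (m1 : nat -> nat -> nat) (m2 : nat -> nat -> nat -> nat)
    (mc : nat -> option Sigma) (r : nat -> nat) (rc : nat -> option Sigma) out (tt v p o k h : nat) (Q : hst Sigma -> Prop) :
  r 1 = v -> r 2 = p -> r 49 = o -> r 13 = 1 -> r 19 = k -> r 44 = h -> v < B -> p < B -> o < B -> v != p ->
  m1 CNT o < B -> m1 NCH p < B -> B < 2 ^ w -> k <= m1 ACT p -> h <= m1 TOPA p ->
  (forall (r' : nat -> nat) n1, (forall f u, f \notin NDf -> n1 f u = m1 f u) ->
     (forall f u, f \in [:: PAL; KILL; KTOP] -> u != v -> n1 f u = m1 f u) -> n1 IDN =1 m1 IDN ->
     [/\ n1 PAL v = o, n1 KILL v = k & n1 KTOP v = h] ->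
     (forall u, u != v -> n1 ACT u = (if u == p then m1 ACT u - k else m1 ACT u) /\
        n1 TOPA u = (if u == p then m1 TOPA u - h else m1 TOPA u)) ->
     n1 ACT v = m1 LMASK o /\ n1 TOPA v = 1 ->
     (forall u, n1 NCH u = if u == p then (m1 NCH u).+1 else m1 NCH u) ->
     (forall u, n1 CNT u = if u == o then (m1 CNT u).+1 else m1 CNT u) ->
     frameS [:: 0; 42] r r' -> r' 0 = v -> Q (HS r' rc n1 m2 mc out (tt + 19))) ->
  ok w B ins_fin (HS r rc m1 m2 mc out tt) Q.
Proof.
move=> e1 e2 e49 e13 e19 e44 vB pB oB vp cB nB Bw kA hT HQ; have pv : p == v = false by rewrite eq_sym (negPf vp).
rewrite /ins_fin.
bs; first by rewrite e1.
bs; first by rewrite e49.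
bs; first by rewrite e49 e13 addn1; apply: leq_ltn_trans Bw.
bs; first by rewrite e49.
bs; first by rewrite e49.
bs; first by rewrite e1.
bs; first by rewrite e1.
bs; first by rewrite e1.
bs; first by rewrite e1.
bs; first by rewrite e2.
rewrite e2 e1 pv; bs; first by rewrite e19.
rewrite e19; bs; first by rewrite e2.
bs; first by rewrite e2.
rewrite e2 pv; bs; first by rewrite e44.
rewrite e44; bs; first by rewrite e2.
bs; first by rewrite e2.
rewrite e2; bs; first by rewrite e13 addn1; apply: leq_ltn_trans Bw.
bs; first by rewrite e2.
bs => //; apply: ok_nil.
rewrite (_ : tt + 19 = tt.+4.+4.+4.+4.+3) in HQ; last by rewrite addnC.
rewrite e1 e2 e13 e49; apply: HQ => /=.
- by move=> f u hf; nf hf.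
- by move=> f u hf /negPf nu; move: hf; rewrite !inE; do ?[case/orP]; move/eqP => -> /=; rewrite ?nu.
- by [].
- by rewrite !eqxx.
- by move=> u /negPf nu; rewrite nu; split=> //; case: eqP => // ->.
- by rewrite !eqxx (negPf vp).
- by move=> u; rewrite addn1; case: eqP => // ->.
- by move=> u; rewrite addn1; case: eqP => // ->.
- by frs.
- by [].
Qed.

(** The root is always 3, the first name of the pool. *)
Definition Inv (Sigma : finType) B M K n m1 m2 (mc : nat -> option Sigma) ns pn ob pals : Prop :=
  [/\ invLA B M m1 m2 3 ns pn, invO B m1 m2 ob pals, invW (m1 IDN) mc 3 ns pn,
      invM m1 m2 3 ns pn ob pals M & invA K m1 (ns ++ map ob pals) n].

Lemma invA_ext K m1 n1 live n : (forall i, n1 ALL i = m1 ALL i) -> invA K m1 live n -> invA K n1 live n.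
Proof.
move=> e [h1 h2 h3]; split=> //; apply: perm_trans h3.
rewrite (_ : map (alloc_of n1) _ = map (alloc_of m1) (iota n (K - n))) //.
by apply: eq_map => i; rewrite /alloc_of e.
Qed.

Lemma KB N B K : N.+2 ^ 8 <= B -> K = N.*2 + 6 -> K <= B.
Proof. by move=> /N4B NB ->; rewrite -muln2; lia. Qed.

Section Facts.
Variables (Sigma : finType) (b B M K n N w : nat).
Variables (m1 : nat -> nat -> nat) (m2 : nat -> nat -> nat -> nat) (mc : nat -> option Sigma).
Variables (ns : seq nat) (pn : nat -> seq nat) (ob : seq nat -> nat) (pals : seq (seq nat)).
Hypothesis inv : Inv B M K n m1 m2 mc ns pn ob pals.

Lemma inv_wf : wft 3 ns pn. Proof. by case: inv => -[]. Qed.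

Lemma pals_uniq : uniq pals.
Proof. by have [_ [_ _ [u _] _ _] _ _ _] := inv; apply: map_uniq u. Qed.

(** Each nonempty palindrome is the longest palindromic suffix of some node, and the root accounts
    for the empty one. Hence [K = N.*2 + 6] names suffice for nodes and palindromes together. *)
Lemma pals_size : size pals < size ns.
Proof.
have wf := inv_wf; have [_ _ _ [[_ A2 _] _ _ _] _] := inv; have [r0 r1 _ _ _] := wf.
rewrite -(size_map (fun v => lps (iwd (m1 IDN) pn v)) ns) -[X in X <= _]/(size ([::] :: pals)).
apply: uniq_leq_size.
  by rewrite /= pals_uniq andbT; apply/negP => /A2[].
move=> y; rewrite inE => /orP[/eqP ->|/A2[_ [v hv <-]]]; last by apply: map_f.
by apply/mapP; exists 3 => //; rewrite /iwd r1 lps_nil.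
Qed.

Lemma live_names u : u \in ns ++ map ob pals -> 3 <= u < K.
Proof.
have [_ _ _ _ [e1 e2 e3]] := inv => hu.
have := perm_mem e3 u; rewrite mem_cat hu mem_iota => /esym; clear; lia.
Qed.

Lemma ns_B : N.+2 ^ 8 <= B -> K = N.*2 + 6 -> forall u : nat, u \in ns -> u < B.
Proof.
move=> NB KE u hu; apply: leq_trans (KB NB KE); have := @live_names u; rewrite mem_cat hu.
by move=> /(_ isT) /andP[].
Qed.

Lemma n_lt : size ns <= N -> n + 2 <= size ns + N + 4.
Proof.
have [_ _ _ _ [-> _ _]] := inv; rewrite size_cat size_map; have := pals_size; lia.
Qed.

Lemma slots_ok p : size (kids 3 ns pn p) < M -> m1 NCH p = size (kids 3 ns pn p) /\
  slot_of m2 p (m1 NCH p) < M /\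
  forall u, u \in ns -> u != 3 -> par 3 pn u = p -> m1 RNK u != slot_of m2 p (m1 NCH p).
Proof.
have [_ _ _ [_ _ _ /(_ p)[e pe]] _] := inv => kM; split=> //.
have eM : M - m1 NCH p = (M - (m1 NCH p).+1).+1 by rewrite e; lia.
rewrite eM /= in pe; split.
  have := perm_mem pe (slot_of m2 p (m1 NCH p)); rewrite mem_cat mem_head orbT mem_iota add0n => /esym /andP[] //.
move=> u hu u0 up; have := perm_uniq pe; rewrite iota_uniq cat_uniq => /and3P[_ /hasPn /(_ _ (mem_head _ _)) h _].
apply: contraNneq h => <-; apply: map_f; by rewrite mem_filter u0 up eqxx hu.
Qed.

Lemma lps_live u : u \in ns -> lps (iwd (m1 IDN) pn u) \in [::] :: pals.
Proof.
have [_ _ _ [[_ A2 _] _ _ _] _] := inv => hu; rewrite inE -implyNb; apply/implyP => h.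
by apply/A2; split=> //; exists u.
Qed.

Lemma suf_live u k : u \in ns -> k <= dep pn u -> pal (suf k (iwd (m1 IDN) pn u)) ->
  suf k (iwd (m1 IDN) pn u) \in [::] :: pals.
Proof.
have [_ _ _ [[_ A2 _] _ _ _] _] := inv => hu hk pk.
have sk : size (suf k (iwd (m1 IDN) pn u)) = k by rewrite size_suf // size_iw.
rewrite inE -implyNb; apply/implyP => h; apply/A2; split=> //.
by apply: (lps_iw_first inv_wf hu h pk); rewrite sk.
Qed.

End Facts.

(** Two level ancestor queries and two scans over leaders, one for the parent and one for a new
    palindrome. *)
Definition ins_cost (Sigma : finType) M D := 300 + 8 * minn (2 * lam D.+1) (3 * M + 1) +
  24 * minn #|Sigma| (trunc_log 2 D.+1).*2.+2.

Lemma ins_ok (Sigma : finType) (w b B M K N n : nat) m1 m2 (mc : nat -> option Sigma) ns pn ob pals (p : nat) (c : option Sigma)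
    (r : nat -> nat) (rc : nat -> option Sigma) out (tt : nat) (Q : hst Sigma -> Prop) :
  Inv B M K n m1 m2 mc ns pn ob pals -> B = 2 ^ b -> 128 * B * B <= 2 ^ w -> N.+2 ^ 8 <= B -> 0 < M <= N.+1 ->
  K = N.*2 + 6 -> size ns < N -> p \in ns -> c != None ->
  (forall u, u \in ns -> u != 3 -> par 3 pn u = p -> mc u != c) -> size (kids 3 ns pn p) < M ->
  r 0 = p -> r 40 = n -> r 59 = B -> rc 0 = c ->
  (forall (r' : nat -> nat) (rc' : nat -> option Sigma) f1 f2 ob' pals' n' v (tt' : nat), v \notin ns ->
     Inv B M K n' f1 f2 (huc mc v c) (v :: ns) (pn_ins pn p v) ob' pals' ->
     r' 40 = n' -> r' 59 = B -> r' 0 = v -> tt' <= tt + ins_cost Sigma M (dep pn p) ->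
     Q (HS r' rc' f1 f2 (huc mc v c) out tt')) ->
  ok w B ins (HS r rc m1 m2 mc out tt) Q.
Proof.
move=> inv BE Bw NB MN KE nsz pns c0 cn kM e0 e40 e59 ec HQ.
have wf := inv_wf inv; have [invl invo invw invm inva] := inv.
have NB' := N4B NB; have KB' := KB NB KE; have nl := n_lt inv (ltnW nsz).
have B2 : B < 2 ^ w by apply: leq_trans Bw; nia.
have nK : n.+1 < K by rewrite KE -muln2; lia.
have [vlive vK inva1] := invA_new inva (ltnW nK); set v := alloc_of m1 n in vlive vK inva1.
(* The name that a new palindrome would receive; it remains in the pool if the palindrome exists
   already. *)
have [olive oK inva2] := invA_new inva1 nK; set o := alloc_of m1 n.+1 in olive oK inva2.
have [vns vob] : v \notin ns /\ v \notin map ob pals by move: vlive; rewrite mem_cat negb_or => /andP[].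
have oob : o \notin map ob pals by move: olive; rewrite inE mem_cat !negb_or => /and3P[].
have vB : v < B by lia.
have oB' : 3 <= o < B by lia.
have [n1B n2w sB B0] : [/\ n.+1 < B, n.+2 < 2 ^ w, size ns < B & 0 < B] by split; lia.
have B3 : maxn 3 B = B by lia.
have [eN [sM sd]] := slots_ok inv kM.
have pB : p < B by apply: (ns_B inv NB KE pns).
have NpB : m1 NCH p < B by lia.
have vp : v != p by apply: contraNneq vns => ->.
rewrite /ins; bs; first by lia.
bs; first by rewrite expn_gt0.
bs => //; apply: (@alloc_ok _ w B n) => //=; [by lia | by lia |].
move=> ra fra a48 a40; bs => //; bs => //=.
rewrite ec a48 -/v; set mc' := huc mc v c.
apply: ok_cons; apply: (lains_ok invl BE Bw NB (ltnW nsz) (ns_B inv NB KE) MN pns vns vB) => //=; rewrite ?a48 ?fra //=.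
move=> rb q1 q2 tb A1 A2 A3 A4 A5 frb b3 htb.
(* An equality of functions rewrites all words of names at once. *)
have eI : q1 IDN = m1 IDN by apply: functional_extensionality => u; apply: A1.
have invw' : invW (q1 IDN) mc 3 ns pn by rewrite eI.
have invo' : invO B q1 q2 ob pals.
  apply: invO_ext invo => [f u hf|f u u' hf]; [apply: A1 | apply: A2]; move: hf; rewrite !inE;
    by do ?[case/orP]; move/eqP => ->.
have palp : q1 PAL p = ob (lps (iwd (q1 IDN) pn p)) by rewrite A1 // eI; case: invm => -[H _ _] _ _ _; apply: H.
have livep : lps (iwd (q1 IDN) pn p) \in [::] :: pals by rewrite eI; apply: (lps_live inv).
have nsBv u : u \in v :: ns -> u < B by rewrite inE => /orP[/eqP ->|/(ns_B inv NB KE)].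
have b13 : rb 13 = 1 by rewrite frb //= fra.
have b41 : rb 41 = 0 by rewrite frb //= fra.
have b2 : rb 2 = p by rewrite frb //= fra.
have b1 : rb 1 = v by rewrite frb.
have b40 : rb 40 = n.+1 by rewrite frb.
have b59 : rb 59 = B by rewrite frb //= fra.
apply: ok_cons; apply: (ins_top_ok A3 wf invw' invo' BE Bw NB (ltnW nsz) nsBv MN pns vns palp livep) => //.
move=> rd rcd td d14 dc0 d44 d16 frd htd.
have d13 : rd 13 = 1 by rewrite frd.
have d41 : rd 41 = 0 by rewrite frd.
apply: ok_cons; apply: (ins_scan_ok wf invw' invo' BE Bw NB (ltnW nsz) MN pns vns palp livep) => //.
move=> re rce te hsc fre hte.
have e1' : re 1 = v by rewrite fre // frd.
have e13' : re 13 = 1 by rewrite fre.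
have e41' : re 41 = 0 by rewrite fre.
have e14' : re 14 = ob (lps (iwd (q1 IDN) pn p)) by rewrite fre.
have e44' : re 44 = istop q1 mc pn p c by rewrite fre.
have e16' : istop q1 mc pn p c -> re 16 = nth 0 (iwd (q1 IDN) pn p) (dep pn p - (lpsn (iwd (q1 IDN) pn p)).+1).
  by rewrite fre.
apply: ok_cons; apply: (ins_choose_ok wf invw' invo' BE Bw NB (ltnW nsz) MN pns vns palp livep) => //.
move=> rf tf ids ch frf htf; have [ek eh] := id_scan wf invw' pns vns ids hsc.
move: ids ch ek eh d16 e16' palp livep; rewrite eI; set W := iwd (m1 IDN) pn p; set i := rf 16.
move=> ids ch ek eh d16 e16' palp livep.
have f1' : rf 1 = v by rewrite frf.
have f2' : rf 2 = p by rewrite frf // fre // frd.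
have f13' : rf 13 = 1 by rewrite frf.
have f41' : rf 41 = 0 by rewrite frf.
have f40' : rf 40 = n.+1 by rewrite frf // fre // frd.
have f59' : rf 59 = B by rewrite frf // fre // frd.
have f3' : rf 3 = (dep pn p).+1 by rewrite frf // fre // frd // b3.
have f19' : rf 19 = kill (lps W) i by rewrite frf.
have f44' : rf 44 = ktop W i by rewrite frf // e44'.
have iB : i < B.
  case: ids => [[k [hk _ _ ->]]|[_ ->]] //; apply: (ns_B inv NB KE); apply: (iw_ns wf invw pns).
  by have := lettersP (w := W) (n := k); rewrite size_iw => /(_ hk).
bs; first by rewrite f1'.
rewrite f1' -/i; set m1b := hu1 q1 10 v i.
have M1 f u : f != IDN -> m1b f u = q1 f u by rewrite /m1b /hu1 (_ : Nat.eqb f 10 = (f == IDN)) // => /negPf ->.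
have invlb : invLA B M m1b q2 3 (v :: ns) (pn_ins pn p v).
  by apply: invLA_ext A3 => // f u hf; apply: M1; move: hf; rewrite !inE; do ?[case/orP]; move/eqP => ->.
have invob : invO B m1b q2 ob pals.
  by apply: invO_ext invo' => // f u hf; apply: M1; move: hf; rewrite !inE; do ?[case/orP]; move/eqP => ->.
have bE : m1b IDN = fun u => if u == v then i else m1 IDN u.
  by apply: functional_extensionality => u; rewrite /m1b /= eI.
have iwv : iwd (m1b IDN) (pn_ins pn p v) v = rcons W i by rewrite bE; apply: (iw_new (m1 IDN) wf i pns vns).
have iwo u : u \in ns -> iwd (m1b IDN) (pn_ins pn p v) u = iwd (m1 IDN) pn u.
  by move=> hu; rewrite bE; apply: (iw_old (m1 IDN) wf p i vns hu).
have wf' : wft 3 (v :: ns) (pn_ins pn p v) by case: invlb.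
have [[A1m A2m A3m] _ _ _] := invm.
have xn0 : lps (rcons W i) != [::].
  by rewrite -size_eq0 size_lps -lt0n lpsn_gt0 // -size_eq0 size_rcons.
have hx : lps (rcons W i) \notin pals -> [/\ pclosed (lps (rcons W i) :: pals),
    3 <= alloc_of m1b n.+1 < B & alloc_of m1b n.+1 \notin map ob pals].
  have -> : alloc_of m1b n.+1 = o by rewrite /o /alloc_of !M1 // !A1.
  move=> xp; split=> //.
  apply: (nodes_closed (idn := m1b IDN) wf') => y; split=> [|[yn [u]]].
    rewrite inE => /orP[/eqP ->|/A2m[yn [u hu e]]].
      by split=> //; exists v; rewrite ?mem_head ?iwv.
    by split=> //; exists u; rewrite ?inE ?hu ?orbT // iwo.
  rewrite inE => /orP[/eqP ->|hu]; first by rewrite iwv => <-; rewrite mem_head.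
  by rewrite iwo // => e; rewrite inE; apply/orP; right; apply/A2m; split=> //; exists u.
have Wl k : k <= size W -> pal (suf k W) -> suf k W \in [::] :: pals.
  by rewrite size_iw => hk; apply: (suf_live inv pns hk).
have dv : dep (pn_ins pn p v) v = (dep pn p).+1 by apply: dep_ins_new.
rewrite -dv in f3'; have szv : size (v :: ns) <= N.+1 by apply: ltnW.
have ch' := ch; rewrite /chosen eI -/W in ch'.
apply: ok_cons; apply: (ins_obj_ok invlb invob BE Bw NB szv nsBv MN (mem_head _ _) iwv iB Wl ch' hx) => //.
move=> rg n1 n2 ob' pals' tg invog obl palsE g49 gnew g40 G1 G2 G3 G4 frg htg.
set x := lps (rcons W i) in hx xn0 palsE g49 gnew g40 G2 G3 htg *.
have g1 : rg 1 = v by rewrite frg.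
have g2 : rg 2 = p by rewrite frg.
have g13 : rg 13 = 1 by rewrite frg.
have g19 : rg 19 = kill (lps W) i by rewrite frg.
have g44 : rg 44 = ktop W i by rewrite frg.
have g59 : rg 59 = B by rewrite frg.
have xl : x \in [::] :: pals' by rewrite palsE inE; case: ifP => [->|_]; rewrite ?mem_head orbT.
have oB : ob' x < B by have := ob_gt1 invog xl; rewrite B3 => /andP[].
have k1 := kill_le wf invw invm pns vns ids cn.
have nLA f u : f \in LAf -> f != RNK -> n1 f u = q1 f u.
  move=> hf _; rewrite G1 ?M1 //; by move: hf; rewrite !inE; do ?[case/orP]; move/eqP => ->.
have cB : n1 CNT (ob' x) < B.
  rewrite G3; case: ifP => [hp|_] //.
  rewrite M1 // A1 // A3m //; exact: leq_ltn_trans (count_size _ _) sB.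
apply: ok_cons; apply: (@ins_fin_ok _ w b B _ _ _ _ _ _ _ v p (ob' x) (kill (lps W) i) (ktop W i)) => //.
- by rewrite G1 // M1 // A1.
- by rewrite G1 // M1 // A1 //; case: k1.
- by rewrite G1 // M1 // A1 //; case: k1.
move=> rh f1 F1 F2 F3 F4 F5 F6 F7 F8 frh h0; apply: ok_nil.
have h59 : rh 59 = B by rewrite frh.
have h40 : rh 40 = if x \in pals then n.+1 else n.+2 by rewrite frh.
have fLA f u : f \in LAf -> f1 f u = q1 f u.
  move=> hf; rewrite F1 ?G1 ?M1 //; by move: hf; rewrite !inE; do ?[case/orP]; move/eqP => ->.
have fI : f1 IDN = fun u => if u == v then i else m1 IDN u.
  by rewrite -bE; apply: functional_extensionality => u; rewrite F3 G1.
have q2E f u u' : f \notin [:: NEXT; LD] -> n2 f u u' = q2 f u u' by move=> hf; rewrite G4.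
have invwf : invW (f1 IDN) mc' 3 (v :: ns) (pn_ins pn p v).
  by rewrite fI; apply: (invW_ins wf invw pns vns ids c0 cn).
have invlf : invLA B M f1 n2 3 (v :: ns) (pn_ins pn p v).
  apply: invLA_ext A3 => // f u u' hf; apply: q2E; by move: hf; rewrite !inE; do ?[case/orP]; move/eqP => ->.
have [[oLm _ _ oLk] _ _] : obj_ok n1 n2 ob' x by have [_ _ _ H _] := invog; apply: H.
have obu : uniq (map ob' pals') by have [_ _ [u _] _ _] := invog.
apply: (HQ rh _ f1 n2 ob' pals' (if x \in pals then n.+1 else n.+2)) => //.
- split=> //.
  + by apply: invO_ext invog => // f u hf; apply: F1; move: hf; rewrite !inE; do ?[case/orP]; move/eqP => ->.
  + have [f4a f4b f4c] := F4.
    apply: (@invM_ins _ mc m1 f1 m2 n2 3 ns pn ob ob' pals pals' M wf invw invm p v c i) => //.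
    * move=> f u; rewrite !inE; do ?[case/orP]; move/eqP => -> nu.
      - by rewrite fI (negPf nu).
      - by rewrite F2 // G1 // M1 // A1.
      - by rewrite F2 // G1 // M1 // A1.
      - by rewrite F2 // G1 // M1 // A1.
      - by rewrite fLA // A4.
    * by rewrite fI eqxx f4a f4b f4c fLA // A5.
    * by move=> u nu; have [-> ->] := F5 u nu; rewrite !G1 // !M1 // !A1.
    * by have [-> ->] := F6; rewrite oLk.
    * by move=> u; rewrite F7 G1 // M1 // A1.
    * by rewrite eN.
    * by move=> q j; rewrite q2E // A2.
    * rewrite F8 eqxx G3; case: ifP => // hp; by rewrite M1 // A1.
    * by move=> u /negPf nu; rewrite F8 nu G2 ?nu // M1 // A1.
  + apply: (@invA_ext _ m1); first by move=> j; rewrite F1 // G1 // M1 // A1.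
    have em : map ob' pals = map ob pals by apply/eq_in_map => y hy; rewrite obl // inE hy orbT.
    rewrite palsE; case: ifP => hp; first by rewrite em.
    rewrite /= em gnew ?hp // (_ : alloc_of m1b n.+1 = o); last by rewrite /o /alloc_of !M1 // !A1.
    apply: invA_perm inva2; rewrite -cat1s -[X in perm_eq _ X]cat1s -cat1s.
    by rewrite perm_sym -cat1s catA; apply/permPl; apply: (perm_catCA (v :: ns) [:: o]).
have L1 : size (leaders 0 (lps W)) <= minn #|Sigma| (trunc_log 2 (dep pn p)).*2.+2.
  have [w1 w2] := lpsnP W; rewrite size_iw in w1.
  by apply: (size_leaders wf invw pns (pal_lps _)); rewrite size_lps.
have L2 : size (leaders 0 (slk x)) <= minn #|Sigma| (trunc_log 2 (dep pn p).+1).*2.+2.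
  rewrite -dv; have [w1 w2] := lpsnP (rcons W i); have px : pal x := pal_lps _.
  have [s1 s2 s3 _] := slkP px xn0.
  have iwf : iwd (f1 IDN) (pn_ins pn p v) v = rcons W i by rewrite fI -bE.
  have sx : size x <= size (rcons W i) by rewrite size_lps.
  apply: (size_leaders wf' invwf (mem_head _ _) s3).
    by rewrite -(size_iw (f1 IDN)) iwf; apply: leq_trans (ltnW s1) sx.
  have ex : suf (size x) (rcons W i) = x by rewrite size_lps.
  by rewrite iwf [RHS]s2 -[X in _ = suf _ X]ex suf_suf // (ltnW s1).
have ll : trunc_log 2 (dep pn p) <= trunc_log 2 (dep pn p).+1 by apply: log_le.
have X1 : minn (2 * lam (dep pn p)) (3 * M + 1) <= minn (2 * lam (dep pn p).+1) (3 * M + 1).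
  by rewrite leq_min geq_minr andbT; apply: leq_trans (geq_minl _ _) _; rewrite leq_mul2l /= lam_le.
have X2 : minn #|Sigma| (trunc_log 2 (dep pn p)).*2.+2 <= minn #|Sigma| (trunc_log 2 (dep pn p).+1).*2.+2.
  by rewrite leq_min geq_minl /=; apply: leq_trans (geq_minr _ _) _; rewrite !ltnS leq_double.
move: htb htd hte htf htg (leq_trans L1 X2) L2 X1; rewrite eI -/W dv /ins_cost /=.
move: (minn (2 * lam (dep pn p)) _) (minn (2 * lam (dep pn p).+1) _) (minn #|Sigma| (trunc_log 2 (dep pn p).+1).*2.+2).
move: (size (leaders 0 (lps W))) (size (leaders 0 (slk x))); clear; lia.
Qed.

(** * Deletion *)

(** Nothing has to be undone, because the invariant quantifies over live nodes; only the presence of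
    all parents requires that a leaf is removed. *)
Lemma invLA_del B M m1 m2 rt ns pn v : invLA B M m1 m2 rt ns pn -> v \in ns -> v != rt ->
  kids rt ns pn v = [::] -> invLA B M m1 m2 rt (rem v ns) pn.
Proof.
move=> [wf H1 H2] vns vrt kv; have [r0 r1 u H3 H4] := wf.
have sub x : x \in rem v ns -> x \in ns by apply: mem_rem.
split; [| by move=> x /sub; apply: H1 | by move=> x /sub; apply: H2].
split=> //; [by rewrite (mem_rem_uniq _ u) inE eq_sym vrt | exact: rem_uniq | by move=> x /sub; apply: H3 |].
move=> x /sub hx x0; have [p hp e] := H4 x hx x0; exists p => //.
rewrite (mem_rem_uniq _ u) inE hp andbT; apply/eqP => ep.
have px : par rt pn x = v.
  have := pn_par wf hx x0; rewrite {1}e => /rcons_inj[e2].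
  by rewrite -(anc_dep wf (par_ns wf hx)) -ep -(anc_dep wf hp) /anc /dep e2.
have : x \in kids rt ns pn v by rewrite mem_filter x0 px eqxx hx.
by rewrite kv.
Qed.

(** The cleared transition serves no other palindrome, since it would have the same object. *)
Lemma invO_del B m1 m2 n2 ob pals x : invO B m1 m2 ob pals -> x \in pals ->
  pclosed [seq y <- pals | y != x] ->
  (forall q i, n2 NEXT q i = if (q == inn ob x) && (i == head 0 x) then 0 else m2 NEXT q i) ->
  (forall u g, n2 LD u g = m2 LD u g) ->
  invO B m1 n2 ob [seq y <- pals | y != x].
Proof.
move=> inv xp cl HN HL; have [_ H2 [u bd] H4 H5] := inv.
have sub y : y \in [seq y <- pals | y != x] -> y \in pals by rewrite mem_filter => /andP[].
split=> //.
- split; last by move=> y /sub; apply: bd.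
  by rewrite map_inj_in_uniq ?filter_uniq ?(map_uniq u) // => y z /sub hy /sub hz; apply: (uniq_map_inj u).
- move=> y hy; have hy' : y \in [::] :: pals by move: hy; rewrite !inE => /orP[->//|/sub ->]; rewrite orbT.
  have [a b c] := H4 y hy'; split=> //.
    by move=> /b[b1 b2 b3 b4 b5]; split=> // z hz; rewrite HL b5.
  move=> yn; have [c1 c2 c3] := c yn; split=> //; rewrite HN; case: andP => // -[/eqP e1 /eqP e2].
  have xl : x \in [::] :: pals by rewrite inE xp orbT.
  have xn : x != [::] by have [[H _ _] _ _ _ _] := inv; case: (H x xp).
  have [_ _ /(_ xn)[_ _ d3]] := H4 x xl.
  move: hy; rewrite inE (negPf yn) mem_filter => /andP[/eqP[]]; apply: (ob_inj inv) => //.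
  by rewrite -c3 e1 e2.
- move=> q i; rewrite HN; case: andP => // h /H5[z hz [h1 h2]]; exists z => //.
  by rewrite mem_filter hz andbT; apply/eqP => e; apply: h; rewrite -h1 -h2 e !eqxx.
Qed.

(** A palindrome whose count vanishes is pushed on the stack of free names before the node. No
    leader is scanned, because the node has stored what it had removed from its parent. *)
Definition del : cmd := seqs [:: BConst 13 1 : cmd; BConst 41 0 : cmd; Ld1 2 PAR 0 : cmd;
  Ld1 14 KILL 0 : cmd; Ld1 15 ACT 2 : cmd; BArith Add 15 15 14 : cmd; St1 ACT 2 15 : cmd;
  Ld1 14 KTOP 0 : cmd; Ld1 15 TOPA 2 : cmd; BArith Add 15 15 14 : cmd; St1 TOPA 2 15 : cmd;
  Ld1 14 NCH 2 : cmd; BArith Defs.Sub 14 14 13 : cmd; St1 NCH 2 14 : cmd;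
  Ld1 15 RNK 0 : cmd; BArith Add 15 15 13 : cmd; St2 SLOT 2 14 15 : cmd;
  Ld1 49 PAL 0 : cmd; Ld1 14 CNT 49 : cmd; BArith Defs.Sub 14 14 13 : cmd; St1 CNT 49 14 : cmd;
  CIf (CEq 14 41) (seqs [:: Ld1 15 INNER 49 : cmd; Ld1 16 CHAR 49 : cmd; St2 NEXT 15 16 41 : cmd;
     BArith Defs.Sub 40 40 13 : cmd; BArith Add 15 49 13 : cmd; St1 ALL 40 15 : cmd]) CSkip;
  BArith Defs.Sub 40 40 13 : cmd; BArith Add 15 0 13 : cmd; St1 ALL 40 15 : cmd].

Lemma del_ok (Sigma : finType) (w b B M K N n : nat) m1 m2 (mc : nat -> option Sigma) ns pn ob pals (v : nat)
    (r : nat -> nat) (rc : nat -> option Sigma) out (tt : nat) (Q : hst Sigma -> Prop) :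
  Inv B M K n m1 m2 mc ns pn ob pals -> B = 2 ^ b -> 128 * B * B <= 2 ^ w -> N.+2 ^ 8 <= B -> 0 < M <= N.+1 ->
  K = N.*2 + 6 -> size ns <= N.+1 -> v \in ns -> v != 3 -> kids 3 ns pn v = [::] ->
  r 0 = v -> r 40 = n -> r 59 = B ->
  (forall (r' : nat -> nat) f1 f2 pals' n', Inv B M K n' f1 f2 mc (rem v ns) pn ob pals' ->
     r' 40 = n' -> r' 59 = B -> forall tt', tt' <= tt + 40 -> Q (HS r' rc f1 f2 mc out tt')) ->
  ok w B del (HS r rc m1 m2 mc out tt) Q.
Proof.
move=> inv BE Bw NB MN KE nsz vns v3 kv e0 e40 e59 HQ.
have wf := inv_wf inv; have [invl invo invw invm inva] := inv.
have NB' := N4B NB; have KB' := KB NB KE; have pz := pals_size inv.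
have B2 : 4 * B < 2 ^ w by apply: leq_trans Bw; nia.
have szB : size ns < B by lia.
have un : uniq ns by case: wf.
have pe : perm_eq ns (v :: rem v ns) := perm_to_rem vns.
have invm' := invM_perm pe invm; set ns0 := rem v ns in pe invm' *; set p := par 3 pn v.
have pns : p \in ns0.
  rewrite /ns0 (mem_rem_uniq _ un) inE (par_ns wf vns) andbT; apply/eqP => e.
  by have : v \in kids 3 ns pn v; [rewrite mem_filter v3 -/p e eqxx vns | rewrite kv].
have vns0 : v \notin ns0 by rewrite (mem_rem_uniq _ un) inE eqxx.
have pB : p < B by apply: (ns_B inv NB KE); apply: par_ns.
have vB : v < B by apply: (ns_B inv NB KE).
have invl0 : invLA B M m1 m2 3 ns0 pn := invLA_del invl vns v3 kv.
have wf0 : wft 3 ns0 pn by case: invl0.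
have [lDEP lPAR lAM] := la_basic invl vns; rewrite -/p in lPAR.
set x := lps (iwd (m1 IDN) pn v).
have xn : x != [::].
  rewrite -size_eq0 size_lps -lt0n lpsn_gt0 // -size_eq0 size_iw -lt0n.
  exact: (dep_gt0 wf vns v3).
have xp : x \in pals by exact: (lps_pals invm' xn).
have xl : x \in [::] :: pals by rewrite inE xp orbT.
have c1 : 0 < m1 CNT (ob x) by exact: (cnt_gt0 invm' xn).
have xB : ob x < B by have := ob_gt1 invo xl; lia.
have [_ _ /(_ xn)[oI oC _]] : obj_ok m1 m2 ob x by have [_ _ _ H _] := invo; apply: H.
have inB : inn ob x < B /\ head 0 x < B.
  have [i1 i2 _ _ _] := invo; have [_ _ st] := i1; split.
    rewrite /inn; case: eqP => [_|sx]; first by lia.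
    have s2 : 1 < size x by move: sx xn; rewrite -size_eq0; case: (size x) => [|[]].
    by have := ob_gt1 invo (st x xp s2); lia.
  have hx : head 0 x \in iwd (m1 IDN) pn v.
    have : head 0 x \in x by case: (x) xn => //= a s _; rewrite mem_head.
    by rewrite {2}/x /lps /suf; apply: mem_drop.
  exact: (ns_B inv NB KE (iw_ns wf invw vns hx)).
have [[[A1 A2 A3] H2 H3 H4] nH4] : invM m1 m2 3 (v :: ns0) pn ob pals M /\ True by [].
have pin : p \in v :: ns0 by rewrite inE pns orbT.
have [sA sT] := H3 p pin.
rewrite (kids_del _ _ v3) eqxx !big_cons in sA sT.
have kA : m1 ACT p + m1 KILL v < 2 ^ w.
  have := lmask_lt (pal_lps (iwd (m1 IDN) pn p)); rewrite -sA.
  have : gw (lps (iwd (m1 IDN) pn p)) < B.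
    apply: (@gw_lt N) => //; first exact: pal_lps.
    rewrite size_lps; have [+ _] := lpsnP (iwd (m1 IDN) pn p); rewrite size_iw => h; apply: leq_trans h _.
    have := dep_size wf0 pns; have := perm_size pe => /= e; move: nsz; rewrite e ltnS => h1 h2.
    exact: ltnW (leq_trans h2 h1).
  by move: B2; clear; lia.
have kT : m1 TOPA p + m1 KTOP v < 2 ^ w by move: sT B2 KB'; rewrite KE; clear; lia.
have [eN eP] := H4 p; rewrite (kids_del _ _ v3) eqxx in eN eP.
have NM : m1 NCH p <= M.
  by have := perm_size eP; rewrite size_cat !size_map !size_iota -eN; clear; lia.
have RM : m1 RNK v < M by have := perm_mem eP (m1 RNK v); rewrite mem_head mem_iota add0n => /esym /andP[].
have N0 : 0 < m1 NCH p by rewrite eN.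
have n2 : n = (size ns0 + size pals).+1 + 3.
  by have [_ _ _ _ [-> _ _]] := inv; rewrite size_cat size_map (perm_size pe).
have p0 : 0 < size pals by case: (pals) xp.
have nB : n < B /\ 1 < n by have := perm_size pe; move: n2 p0 pz nsz KB' NB' => /=; clear; lia.
have w1 : 1 < 2 ^ w by move: B2 NB'; clear; lia.
rewrite /del; bs => //; bs; first by rewrite expn_gt0.
bs; first by rewrite e0.
rewrite e0 lPAR; bs; first by rewrite e0.
bs => //; rewrite e0; bs => //; bs => //; bs; first by rewrite e0.
bs => //; rewrite e0; bs => //; bs => //; bs => //; bs => //; bs => //; rewrite subn1; bs; first by rewrite e0.
rewrite e0; bs; first by rewrite addn1; move: RM MN B2 NB'; clear; lia.
rewrite addn1; bs; first by split=> //; move: N0 NM MN NB'; clear; lia.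
bs; first by rewrite e0.
rewrite e0 A1 ?mem_head // -/x; bs => //; bs => //; bs => //; rewrite subn1.
set g1 := hu1 _ 30 _ _; set g2 := hu2 _ _ _ _ _.
have cn : m1 CNT (ob x) < B.
  rewrite A3 //; apply: leq_ltn_trans (count_size _ _) _.
  by rewrite -(perm_size pe).
have MD pals' f1 f2 : pals' = (if m1 CNT (ob x) == 1 then [seq y <- pals | y != x] else pals) ->
    (forall f u, f != ALL -> f1 f u = g1 f u) -> (forall q j, f2 SLOT q j = g2 SLOT q j) ->
    invM f1 f2 3 ns0 pn ob pals' M.
  move=> -> e1 e2; apply: (invM_del invm' v3 xn) => //.
  - by move=> f u; rewrite !inE; do ?[case/orP]; move/eqP => ->; rewrite e1.
  - by move=> u; rewrite !e1 // /g1 /=; case: eqP => // ->.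
  - by move=> u; rewrite e1 // /g1 /=; case: eqP => // ->.
  - by have [_ _ []] := invo.
  - by move=> u; rewrite e1 // /g1 /=; case: eqP => // ->.
have LAx f1 f2 : (forall f u, f != ALL -> f1 f u = g1 f u) ->
    (forall f u u', f \in [:: NODE; YT; TT] -> f2 f u u' = g2 f u u') -> invLA B M f1 f2 3 ns0 pn.
  move=> e1 e2; apply: invLA_ext invl0 => [f u hf|f u u' hf]; rewrite ?e1 ?e2 //;
    by move: hf; rewrite !inE; do ?[case/orP]; move/eqP => ->.
have OE f1 f2 ob' pals' : (forall f u, f != ALL -> f1 f u = g1 f u) -> invO B m1 f2 ob' pals' -> invO B f1 f2 ob' pals'.
  move=> e1; apply: invO_ext => // f u hf; rewrite e1; by move: hf; rewrite !inE; do ?[case/orP]; move/eqP => ->.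
have WE f1 : (forall f u, f != ALL -> f1 f u = g1 f u) -> invW (f1 IDN) mc 3 ns0 pn.
  move=> e1; have -> : f1 IDN = m1 IDN by apply: functional_extensionality => u; rewrite e1.
  have sub y : y \in ns0 -> y \in ns by apply: mem_rem.
  have [h1 h2 h3] := invw; split; [by move=> y /sub; apply: h1 | by move=> y k /sub; apply: h2 |].
  by move=> y y' /sub hy /sub hy'; apply: h3.
have iA : invA K m1 (v :: ns0 ++ map ob pals) n.
  by apply: invA_perm inva; rewrite -cat_cons perm_cat2r.
apply: ok_cons; apply: ok_if => /=; case: eqP => ec.
  have ec1 : m1 CNT (ob x) == 1 by move: ec c1; case: (m1 CNT (ob x)) => [|[]].
  bs => //; rewrite {1}/g1 /= oI; bs => //; rewrite {1}/g1 /= oC; bs => //.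
  bs; first by rewrite e40; case: nB => _ /ltnW.
  rewrite e40 subn1; bs; first by move: xB B2; clear; lia.
  bs; first by case: nB => h _; apply: leq_ltn_trans (leq_pred _) h.
  apply: ok_nil; bs; first by case: nB => _; case: (n) => [|[]].
  rewrite subn1; bs; first by rewrite e0; move: vB B2; clear; lia.
  rewrite e0; bs; first by case: nB => h _; apply: leq_ltn_trans (leq_trans (leq_pred _) (leq_pred _)) h.
  apply: ok_nil.
  set f1 := hu1 _ 33 _ _; set f2 := hu2 _ _ _ _ _.
  have E1 f u : f != ALL -> f1 f u = g1 f u.
    by rewrite /f1 /hu1 (_ : Nat.eqb f 33 = (f == ALL)) // => /negPf ->.
  have im : invM f1 f2 3 ns0 pn ob [seq y <- pals | y != x] M by apply: MD => //; rewrite ec1.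
  apply: (HQ _ f1 f2 [seq y <- pals | y != x] n.-2) => //=; last by clear; lia.
  split.
  - by apply: LAx => // f u u'; rewrite !inE; do ?[case/orP]; move/eqP => ->.
  - apply: OE => //; apply: (invO_del invo xp) => //.
    have [[_ C2 _] _ _ _] := im; exact: (nodes_closed (idn := f1 IDN) wf0).
  - exact: WE.
  - exact: im.
  have up := pals_uniq inv.
  (* The live names are reordered so that the two freed ones come in the order of their release. *)
  have pr : perm_eq (v :: ns0 ++ map ob pals) (ob x :: v :: (ns0 ++ map ob [seq y <- pals | y != x])).
    have px : perm_eq pals (x :: [seq y <- pals | y != x]).
      by rewrite -(rem_filter x up); apply: perm_to_rem.
    apply: (@perm_trans _ ((v :: ns0) ++ map ob (x :: [seq y <- pals | y != x]))).
      by rewrite -cat_cons perm_cat2l; apply: perm_map px.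
    by apply/permPl; apply: (perm_catCA (v :: ns0) [:: ob x]).
  have en : n = n.-2.+2 by case: nB => _; case: (n) => [|[]].
  have iB := invA_perm pr iA; rewrite en in iB.
  have iC := @invA_free K m1 (fun f i => if i == n.-2.+1 then (ob x).+1 else m1 ALL i) _ _ _ iB (fun i => erefl).
  apply: (invA_free iC) => i; rewrite /f1 /= !addn1.
  by rewrite (_ : n.-1 = n.-2.+1) // {1}en.
apply: ok_skip; bs; first by rewrite e40; case: nB => _ /ltnW.
rewrite e40 subn1; bs; first by rewrite e0; move: vB B2; clear; lia.
rewrite e0; bs; first by case: nB => h _; apply: leq_ltn_trans (leq_pred _) h.
apply: ok_nil; set f1 := hu1 _ 33 _ _.
have E1 f u : f != ALL -> f1 f u = g1 f u.
  by rewrite /f1 /hu1 (_ : Nat.eqb f 33 = (f == ALL)) // => /negPf ->.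
have ec1 : m1 CNT (ob x) == 1 = false by apply/eqP => h; apply: ec; rewrite h.
have im : invM f1 g2 3 ns0 pn ob pals M by apply: MD => //; rewrite ec1.
apply: (HQ _ f1 g2 pals n.-1) => //=; last by clear; lia.
split.
- by apply: LAx => // f u u'; rewrite !inE; do ?[case/orP]; move/eqP => ->.
- apply: OE => //; apply: invO_ext invo => // f u u'; rewrite !inE; by do ?[case/orP]; move/eqP => ->.
- exact: WE.
- exact: im.
have en : n = n.-1.+1 by case: nB => _; case: (n).
rewrite en in iA; apply: (invA_free iA) => i; rewrite /f1 /= addn1 //.
Qed.

(** * Report *)

Definition tri (z : seq nat) : progression := (size (slk z), df z, cnt z).
(** At a leaf the empty palindrome is not maximal. The progression that starts at 0 then loses its
    first term, and disappears if it had no other. *)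
Definition piece (lf : bool) (z : seq nat) : seq progression :=
  if lf && (size (slk z) == 0) then (if cnt z == 1 then [::] else [:: (df z, df z, (cnt z).-1)]) else [:: tri z].
(** The longest palindromic suffix is a member of no series and is reported on its own, with an
    arbitrary difference. If it is the whole word it starts at the root and cannot be extended. *)
Definition topl (W ids : seq nat) : seq progression :=
  if (lpsn W < size W) && (nth 0 W (size W - (lpsn W).+1) \in ids) then [::] else [:: (lpsn W, 1, 1)].
Definition pieces (W ids : seq nat) := [seq z <- grp (lps W) | pch 0 z \notin ids].
Definition rep_list (lf : bool) (W ids : seq nat) : seq progression :=
  flatten [seq piece lf z | z <- rev (pieces W ids)] ++ topl W ids.

Lemma piece_terms lf (z : seq nat) : pal z -> z != [::] ->
  flatten (map terms (piece lf z)) = [seq n <- terms (tri z) | ~~ lf || (0 < n)] /\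
  all (fun x : progression => 0 < x.2) (piece lf z) /\ size (piece lf z) <= 1 /\ (0 < size (slk z) -> size (piece lf z) = 1).
Proof.
move=> pz zn; have [c0 _] := cntP pz zn; have d0 := df_gt0 zn; rewrite /piece /tri /=.
case: (boolP (lf && _)) => [/andP[-> /eqP s0]|h]; last first.
  split; last by rewrite /= c0.
  rewrite /= cats0; apply/esym/all_filterP/allP => n /mapP[i _ ->].
  by case: lf h => //=; rewrite -lt0n => h; rewrite ltn_addr.
rewrite s0; case: (cnt z) c0 => // t _.
have E : [seq n <- mkseq (fun i => 0 + i * df z) t.+1 | ~~ true || (0 < n)] = mkseq (fun i => df z + i * df z) t.
  rewrite /mkseq -[iota 0 t.+1]/(0 :: iota (1 + 0) t) iotaDl /= -map_comp.
  rewrite (eq_map (g := fun i => df z + i * df z)); last by move=> i; rewrite /= add0n mulSn.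
  by apply/all_filterP/allP => n /mapP[i _ ->]; rewrite ltn_addr.
rewrite E; case: t {E} => [|t]; first by [].
by rewrite /= cats0.
Qed.

(** All members of the later series are shorter than [slk x], where the series of [x] begins. *)
Lemma pieces_sorted (f : pred (seq nat)) (x : seq nat) : pal x ->
  let l := flatten [seq terms (tri z) | z <- rev (filter f (grp x))] in sorted ltn l /\ all (gtn (size x)) l.
Proof.
elim/seq_ind_size: x => x IH px; rewrite grpE; case: eqP => [->|/eqP xn] //=.
have [s1 s2 s3 _] := slkP px xn; have [/= h1 h2] := IH _ s1 s3; have d0 := df_gt0 xn.
have [c0 ec] := cntP px xn.
have h3 : all (gtn (size x)) (flatten [seq terms (tri z) | z <- rev (filter f (grp (slk x)))]).
  by apply: sub_all h2 => n /= h; apply: ltn_trans h s1.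
case: ifP => // _; rewrite rev_cons map_rcons flatten_rcons.
have ht : all (gtn (size x)) (terms (tri x)).
  apply/allP => n /mapP[i]; rewrite mem_iota add0n => hi ->; rewrite /= ec ltn_add2l ltn_mul2r d0.
  by case/andP: hi.
have st : sorted ltn (terms (tri x)).
  rewrite /terms /tri /mkseq; move: (cnt x) (size (slk x)) => t s; elim: t (0) => [|t IHt] k //=.
  rewrite path_min_sorted ?IHt //; apply/allP => n /mapP[i]; rewrite mem_iota => /andP[hi _] ->.
  by rewrite /= ltn_add2l ltn_mul2r d0.
split; last by rewrite all_cat h3.
rewrite sorted_pairwise ?pairwise_cat; last exact: ltn_trans.
rewrite -!sorted_pairwise; try exact: ltn_trans.
rewrite h1 st !andbT; apply/allrelP => n m hn /mapP[i _ ->].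
by apply: (leq_trans ((allP h2) _ hn)); apply: leq_addr.
Qed.

Lemma rep_represents lf (W ids : seq nat) : W != [::] ->
  represents (rep_list lf W ids) (fun n => [/\ n <= size W, pal (suf n W),
     n < size W -> nth 0 W (size W - n.+1) \notin ids & lf -> 0 < n]).
Proof.
move=> Wn; set P := lps W; have pP : pal P := pal_lps W; have [w1 w2] := lpsnP W; have w0 := lpsn_gt0 Wn.
have gP z : z \in rev (pieces W ids) -> [/\ z \in grp P, pch 0 z \notin ids, pal z & z != [::]].
  by rewrite mem_rev mem_filter => /andP[h1 h2]; have [a1 a2 _ _] := grp_mem pP h2.
have E : flatten (map terms (flatten [seq piece lf z | z <- rev (pieces W ids)])) =
    [seq n <- flatten [seq terms (tri z) | z <- rev (pieces W ids)] | ~~ lf || (0 < n)].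
  elim: (rev _) gP => //= z l IH H; rewrite map_cat flatten_cat filter_cat IH; last first.
    by move=> y hy; apply: H; rewrite inE hy orbT.
  by have [_ _ h1 h2] := H z (mem_head _ _); have [-> _] := piece_terms lf h1 h2.
have [/= s1 s2] := pieces_sorted (fun z => pch 0 z \notin ids) pP; rewrite -/(pieces W ids) in s1 s2.
have M n : (n \in flatten [seq terms (tri z) | z <- rev (pieces W ids)]) <->
    [/\ n < lpsn W, pal (suf n W) & nth 0 W (size W - n.+1) \notin ids].
  split.
    move=> h; have hn := (allP s2) n h; rewrite /= size_lps in hn; move: h.
    case/flattenP => l /mapP[z /gP[h1 h2 h3 h4] ->] /mapP[i]; rewrite mem_iota add0n => /andP[_ hi] en.
    have hz := grp_bound pP h1 hi; rewrite -en in hz.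
    have zz : n < size z by apply: leq_ltn_trans hz _; rewrite -size_lnk size_lnk_lt.
    have pn : pal (suf n P) by apply/(grp_pals pP); [rewrite size_lps | exists z, i].
    have [a1 a2 a3 a4] := grp_mem pP h1.
    split=> //; first by move: pn; rewrite suf_suf // (ltnW hn).
    rewrite -(mirror 0 w1 w2 hn) -/P -(nth_border 0 pP a3 _ zz) -?a4 //.
    by rewrite en (piece_pch 0 h3 h4 hi).
  move=> [hn pn hl]; have pn' : pal (suf n P) by rewrite suf_suf // (ltnW hn).
  have hn' : n < size P by rewrite size_lps.
  have [z zg [z1 z2 [i hi en]]] := @grp_pals_pch _ 0 P n pP hn' pn'.
  apply/flattenP; exists (terms (tri z)).
    apply: map_f; rewrite mem_rev mem_filter zg andbT z1 (mirror 0 w1 w2 hn) //.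
  by rewrite en; apply: map_f; rewrite mem_iota.
have tl : flatten (map terms (topl W ids)) = if (lpsn W < size W) && (nth 0 W (size W - (lpsn W).+1) \in ids) then [::] else [:: lpsn W].
  by rewrite /topl; case: ifP => //= _; rewrite addn0.
split.
- rewrite all_cat; apply/andP; split; last by rewrite /topl; case: ifP.
  elim: (rev _) gP => //= z l IH H; rewrite all_cat IH ?andbT; last first.
    by move=> y hy; apply: H; rewrite inE hy orbT.
  by have [_ _ h1 h2] := H z (mem_head _ _); have [_ [-> _]] := piece_terms lf h1 h2.
- rewrite map_cat flatten_cat E tl.
  have sf := sorted_filter ltn_trans (fun n => ~~ lf || (0 < n)) s1.
  case: ifP => _; first by rewrite cats0.
  rewrite sorted_pairwise ?pairwise_cat; last exact: ltn_trans.
  rewrite -sorted_pairwise; last exact: ltn_trans.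
  rewrite sf !andbT; apply/allrelP => n m; rewrite mem_filter inE => /andP[_ hn] /eqP ->.
  by have := (allP s2) n hn; rewrite /= size_lps.
- move=> n; rewrite map_cat flatten_cat E tl mem_cat mem_filter; split.
    case/orP => [/andP[h1 /M[h2 h3 h4]]|].
      by split=> //; [apply: ltnW (leq_trans h2 w1) | case: (lf) h1].
    case: ifP => // h; rewrite inE => /eqP ->; split=> // hl; by move: h; rewrite hl => /= ->.
  move=> [h1 h2 h3 h4]; have := lpsn_max h1 h2; rewrite leq_eqVlt => /orP[/eqP en|hl].
    apply/orP; right; case: ifP => [/andP[k1 k2]|_]; last by rewrite inE en.
    by rewrite -en in k1 k2; have := h3 k1; rewrite k2.
  apply/orP; left; apply/andP; split; last by apply/M; split=> //; apply: h3; apply: leq_trans hl w1.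
  by case: (lf) h4 => //= ->.
Qed.

Lemma slk_nil_last (x z : seq nat) : pal x -> z \in grp x -> slk z = [::] -> z = last [::] (grp x).
Proof.
elim/seq_ind_size: x => x IH px; rewrite grpE; case: eqP => [_|/eqP xn] //.
have [s1 s2 s3 _] := slkP px xn; rewrite inE => /orP[/eqP ->|hz] e /=; first by rewrite e.
have := IH _ s1 s3 hz e; case: (grp (slk x)) hz => // y s _ ->.
Qed.

(** Only the last head has an empty series link, so at most one series contributes nothing. The
    first bound charges the work to the output, the second one leads to the logarithmic size. *)
Lemma rep_size lf (W ids : seq nat) : size (pieces W ids) <= (size (rep_list lf W ids)).+1 /\
  size (rep_list lf W ids) <= (size (grp (lps W))).+1.
Proof.
have pP : pal (lps W) := pal_lps W.
have gP z : z \in rev (pieces W ids) -> [/\ z \in grp (lps W), pal z & z != [::]].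
  by rewrite mem_rev mem_filter => /andP[h1 h2]; have [a1 a2 _ _] := grp_mem pP h2.
have st : size (topl W ids) <= 1 by rewrite /topl; case: ifP.
have ug : uniq (rev (pieces W ids)).
  rewrite rev_uniq filter_uniq //; apply: (@map_uniq _ _ (@gx _)).
  by apply: sorted_uniq (grp_sorted pP); [move=> a b c /= h1 h2; apply: ltn_trans h2 h1 | move=> a; apply: ltnn].
have H l : uniq l -> (forall z, z \in l -> [/\ z \in grp (lps W), pal z & z != [::]]) ->
    size l <= size (flatten [seq piece lf z | z <- l]) + (last [::] (grp (lps W)) \in l) /\
    size (flatten [seq piece lf z | z <- l]) <= size l.
  elim: l => //= z l IH /andP[zl ul] H; have [h1 h2 h3] := H z (mem_head _ _).
  have [|a1 a2] := IH ul; first by move=> y hy; apply: H; rewrite inE hy orbT.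
  have [_ [_ [k1 k2]]] := piece_terms lf h2 h3; rewrite size_cat; split; last by rewrite -add1n leq_add.
  rewrite inE; have [s0|s0] := posnP (size (slk z)); last by rewrite k2 //= add1n addSn ltnS; apply: leq_trans a1 _; rewrite leq_add2l; case: (_ \in l); rewrite ?orbT.
  have el := slk_nil_last pP h1 (size0nil s0); rewrite -el eqxx /=; move: a1; rewrite -el (negPf zl) addn0 => a1.
  by rewrite addn1 ltnS; apply: leq_trans a1 (leq_addl _ _).
have [h1 h2] := H _ ug gP; rewrite size_rev in h1 h2.
rewrite /rep_list size_cat; split.
  apply: leq_trans h1 _; rewrite -addn1; case: (_ \in _) => /=; lia.
by rewrite -addn1 leq_add //; apply: leq_trans h2 _; rewrite size_filter count_size.
Qed.

Lemma part_sum (F : seq nat -> nat) (s : seq (seq nat)) (l : seq nat) : uniq l ->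
  \sum_(i <- l) \sum_(z <- s | pch 0 z == i) F z = \sum_(z <- s | pch 0 z \in l) F z.
Proof.
elim: l => [|i l IH] /=; first by rewrite big_nil big_pred0.
case/andP => il ul; rewrite big_cons IH //.
rewrite [RHS](bigID (fun z => pch 0 z == i)) /=; congr (_ + _); apply: eq_bigl => z.
  by rewrite inE; case: (_ == i); rewrite ?andbF.
by rewrite inE; case: eqP => /= [->|_]; rewrite ?andbT // (negPf il).
Qed.

Lemma words_cat L1 L2 : words_of (L1 ++ L2) = words_of L1 ++ words_of L2.
Proof. by rewrite /words_of map_cat flatten_cat. Qed.

(** The classes of different leaders interleave in length. Each head is filed in [SCR] under its bit
    and its bit is added to a mask; visiting the mask from the lowest bit then yields increasing
    lengths without any sorting. *)
Definition rep_chain : cmd := CWhile (CLt 41 45) (seqs [:: Ld1 46 GW 45 : cmd; St1 SCR 46 45 : cmd;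
  BArith Add 18 18 46 : cmd; Ld1 45 CNEXT 45 : cmd]).

Definition rep_piece : seq cmd := [:: Ld1 45 SCR 43 : cmd; Ld1 46 SLINK 45 : cmd; Ld1 46 LEN 46 : cmd; Ld1 47 DIFF 45 : cmd;
  Ld1 50 LEN 45 : cmd; BArith Defs.Sub 50 50 46 : cmd; BArith Div 50 50 47 : cmd;
  CIf (CEq 46 41) (CIf (CEq 15 41) (seqs [:: BMov 46 47 : cmd; BArith Defs.Sub 50 50 13 : cmd]) CSkip) CSkip;
  CIf (CLt 41 50) (seqs [:: BEmit 46 : cmd; BEmit 47 : cmd; BEmit 50 : cmd]) CSkip].

Definition rep_body : cmd := seqs [:: Ld1 14 PAL 0 : cmd; Ld1 17 ACT 0 : cmd; BConst 18 0 : cmd;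
  bitloop [:: Ld2 45 LD 14 43 : cmd; rep_chain];
  BMov 17 18 : cmd; Ld1 15 NCH 0 : cmd; bitloop rep_piece;
  Ld1 16 TOPA 0 : cmd;
  CIf (CEq 16 13) (seqs [:: Ld1 45 LEN 14 : cmd; BEmit 45 : cmd; BEmit 13 : cmd; BEmit 13 : cmd]) CSkip].

(** No palindrome ending at the root is maximal, since each case of the definition excludes the
    empty path there. *)
Definition rep : cmd := seqs [:: BConst 13 1 : cmd; BConst 41 0 : cmd; Ld1 14 DEP 0 : cmd;
  CIf (CEq 14 41) CSkip rep_body].

Section Rep.
Variables (Sigma : finType) (w b B M K N n : nat).
Variables (m1 : nat -> nat -> nat) (m2 : nat -> nat -> nat -> nat) (mc : nat -> option Sigma).
Variables (ns : seq nat) (pn : nat -> seq nat) (ob : seq nat -> nat) (pals : seq (seq nat)) (v : nat).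
Hypothesis inv : Inv B M K n m1 m2 mc ns pn ob pals.
Hypothesis BE : B = 2 ^ b.
Hypothesis Bw : 128 * B * B <= 2 ^ w.
Hypothesis NB : N.+2 ^ 8 <= B.
Hypothesis KE : K = N.*2 + 6.
Hypothesis nsz : size ns <= N.+1.
Hypothesis hv : v \in ns.
Local Notation ok := (@ok Sigma w B).
Local Notation W := (iwd (m1 IDN) pn v).
Local Notation P := (lps W).
Local Notation ids := (map (m1 IDN) (kids 3 ns pn v)).
Local Notation lf := (kids 3 ns pn v == [::]).

Let invo : invO B m1 m2 ob pals. Proof. by case: inv. Qed.
Let wf := inv_wf inv.

Lemma rB y : y \in [::] :: pals -> [/\ 1 < ob y, ob y < B & obj_ok m1 m2 ob y].
Proof.
move=> hy; have := ob_gt1 invo hy; have := N4B NB; have [_ _ _ H _] := invo.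
by move=> h1 /andP[h2 h3]; split=> //; [lia | apply: H].
Qed.

Lemma Plive : P \in [::] :: pals. Proof. exact: (lps_live inv hv). Qed.

Lemma grpB z : z \in grp P -> [/\ z \in pals, pal z, z != [::] & gw z < B].
Proof.
move=> hz; have zl := live_grp invo Plive hz; have [a1 a2 a3 _] := grp_mem (pal_lps W) hz.
split=> //; apply: (@gw_lt N) => //; apply: leq_trans a3 _; rewrite size_lps.
have [h _] := lpsnP W; rewrite size_iw in h; apply: leq_trans h _.
exact: leq_trans (dep_size wf hv) nsz.
Qed.

Lemma chain_sub (x z : seq nat) : pal x -> x != [::] -> z \in chain 0 x -> z \in grp x.
Proof.
move=> px xn hz; apply/(chain_grp 0 z px); exists x => //.
by rewrite leadersE (negPf xn) mem_head.
Qed.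

Lemma chain_gx (x z : seq nat) : pal x -> x != [::] -> cnx 0 x != [::] -> z \in chain 0 (cnx 0 x) -> gx z < gx x.
Proof.
move=> px xn cn hz; have [_ _ ps _] := slkP px xn; have hc := cnx_grp px xn cn.
have := grp_gx ps hc; have := grp_gx (cnx_pal 0 px xn) (chain_sub (cnx_pal 0 px xn) cn hz).
by rewrite (gxE xn) ltnS; apply: leq_trans.
Qed.

Lemma rep_chain_ok (x : seq nat) (r : nat -> nat) rc n1 out (tt : nat) (Q : hst Sigma -> Prop) :
  x \in [::] :: pals -> (forall z, z \in chain 0 x -> z \in grp P) -> r 41 = 0 ->
  r 45 = (if x == [::] then 0 else ob x) ->
  r 18 + \sum_(z <- chain 0 x) gw z < 2 ^ w -> (forall f u, f != SCR -> n1 f u = m1 f u) ->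
  (forall (r' : nat -> nat) n1' (tt' : nat), r' 18 = r 18 + \sum_(z <- chain 0 x) gw z ->
     (forall f u, f != SCR -> n1' f u = m1 f u) ->
     (forall z, z \in chain 0 x -> n1' SCR (gw z) = ob z) ->
     (forall u, u \notin map (@gw _) (chain 0 x) -> n1' SCR u = n1 SCR u) ->
     frameS [:: 18; 45; 46] r r' -> tt' <= tt + 5 * size (chain 0 x) + 1 ->
     Q (HS r' rc n1' m2 mc out tt')) ->
  ok rep_chain (HS r rc n1 m2 mc out tt) Q.
Proof.
elim/seq_ind_size: x r n1 tt Q => x IH r n1 tt Q xl hg e41 e45 hw F HQ; apply: ok_while => /=.
have px := live_pal invo xl; move: hg hw HQ; rewrite (chainE 0 px) e41 e45; case: eqP => [_|/eqP xn] hg hw HQ.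
  by rewrite ltnn; apply: HQ => //; rewrite ?big_nil ?addn0 //; clear; lia.
rewrite (negPf xn) in e45; have [o1 o2 [[_ _ o3 _] /(_ xn)[_ _ _ o4 _] _]] := rB xl.
have [_ _ _ gB] := grpB (hg x (mem_head _ _)).
rewrite (ltn_trans _ o1) //; bs; first by rewrite e45.
rewrite e45 F // o3; bs => //; rewrite e45; rewrite big_cons in hw.
bs; first by move: hw; rewrite addnA; apply: leq_ltn_trans; apply: leq_addr.
bs; first by rewrite e45.
rewrite e45 /= F // o4; apply: ok_nil.
have cl : cnx 0 x \in [::] :: pals.
  by have [->|cn] := eqVneq (cnx 0 x) [::]; rewrite inE // (live_cnx invo xl cn) orbT.
have cs : size (cnx 0 x) < size x := cnx_size 0 px xn.
apply: IH => //=.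
- exact: cs.
- exact: cl.
- by move=> z hz; apply: hg; rewrite inE hz orbT.
- by rewrite -addnA.
- by move=> f u hf; rewrite /hu1 (_ : Nat.eqb f 34 = (f == SCR)) // (negPf hf) F.
move=> r' n1' t' h1 h2 h3 h4 h5 h6; apply: HQ => //.
- by rewrite h1 big_cons addnA.
- move=> z; rewrite inE => /orP[/eqP ->|]; last exact: h3.
  rewrite h4 /= ?eqxx //; apply/mapP => -[y hy e].
  have cn : cnx 0 x != [::] by apply: contraTneq hy => ->; rewrite chainE.
  by have := chain_gx px xn cn hy; rewrite (@expnI 2 _ _ _ e) // ltnn.
- by move=> u; rewrite /= inE negb_or => /andP[/negPf nu hu]; rewrite h4 //= nu.
- by apply: frs_trans h5; frs.
- by move: h6 => /=; clear; lia.
Qed.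

Lemma act_ids z : z \in grp P -> pch 0 z \notin ids ->
  pch 0 z \in [seq pch 0 y | y <- leaders 0 P & pch 0 y \notin ids].
Proof.
move=> hz hp; have [y hy [e _]] := leaders_ex 0 (pal_lps W) hz.
by apply/mapP; exists y => //; rewrite mem_filter hy e hp.
Qed.

Lemma pieces_sum (F : seq nat -> nat) :
  \sum_(y <- [seq y <- leaders 0 P | pch 0 y \notin ids]) \sum_(z <- chain 0 y) F z = \sum_(z <- pieces W ids) F z.
Proof.
have u : uniq [seq pch 0 y | y <- leaders 0 P & pch 0 y \notin ids].
  by apply: subseq_uniq (leaders_uniq 0 P); apply: map_subseq; apply: filter_subseq.
transitivity (\sum_(i <- [seq pch 0 y | y <- leaders 0 P & pch 0 y \notin ids]) \sum_(z <- grp P | pch 0 z == i) F z).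
  rewrite big_map big_seq [RHS]big_seq; apply: eq_bigr => y; rewrite mem_filter => /andP[_ hy].
  by rewrite (chain_filter (pal_lps W) hy) big_filter.
rewrite part_sum // /pieces big_filter big_seq_cond [RHS]big_seq_cond; apply: eq_bigl => z.
case: (boolP (z \in grp P)) => //= hz; apply/mapP/idP => [[y]|h].
  by rewrite mem_filter => /andP[h _] ->.
by apply/mapP; apply: act_ids.
Qed.

Lemma act_mask : m1 ACT v = \sum_(z <- leaders 0 P | pch 0 z \notin ids) gw z /\
  m1 TOPA v = ~~ ((lpsn W < size W) && (nth 0 W (size W - (lpsn W).+1) \in ids)).
Proof.
have [_ _ invw [_ H2 H3 _] _] := inv; have [h1 h2] := H3 v hv.
have [e1 e2] := kids_sums v H2; have u := kid_uniq wf invw v.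
rewrite e1 kill_sum // in h1; rewrite e2 ktop_sum // in h2; split.
  by apply/eqP; rewrite -(eqn_add2r (\sum_(z <- leaders 0 P | pch 0 z \in ids) gw z)) h1 /lmask
    [X in X == _](bigID (fun z => pch 0 z \in ids)) /= addnC.
by move: h2; case: (_ && _) => /=; clear; lia.
Qed.


Lemma pieces_bsum : \sum_(z <- pieces W ids) gw z = bsum (map (@gx _) (rev (pieces W ids))) /\
  sorted ltn (map (@gx _) (rev (pieces W ids))).
Proof.
rewrite map_rev rev_sorted /bsum big_rev big_map; split=> //.
have tr : transitive gtn by move=> a c d /= h1 h2; apply: ltn_trans h2 h1.
apply: (subseq_sorted tr) (grp_sorted (pal_lps W)); apply: map_subseq; exact: filter_subseq.
Qed.

Lemma pieces_in z : z \in pieces W ids -> z \in grp P.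
Proof. by rewrite mem_filter => /andP[]. Qed.

Lemma pieces_lt : \sum_(z <- pieces W ids) gw z < 2 ^ w.
Proof.
have [_ h] := pieces_bsum; have NB' := N4B NB.
have B2 : 2 * B <= 2 ^ w by apply: leq_trans Bw; nia.
apply: leq_trans B2; rewrite map_rev rev_sorted in h.
rewrite -(big_map (@gx _) predT (fun k => 2 ^ k)) -/(bsum _).
case E : (pieces W ids) h => [|z s] h; first by rewrite /bsum big_nil; lia.
have zp : z \in pieces W ids by rewrite E mem_head.
have [_ _ _ gB] := grpB (pieces_in zp).
by apply: leq_trans (bsum_lt h) _; rewrite expnS leq_mul2l; apply: ltnW.
Qed.

Lemma rep_loop1_ok (r : nat -> nat) rc out (tt : nat) (Q : hst Sigma -> Prop) :
  r 13 = 1 -> r 41 = 0 -> r 14 = ob P -> r 17 = m1 ACT v -> r 18 = 0 ->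
  (forall (r' : nat -> nat) rc' n1 (tt' : nat), r' 18 = bsum (map (@gx _) (rev (pieces W ids))) ->
     (forall f u, f != SCR -> n1 f u = m1 f u) ->
     (forall z, z \in pieces W ids -> n1 SCR (gw z) = ob z) ->
     frameS [:: 17; 18; 42; 43; 45; 46] r r' -> tt' <= tt + 13 * size (pieces W ids) + 1 ->
     Q (HS r' rc' n1 m2 mc out tt')) ->
  ok (bitloop [:: Ld2 45 LD 14 43 : cmd; rep_chain]) (HS r rc m1 m2 mc out tt) Q.
Proof.
move=> e13 e41 e14 e17 e18 HQ; set act := [seq y <- leaders 0 P | pch 0 y \notin ids].
have pP := pal_lps W; have [a1 a2] := act_mask.
have actP y : y \in act -> y \in leaders 0 P by rewrite mem_filter => /andP[].
have actg y : y \in act -> y \in grp P by move=> /actP /leaders_grp.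
have cg y z : y \in act -> z \in chain 0 y -> z \in grp P /\ pch 0 z = pch 0 y.
  move=> hy hz; split; last exact: (chain_pch pP (actP y hy) hz).
  by move: hz; rewrite (chain_filter pP (actP y hy)) mem_filter => /andP[].
have act0 y : y \in act -> 0 < size (chain 0 y).
  by move=> /actg /(grpB)[_ py yn _]; rewrite (chainE 0 py) (negPf yn).
(* By the last clause a head is filed once the leader of its letter has been processed. *)
pose I (l : seq (seq nat)) (r' : nat -> nat) (rc' : nat -> option Sigma) n1 (n2 : nat -> nat -> nat -> nat) (o : seq nat) :=
  [/\ [/\ forall y, y \in l -> y \in act, n2 = m2 & o = out],
    forall f u, f != SCR -> n1 f u = m1 f u, frameS [:: 17; 18; 42; 43; 45; 46] r r',
    r' 18 + \sum_(y <- l) \sum_(z <- chain 0 y) gw z = \sum_(z <- pieces W ids) gw z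
  & forall z, z \in pieces W ids -> pch 0 z \notin map (pch 0) l -> n1 SCR (gw z) = ob z].
apply: (@bitloop_gen Sigma w B _ (@gx _) (fun y => 5 * size (chain 0 y) + 3) _ I mc _ _ (rev act)) => //.
- move=> l r1 r2 rc1 n1 n2 o fr [h1 h2 h3 h4 h5]; split=> //; last by rewrite fr.
  by apply: frs_trans h3 _; apply: frs_sub fr => y; rewrite !inE; do ?[case/orP] => /eqP ->.
- move=> y l r1 rc1 n1 n2 o t hs [[h1 -> ->] h2 h3 h4 h5] f13 f41 f43.
  have hy := h1 y (mem_head _ _); have [y1 y2 y3 y4] := grpB (actg y hy).
  have Pn : P != [::] by apply: contraTneq (actg y hy) => ->; rewrite grpE.
  have [p1 p2 [_ /(_ Pn)[_ _ _ _ /(_ y (actP y hy)) eld] _]] := rB Plive.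
  have f14 : r1 14 = ob P by rewrite h3.
  bs; first by rewrite f14 f43.
  rewrite f14 f43 -/(gw y) eld; rewrite big_cons in h4.
  apply: ok_cons; apply: (rep_chain_ok (x := y)) => //=.
  + by rewrite inE y1 orbT.
  + by move=> z /(cg y z hy)[].
  + by rewrite (negPf y3).
  + apply: leq_ltn_trans pieces_lt; rewrite -h4 addnA; exact: leq_addr.
  move=> r2 n1' t2 k1 k2 k3 k4 k5 k6; apply: ok_nil; do 6![eexists]; split; first by reflexivity.
  + split=> //.
    * by split=> // z hz; apply: h1; rewrite inE hz orbT.
    * by apply: frs_trans h3 _; apply: (@frs_trans _ _ (hu r1 45 (ob y))); [frs|apply: frs_sub k5 => z; rewrite !inE; do ?[case/orP] => /eqP ->].
    * by rewrite k1 -h4 addnA.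
    * move=> z hz nz; have [ez|nez] := eqVneq (pch 0 z) (pch 0 y).
        by apply: k3; rewrite (chain_filter pP (actP y hy)) mem_filter ez eqxx (pieces_in hz).
      rewrite k4; first by apply: h5; rewrite // inE negb_or nez.
      apply/mapP => -[z' hz' e]; have [g1 g2] := cg y z' hy hz'.
      have ez : z = z' by apply: (grp_gx_inj pP (pieces_in hz) g1); apply: (@expnI 2).
      by rewrite ez g2 eqxx in nez.
  + by move: k6; clear; lia.
  + by rewrite k5 // k5 // k5.
- rewrite map_rev rev_sorted; have tr : transitive gtn by move=> a c d /= h1 h2; apply: ltn_trans h2 h1.
  by apply: (subseq_sorted tr) (leaders_sorted 0 pP); apply: map_subseq; apply: filter_subseq.
- split=> //.
  + by split=> // y; rewrite mem_rev.
  + by rewrite e18 big_rev add0n; apply: pieces_sum.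
  + by move=> z hz; rewrite map_rev mem_rev act_ids ?(pieces_in hz) //; move: hz; rewrite mem_filter => /andP[].
- by rewrite e17 a1 map_rev /bsum big_rev big_map /act big_filter.
move=> r' rc' n1 n2 o t' [[_ -> ->] h2 h3 h4 h5] _ _ ht; apply: (HQ r' rc' n1) => //.
- by rewrite big_nil addn0 in h4; rewrite h4; case: pieces_bsum.
- by move=> z hz; apply: h5.
(* Chains of leaders are nonempty, so the overhead per leader can be charged to the heads. *)
apply: leq_trans ht _; rewrite leq_add2r leq_add2l big_rev.
have -> : size (pieces W ids) = \sum_(y <- act) size (chain 0 y).
  by rewrite -sum1_size -pieces_sum; apply: eq_bigr => y _; rewrite sum1_size.
rewrite big_distrr /= big_seq [leqRHS]big_seq; apply: leq_sum => y /act0; move: (size _) => k; clear; lia.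
Qed.

Lemma rep_loop2_ok (r : nat -> nat) rc n1 out (tt : nat) (Q : hst Sigma -> Prop) :
  r 13 = 1 -> r 41 = 0 -> r 17 = bsum (map (@gx _) (rev (pieces W ids))) -> (r 15 == 0) = lf ->
  (forall f u, f != SCR -> n1 f u = m1 f u) -> (forall z, z \in pieces W ids -> n1 SCR (gw z) = ob z) ->
  (forall (r' : nat -> nat) rc' (tt' : nat),
     frameS [:: 17; 42; 43; 45; 46; 47; 50] r r' -> tt' <= tt + 20 * size (pieces W ids) + 1 ->
     Q (HS r' rc' n1 m2 mc (out ++ words_of (flatten [seq piece lf z | z <- rev (pieces W ids)])) tt')) ->
  ok (bitloop rep_piece) (HS r rc n1 m2 mc out tt) Q.
Proof.
move=> e13 e41 e17 e15 F1 F2 HQ; have B2 : B < 2 ^ w by apply: leq_trans Bw; have := N4B NB; nia.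
set total := flatten [seq piece lf z | z <- rev (pieces W ids)] in HQ.
pose I (l : seq (seq nat)) (r' : nat -> nat) (rc' : nat -> option Sigma) k1 (k2 : nat -> nat -> nat -> nat) (o : seq nat) :=
  [/\ [/\ forall y, y \in l -> y \in pieces W ids, k2 = m2 & k1 = n1],
    frameS [:: 17; 42; 43; 45; 46; 47; 50] r r' &
    o ++ words_of (flatten [seq piece lf z | z <- l]) = out ++ words_of total].
have [_ srt] := pieces_bsum.
apply: (@bitloop_gen Sigma w B _ (@gx _) (fun y => 15) _ I mc _ _ (rev (pieces W ids))) => //.
- move=> l r1 r2 rc1 k1 k2 o fr [h1 h2 h3]; split=> //.
  by apply: frs_trans h2 _; apply: frs_sub fr => y; rewrite !inE; do ?[case/orP] => /eqP ->.
- move=> z l r1 rc1 k1 k2 o t hs [[h1 -> ->] h2 h3] f13 f41 f43.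
  have hz := h1 z (mem_head _ _); have [z1 z2 z3 z4] := grpB (pieces_in hz).
  have [o1 o2 [[o3 o4 _ _] /(_ z3)[_ o5 _ _ _] _]] : [/\ 1 < ob z, ob z < B & obj_ok m1 m2 ob z] by apply: rB; rewrite inE z1 orbT.
  have sl : slk z \in [::] :: pals by apply: (live_slk invo); rewrite inE z1 orbT.
  have [s1 s2 [[s3 _ _ _] _ _]] := rB sl; have sz := size_slk_lt z3.
  have f15 : (r1 15 == 0) = lf by rewrite h2.
  have [c0 _] := cntP z2 z3.
  have I' : forall r2, frameS [:: 17; 42; 43; 45; 46; 47; 50] r r2 ->
      I l r2 rc1 n1 m2 (o ++ words_of (piece lf z)).
    move=> r2 fr; split=> //; first by split=> // y hy; apply: h1; rewrite inE hy orbT.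
    by rewrite -h3 /= words_cat catA.
  rewrite /rep_piece; bs; first by rewrite f43.
  rewrite f43 -/(gw z) F2 //; bs => //; rewrite F1 // o5; bs => //; rewrite F1 // s3.
  bs => //; rewrite F1 // o4; bs => //; rewrite F1 // o3; bs; first exact: ltnW.
  bs => //; rewrite -/(cnt z).
  apply: ok_cons; apply: ok_cut (_ : ok _ _ (fun s' => exists r2 t2, [/\ s' = HS r2 rc1 n1 m2 mc o t2,
      frameS [:: 17; 42; 43; 45; 46; 47; 50] r r2, t2 <= t + 11, [/\ r2 42 = r1 42, r2 13 = 1 & r2 41 = 0] &
      r2 47 = df z /\ (if lf && (size (slk z) == 0) then r2 46 = df z /\ r2 50 = (cnt z).-1 else r2 46 = size (slk z) /\ r2 50 = cnt z)])) _.
    apply: ok_if => /=; rewrite f41; case: (boolP (size (slk z) == 0)) => s0.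
      apply: ok_if => /=; rewrite f41 f15; case: (boolP lf) => l0.
        bs => //; bs; first by rewrite f13.
        rewrite f13 subn1; apply: ok_nil; do 2![eexists]; split; first by reflexivity.
        - by frs; apply: frs_trans h2 _; frs.
        - by clear; lia.
        - by [].
        - by [].
      apply: ok_skip; do 2![eexists]; split; first by reflexivity.
      - by frs; apply: frs_trans h2 _; frs.
      - by clear; lia.
      - by [].
      - by [].
    apply: ok_skip; do 2![eexists]; split; first by reflexivity.
    - by frs; apply: frs_trans h2 _; frs.
    - by clear; lia.
    - by [].
    - by rewrite andbF.
  move=> s' [r2 [t2 [-> fr ht [g42 g13 g41] [g47 gg]]]].
  have pE : words_of (piece lf z) = if 0 < r2 50 then [:: r2 46; r2 47; r2 50] else [::].
    rewrite g47 /piece; case: ifP gg => _ [-> ->] /=; last by rewrite c0.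
    by move: c0; case: (cnt z) => [|[|t0]].
  apply: ok_cons; apply: ok_if => /=; rewrite g41; move: (I' r2 fr); rewrite pE; case: ifP => _ I2.
    do 3![bs => //]; do 2![apply: ok_nil]; do 6![eexists]; split; first by reflexivity.
    - by move: I2; rewrite -!cats1 -!catA.
    - by move: ht; clear; lia.
    - by [].
  apply: ok_skip; apply: ok_nil; do 6![eexists]; split; first by reflexivity.
  - by move: I2; rewrite cats0.
  - by move: ht; clear; lia.
  - by [].
- by split=> //; split=> // y; rewrite mem_rev.
move=> r' rc' k1 k2 o t' [[_ -> ->] h2 h3] _ _ ht.
rewrite cats0 in h3; rewrite h3; apply: HQ => //.
by move: ht; rewrite big_const_seq count_predT iter_addn_0 size_rev.
Qed.

Lemma rep_ok (r : nat -> nat) rc out (tt : nat) (Q : hst Sigma -> Prop) :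
  r 0 = v -> r 59 = B ->
  let L := if dep pn v == 0 then [::] else rep_list lf W ids in
  (forall (r' : nat -> nat) rc' n1 (tt' : nat), (forall f u, f != SCR -> n1 f u = m1 f u) ->
     r' 40 = r 40 -> r' 59 = B -> tt' <= tt + 80 * (size L).+1 ->
     Q (HS r' rc' n1 m2 mc (out ++ words_of L) tt')) ->
  ok rep (HS r rc m1 m2 mc out tt) Q.
Proof.
move=> e0 e59 L HQ; have [invl _ _ [[A1 _ _] _ _ H4] _] := inv; have vB := ns_B inv NB KE hv.
have w1 : 1 < 2 ^ w by apply: leq_trans Bw; have := N4B NB; nia.
have [lD _ _] := la_basic invl hv.
rewrite /rep; bs => //; bs; first by rewrite expn_gt0.
bs; first by rewrite e0.
rewrite e0 lD; apply: ok_cons; apply: ok_if => /=; move: HQ; rewrite /L; case: eqP => [_|/eqP d0] HQ.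
  by apply: ok_skip; apply: ok_nil; rewrite -[out]cats0; apply: HQ => //; clear; lia.
have Wn : W != [::] by rewrite -size_eq0 size_iw.
rewrite /rep_body; bs; first by rewrite e0.
rewrite e0 A1 //; bs; first by rewrite e0.
rewrite e0; bs; first by rewrite expn_gt0.
apply: ok_cons; apply: rep_loop1_ok => //=.
move=> r1 rc1 n1 t1 k1 k2 k3 k4 k5; have g0 : r1 0 = v by rewrite k4.
bs => //; bs; first by rewrite g0.
rewrite g0 k2 //; apply: ok_cons; apply: (rep_loop2_ok) => //=.
- by rewrite k4.
- by rewrite k4.
- by rewrite (H4 v).1 size_eq0.
move=> r2 rc2 t2 k6 k7; have h0 : r2 0 = v by rewrite k6.
have h13 : r2 13 = 1 by rewrite k6 //= k4.
have h14 : r2 14 = ob P by rewrite k6 //= k4.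
have h40 : r2 40 = r 40 by rewrite k6 //= k4.
have h59 : r2 59 = B by rewrite k6 //= k4.
have [s1 s2] := rep_size lf W ids; have [_ eT] := act_mask.
bs; first by rewrite h0.
rewrite h0 k2 // eT; apply: ok_cons; apply: ok_if => /=; rewrite h13.
move: HQ s1; rewrite /rep_list /topl; case: (_ && _) => /= HQ s1; rewrite ?cats0 in s1 HQ *.
  apply: ok_skip; do 2![apply: ok_nil]; apply: HQ => //.
  by move: s1 k5 k7; clear; lia.
have [_ _ [[o3 _ _ _] _ _]] := rB Plive.
bs; first by rewrite h14; case: (rB Plive).
rewrite h14 k2 // o3; do 3![bs => //]; do 3![apply: ok_nil].
rewrite h13 -!cats1 -!catA /= size_lps.
rewrite words_cat /= in HQ; apply: HQ => //.
by move: s1 k5 k7; clear; lia.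
Qed.

End Rep.

(** * The trie and its representation *)

Section Trie.
Variables (Sigma : finType) (B M K n : nat).
Variables (m1 : nat -> nat -> nat) (m2 : nat -> nat -> nat -> nat) (mc : nat -> option Sigma).
Variables (ns : seq nat) (pn : nat -> seq nat) (ob : seq nat -> nat) (pals : seq (seq nat)).
Hypothesis inv : Inv B M K n m1 m2 mc ns pn ob pals.
Variable T : trie Sigma.

Definition relT : Prop :=
  [/\ Defs.root T = 3, forall x, (x \in nodes T) = (x \in ns)
    & forall p a v, edge T p a v <-> [/\ v \in ns, v != 3, par 3 pn v = p & mc v = Some a]].

Hypothesis rT : relT.
Let wf := inv_wf inv.
Let invw : invW (m1 IDN) mc 3 ns pn. Proof. by case: inv. Qed.
Local Notation iw := (iwd (m1 IDN) pn).
Local Notation rw := (rwd mc pn).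
Local Notation dep := (dep pn).
Local Notation anc := (anc 3 pn).

Lemma edge_some v : v \in ns -> v != 3 -> exists a, edge T (par 3 pn v) a v.
Proof.
move=> hv v3; have [/(_ v hv v3)[_ _ +] _ _] := invw; case E: (mc v) => [a|] // _.
by exists a; have [_ _ H] := rT; apply/H.
Qed.

Lemma parentE v : v \in ns -> v != 3 -> parent T v = par 3 pn v.
Proof. by move=> hv v3; have [a] := edge_some hv v3; rewrite /parent /edge => ->. Qed.

Lemma par_anc v t : v \in ns -> 0 < t <= dep v -> par 3 pn (anc v t) = anc v t.-1.
Proof.
move=> hv /andP[t0 ht]; rewrite /par (dep_anc wf) // (anc_anc wf) //; exact: leq_pred.
Qed.

Lemma anc_eq v t t' : v \in ns -> t <= dep v -> t' <= dep v -> anc v t = anc v t' -> t = t'.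
Proof. by move=> hv h h' e; rewrite -(dep_anc wf hv h) e (dep_anc wf). Qed.

Lemma anc_rt v t : v \in ns -> t <= dep v -> (anc v t == 3) = (t == 0).
Proof. by move=> hv ht; rewrite -(dep0 wf (anc_ns wf hv ht)) (dep_anc wf). Qed.

Lemma leafP v : v \in ns -> leaf T v <-> kids 3 ns pn v = [::].
Proof.
have [_ hn H] := rT => hv; split.
  move=> [_ h]; apply/eqP; rewrite -size_eq0 size_filter -leqn0 leqNgt -has_count.
  apply/hasP => -[u hu /andP[u3 /eqP pu]]; have [a e] := edge_some hu u3.
  by apply: (h a u); rewrite -pu.
move=> k0; split; first by rewrite hn.
move=> a u /H[hu u3 pu _]; have : u \in kids 3 ns pn v by rewrite mem_filter u3 pu eqxx.
by rewrite k0.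
Qed.

Lemma rw_par v a : v \in ns -> v != 3 -> mc v = Some a -> rw v = rcons (rw (par 3 pn v)) (Some a).
Proof. by move=> hv v3 e; rewrite /rwd {1}(pn_par wf hv v3) map_rcons e. Qed.

Lemma spellsP u s v : spells T u s v -> exists2 k, k <= dep v &
  [/\ v \in ns, u = anc v (dep v - k) & map Some s = suf k (rw v)].
Proof.
have [_ hn H] := rT; elim=> [|{}s x a y _ [k hk [hx -> e]] /H[hy y3 pe ea]].
  rewrite hn => hu; exists 0 => //; rewrite subn0 (anc_dep wf) //; split=> //; by rewrite suf0.
have dy : dep y = (dep x).+1 by have := dep_par wf hy; rewrite pe => ->; rewrite prednK // (dep_gt0 wf).
exists k.+1; first by rewrite dy.
have ax : anc y (dep x - k) = anc x (dep x - k).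
  by rewrite -{2}pe (anc_par wf hy) //; rewrite dy ltnS leq_subr.
split=> //; first by rewrite dy subSS ax.
by rewrite (rw_par hy y3 ea) pe map_rcons e suf_rcons // size_map.
Qed.

Lemma spells_ex k v : v \in ns -> k <= dep v ->
  exists2 s, map Some s = suf k (rw v) & spells T (anc v (dep v - k)) s v.
Proof.
have [_ hn H] := rT; elim: k v => [|k IH] v hv hk.
  exists [::]; first by rewrite suf0.
  by rewrite subn0 (anc_dep wf) //; constructor; rewrite hn.
have v3 : v != 3 by rewrite -(dep0 wf hv) -lt0n; apply: leq_trans hk.
have [a e] := edge_some hv v3; have hp := par_ns wf hv; have dp := dep_par wf hv.
have [|s es ss] := IH _ hp; first by rewrite dp; case: (dep v) hk.
have [_ _ _ ea] := (H _ _ _).1 e.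
exists (rcons s a).
  rewrite (rw_par hv v3 ea) map_rcons es suf_rcons // size_map -/(pathlen pn _) dp; by case: (dep v) hk.
apply: spells_rcons e; move: ss; rewrite dp (anc_par wf) //; last by case: (dep v) hk => // m _; rewrite ltnS leq_subr.
by rewrite (_ : (dep v).-1 - k = dep v - k.+1) // -subn1 -subnDA add1n.
Qed.

Lemma palSome (s : seq Sigma) : palindrome s <-> pal (map Some s).
Proof.
rewrite /palindrome /pal -map_rev; split=> [e|/eqP]; first by rewrite -e.
by move/inj_map; apply=> x y [].
Qed.

Lemma iw_par v : v \in ns -> v != 3 -> iw v = rcons (iw (par 3 pn v)) (m1 IDN v).
Proof. by move=> hv v3; rewrite /iwd {1}(pn_par wf hv v3) map_rcons. Qed.

Definition maxlen v k := [/\ k <= size (iw v), pal (suf k (iw v)),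
  k < size (iw v) -> nth 0 (iw v) (size (iw v) - k.+1) \notin map (m1 IDN) (kids 3 ns pn v)
  & kids 3 ns pn v == [::] -> 0 < k].

(** By [pal_iw] labels may be replaced by names. A child then extends the palindrome on both sides
    exactly if its name is the letter before the suffix, which [pal_cand] expresses. *)
Lemma maximalP v k : v \in ns -> 0 < dep v ->
  maxlen v k <-> exists u s, size s = k /\ maximal_palindrome T u s v.
Proof.
have [hr hn H] := rT => hv d0; rewrite /maxlen size_iw; have sz m : m <= dep v -> size (suf m (rw v)) = m.
  by move=> hm; rewrite size_suf // size_map.
split=> [[h1 h2 h3 h4]|[u [s [sk [/spellsP[k' hk [_ eu es]] ps hc]]]]].
  have [s es ss] := spells_ex hv h1; exists (anc v (dep v - k)), s.
  have szs : size s = k by rewrite -(sz k h1) -es size_map.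
  have ps : palindrome s by apply/palSome; rewrite es (pal_iw wf invw).
  split=> //; split=> //; have [ek|nk] := eqVneq k (dep v).
    apply: Or31; rewrite ek subnn hr; split=> //; rewrite anc0 => e.
    by move: d0; rewrite lt0n (dep0 wf hv) -e eqxx.
  have kd : k < dep v by rewrite ltn_neqAle nk.
  have [k0|kn] := eqVneq (kids 3 ns pn v) [::].
    apply: Or32; split; last exact/(leafP hv).
    move=> e; have e' : anc v (dep v - k) = anc v (dep v) by rewrite (anc_dep wf hv).
    have k0' := h4 (introT eqP k0); have := anc_eq hv (leq_subr _ _) (leqnn _) e'.
    by move: k0' d0; clear; lia.
  have au : anc v (dep v - k) != 3 by rewrite (anc_rt hv) ?leq_subr // -lt0n subn_gt0.
  apply: Or33; split.
  - by rewrite hr; apply/eqP.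
  - by move/(leafP hv) => e; rewrite e eqxx in kn.
  move=> a v' s' /[dup] ee /H[hv' v3 pv' _]; rewrite parentE ?(anc_ns wf) ?leq_subr // par_anc ?leq_subr ?subn_gt0 ?kd //.
  move=> /spellsP[m hm [_ e1 e2]] /palSome; rewrite e2 (pal_iw wf invw) //.
  have dv' : dep v' = (dep v).+1 by have := dep_par wf hv'; rewrite pv' => ->; rewrite prednK // (dep_gt0 wf).
  (* Depths determine the length: the path from the parent of [u] to a child of [v] is two edges
     longer. *)
  have em : m = k.+2.
    have hm' : dep v' - m < dep v'.
      rewrite ltnNge; apply/negP => hh; have m0 : m = 0 by lia.
      move: e1; rewrite m0 subn0 (anc_dep wf hv') => e.
      have hx : (dep v - k).-1 <= dep v by lia.
      by have := dep_anc wf hv hx; rewrite e dv'; lia.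
    move: e1; rewrite -(anc_par wf hv' hm') pv' => e1.
    have l1 : (dep v - k).-1 <= dep v by move: kd; clear; lia.
    have l2 : dep v' - m <= dep v by move: hm' dv'; clear; lia.
    by have := anc_eq hv l1 l2 e1; move: dv' kd hm hm'; clear; lia.
  rewrite em (iw_par hv' v3) pv' (pal_cand 0) ?size_iw // /cand size_iw kd h2 /= => /eqP el.
  have := h3 kd; rewrite el => /negP; apply; apply: map_f.
  by rewrite mem_filter v3 pv' eqxx.
have ek : k' = k by rewrite -sk -(size_map Some) es sz.
rewrite ek in hk eu es => {sk}; have pk : pal (suf k (iw v)) by rewrite -(pal_iw wf invw hv hk) -es; apply/palSome.
case: hc => [[uv ur]|[uv lf]|[ur nl hx]].
- have kd : k = dep v.
    by move: ur; rewrite eu hr => /eqP; rewrite (anc_rt hv) ?leq_subr // subn_eq0 => h; apply/eqP; rewrite eqn_leq hk.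
  split=> [//|//|h|_]; last by rewrite kd.
  by move: h; rewrite kd ltnn.
- have k0 := (leafP hv).1 lf; split=> //; first by rewrite k0.
  by move=> _; rewrite lt0n; apply: contra_not_neq uv => e; rewrite eu e subn0 (anc_dep wf).
split=> //; last by move=> /eqP k0; case: nl; apply/(leafP hv).
move=> kd; apply/negP => /mapP[v' hv' el].
move: hv'; rewrite mem_filter => /andP[/andP[v3 /eqP pv'] hv'].
have [a ea] := edge_some hv' v3; rewrite pv' in ea.
have dv' : dep v' = (dep v).+1 by have := dep_par wf hv'; rewrite pv' => ->; rewrite prednK // (dep_gt0 wf).
have k2 : k.+2 <= dep v' by rewrite dv'.
have [s' es' ss'] := spells_ex hv' k2; apply: (hx a v' s' ea).
  have au : u != 3 by apply/eqP; rewrite -hr.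
  rewrite eu in au *; rewrite parentE ?(anc_ns wf) ?leq_subr // par_anc ?leq_subr ?subn_gt0 ?kd //.
  move: ss'; rewrite dv' subSS -(anc_par wf hv') ?pv'; first by rewrite subnS.
  by rewrite dv' ltnS leq_subr.
apply/palSome; rewrite es' (pal_iw wf invw) // (iw_par hv' v3) pv' (pal_cand 0) ?size_iw //.
by rewrite /cand size_iw kd pk el eqxx.
Qed.

Lemma represents_ext L (P Q : nat -> Prop) : (forall k, P k <-> Q k) -> represents L P -> represents L Q.
Proof. by move=> h [h1 h2 h3]; split=> // k; rewrite h3. Qed.

Lemma report_represents v : v \in ns ->
  represents (if dep v == 0 then [::] else rep_list (kids 3 ns pn v == [::]) (iw v) (map (m1 IDN) (kids 3 ns pn v)))
    (fun k => exists u s, size s = k /\ maximal_palindrome T u s v).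
Proof.
move=> hv; case: eqP => [d0|/eqP d0].
  split=> // k; split=> // -[u [s [_ [/spellsP[k' hk [_ eu _]] _ hc]]]].
  have k0 : k' = 0 by lia.
  have uv : u = v by rewrite eu k0 subn0 (anc_dep wf).
  have [hr _ _] := rT; have v3 : v = 3 by apply/eqP; rewrite -(dep0 wf hv) d0.
  by case: hc => [[]|[]|[+ _ _]] //; rewrite uv hr v3.
have Wn : iw v != [::] by rewrite -size_eq0 size_iw.
by apply: represents_ext (rep_represents _ _ Wn) => k; apply: maximalP; rewrite ?lt0n.
Qed.

Lemma card_nodes : #|` nodes T|%fset = size ns.
Proof.
have [_ hn _] := rT; apply: perm_size; apply: uniq_perm; first exact: fset_uniq.
  by case: wf.
exact: hn.
Qed.

(** Fewer than [dep v] parent steps do not reach the root, so the root cannot appear earlier in the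
    sequence that defines [depth]. *)
Lemma dep_height v : v \in ns -> dep v <= height T.
Proof.
move=> hv; have [hr hn _] := rT; apply: (@leq_trans (depth T v)); last first.
  by rewrite /height; apply: (leq_bigmax_seq (F := depth T)); rewrite ?hn.
rewrite /depth leqNgt; apply/negP => hi; have ds := dep_size wf hv.
have it k : k <= dep v -> iter k (parent T) v = anc v (dep v - k).
  elim: k => [|k IH] hk; first by rewrite subn0 (anc_dep wf).
  rewrite iterS IH ?(ltnW hk) // parentE ?(anc_ns wf) ?leq_subr //.
    by rewrite par_anc ?leq_subr ?subn_gt0 ?hk // subnS.
  by rewrite (anc_rt hv) ?leq_subr // -lt0n subn_gt0.
have hs : index (Defs.root T) (traject (parent T) v #|` nodes T|%fset) < #|` nodes T|%fset.
  by apply: ltn_trans hi _; rewrite card_nodes.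
have := nth_index v (_ : Defs.root T \in traject (parent T) v #|` nodes T|%fset).
rewrite -index_mem size_traject hs => /(_ isT); rewrite nth_traject // it ?(ltnW hi) // hr => /eqP.
by rewrite (anc_rt hv) ?leq_subr // subn_eq0 leqNgt -hr hi.
Qed.

(** The label to be inserted is missing among the children, and so is at least one node of the trie
    budget; hence a free slot exists. *)
Lemma kids_lt N p a : insertable T p a -> size ns < N ->
  size (kids 3 ns pn p) < maxn 1 (minn #|Sigma| N).
Proof.
move=> [pT nT] nsN; have [_ hn H] := rT; have [H1 _ H3] := invw.
have uk : uniq (kids 3 ns pn p) by apply: filter_uniq; case: wf.
have kP u : u \in kids 3 ns pn p -> [/\ u \in ns, u != 3 & par 3 pn u = p].
  by rewrite mem_filter => /andP[/andP[h1 /eqP h2] h3].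
rewrite leq_max leq_min; apply/orP; right; apply/andP; split; last first.
  apply: leq_ltn_trans nsN; rewrite size_filter; exact: count_size.
have -> : #|Sigma| = size (map (@Some Sigma) (enum Sigma)) by rewrite size_map cardE.
rewrite -(size_map mc) -[X in X <= _]/(size (Some a :: map mc (kids 3 ns pn p))).
apply: uniq_leq_size => [|y].
  rewrite /= map_inj_in_uniq ?uk ?andbT; last first.
    move=> u u' /kP[a1 a2 a3] /kP[b1 b2 b3] e; apply: H3 => //; by rewrite a3 b3.
  apply/mapP => -[u /kP[h1 h2 h3] e]; apply: (nT u); apply/H; by split.
rewrite inE => /orP[/eqP ->|/mapP[u /kP[h1 h2 _] ->]]; first by apply: map_f; rewrite mem_enum.
by have [_ _] := H1 u h1 h2; case: (mc u) => // b _; apply: map_f; rewrite mem_enum.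
Qed.

End Trie.

(** * The algorithm *)

Definition init_c : cmd := seqs [:: BConst 1 1 : cmd; BConst 2 2 : cmd; BConst 3 3 : cmd;
  St1 GW 2 1 : cmd; St1 PAL 3 2 : cmd; St1 TOPA 3 1 : cmd; St1 PAR 3 3 : cmd; St1 AM 3 3 : cmd; St1 MPAR 3 3 : cmd;
  St1 SUB 3 3 : cmd; St1 CODE 3 1 : cmd; St1 BET 3 1 : cmd; St2 NODE 3 1 3 : cmd; BConst 40 4 : cmd; BMov 0 3 : cmd].

(* The base of the memory layout is 2 ^ (w / 4). *)
Definition pre : seq instr := [:: Const 60 4; Arith Div 61 0 60; Const 60 1; Arith Shl 59 60 61].

Definition alg : algorithm := Algorithm (pre ++ compile 4 init_c) (compile 0 ins) (compile 0 del) (compile 0 rep).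

(** From [w >= 40] it follows that five quarters, rounded down, still cover [w]. Hence the fifth
    power of the base exceeds the fortieth power of [N.+2], and the base its eighth power. *)
Lemma base_bounds w N : N.+2 ^ 40 <= 2 ^ w ->
  [/\ 40 <= w, 128 * 2 ^ (w %/ 4) * 2 ^ (w %/ 4) <= 2 ^ w & N.+2 ^ 8 <= 2 ^ (w %/ 4)].
Proof.
move=> hN; have w40 : 40 <= w.
  by rewrite -(@leq_exp2l 2) //; apply: leq_trans hN; rewrite leq_exp2r.
split=> //.
  rewrite -mulnA -expnD (_ : 128 = 2 ^ 7) // -expnD leq_exp2l //.
  by have := leq_trunc_div w 4; move: w40; move: (w %/ 4) => q; clear; lia.
rewrite -(@leq_exp2r _ _ 5) // -!expnM; apply: leq_trans hN _; rewrite leq_exp2l //.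
by have := ltn_ceil w (isT : 0 < 4); move: w40; move: (w %/ 4) => q; clear; lia.
Qed.

(** * Transfer of the invariant to the machine *)

Section Final.
Variables (Sigma : finType) (w N b B : nat).
Hypothesis w40 : 40 <= w.
Hypothesis bE : b = w %/ 4.
Hypothesis BE : B = 2 ^ b.
Hypothesis fBw : 128 * B * B <= 2 ^ w.
Hypothesis fNB : N.+2 ^ 8 <= B.
Local Notation M := (maxn 1 (minn #|Sigma| N)).
Local Notation K := (N.*2 + 6).
Implicit Types (st : state Sigma) (T : trie Sigma).

Lemma fB : 64 * N.+2 <= B. Proof. exact: N4B fNB. Qed.
Lemma fMN : 0 < M <= N.+1. Proof. by clear; lia. Qed.
Lemma fB1 : 1 < B. Proof. by have := fB; clear; lia. Qed.
Lemma fB2 : 4 * B < 2 ^ w. Proof. by apply: leq_trans fBw; have := fB; clear; nia. Qed.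

Lemma ltw x : x < B -> x < 2 ^ w.
Proof. by move=> h; apply: leq_trans h _; have := fB2; clear; lia. Qed.

(** A halted machine stays where it is, so the run given by [reachable] ends in the state of the run
    constructed here. *)
Lemma runs_det P st t1 t2 st1 st2 : runs w P st t1 st1 -> runs w P st t2 st2 -> st1 = st2.
Proof.
have fix_h s k : halted P s -> iter k (step w P) s = s.
  by move=> h; elim: k => //= k ->; rewrite /step h.
wlog le : t1 t2 st1 st2 / t1 <= t2.
  by move=> H h1 h2; case/orP: (leq_total t1 t2) => h; [apply: H h h1 h2 | apply/esym; apply: H h h2 h1].
by move=> [<- h1] [<- h2]; rewrite -(subnK le) iterD [RHS]fix_h.
Qed.

Lemma run_ok (c : cmd) (s : hst Sigma) st (Q : hst Sigma -> Prop) : wfc c -> simrel w B s st -> pc st = 0 -> tk s = 0 -> ok w B c s Q ->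
  exists t st' s', [/\ runs w (compile 0 c) st t st', simrel w B s' st', Q s' & t <= 6 * tk s'].
Proof.
move=> hw hr hp ht [s' [he hq]].
have pl : place (compile 0 c) 0 (compile 0 c) by exists [::], [::]; rewrite cats0.
have [t [st' [e1 e2 e3 e4]]] := comp_sim fBw fB1 he hw pl hr hp.
exists t, st', s'; split=> //; last by move: e4; rewrite ht muln0 addn0.
by split=> //; rewrite /halted e3 size_comp.
Qed.

Lemma rel_call (s : hst Sigma) st x a : simrel w B s st -> x < 2 ^ w ->
  simrel w B (HS (hu (vr s) 0 x) (hu (vc s) 0 a) (h1 s) (h2 s) (hc s) [::] 0) (call st x a).
Proof.
move=> [[r1 r2 r3 r4] rc m1 m2 [mc _]] hx; split=> //; last first.
  by move=> i; rewrite /= /upd /hu (_ : Nat.eqb i 0 = (i == 0)) //; case: eqP.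
split=> //= i; rewrite /upd; last by case: eqP.
by move=> hi; rewrite (_ : Nat.eqb i 0 = (i == 0)) //; case: eqP => // _; apply: r1.
Qed.

(** The bound is [maxn 1 N] because the initial trie has one node even for [N = 0]. *)
Definition SI st T : Prop := exists s ns pn ob pals,
  [/\ simrel w B s st, Inv B M K (vr s 40) (h1 s) (h2 s) (hc s) ns pn ob pals, relT (hc s) ns pn T & size ns <= maxn 1 N].

Lemma inv_init n1 n2 : n1 GW 2 = 1 -> n1 PAL 3 = 2 -> n1 TOPA 3 = 1 -> n1 PAR 3 = 3 -> n1 AM 3 = 3 -> n1 MPAR 3 = 3 ->
  n1 SUB 3 = 3 -> n1 CODE 3 = 1 -> n1 BET 3 = 1 -> n2 NODE 3 1 = 3 ->
  (forall f u, f \in [:: LEN; DIFF; LMASK; ACT; DEP; LOG; KOF; KIX; NCH; ALL] -> n1 f u = 0) ->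
  (forall f u u', f \in [:: NEXT; SLOT] -> n2 f u u' = 0) ->
  Inv B M K 4 n1 n2 (fun=> None : option Sigma) [:: 3] (fun=> [::]) (fun=> 2) [::].
Proof.
move=> e1 e2 e3 e4 e5 e6 e7 e8 e9 e10 z1 z2; have fb := fB; have fb1 := fB1.
have l0 : lps ([::] : seq nat) = [::] := lps_nil _.
have ld : leaders 0 ([::] : seq nat) = [::] by rewrite leadersE.
have kd p : kids 3 [:: 3] (fun=> [::]) p = [::] by [].
have k0 : kap 0 = 0 by [].
have lw : lps (iwd (n1 IDN) (fun=> [::]) 3) = [::] := lps_nil _.
split.
- split.
  + by split=> // v; rewrite inE => /eqP ->.
  + move=> v; rewrite inE => /eqP ->; split.
    * by split; rewrite /dep ?[size _]/(0) ?k0 ?e4 ?e5 ?z1.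
    * by move=> _; rewrite /dep /= k0 e6 z1.
    * by rewrite /dep /= k0.
  + move=> v; rewrite inE => /eqP ->; rewrite /issb e7 eqxx e8 e9 e10; split=> //.
    by split=> //; have := fMN; clear; lia.
- split=> //.
    by move=> x; rewrite inE => /eqP ->; split=> //; split; rewrite ?e1 ?z1 //; rewrite /gw /df /lnk /lmask ?ld ?big_nil ?l0.
  by move=> q i; rewrite z2.
- split.
  + by move=> v; rewrite inE => /eqP ->.
  + by move=> v k; rewrite inE => /eqP ->; rewrite /dep /= leqn0 => /eqP ->.
  + by move=> u u'; rewrite inE => /eqP ->.
- split.
  + split=> //; first by move=> v; rewrite inE => /eqP ->; rewrite e2.
    move=> x; split=> // -[xn [v]]; rewrite inE => /eqP -> e; by rewrite -e lw in xn.
  + by move=> u; rewrite inE => /eqP ->.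
  + move=> v; rewrite inE => /eqP ->; by rewrite kd !big_nil z1 // e3 lw /lmask ld big_nil.
  + move=> p; rewrite kd z1 //; split=> //; rewrite /= subn0.
    rewrite (_ : map _ _ = iota 0 M) //; apply: map_id_in => i _; by rewrite /slot_of z2.
- split=> //; first by lia.
  have -> : [seq alloc_of n1 i | i <- iota 4 (K - 4)] = iota 4 (K - 4).
    by apply: map_id_in => i _; rewrite /alloc_of z1.
  by rewrite (_ : K - 3 = (K - 4).+1); [apply: perm_refl | lia].
Qed.

Lemma init_ok : exists t st, [/\ t <= 100, runs w (init alg) (call (blank Sigma) w None) t st &
  SI st (trie_init Sigma (result st))].
Proof.
have fb := fB; have fb2 := fB2.
have p4 : 4 < 2 ^ w by lia.
have pw : w < 2 ^ w by apply: ltn_expl.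
have pq : b < 2 ^ w by rewrite bE; apply: leq_ltn_trans pw; apply: leq_div.
have eD : wop_eval w Div w (4 %% 2 ^ w) = b by rewrite /wop_eval [4 %% _]modn_small // -bE modn_small.
have eS : wop_eval w Shl (1 %% 2 ^ w) b = B.
  by rewrite /wop_eval [1 %% _]modn_small ?mul1n -?BE ?modn_small //; lia.
set st0 := call (blank Sigma) w None; set P := init alg.
(* The first four instructions are executed by hand: the structured language presupposes that
   register 59 holds the base. *)
have [st1 [i1 p1 r1 [c1 m1 cm1 o1]]] : exists st1, [/\ iter 4 (step w P) st0 = st1, pc st1 = 4,
    reg st1 =1 (fun x => if x == 59 then B else if x == 60 then 1 else if x == 61 then b else if x == 0 then w else 0) &
    [/\ creg st1 =1 (fun=> None), Defs.mem st1 =1 (fun=> 0), cmem st1 =1 (fun=> None) & output st1 = [::]]].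
  eexists; split; [by reflexivity | by [] | | split=> //].
    move=> x; rewrite /= /upd /= eD eS modn_small ?(leq_trans _ p4) //.
    by do ?[case: eqP => // _].
  by move=> [|i].
have R : simrel w B (HS (reg st1) (fun=> None) (fun _ _ => 0) (fun _ _ _ => 0) (fun=> None) [::] 0) st1.
  split=> //; first split=> //; idtac.
  - by rewrite /= r1.
  - by move=> x; rewrite r1; do ?[case: eqP => // _]; lia.
  - by move=> a; rewrite m1 expn_gt0.
pose Q (s : hst Sigma) := [/\ vr s 0 = 3, vr s 40 = 4, hc s = (fun=> None), tk s = 15 &
  Inv B M K 4 (h1 s) (h2 s) (fun=> None : option Sigma) [:: 3] (fun=> [::]) (fun=> 2) [::]].
have oki : ok w B init_c (HS (reg st1) (fun=> None) (fun _ _ => 0) (fun _ _ _ => 0) (fun=> None) [::] 0) Q.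
  rewrite /init_c; do 3![bs; first by lia]; do 9![bs; first by lia].
  bs; first by split; lia.
  bs; first by lia.
  bs => //; apply: ok_nil; split=> //=; apply: inv_init => //.
    by move=> f u hf /=; nf hf; move: hf; rewrite !inE; do ?[case/orP]; move/eqP => -> //=; rewrite ?andbF //; case: eqP.
  by move=> f u u' /=; rewrite !inE; do ?[case/orP]; move/eqP => ->.
have [s' [he [q1 q2 q3 q4 q5]]] := oki.
have pl : place P 4 (compile 4 init_c) by exists pre, [::]; rewrite cats0.
have [t [st' [e1 e2 e3 e4]]] := comp_sim fBw fB1 he (isT : wfc init_c) pl R p1.
rewrite /= q4 in e4; have [[rr _ _ _] _ _ _ _] := e2.
have e0 : result st' = 3 by rewrite /result rr.
exists (t + 4), st'; split; first by move: e4; clear; lia.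
  split; first by rewrite iterD i1.
  by rewrite /halted e3 size_cat size_comp.
rewrite e0; exists s', [:: 3], (fun=> [::]), (fun=> 2), [::]; split=> //.
- by rewrite q2 q3.
- split=> //.
    by move=> x; rewrite /nodes in_fset1U [edges _]/(fmap0) domf0 in_fset0 orbF inE.
  move=> p a v; rewrite /edge /trie_init /= fnd_fmap0; split=> // -[]; by rewrite inE => /eqP ->.
- exact: leq_maxl.
Qed.

Lemma log_succ h : trunc_log 2 h.+1 <= (trunc_log 2 h).+1.
Proof.
rewrite -[X in _ <= X](trunc_expnK (p := 2)) //; apply: log_le.
by have := trunc_log_ltn h (isT : 1 < 2).
Qed.

(** The depth of the new leaf exceeds [d] by one, which raises the logarithm by at most one, and [M]
    is at most sigma or 1. Thus each of the two minima in the cost is a constant multiple of the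
    bound. *)
Lemma ins_bound T d : d <= height T -> 6 * ins_cost Sigma M d <= 4000 * op_bound T.
Proof.
move=> hd; rewrite /ins_cost /op_bound /lam.
have h1 : trunc_log 2 d.+1 <= (trunc_log 2 (height T)).+1.
  by apply: leq_trans (log_succ _); apply: log_le.
move: h1; move: (trunc_log 2 d.+1) (trunc_log 2 (height T)) #|Sigma|; clear; move=> l1 l2 S h.
rewrite -muln2; have : minn S N <= S := geq_minl _ _; move: (minn S N) => X; lia.
Qed.

Lemma ins_step st T p a : SI st T -> insertable T p a -> #|` nodes T|%fset < N ->
  exists t st', [/\ t <= 4000 * op_bound T, runs w (insert alg) (call st p (Some a)) t st',
    result st' \notin nodes T & SI st' (trie_insert T p a (result st'))].
Proof.
move=> [s [ns [pn [ob [pals [hr hi hT hz]]]]]] hins hcard; have [hrt hn H] := hT; have [pT nT] := hins.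
rewrite (card_nodes hi hT) in hcard; have pns : p \in ns by rewrite -hn.
have pB : p < B by apply: (ns_B hi fNB erefl).
have pw := ltw pB.
have R := rel_call (Some a) hr pw.
have wf := inv_wf hi.
have cn u : u \in ns -> u != 3 -> par 3 pn u = p -> hc s u != Some a.
  by move=> hu u3 pu; apply/eqP => e; apply: (nT u); apply/H.
have [_ r59 _ _] : [/\ True, vr s 59 = B, True & True] by have [[_ ? _ _] _ _ _ _] := hr.
have := @run_ok ins _ _ _ isT R erefl erefl (ins_ok (r := hu (vr s) 0 p) (rc := hu (vc s) 0 (Some a)) (Q := fun s' => exists v pn' ob' pals',
  [/\ v \notin ns, Inv B M K (vr s' 40) (h1 s') (h2 s') (hc s') (v :: ns) pn' ob' pals', pn' = pn_ins pn p v, vr s' 0 = v &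
   tk s' <= ins_cost Sigma M (dep pn p) /\ hc s' = huc (hc s) v (Some a)])
  hi BE fBw fNB fMN erefl hcard pns (isT : Some a != None) cn (kids_lt hi hT hins hcard) erefl erefl r59 erefl _).
case.
  by move=> r' rc' f1 f2 ob' pals' n' v t' h1 h2 h3 h4 h5 h6; exists v, (pn_ins pn p v), ob', pals'; rewrite /= h3.
move=> t [st' [s' [h1 h2 [v [pn' [ob' [pals' [g1 g2 g3 g4 [g5 g6]]]]]] h3]]].
have [[rr _ _ _] _ _ _ _] := h2; have e0 : result st' = v by rewrite /result rr.
exists t, st'; rewrite e0; split=> //.
- apply: leq_trans h3 _; apply: leq_trans (ins_bound (dep_height hi hT pns)).
  by rewrite leq_mul2l g5.
- by rewrite hn.
exists s', (v :: ns), pn', ob', pals'; split=> //; last by rewrite leq_max /= hcard orbT.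
split=> //.
- by move=> x; rewrite /nodes /= !inE -hn /nodes !inE orbCA.
move=> q c x; rewrite /edge /= fnd_set g6 g3 inE /huc; case: eqP => [->|nx] /=.
  rewrite (par_new wf v pns); split=> [[<- <-]|[_ _ -> [->]] //]; split=> //.
  by apply: contraNneq g1 => ->; case: wf.
split=> [/H[h4 h5 h6 h7]|[h4 h5 h6 h7]].
  by rewrite (par_ins_old 3 pn p g1 h4).
by apply/H; rewrite -(par_ins_old 3 pn p g1 h4).
Qed.

Lemma del_step st T v : SI st T -> deletable T v ->
  exists t st', [/\ t <= 4000 * op_bound T, runs w (delete alg) (call st v None) t st' & SI st' (trie_delete T v)].
Proof.
move=> [s [ns [pn [ob [pals [hr hi hT hz]]]]]] [hl /eqP vr3]; have [hrt hn H] := hT.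
have vns : v \in ns by rewrite -hn; case: hl.
rewrite hrt in vr3; have kv := (leafP hi hT vns).1 hl.
have vB : v < B by apply: (ns_B hi fNB erefl).
have vw := ltw vB.
have R := rel_call None hr vw; have wf := inv_wf hi.
have [_ r59 _ _] : [/\ True, vr s 59 = B, True & True] by have [[_ ? _ _] _ _ _ _] := hr.
have hz' : size ns <= N.+1 by apply: leq_trans hz _; rewrite geq_max leqnSn.
have := @run_ok del _ _ _ isT R erefl erefl (del_ok (r := hu (vr s) 0 v) (Q := fun s' => exists pals',
  [/\ Inv B M K (vr s' 40) (h1 s') (h2 s') (hc s') (rem v ns) pn ob pals', tk s' <= 40 & hc s' = hc s])
  hi BE fBw fNB fMN erefl hz' vns vr3 kv erefl erefl r59 _).
case.
  by move=> r' f1 f2 pals' n' h1 h2 h3 t' h4; exists pals'; rewrite /= h2.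
move=> t [st' [s' [h1 h2 [pals' [g1 g2 g3]] h3]]].
exists t, st'; split=> //.
  apply: leq_trans h3 _; have : 0 < op_bound T by rewrite /op_bound leq_max.
  by move: g2; clear; lia.
have un : uniq ns by case: wf.
exists s', (rem v ns), pn, ob, pals'; split=> //; last by apply: leq_trans hz; rewrite size_rem // leq_pred.
split=> //.
- move=> x; rewrite (mem_rem_uniq _ un) !inE -(hn x) /nodes /= !inE.
  case: (eqVneq x v) => [->|_] /=; first by rewrite hrt andbF orbF; apply/negbTE.
  by rewrite (_ : (x \in [eta mem_seq (domf (edges T))]) = (x \in domf (edges T))) // andbb.
move=> q c x; rewrite /edge /= fnd_rem1 g3 (mem_rem_uniq _ un) inE; case: eqP => [->|nx] /=.
  by split=> // -[].
exact: H.
Qed.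

Lemma rep_step st T v : SI st T -> v \in nodes T ->
  exists t st' L, [/\ represents L (fun n => exists u s, size s = n /\ maximal_palindrome T u s v),
    runs w (report alg) (call st v None) t st', output st' = words_of L,
    size L <= 4000 * log_height T & t <= 4000 * (size L).+1].
Proof.
move=> [s [ns [pn [ob [pals [hr hi hT hz]]]]]] hv; have [hrt hn H] := hT.
have vns : v \in ns by rewrite -hn.
have vB : v < B by apply: (ns_B hi fNB erefl).
have vw := ltw vB.
have R := rel_call None hr vw.
have [_ r59 _ _] : [/\ True, vr s 59 = B, True & True] by have [[_ ? _ _] _ _ _ _] := hr.
have hz' : size ns <= N.+1 by apply: leq_trans hz _; rewrite geq_max leqnSn.
set W := iwd (h1 s IDN) pn v; set ids := map (h1 s IDN) (kids 3 ns pn v).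
pose L := if dep pn v == 0 then [::] else rep_list (kids 3 ns pn v == [::]) W ids.
have := @run_ok rep _ _ _ isT R erefl erefl (rep_ok (r := hu (vr s) 0 v) (Q := fun s' => ho s' = words_of L /\ tk s' <= 80 * (size L).+1)
  hi BE fBw fNB erefl hz' vns (hu (vc s) 0 None) erefl r59 _).
case; first by move=> r' rc' n1 t' _ _ _ ht.
move=> t [st' [s' [h1 h2 [g1 g2] h3]]]; exists t, st', L; split=> //.
- exact: (report_represents hi hT vns).
- by have [_ _ _ _ [_ ->]] := h2.
- rewrite /L; case: eqP => // _.
  have [_ l2] := rep_size (kids 3 ns pn v == [::]) W ids; apply: leq_trans l2 _.
  have := grp_size (pal_lps W); rewrite size_lps; have [w1 _] := lpsnP W.
  have := log_le (leq_trans w1 (_ : size W <= height T)); rewrite size_iw => /(_ (dep_height hi hT vns)).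
  rewrite /log_height; move: (size _) (trunc_log 2 _) (trunc_log 2 _); clear; lia.
- by move: h3 g2; clear; lia.
Qed.

Lemma SI_reach st T : reachable alg w N st T -> SI st T.
Proof.
elim=> [t {}st hr|{}st {}T p a t st' _ IH hi hc hr|{}st {}T v t st' _ IH hd hr].
- by have [t' [st' [_ h1 h2]]] := init_ok; rewrite (runs_det hr h1).
- by have [t' [st2 [_ h1 _ h2]]] := ins_step IH hi hc; rewrite (runs_det hr h1).
- by have [t' [st2 [_ h1 h2]]] := del_step IH hd; rewrite (runs_det hr h1).
Qed.

End Final.

Theorem corollary1 :
  exists (A : algorithm) (C c : nat),
  forall (Sigma : finType) (w N : nat), (N.+2 ^ c <= 2 ^ w)%N ->
    (exists (t : nat) (st : state Sigma),
       (t <= C)%N /\ runs w (init A) (call (blank Sigma) w None) t st) /\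
    forall (st : state Sigma) (T : trie Sigma), reachable A w N st T ->
      [/\ forall (p : nat) (a : Sigma), insertable T p a ->
            (#|` nodes T|%fset < N)%N ->
            exists (t : nat) (st' : state Sigma),
              [/\ (t <= C * op_bound T)%N,
                  runs w (insert A) (call st p (Some a)) t st'
                & result st' \notin nodes T],
          forall v : nat, deletable T v ->
            exists (t : nat) (st' : state Sigma),
              (t <= C * op_bound T)%N /\
              runs w (delete A) (call st v None) t st'
        & forall v : nat, v \in nodes T ->
            exists (t : nat) (st' : state Sigma) (L : seq progression),
              [/\ represents L (fun n : nat => exists (u : nat) (s : seq Sigma),
                    size s = n /\ maximal_palindrome T u s v),
                  runs w (report A) (call st v None) t st',
                  output st' = words_of L,
                  (size L <= C * log_height T)%N
                & (t <= C * (size L).+1)%N]].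
Proof.
(* The exponent 40 is that of [base_bounds]; 4000 covers six instructions per tick of the costliest
   operation. *)
exists alg, 4000, 40 => Sigma w N /base_bounds[w40 Bw NB]; split.
  by have [t [st [h1 h2 _]]] := init_ok Sigma w40 erefl erefl Bw NB; exists t, st; split=> //; apply: leq_trans h1 _.
move=> st T /(SI_reach w40 erefl erefl Bw NB) hS; split.
- by move=> p a hi hc; have [t [st' [h1 h2 h3 _]]] := ins_step erefl Bw NB hS hi hc; exists t, st'.
- by move=> v hd; have [t [st' [h1 h2 _]]] := del_step erefl Bw NB hS hd; exists t, st'.
- by move=> v hv; apply: (rep_step erefl Bw NB hS hv).
Qed.
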